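(* Fix $\lambda\in(0,e/2)$, $\eta>0$, $m>1$. Let $\Psi:\mathbb{R}^d\to[0,\infty)$ be in $C^1(\mathbb{R}^d)$ and satisfy: there are $R,\delta>0$ with $\Psi(y)\ge(\lambda(d+2)+\delta)\ln|y|$ for all $|y|\ge R$; $\nabla\Psi$ is Lipschitz; and there is $K>0$ with $|\nabla\Psi(y)|\le K(1+|y|)$ for all $y\in\mathbb{R}^d$. For any $\rho_0\in\mathcal{D}_2(\mathbb{R}^d)$ with $J_{\lambda,\eta}(\rho_0)<\infty$, let $\rho:[0,\infty)\to\mathcal{D}_2(\mathbb{R}^d)$ be the solution to the Fokker-Planck equation $$\partial_tu-\operatorname{div}\big(u\nabla\Psi+\nabla(\lambda u+\eta u^m)\big)=0,\qquad u(0,\cdot)=\rho_0,$$ satisfying $\{\rho(t)\mathcal{L}^d\}_{t\ge0}\in AC^2_{\mathrm{loc}}([0,\infty);\mathcal{P}_2(\mathbb{R}^d))$ and $\int_0^T\int_{\mathbb{R}^d}|v_\rho|^2\rho\,dy\,dt<\infty$ for all $T>0$ (which exists, and is unique up to $\mathcal{L}^d$-null sets at each time). Then there exists $\{t_n\}_{n\in\mathbb{N}}$ in $[0,\infty)$ with $t_n\uparrow\infty$ such that $$\rho(t_n)\mathcal{L}^d\to\rho_\infty\mathcal{L}^d\quad\text{weakly in }\mathcal{P}(\mathbb{R}^d)\text{ as }n\to\infty,$$ where $\rho_\infty\in\mathcal{D}_2(\mathbb{R}^d)$ (defined in the context) is the unique minimizer of $J_{\lambda,\eta}$.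
   Context: Notation. $\mathcal{L}^d$ is Lebesgue measure on $\mathbb{R}^d$. $\mathcal{D}(\mathbb{R}^d)$ is the set of probability density functions on $\mathbb{R}^d$, and $\mathcal{D}_2(\mathbb{R}^d)$ the subset with $\int|y|^2\rho(y)dy<\infty$. $\mathcal{P}(\mathbb{R}^d)$ is the set of Borel probability measures; $\mathcal{P}_2(\mathbb{R}^d)$ is the subset with finite second moment, equipped with the Wasserstein-2 metric $\mathcal{W}_2$. $\rho\mathcal{L}^d$ is the measure with density $\rho$. $H(s)=\lambda s\ln s$ for $s>0$, $H(0)=0$; $F(s)=H(s)+\frac{\eta}{m-1}s^m$; $L_F(s):=sF'(s)-F(s)=\lambda s+\eta s^m$. For $\rho\in\mathcal{D}_2(\mathbb{R}^d)$, $J_{\lambda,\eta}(\rho)=\int\Psi\rho\,dy+\int H^+(\rho)\,dy-\int H^-(\rho)\,dy+\int\frac{\eta}{m-1}\rho^m\,dy\in(-\infty,\infty]$ ($H^-(\rho)$ is integrable). Solution of the Fokker-Planck equation. $\rho:[0,\infty)\to\mathcal{D}(\mathbb{R}^d)$ is a solution if: (i) $t\mapsto\rho(t)$ is continuous on $[0,\infty)$ under the weak-$*$ topology in $L^1(\mathbb{R}^d)$ (i.e. $t\mapsto\rho(t)\mathcal{L}^d$ is weakly continuous in $\mathcal{P}(\mathbb{R}^d)$), with $\rho(0)=\rho_0$; (ii) $L_F(\rho(t))\in W^{1,1}_{\mathrm{loc}}(\mathbb{R}^d)$ for all $t>0$ (this implies $\rho(t),\rho^m(t)\in W^{1,1}_{\mathrm{loc}}(\mathbb{R}^d)$);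 (iii) for all $\varphi\in C_c^\infty((0,\infty)\times\mathbb{R}^d)$, $\int_0^\infty\int\{\rho\,\partial_t\varphi-(\rho\nabla\Psi+\nabla(\lambda\rho+\eta\rho^m))\cdot\nabla\varphi\}\,dy\,dt=0$. $v_\rho(t,y):=-(\nabla\Psi+\lambda\nabla\rho/\rho+\eta\nabla\rho^m/\rho)(t,y)$ for $t>0$ (understood $\rho(t)\mathcal{L}^d$-a.e.). $\nu\in AC^2_{\mathrm{loc}}([0,\infty);\mathcal{P}_2(\mathbb{R}^d))$ means there is $g\in L^2_{\mathrm{loc}}([0,\infty))$ with $\mathcal{W}_2(\nu_t,\nu_s)\le\int_s^tg(z)\,dz$ for all $0\le s\le t$. The density $\rho_\infty$. Let $h(z)=\lambda\ln z+\frac{\eta m}{m-1}(z^{m-1}-1)$, $z>0$, a strictly increasing bijection from $(0,\infty)$ onto $\mathbb{R}$, and $U(y;C)=h^{-1}(C-\Psi(y))$ for $y\in\mathbb{R}^d$, $C\in\mathbb{R}$. Since there are $R,\delta>0$ with $\Psi(y)\ge(\lambda(d+2)+\delta)\ln|y|$ for all $|y|\ge R$, there is a unique $C^*\in\mathbb{R}$ with $\int_{\mathbb{R}^d}U(y;C^* )\,dy=1$; $\rho_\infty:=U(\cdot;C^* )$. *)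

(* Defs.v *)
From HB Require Import structures.
From mathcomp Require Import all_boot all_order all_algebra.
From mathcomp Require Import all_classical all_reals all_analysis measurable_realfun.
Set Implicit Arguments.
Unset Strict Implicit.
Unset Printing Implicit Defensive.
Import Order.TTheory GRing.Theory Num.Theory.
Import numFieldNormedType.Exports.
Local Open Scope classical_set_scope.
Local Open Scope ring_scope.

(* R^d is 'rV[R]_d with the library's (product) topology. Its measurable sets
   are the Borel sets. *)
HB.instance Definition _ (R : realType) (d : nat) :=
  @isMeasurable.Build (sigma_display (@open 'rV[R]_d)) 'rV[R]_d
    <<s @open 'rV[R]_d >> (@sigma_algebra0 _ setT _) (@sigma_algebraC _ _)
    (@sigma_algebra_bigcup _ setT _).

Section rV_measurability.
Context {R : realType}.

Lemma open_measurable_rV d (U : set 'rV[R]_d) : open U -> measurable U.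
Proof. exact: sub_sigma_algebra. Qed.

Lemma continuous_measurable_rV d (f : 'rV[R]_d -> R) :
  continuous f -> measurable_fun setT f.
Proof.
move=> cf; apply: (measurability _ (RGenOpens.measurableE R)).
move=> _ [_ [a [b ->]] <-]; rewrite setTI; apply: open_measurable_rV.
by move/continuousP : cf; apply; exact: interval_open.
Qed.

Lemma measurable_coord d (i : 'I_d) :
  measurable_fun setT (fun y : 'rV[R]_d => y ord0 i).
Proof. by apply: continuous_measurable_rV => x; exact: coord_continuous. Qed.

Let qball d (q : 'rV[rat]_d * nat) : set 'rV[R]_d :=
  [set y | forall i, `|ratr (q.1 ord0 i) - y ord0 i| < q.2.+1%:R^-1].

Lemma measurable_fun_rV d' (T : measurableType d') d (g : T -> 'rV[R]_d) :
  (forall i, measurable_fun setT (fun t => g t ord0 i)) ->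
  measurable_fun setT g.
Proof.
move=> mg; apply: (@measurability _ _ _ _ setT g (@open 'rV[R]_d)) => //.
move=> _ [U oU <-]; rewrite setTI.
have -> : U = \bigcup_q (if `[< qball q `<=` U >] then qball q else set0).
  apply/seteqP; split => [x Ux|x [q /= _]]; last by case: asboolP => // qU /qU.
  move: (oU); rewrite openE => /(_ x Ux) /nbhs_ballP[e /= e0 eU].
  have [n ne] : exists n : nat, 2 * n.+1%:R^-1 < e.
    have e2 : 0 < e / 2 by rewrite divr_gt0.
    have [n _ /(_ n (leqnn n)) ne] := near_infty_natSinv_lt (PosNum e2).
    by exists n; move: ne => /=; rewrite ltr_pdivlMr// mulrC.
  have rq i : exists q : rat, `|ratr q - x ord0 i| < n.+1%:R^-1.
    have [|q] := @rat_in_itvoo R (x ord0 i - n.+1%:R^-1) (x ord0 i + n.+1%:R^-1).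
      by rewrite ltrD2l gtrN// invr_gt0.
    by rewrite in_itv/= => qx; exists q; rewrite ltr_distl.
  pose q := \row_i xchoose (rq i).
  have qx i : `|ratr (q ord0 i) - x ord0 i| < n.+1%:R^-1.
    by rewrite mxE; exact: (xchooseP (rq i)).
  exists (q, n) => //=; case: asboolP => //=; case=> y /= qy.
  apply: eU; split=> // k i; rewrite ord1 -ball_normE/=; apply: le_lt_trans ne.
  rewrite (le_trans (ler_distD (ratr (q ord0 i)) _ _))// mulr_natl mulr2n.
  by rewrite lerD// ltW// 1?distrC// qx.
rewrite preimage_bigcup; apply: countable_bigcupT_measurable => // q.
case: ifPn => _; last by rewrite preimage_set0.
have -> : g @^-1` qball q = \bigcap_i
    ((fun t => g t ord0 i) @^-1` [set r | `|ratr (q.1 ord0 i) - r| < q.2.+1%:R^-1]).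
  by apply/seteqP; split => [t qt i _|t qt i]; [exact: qt|exact: (qt i I)].
apply: fin_bigcap_measurable => // i _.
rewrite -[X in measurable X]setTI; apply: mg => //.
apply: open_measurable.
have -> : [set r : R | `|ratr (q.1 ord0 i) - r| < q.2.+1%:R^-1]
   = ball (ratr (q.1 ord0 i) : R) q.2.+1%:R^-1 by rewrite -ball_normE.
exact: ball_open.
Qed.

End rV_measurability.

Section lebesgue_rV.
Context {R : realType}.

Definition rV_cons d (p : R * 'rV[R]_d) : 'rV[R]_d.+1 :=
  \row_i oapp (p.2 ord0) p.1 (unlift ord0 i).

Let rV_split d (y : 'rV[R]_d.+1) : R * 'rV[R]_d :=
  (y ord0 ord0, \row_j y ord0 (lift ord0 j)).

Let rV_consK d : cancel (@rV_cons d) (@rV_split d).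
Proof.
move=> [x y]; rewrite /rV_split !mxE unlift_none/=; congr pair.
by apply/rowP => j; rewrite !mxE liftK.
Qed.

Lemma measurable_rV_cons d : measurable_fun setT (@rV_cons d).
Proof.
apply: measurable_fun_rV => i; case: (unliftP ord0 i) => [j ->|->].
  rewrite (_ : (fun _ => _) = (fun y : 'rV[R]_d => y ord0 j) \o snd).
    apply: measurableT_comp => //.
    exact: measurable_coord.
  by apply/funext => -[x y]/=; rewrite mxE liftK.
rewrite (_ : (fun _ => _) = fst) //.
by apply/funext => -[x y]/=; rewrite mxE unlift_none.
Qed.

Let measurable_rV_split d : measurable_fun setT (@rV_split d).
Proof.
apply/measurable_fun_pairP; split.
  exact: measurable_coord.
apply: measurable_fun_rV => i; rewrite (_ : (fun _ => _) =
    (fun y : 'rV[R]_d.+1 => y ord0 (lift ord0 i))).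
  exact: measurable_coord.
by apply/funext => y/=; rewrite mxE.
Qed.

Local Open Scope ereal_scope.

Section leb_succ.
Context d (mu : {sigma_finite_measure set 'rV[R]_d -> \bar R}).

Definition leb_succ : set 'rV[R]_d.+1 -> \bar R :=
  pushforward (lebesgue_measure \x mu) (@rV_cons d).

Let preim A : measurable A -> measurable (@rV_cons d @^-1` A).
Proof. by move=> mA; rewrite -[X in measurable X]setTI; exact: measurable_rV_cons. Qed.

Let leb_succ0 : leb_succ set0 = 0.
Proof. by rewrite /leb_succ /pushforward preimage_set0 measure0. Qed.

Let leb_succ_ge0 A : 0 <= leb_succ A.
Proof. by rewrite /leb_succ /pushforward; exact: measure_ge0. Qed.

Let leb_succ_sigma_additive : semi_sigma_additive leb_succ.
Proof.
move=> F mF tF mUF; rewrite /leb_succ /pushforward preimage_bigcup.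
apply: measure_semi_sigma_additive.
- by move=> n; exact: preim.
- apply/trivIsetP => /= i j _ _ ij; rewrite -preimage_setI.
  by move/trivIsetP : tF => /(_ _ _ _ _ ij) ->//; rewrite preimage_set0.
- by rewrite -preimage_bigcup; exact: preim.
Qed.

HB.instance Definition _ := isMeasure.Build _ _ _ leb_succ
  leb_succ0 leb_succ_ge0 leb_succ_sigma_additive.

Let leb_succ_sigma_finite : sigma_finite setT leb_succ.
Proof.
have /sigma_finiteP[F [TF ndF Foo]] :=
  sigma_finiteT (@lebesgue_measure R : {sigma_finite_measure set _ -> \bar R}).
have /sigma_finiteP[G [TG ndG Goo]] := sigma_finiteT mu.
exists (fun k => @rV_split d @^-1` (F k `*` G k)).
  rewrite -preimage_bigcup -(preimage_setT (@rV_split d)); congr (_ @^-1` _).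
  apply/seteqP; split => // -[x y] _.
  have [n _ Fnx] : (\bigcup_i F i) x by rewrite -TF.
  have [k _ Gky] : (\bigcup_i G i) y by rewrite -TG.
  exists (maxn n k) => //; split.
    by move: x Fnx; exact/subsetPset/ndF/leq_maxl.
  by move: y Gky; exact/subsetPset/ndG/leq_maxr.
move=> k; have [mF Fk] := Foo k; have [mG Gk] := Goo k; split.
  rewrite -[X in measurable X]setTI; apply: measurable_rV_split => //.
  exact: measurableX.
rewrite /leb_succ /pushforward -comp_preimage.
rewrite (_ : _ \o _ = id); last by apply/funext => p; exact: rV_consK.
by rewrite preimage_id product_measure1E// lte_mul_pinfty// ge0_fin_numE.
Qed.

HB.instance Definition _ := Measure_isSigmaFinite.Build _ _ _ leb_succ
  leb_succ_sigma_finite.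

End leb_succ.

(* d-dimensional Lebesgue measure: L^0 is the unit mass at the only point, and
   L^(d+1) is the image of L^1 x L^d under (x, y) |-> (x, y_1, ..., y_d). *)
Fixpoint leb (d : nat) : {sigma_finite_measure set 'rV[R]_d -> \bar R} :=
  if d is d'.+1 then leb_succ (leb d') else \d_(0%R : 'rV[R]_0).

Lemma leb_box d (A : 'I_d -> set R) : (forall i, measurable (A i)) ->
  leb d [set y | forall i, A i (y ord0 i)] = \prod_i lebesgue_measure (A i).
Proof.
elim: d A => [|d IH] A mA.
  by rewrite big_ord0 /= diracE mem_set// => -[].
rewrite big_ord_recl -IH; last by move=> i.
transitivity ((lebesgue_measure \x leb d)
    (A ord0 `*` [set y : 'rV[R]_d | forall i, A (lift ord0 i) (y ord0 i)])); last first.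
  rewrite product_measure1E//; first exact: mA.
  have -> : [set y : 'rV[R]_d | forall i, A (lift ord0 i) (y ord0 i)] =
      \bigcap_i ((fun y : 'rV[R]_d => y ord0 i) @^-1` A (lift ord0 i)).
    by apply/seteqP; split => [y Ay i _|y Ay i]; [exact: Ay|exact: (Ay i I)].
  apply: fin_bigcap_measurable => // i _.
  by rewrite -[X in measurable X]setTI; exact: measurable_coord.
congr (product_measure1 _ _ _).
apply/seteqP; split => [[x y] xyA|[x y] [/= xA yA] i].
  split; first by have := xyA ord0; rewrite mxE unlift_none.
  by move=> i; have := xyA (lift ord0 i); rewrite mxE liftK.
by case: (unliftP ord0 i) => [j|] ->; rewrite mxE ?liftK ?unlift_none//=.
Qed.

End lebesgue_rV.

Section euclidean_calculus.
Context {R : realType}.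

(* Euclidean norm; the library norm on matrices is the sup norm. *)
Definition enorm d (x : 'rV[R]_d) : R := Num.sqrt (\sum_i x ord0 i ^+ 2).

Definition edot d (x y : 'rV[R]_d) : R := \sum_i x ord0 i * y ord0 i.

Definition grad d (f : 'rV[R]_d -> R) (x : 'rV[R]_d) : 'rV[R]_d :=
  \row_i 'D_(delta_mx ord0 i) f x.

(* f is C^k in the Frechet sense (V finite-dimensional), through iterated
   directional derivatives. *)
Fixpoint Ck (V : normedModType R) (k : nat) (f : V -> R) : Prop :=
  if k is k'.+1 then
    (forall x, differentiable f x) /\ (forall v, Ck k' (fun x => 'D_v f x))
  else continuous f.

Definition smooth (V : normedModType R) (f : V -> R) := forall k, Ck k f.

Definition fsupport (V : normedModType R) (f : V -> R) : set V :=
  closure [set x | f x != 0].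

(* C_c^infty(O) for an open subset O of V; test functions are extended by 0
   outside O. *)
Definition test_fun (V : normedModType R) (O : set V) (f : V -> R) :=
  [/\ smooth f, compact (fsupport f) & fsupport f `<=` O].

Definition loc_integrable d (u : 'rV[R]_d -> R) :=
  forall K : set 'rV[R]_d, compact K -> (leb d).-integrable K (EFin \o u).

Definition is_weak_grad d (u : 'rV[R]_d -> R) (G : 'rV[R]_d -> 'rV[R]_d) :=
  forall i : 'I_d, loc_integrable (fun y => G y ord0 i) /\
    forall phi : 'rV[R]_d -> R, test_fun setT phi ->
      (\int[leb d]_y (u y * grad phi y ord0 i) =
       - \int[leb d]_y (G y ord0 i * phi y))%R.

(* W^{1,1}_loc(R^d) *)
Definition W11loc d (u : 'rV[R]_d -> R) :=
  loc_integrable u /\ exists G, is_weak_grad u G.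

(* A representative of the weak gradient, which is unique up to null sets. *)
Definition wgrad d (u : 'rV[R]_d -> R) : 'rV[R]_d -> 'rV[R]_d :=
  xget (fun=> 0) [set G | is_weak_grad u G].

End euclidean_calculus.

Section densities.
Context {R : realType} (d : nat).

(* Elements of D(R^d), as everywhere defined Borel representatives. *)
Record density := Density {
  density_fun :> 'rV[R]_d -> R ;
  density_measurable : measurable_fun setT density_fun ;
  density_ge0 : forall y, 0 <= density_fun y ;
  density_int : (\int[leb d]_y (density_fun y)%:E = 1)%E }.

(* rho L^d *)
Definition dmeas (rho : density) (A : set 'rV[R]_d) : \bar R :=
  (\int[leb d]_(y in A) (rho y)%:E)%E.

Section dmeas_probability.
Variable rho : density.

Let dmeas0 : dmeas rho set0 = 0%E.
Proof. by rewrite /dmeas integral_set0. Qed.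

Let dmeas_ge0 A : (0 <= dmeas rho A)%E.
Proof. by apply: integral_ge0 => y _; rewrite lee_fin density_ge0. Qed.

Let dmeas_sigma_additive : semi_sigma_additive (dmeas rho).
Proof.
move=> F mF tF mUF; rewrite /dmeas ge0_integral_bigcup//; last 2 first.
- by apply/measurable_funTS/measurable_EFinP; exact: density_measurable.
- by move=> y _; rewrite lee_fin density_ge0.
by apply: is_cvg_ereal_nneg_natsum_cond => n _ _; exact: dmeas_ge0.
Qed.

HB.instance Definition _ := isMeasure.Build _ _ _ (dmeas rho)
  dmeas0 dmeas_ge0 dmeas_sigma_additive.

Let dmeas_setT : dmeas rho setT = 1%E.
Proof. exact: density_int. Qed.

HB.instance Definition _ := Measure_isProbability.Build _ _ _ (dmeas rho)
  dmeas_setT.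

End dmeas_probability.

Definition dprob (rho : density) : probability 'rV[R]_d R := dmeas rho.

(* D_2(R^d) *)
Definition D2 (rho : density) :=
  (\int[leb d]_y (enorm y ^+ 2 * rho y)%:E < +oo)%E.

End densities.
Arguments density : clear implicits.

Section probability_measures.
Context {R : realType} (d : nat).
Local Notation P := (probability 'rV[R]_d R).

(* Weak convergence (against bounded continuous functions) along a filter. *)
Definition weak_cvg (I : Type) (F : set_system I) (mu : I -> P) (nu : P) :=
  forall f : 'rV[R]_d -> R, continuous f -> bounded_fun f ->
    (\int[mu i]_y f y @[i --> F] --> \int[nu]_y f y)%R.

(* P_2(R^d) *)
Definition P2 (mu : P) := (\int[mu]_y (enorm y ^+ 2)%:E < +oo)%E.

Definition coupling (mu nu : P)
    (gamma : probability ('rV[R]_d * 'rV[R]_d)%type R) :=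
  forall A : set 'rV[R]_d, measurable A ->
    gamma (A `*` setT) = mu A /\ gamma (setT `*` A) = nu A.

Definition W2 (mu nu : P) : \bar R :=
  sqrte (ereal_inf
    [set (\int[gamma]_p (enorm (p.1 - p.2) ^+ 2)%:E)%E | gamma in coupling mu nu]).

(* AC^2_loc([0, oo); P_2(R^d)); only the values nu t with 0 <= t matter. *)
Definition AC2loc (nu : R -> P) :=
  (forall t, 0 <= t -> P2 (nu t)) /\
  exists g : R -> R,
    [/\ measurable_fun (`[0, +oo[ : set R) g,
        forall T, 0 <= T ->
          (\int[lebesgue_measure]_(z in (`[0%R, T] : set R)) (g z ^+ 2)%:E < +oo)%E &
        forall s t, 0 <= s -> s <= t ->
          (W2 (nu t) (nu s) <= \int[lebesgue_measure]_(z in (`[s, t] : set R)) (g z)%:E)%E].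

End probability_measures.

Section fokker_planck.
Context {R : realType} (d : nat).
Variables (lam eta m : R) (Psi : 'rV[R]_d -> R).

(* ln 0 = 0 in the library, so Hent 0 = 0. *)
Definition Hent (s : R) : R := lam * s * ln s.

(* The free energy J, meant for rho in D_2(R^d), where the third integral is
   finite. *)
Definition Jfun (rho : density R d) : \bar R :=
  (\int[leb d]_y (Psi y * rho y)%:E
   + \int[leb d]_y (Num.max (Hent (rho y)) 0)%:E
   - \int[leb d]_y (Num.max (- Hent (rho y)) 0)%:E
   + \int[leb d]_y (eta / (m - 1) * rho y `^ m)%:E)%E.

Definition LF (s : R) : R := lam * s + eta * s `^ m.

(* rho : R -> density R d stands for a curve on [0, oo): its values at negative
   times are irrelevant. *)
Definition FP_solution (rho0 : density R d) (rho : R -> density R d) :=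
  [/\ forall t : R, 0 <= t ->
        weak_cvg (within (`[0, +oo[ : set R) (nbhs t)) (fun s => dprob (rho s))
          (dprob (rho t)),
      {ae leb d, forall y, rho 0 y = rho0 y},
      forall t : R, 0 < t -> W11loc (fun y => LF (rho t y)) &
      forall phi : (R^o * 'rV[R]_d)%type -> R,
        test_fun [set p : R^o * 'rV[R]_d | 0 < p.1 :> R] phi ->
        (\int[lebesgue_measure]_(t in (`]0%R, +oo[ : set R))
          (\int[leb d]_y
            (rho t y * derive1 (fun s : R => phi (s, y)) t
             - edot (rho t y *: grad Psi y + wgrad (fun z => LF (rho t z)) y)
                    (grad (fun z => phi (t, z)) y)))%R%:E = 0)%E].

(* The quotients by rho t y only matter rho(t)L^d-almost everywhere. *)
Definition velocity (rho : R -> density R d) (t : R) (y : 'rV[R]_d) :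
    'rV[R]_d :=
  - (grad Psi y + (lam / rho t y) *: wgrad (rho t) y
     + (eta / rho t y) *: wgrad (fun z => rho t z `^ m) y).

Definition hfun (z : R) : R := lam * ln z + eta * m / (m - 1) * (z `^ (m - 1) - 1).

(* Inverse of the bijection hfun : ]0, oo[ -> R. *)
Definition hinv (w : R) : R := xget 0 [set z | 0 < z /\ hfun z = w].

Definition Ufun (C : R) (y : 'rV[R]_d) : R := hinv (C - Psi y).

Definition Cstar : R := xget 0 [set C | (\int[leb d]_y (Ufun C y)%:E = 1)%E].

Definition rho_infty : 'rV[R]_d -> R := Ufun Cstar.

Definition unique_minimizer (rho : density R d) :=
  [/\ D2 rho,
      forall rho' : density R d, D2 rho' -> (Jfun rho <= Jfun rho')%E &
      forall rho' : density R d, D2 rho' -> Jfun rho' = Jfun rho ->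
        {ae leb d, forall y, rho' y = rho y}].

End fokker_planck.

(* Main.v *)
(* The relative weight of the density u at a point x is measured by
   z = exp((h(u) + Psi(x) - C) / lambda), so that z = 1 exactly when u = U(x; C).
   The bounded convex entropies E_C(u) = int PH(u), with derivative the logistic
   function phi = z / (1 + z) of z, are finite on every density and decrease
   along the flow, with dissipation int lamb |j|^2 / u where
   j = u grad Psi + grad(lambda u + eta u^m) and lamb = d phi / d ln z / lambda.
   The inequality is derived for the mollified density u_n, which is absolutely
   continuous in time and smooth in space, and then n -> oo.
   Since E_C >= 0, there are times t_k -> oo along which the dissipation tends to
   0 on larger and larger cubes.  It controls the gradient of phi(u(t_k)), so by a
   Poincare inequality phi(u(t_k)) converges a.e. to a constant along a
   subsequence: u(t_k) tends a.e. to 0, to infinity, or to some U(.; C).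
   Monotonicity of E_C and E_C(u(1)) -> 0 as C -> oo give tightness, hence the
   limit has mass 1, C = C* and Scheffe's lemma gives weak convergence. *)
From HB Require Import structures.
Require Import Defs.
From mathcomp Require Import all_boot all_order all_algebra.
From mathcomp Require Import all_classical all_reals all_analysis.
From mathcomp Require Import ring lra measurable_realfun.
Set Implicit Arguments.
Unset Strict Implicit.
Unset Printing Implicit Defensive.
Import Order.TTheory GRing.Theory Num.Theory.
Import numFieldNormedType.Exports.
Local Open Scope classical_set_scope.
Local Open Scope ring_scope.

(** * Real-valued integrals, almost everywhere subsequences and Fatou's lemma *)

Module Integrals.

(** The formula for z is dictated by grad ln z = j / (lambda u): the gradient of phi(u) is then
    [lamb] times j / u and involves the flux alone. As [lamb] is bounded by a multiple of u on
    cubes, the L^1 norm of this gradient is controlled by the dissipation. As phi is flat near z = 0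
    and z = oo, the values 0 and oo survive in the limit and have to be excluded through the mass.
    The obstacle is that mollification does not commute with the nonlinear pressure: at level n the
    product of grad phi(u_n) with the mollified flux has no sign. Jensen's inequality |j_n|^2 <= u_n
    (|j|^2 / u)_n dominates it by quantities that converge in L^1, and only its limit is the
    dissipation. In time, convexity replaces a chain rule: the entropy increment over ]a, b] is
    bounded with phi frozen at b, and partitions are refined. Times of infinite flux energy form a
    null set and are masked by [gd]. *)

Lemma dep_choice (T : Type) (x0 : T) (Q : nat -> T -> T -> Prop) :
  (forall n x, exists y, Q n x y) ->
  exists f : nat -> T, forall n, Q n (f n) (f n.+1).
Proof.
move=> h; have [g hg] := choice (fun p : nat * T => h p.1 p.2).
exists (fix f n := if n is k.+1 then g (k, f k) else x0) => n.
by rewrite -/(g _); exact: (hg (n, _)).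
Qed.

Lemma ereal_ge0_dense (R : realType) (x y : \bar R) : (0 <= x)%E -> (x < y)%E ->
  exists2 c : R, (x < c%:E)%E & (c%:E < y)%E.
Proof.
case: x y => [x| |] [y| |] //= x0 xy.
- by exists ((x + y) / 2); rewrite lte_fin ?midf_lt// -lte_fin.
- by exists (x + 1); rewrite ?lte_fin ?ltrDl// ltry.
Qed.

Section limn_einf_facts.
Variables (R : realType) (u : (\bar R)^nat) (c : \bar R).

Lemma limn_einfE : limn_einf u = ereal_sup (range (einfs u)).
Proof.
rewrite limn_einf_lim; apply/cvg_lim => //.
exact/ereal_nondecreasing_cvgn/nondecreasing_einfs.
Qed.

(** If [u] is below [c] infinitely often, every tail infimum is at most [c]. *)
Lemma einf_le : (forall N, exists2 n, (N <= n)%N & (u n <= c)%E) ->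
  (limn_einf u <= c)%E.
Proof.
move=> h; rewrite limn_einfE; apply: ge_ereal_sup => _ [N _ <-].
have [n Nn un] := h N; apply: le_trans un.
by apply: ereal_inf_lbound; exists n.
Qed.

Lemma einf_ge : (forall n, (c <= u n)%E) -> (c <= limn_einf u)%E.
Proof.
move=> h; rewrite limn_einfE; apply: (@le_trans _ _ (einfs u 0)).
  by apply: le_ereal_inf_tmp => _ [n _ <-].
by apply: ereal_sup_ubound; exists 0.
Qed.

Lemma einf_lt_freq : (limn_einf u < c)%E ->
  forall N, exists n, (N <= n)%N /\ (u n < c)%E.
Proof.
rewrite limn_einfE => h N.
have : (einfs u N < c)%E by apply: le_lt_trans h; apply: ereal_sup_ubound; exists N.
by move=> /ereal_inf_lt[_ [n Nn <-] ?]; exists n.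
Qed.

End limn_einf_facts.

Lemma measurable_limn_einf d (T : measurableType d) (R : realType)
  (f : (T -> \bar R)^nat) : (forall n, measurable_fun setT (f n)) ->
  measurable_fun setT (fun x => limn_einf (f ^~ x)).
Proof.
move=> mf; rewrite /limn_einf; apply: measurableT_comp => //.
apply: (@measurable_fun_limn_esup _ _ _ _ (fun n x => - f n x)%E) => n.
exact: measurableT_comp.
Qed.

Section toolkit.
Context d (T : measurableType d) (R : realType).
Variable mu : {measure set T -> \bar R}.
Implicit Types f g : T -> R.
Local Notation ig f := (mu.-integrable setT (EFin \o f)).

Lemma igP f : measurable_fun setT f -> (\int[mu]_x `|f x|%:E < +oo)%E -> ig f.
Proof. by move=> mf h; apply/integrableP; split => //; exact/measurable_EFinP. Qed.

Lemma ig_meas f : ig f -> measurable_fun setT f.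
Proof. by move=> /integrableP[/measurable_EFinP]. Qed.

Lemma igD f g : ig f -> ig g -> ig (fun x => f x + g x).
Proof. by move=> hf hg; exact: (integrableD measurableT hf hg). Qed.

Lemma igB f g : ig f -> ig g -> ig (fun x => f x - g x).
Proof. by move=> hf hg; exact: (integrableB measurableT hf hg). Qed.

Lemma igN f : ig f -> ig (fun x => - f x).
Proof. by move=> hf; exact: (integrableN hf). Qed.

Lemma igZ c f : ig f -> ig (fun x => c * f x).
Proof. by move=> hf; exact: (integrableZl measurableT c hf). Qed.

Lemma ig_norm f : ig f -> ig (fun x => `|f x|).
Proof. by move=> hf; exact: (integrable_abse hf). Qed.

Lemma ig0 : ig (fun=> 0).
Proof. exact: integrable0. Qed.

Lemma ig_sum (I : Type) (s : seq I) (F : I -> T -> R) :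
  (forall i, ig (F i)) -> ig (fun x => \sum_(i <- s) F i x).
Proof.
move=> h; elim: s => [|i s ih].
  by under eq_fun do rewrite big_nil; exact: ig0.
by under eq_fun do rewrite big_cons; exact: igD.
Qed.

Lemma ig_le f g : measurable_fun setT f -> (forall x, `|f x| <= g x) ->
  ig g -> ig f.
Proof.
move=> mf fg hg; apply: le_integrable hg => //; first exact/measurable_EFinP.
by move=> x _ /=; rewrite lee_fin (le_trans (fg x))// ler_norm.
Qed.

Lemma ig_ae f g : measurable_fun setT g -> {ae mu, forall x, f x = g x} ->
  ig f -> ig g.
Proof.
move=> mg fg /integrableP[mf hf]; apply: igP => //; apply: le_lt_trans hf.
rewrite le_eqVlt; apply/orP; left; apply/eqP; apply: ae_eq_integral => //.
- by apply/measurable_EFinP; exact: measurableT_comp.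
- exact: measurableT_comp.
- by move: fg; apply: filterS => x fgx _ /=; rewrite fgx.
Qed.

Lemma RintD f g : ig f -> ig g ->
  (\int[mu]_x (f x + g x) = \int[mu]_x f x + \int[mu]_x g x)%R.
Proof. by move=> hf hg; rewrite RintegralD. Qed.

Lemma RintB f g : ig f -> ig g ->
  (\int[mu]_x (f x - g x) = \int[mu]_x f x - \int[mu]_x g x)%R.
Proof. by move=> hf hg; rewrite RintegralB. Qed.

Lemma RintZ c f : ig f -> (\int[mu]_x (c * f x) = c * \int[mu]_x f x)%R.
Proof. by move=> hf; rewrite RintegralZl. Qed.

Lemma RintN f : ig f -> (\int[mu]_x (- f x) = - \int[mu]_x f x)%R.
Proof.
by move=> hf; rewrite -mulN1r -RintZ//; apply: eq_Rintegral => x _; rewrite mulN1r.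
Qed.

Lemma Rint0 : (\int[mu]_x (0 : R) = 0)%R.
Proof. by rewrite /Rintegral integral0. Qed.

Lemma Rint_sum (I : Type) (s : seq I) (F : I -> T -> R) :
  (forall i, ig (F i)) ->
  (\int[mu]_x (\sum_(i <- s) F i x) = \sum_(i <- s) \int[mu]_x F i x)%R.
Proof.
move=> h; elim: s => [|i s ih].
  by under eq_fun do rewrite big_nil; rewrite big_nil Rint0.
under eq_fun do rewrite big_cons; rewrite big_cons RintD ?ih//; exact: ig_sum.
Qed.

Lemma Rint_le f g : ig f -> ig g -> (forall x, f x <= g x) ->
  (\int[mu]_x f x <= \int[mu]_x g x)%R.
Proof. by move=> hf hg fg; apply: le_Rintegral. Qed.

Lemma Rint_ge0 f : (forall x, 0 <= f x) -> (0 <= \int[mu]_x f x)%R.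
Proof. by move=> f0; apply: Rintegral_ge0. Qed.

Lemma Rint_norm f : ig f -> (`|\int[mu]_x f x| <= \int[mu]_x `|f x|)%R.
Proof. by move=> hf; apply: le_normr_Rintegral. Qed.

Lemma Rint_ae f g : measurable_fun setT f -> measurable_fun setT g ->
  {ae mu, forall x, f x = g x} -> (\int[mu]_x f x = \int[mu]_x g x)%R.
Proof.
move=> mf mg fg; congr fine; apply: ae_eq_integral => //; try exact/measurable_EFinP.
by move: fg; apply: filterS => x fgx _ /=; rewrite fgx.
Qed.

Lemma EFin_Rint f : ig f -> ((\int[mu]_x f x)%R%:E = \int[mu]_x (f x)%:E)%E.
Proof. by move=> hf; rewrite fineK//; exact: integrable_fin_num. Qed.

Lemma ig_ge0P f : measurable_fun setT f -> (forall x, 0 <= f x) ->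
  (\int[mu]_x (f x)%:E < +oo)%E -> ig f.
Proof.
move=> mf f0 h; apply: igP => //; apply: le_lt_trans h.
by rewrite le_eqVlt; apply/orP; left; apply/eqP; apply: eq_integral => x _; rewrite ger0_norm.
Qed.

Lemma ig_lty f : ig f -> (\int[mu]_x (f x)%:E < +oo)%E.
Proof. by move=> hf; rewrite -EFin_Rint// ltry. Qed.

Lemma Rdct (F : nat -> T -> R) f g :
  (forall n, measurable_fun setT (F n)) -> measurable_fun setT f ->
  {ae mu, forall x, F ^~ x @ \oo --> f x} -> ig g ->
  (forall n x, `|F n x| <= g x) ->
  [/\ ig f, (\int[mu]_x F n x @[n --> \oo] --> \int[mu]_x f x)%R &
      (\int[mu]_x `|F n x - f x| @[n --> \oo] --> (0 : R))%R].
Proof.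
move=> mF mf Ff hg Fg.
have igF n : ig (F n) by apply: ig_le hg.
have [] := @dominated_convergence _ _ _ mu setT measurableT
  (fun n => EFin \o F n) (EFin \o f) (EFin \o g).
- by move=> n; exact/measurable_EFinP.
- exact/measurable_EFinP.
- by move: Ff; apply: filterS => x Fx _; exact/cvg_EFin/Fx/nearW.
- by [].
- by apply: aeW => x n _ /=; rewrite lee_fin.
move=> igf c0 cf; split => //.
- move: cf => /=; under eq_fun do rewrite -EFin_Rint//.
  by rewrite -EFin_Rint// => /fine_cvgP[_].
- move: c0 => /=.
  have igd n : ig (fun x => `|F n x - f x|) by apply: ig_norm; exact: igB.
  under eq_fun do rewrite -(EFin_Rint (igd _)).
  by move=> /fine_cvgP[_].
Qed.

(** Throughout, a subsequence is an index map with [n <= s n], not necessarily increasing: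
    convergence along [\oo] asks for no more, and such maps are easy to choose. *)
Lemma cvg_subs (X : topologicalType) (u : nat -> X) (l : X) (s : nat -> nat) :
  u @ \oo --> l -> (forall n, (n <= s n)%N) -> u \o s @ \oo --> l.
Proof.
move=> ul sn; apply: cvg_comp ul; move=> A [N _ NA]; exists N => // n /= Nn.
by apply: NA => /=; exact: leq_trans Nn (sn n).
Qed.

(** Integrals below 2^-n along the subsequence make the series of the [a (s n)] integrable, hence
    finite almost everywhere, so that its terms tend to 0. *)
Lemma L1_ae_subseq (a : nat -> T -> R) :
  (forall n, ig (a n)) -> (forall n x, 0 <= a n x) ->
  (\int[mu]_x a n x @[n --> \oo] --> (0 : R))%R ->
  exists2 s : nat -> nat, forall n, (n <= s n)%N &
    {ae mu, forall x, a (s n) x @[n --> \oo] --> (0 : R)}.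
Proof.
move=> iga a0 lim.
have h n : exists k, (n <= k)%N /\ (\int[mu]_x a k x < geometric 1 2^-1 n)%R.
  move/cvgr0Pnorm_lt : lim => /(_ (geometric 1 2^-1 n)) [|N _ hN].
    by rewrite /= mul1r exprn_gt0// invr_gt0.
  exists (maxn n N); split; first exact: leq_maxl.
  by apply: le_lt_trans (hN _ (leq_maxr _ _)); exact: ler_norm.
have [s hs] := choice h; exists s; first by move=> n; have [] := hs n.
have Sfin : (\int[mu]_x \sum_(n <oo) (a (s n) x)%:E < +oo)%E.
  rewrite integral_nneseries//; last 2 first.
    by move=> n; apply/measurable_EFinP; exact: ig_meas.
    by move=> n x _; rewrite lee_fin.
  apply: (@le_lt_trans _ _ (\sum_(n <oo) (geometric 1 2^-1 n)%:E)%E).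
    apply: lee_nneseries => [n *|n *].
      by apply: integral_ge0 => x _; rewrite lee_fin.
    by rewrite -EFin_Rint// lee_fin ltW//; have [] := hs n.
  have := @cvg_geometric_series R 1 2^-1.
  rewrite ger0_norm ?invr_ge0// invf_lt1 ?ltr1n// => /(_ isT) cg.
  have : EFin \o series (geometric 1 2^-1) @ \oo --> ((1 / (1 - 2^-1) : R)%:E).
    by apply/cvg_EFin => //; exact: nearW.
  move=> /cvg_lim cl; rewrite (_ : limn _ = (1 / (1 - 2^-1))%:E) ?ltry//.
  by rewrite -cl//; congr (limn _); apply/funext => n /=; rewrite sumEFin.
have mS : measurable_fun setT (fun x => \sum_(n <oo) (a (s n) x)%:E)%E.
  apply: ge0_emeasurable_sum => [n x _ _|n _]; first by rewrite lee_fin.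
  by apply/measurable_EFinP; exact: ig_meas.
have : mu.-integrable setT (fun x => \sum_(n <oo) (a (s n) x)%:E)%E.
  apply/integrableP; split => //; apply: le_lt_trans Sfin.
  rewrite le_eqVlt; apply/orP; left; apply/eqP; apply: eq_integral => x _.
  by rewrite gee0_abs// nneseries_ge0// => n _ _; rewrite lee_fin.
move=> /(integrable_ae measurableT); apply: filterS => x /(_ I) Sx.
apply: cvg_series_cvg_0; apply/cvg_ex; exists (fine (\sum_(n <oo) (a (s n) x)%:E))%E.
have cvS : cvgn (fun n => \sum_(0 <= k < n) (a (s k) x)%:E)%E.
  by apply: is_cvg_nneseries => n *; rewrite lee_fin.
move: cvS => /cvg_ex[l cl]; have lE : (\sum_(n <oo) (a (s n) x)%:E)%E = l by exact/cvg_lim.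
rewrite lE in Sx *; move: cl; rewrite -{1}(fineK Sx) => /fine_cvgP[_].
apply: cvg_trans; apply: near_eq_cvg; apply: nearW => n /=.
by rewrite sumEFin.
Qed.

(* Fatou along subsequences: [a] measures the distance to the limit of the
   quantities that [f_] depends on. *)
Lemma fatou_subseq (f_ : nat -> T -> R) (L : T -> R) (a : nat -> T -> R) :
  (forall n, measurable_fun setT (f_ n)) -> (forall n x, 0 <= f_ n x) ->
  (forall n, ig (a n)) -> (forall n x, 0 <= a n x) ->
  (\int[mu]_x a n x @[n --> \oo] --> (0 : R))%R ->
  measurable_fun setT L -> (forall x, 0 <= L x) ->
  {ae mu, forall x, L x = 0 \/ forall s : nat -> nat, (forall n, (n <= s n)%N) ->
     a (s n) x @[n --> \oo] --> (0 : R) -> f_ (s n) x @[n --> \oo] --> L x} ->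
  (\int[mu]_x (L x)%:E <= limn_einf (fun n => \int[mu]_x (f_ n x)%:E))%E.
Proof.
move=> mf f0 iga a0 lim mL L0 hL; rewrite leNgt; apply/negP => lt.
set I := fun n => (\int[mu]_x (f_ n x)%:E)%E in lt *.
have I0 n : (0 <= I n)%E by apply: integral_ge0 => x _; rewrite lee_fin.
have e0 : (0 <= limn_einf I)%E by exact: einf_ge.
(* If the inequality failed, a real [c] would separate the two sides. First pass to indices whose
   integrals stay below [c], then to a further subsequence along which [a] tends to 0 almost
   everywhere. *)
have [c ec cL] := ereal_ge0_dense e0 lt.
have [s1 hs1] := choice (einf_lt_freq ec).
have [|||s2 hs2 cvs2] := @L1_ae_subseq (a \o s1).
- by move=> n; exact: iga.
- by move=> n x; exact: a0.
- exact: (@cvg_subs _ (fun n => \int[mu]_x a n x)%R _ s1 lim (fun n => (hs1 n).1)).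
have : (\int[mu]_x (L x)%:E <= c%:E)%E; last by rewrite leNgt cL.
have F := @fatou _ _ _ mu setT measurableT (fun n x => (f_ (s1 (s2 n)) x)%:E)
  (fun n => (@measurable_EFinP _ _ _ _ _).2 (mf _))
  (fun n x _ => f0 (s1 (s2 n)) x).
apply: le_trans (le_trans F _); last first.
  by apply: einf_le => N; exists N => //; exact/ltW/(hs1 _).2.
apply: ae_ge0_le_integral => //.
- by move=> x _; rewrite lee_fin.
- exact/measurable_EFinP.
- by move=> x _; apply: einf_ge => n; rewrite lee_fin.
- by apply: measurable_limn_einf => n; exact/measurable_EFinP.
move: hL cvs2; apply: filterS2 => x [L0x|Lx] cx _.
  by rewrite L0x; apply: einf_ge => n; rewrite lee_fin.
have /cvg_limn_einf_sup[-> _] // : (f_ (s1 (s2 n)) x)%:E @[n --> \oo] --> (L x)%:E.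
apply/cvg_EFin; first exact: nearW.
apply: (Lx (s1 \o s2)) => // n /=.
by apply: leq_trans (hs2 n) _; have [] := hs1 (s2 n).
Qed.
End toolkit.

End Integrals.
Import Integrals.

(** * Translations, products and cubes for d-dimensional Lebesgue measure *)

Module LebesgueSpace.

Section leb_facts.
Context {R : realType}.
Local Notation leb1 := (@lebesgue_measure R).

(** The translated measure agrees with Lebesgue measure on the intervals ]u, v], hence everywhere by
    uniqueness. *)
Lemma leb1_shift (a : R) (f : R -> \bar R) : measurable_fun setT f ->
  (forall x, 0 <= f x)%E ->
  (\int[leb1]_x f (x + a)%R = \int[leb1]_x f x)%E.
Proof.
move=> mf f0.
have ms : measurable_fun setT (fun x : measurableTypeR R => (x + a : measurableTypeR R)).
  exact: measurable_funD.
have := @ge0_integral_pushforward _ _ _ _ R _ ms leb1 setT f measurableT mf.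
rewrite preimage_setT /comp /= => <- //.
apply: eq_measure_integral => A mA _.
apply/esym/lebesgue_measure_unique => //= _ [[u v]] _ <-.
rewrite /pushforward.
have -> : (fun x => x + a) @^-1` [set` `]u, v]] = [set` `]u - a, v - a]].
  apply/seteqP; split => x /=; rewrite !in_itv/=; first by rewrite ltrBlDr lerBrDr.
  by rewrite ltrBlDr lerBrDr.
rewrite !lebesgue_measure_itv/= !lte_fin ltrD2r.
by case: ifPn => // _; rewrite -!EFinB; congr EFin; ring.
Qed.

Lemma leb_succE d (f : 'rV[R]_d.+1 -> \bar R) : measurable_fun setT f ->
  (forall x, 0 <= f x)%E ->
  (\int[leb d.+1]_x f x = \int[leb1]_x \int[leb d]_y f (rV_cons (x, y)))%E.
Proof.
move=> mf f0.
have mc := @measurable_rV_cons R d.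
rewrite (eq_measure_integral (pushforward (leb1 \x leb d)%E (@rV_cons R d)))//.
rewrite ge0_integral_pushforward// preimage_setT fubini_tonelli1//.
  exact: measurableT_comp.
by move=> p; exact: f0.
Qed.

Lemma measurable_shift d (a : 'rV[R]_d) : measurable_fun setT (fun x : 'rV[R]_d => x + a).
Proof.
apply: measurable_fun_rV => i; under eq_fun do rewrite mxE.
by apply: measurable_funD => //; exact: measurable_coord.
Qed.

Lemma measurable_subr d (x : 'rV[R]_d) : measurable_fun setT (fun y : 'rV[R]_d => x - y).
Proof.
apply: measurable_fun_rV => i; under eq_fun do rewrite !mxE.
by apply: measurable_funB => //; exact: measurable_coord.
Qed.

(** Induction on the dimension: splitting off the first coordinate turns the translation into one on
    the line and one in dimension d. *)
Lemma leb_shift d (a : 'rV[R]_d) (f : 'rV[R]_d -> \bar R) :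
  measurable_fun setT f -> (forall x, 0 <= f x)%E ->
  (\int[leb d]_x f (x + a)%R = \int[leb d]_x f x)%E.
Proof.
elim: d a f => [|d ih] a f mf f0.
  by apply: eq_integral => x _; rewrite [a]thinmx0 addr0.
have ma : measurable_fun setT (f \o (fun x : 'rV[R]_d.+1 => x + a)).
  by apply: measurableT_comp => //; exact: measurable_shift.
rewrite (leb_succE ma) => [|x]; last exact: f0.
rewrite (leb_succE mf f0) /=.
pose a' : 'rV[R]_d := \row_j a ord0 (lift ord0 j).
have E x y : rV_cons (x, y) + a = rV_cons (x + a ord0 ord0, y + a').
  apply/rowP => i; rewrite !mxE.
  by case: (unliftP ord0 i) => [j ->|->]; rewrite ?liftK ?unlift_none//= !mxE.
have mfc x : measurable_fun setT (fun y => f (rV_cons (x, y))).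
  apply: measurableT_comp => //; apply: measurableT_comp; first exact: measurable_rV_cons.
  exact: measurable_pair1.
under eq_integral => x _.
  under eq_integral do rewrite E.
  rewrite (ih a' (fun y => f (rV_cons (x + a ord0 ord0, y))))//.
  over.
apply: (@leb1_shift _ (fun x => \int[leb d]_y f (rV_cons (x, y)))%E).
  apply: (measurable_fun_fubini_tonelli_F (fun p => f (rV_cons p))) => //.
  by apply: measurableT_comp => //; exact: measurable_rV_cons.
by move=> x; apply: integral_ge0.
Qed.

(** Tonelli by induction; it reduces the integrability of the comparison function [tail] to one
    dimension. *)
Lemma leb_prod d (f : R -> R) : measurable_fun setT f -> (forall x, 0 <= f x) ->
  (\int[leb d]_y (\prod_i f (y ord0 i))%:E = (\int[leb1]_x (f x)%:E) ^+ d)%E.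
Proof.
move=> mf f0; elim: d => [|d ih].
  under eq_integral do rewrite big_ord0.
  by rewrite expe0 integral_cst// mul1e /= diracE mem_setT.
have mp k : measurable_fun setT (fun y : 'rV[R]_k => \prod_i f (y ord0 i)).
  rewrite (_ : (fun _ => _) = (fun y : 'rV[R]_k => \prod_(i <- enum 'I_k) f (y ord0 i))).
    by apply: measurable_prod => i _; apply: measurableT_comp => //; exact: measurable_coord.
  by apply/funext => y; rewrite big_enum.
have p0 k (y : 'rV[R]_k) : 0 <= \prod_i f (y ord0 i) by apply: prodr_ge0.
rewrite leb_succE; last 2 first.
- exact/measurable_EFinP.
- by move=> x; rewrite lee_fin; exact: p0.
under eq_integral => x _.
  under eq_integral => y _.
    rewrite big_ord_recl mxE unlift_none /= EFinM.
    under eq_bigr do rewrite mxE liftK /=.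
    over.
  rewrite ge0_integralZl//; last 3 first.
  - exact/measurable_EFinP.
  - by move=> y _; rewrite lee_fin; exact: p0.
  - by rewrite lee_fin.
  rewrite ih.
  over.
rewrite ge0_integralZr//; last 3 first.
- exact/measurable_EFinP.
- by move=> y _; rewrite lee_fin.
- by apply: expe_ge0; apply: integral_ge0 => y _; rewrite lee_fin.
by rewrite expeS.
Qed.

Lemma norm_coord d (y : 'rV[R]_d) i : `|y ord0 i| <= `|y|.
Proof. by rewrite [leRHS]/Num.norm/= mx_normrE; exact: (le_bigmax _ (fun ij => `|y ij.1 ij.2|) (ord0, i)). Qed.

Lemma normr_le_coord d (y : 'rV[R]_d) r : 0 <= r ->
  (forall i, `|y ord0 i| <= r) -> `|y| <= r.
Proof.
move=> r0 h; rewrite [leLHS]/Num.norm/= mx_normrE; apply: bigmax_le => // -[i j] _ /=.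
by rewrite ord1.
Qed.

(** Closed ball of the sup norm, the norm carried by the matrix type; it is empty for r < 0. *)
Definition cube d (r : R) : set 'rV[R]_d := [set y | `|y| <= r].

Lemma measurable_cube d r : measurable (@cube d r).
Proof.
rewrite /cube -[X in measurable X]setTI.
have mn : measurable_fun setT (fun y : 'rV[R]_d => `|y|).
  by apply: continuous_measurable_rV => y; exact: norm_continuous.
by have := mn measurableT _ (measurable_itv `]-oo, r]); rewrite set_itvE.
Qed.

Lemma leb_cube d r : 0 <= r -> (leb d (@cube d r) < +oo)%E.
Proof.
move=> r0; have -> : @cube d r = [set y | forall i, (`[- r, r]%classic : set R) (y ord0 i)].
  apply/seteqP; split => y /= h.
    by move=> i; rewrite in_itv/= -ler_norml (le_trans (norm_coord y i)).
  by apply: normr_le_coord => // i; have := h i; rewrite in_itv/= -ler_norml.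
rewrite (@leb_box R d (fun=> `[- r, r]%classic)); last by move=> i.
have h : lebesgue_measure (`[- r, r]%classic : set R) \is a fin_num.
  by rewrite lebesgue_measure_itv/=; case: ifPn.
suff : \big[*%E/1%E]_(i < d) lebesgue_measure (`[- r, r]%classic : set R) \is a fin_num.
  by move=> hh; rewrite ltey_eq hh.
by elim/big_ind : _ => // a b; exact: fin_numM.
Qed.

Lemma leb_ball_gt0 d (x : 'rV[R]_d) r : 0 < r ->
  (0 < leb d [set y | (`|x - y| <= r)%R])%E.
Proof.
move=> r0.
have -> : [set y : 'rV[R]_d | `|x - y| <= r] = [set y : 'rV[R]_d | forall i,
    (`[x ord0 i - r, x ord0 i + r]%classic : set R) (y ord0 i)].
  apply/seteqP; split => y /= h.
    move=> i; have := le_trans (norm_coord (x - y) i) h.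
    by rewrite in_itv/= !mxE ler_norml => /andP[? ?]; apply/andP; split; lra.
  apply: normr_le_coord => [|i]; first exact: ltW.
  have := h i; rewrite in_itv/= !mxE ler_norml => /andP[? ?].
  by apply/andP; split; lra.
rewrite (@leb_box R d (fun i => `[x ord0 i - r, x ord0 i + r]%classic))//.
elim/big_ind : _ => [|a b a0 b0|i _]; first exact: lte01.
  exact: mule_gt0.
rewrite lebesgue_measure_itv/= lte_fin ifT; last by lra.
by rewrite -EFinB lte_fin; lra.
Qed.

End leb_facts.

End LebesgueSpace.
Import LebesgueSpace.

(** * Functions of class C^k and smooth cutoffs *)

Module Cutoffs.

Section Ck_facts.
Context {R : realType}.
Implicit Types V W : normedModType R.

Lemma Ck_weaken V k (f : V -> R) : Ck k.+1 f -> Ck k f.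
Proof.
elim: k f => [|k ih] f [df Df]; first by move=> x; exact: differentiable_continuous.
by split => // v; apply: ih; exact: Df.
Qed.

Lemma Ck_continuous V k (f : V -> R) : Ck k f -> continuous f.
Proof. by elim: k f => // k ih f /Ck_weaken/ih. Qed.

Lemma Ck_cst V k (c : R) : Ck k (fun _ : V => c).
Proof.
elim: k c => [|k ih] c /=; first by move=> x; exact: cvg_cst.
split => [x|v]; first exact: differentiable_cst.
have -> : (fun x : V => 'D_v (fun _ : V => c) x) = (fun=> 0); last exact: ih.
by apply/funext => x; rewrite derive_cst.
Qed.

Lemma CkD V k (f g : V -> R) : Ck k f -> Ck k g -> Ck k (fun x => f x + g x).
Proof.
elim: k f g => [|k ih] f g /=; first by move=> cf cg x; exact: cvgD (cf x) (cg x).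
move=> [df Df] [dg Dg]; split => [x|v]; first exact: differentiableD.
have -> : (fun x => 'D_v (fun x => f x + g x) x) = (fun x => 'D_v f x + 'D_v g x); last by apply: ih; [exact: Df|exact: Dg].
by apply/funext => x; rewrite deriveD//; exact: diff_derivable.
Qed.

Lemma CkM V k (f g : V -> R) : Ck k f -> Ck k g -> Ck k (fun x => f x * g x).
Proof.
elim: k f g => [|k ih] f g; first by move=> cf cg x; exact: cvgM (cf x) (cg x).
move=> cf cg; have [df Df] := cf; have [dg Dg] := cg.
split => [x|v]; first exact: differentiableM.
have -> : (fun x => 'D_v (fun x => f x * g x) x) = (fun x => f x * 'D_v g x + g x * 'D_v f x).
  by apply/funext => x; rewrite deriveM//; exact: diff_derivable.
have cf' := Ck_weaken cf; have cg' := Ck_weaken cg.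
by apply: CkD; apply: ih => //; [exact: Dg|exact: Df].
Qed.

Lemma CkZ V k c (f : V -> R) : Ck k f -> Ck k (fun x => c * f x).
Proof. by move=> cf; apply: CkM => //; exact: Ck_cst. Qed.

Lemma Ck_prod V k (I : Type) (s : seq I) (F : I -> V -> R) :
  (forall i, Ck k (F i)) -> Ck k (fun x => \prod_(i <- s) F i x).
Proof.
move=> h; elim: s => [|i s ih].
  by under eq_fun do rewrite big_nil; exact: Ck_cst.
by under eq_fun do rewrite big_cons; apply: CkM.
Qed.

Lemma derive_comp_lin V W (L : {linear W -> V}) (a : V) (f : V -> R) w v :
  continuous L -> differentiable f (a + L w) ->
  differentiable (fun w => f (a + L w)) w /\
  'D_v (fun w => f (a + L w)) w = 'D_(L v) f (a + L w).
Proof.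
move=> cL df.
have dL : differentiable (fun w => a + L w) w.
  apply: differentiableD; first exact: differentiable_cst.
  exact: linear_differentiable.
have dc : differentiable (f \o (fun w => a + L w)) w by exact: differentiable_comp.
split => //; rewrite deriveE// deriveE//.
rewrite (_ : (fun w => _) = f \o (fun w => a + L w))// diff_comp//=.
have -> : (fun w : W => a + L w) = cst a + L by [].
rewrite diffD//; last exact: linear_differentiable.
by rewrite diff_cst diff_lin//= add0r.
Qed.

(** [L] is a bare function with a proof of linearity, bundled inside the proof, so that projections,
    reflections and dilations can be substituted directly. *)
Lemma Ck_comp_lin V W (L : W -> V) (a : V) k (f : V -> R) :
  linear L -> continuous L -> Ck k f -> Ck k (fun w => f (a + L w)).
Proof.
move=> lL cL.
pose Lm := GRing.isLinear.Build _ _ _ _ _ lL.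
pose L' : {linear W -> V} := HB.pack L Lm.
elim: k f => [|k ih] f; first move=> cf w.
  apply: (@continuous_comp _ _ _ (fun w => a + L w) f); last exact: cf.
  exact: (@cvgD _ _ _ _ _ (fun=> a) L _ _ (cvg_cst _) (cL w)).
move=> [df Df]; split => [w|v].
  by have [] := @derive_comp_lin V W L' a f w 0 cL (df _).
have -> : (fun w => 'D_v (fun w => f (a + L w)) w) = (fun w => 'D_(L v) f (a + L w)); last by apply: (ih (fun x => 'D_(L v) f x)); exact: Df.
by apply/funext => w; have [_ ->] := @derive_comp_lin V W L' a f w v cL (df _).
Qed.

End Ck_facts.

Section bump.
Context {R : realType}.
Implicit Types (P : {poly R}) (s x : R).

(** The functions P(1/s) e^(-1/s), extended by 0 to s <= 0, form a family closed under
    differentiation; the induction on k in [Ck_flat] runs over all polynomials at once. *)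
Definition flat P s : R := if 0 < s then P.[s^-1] * expR (- s^-1) else 0.

Lemma poly_bound P : exists2 C : R, 0 <= C & forall x, 1 <= x -> `|P.[x]| <= C * x ^+ size P.
Proof.
elim/poly_ind: P => [|P c [C C0 hC]].
  by exists 0 => // x _; rewrite horner0 normr0 mul0r.
exists (C + `|c|) => [|x x1]; first by rewrite addr_ge0.
have x0 : 0 <= x by exact: le_trans x1.
rewrite hornerMXaddC; have [->|P0] := eqVneq P 0.
  rewrite horner0 mul0r add0r; apply: (@le_trans _ _ ((C + `|c|) * 1)).
    by rewrite mulr1 lerDr.
  by rewrite ler_wpM2l ?addr_ge0// exprn_ege1.
rewrite size_MXaddC (negPf P0)/= (le_trans (ler_normD _ _))// mulrDl lerD//.
  by rewrite normrM (ger0_norm x0) exprSr mulrA ler_wpM2r// hC.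
by rewrite ler_peMr// exprn_ege1.
Qed.

(** For n > 0 this is x / n <= e^(x / n) raised to the n-th power. *)
Lemma expR_power_bound n x : 0 <= x -> x ^+ n <= n%:R ^+ n * expR x.
Proof.
case: n => [|n] x0; first by rewrite !expr0 mul1r -expR0 ler_expR.
have -> : expR x = expR (x / n.+1%:R) ^+ n.+1.
  by rewrite -expRM_natl mulrCA divff ?mulr1// pnatr_eq0.
rewrite -exprMn lerXn2r ?nnegrE ?mulr_ge0 ?expR_ge0//.
apply: (@le_trans _ _ (n.+1%:R * (x / n.+1%:R))).
  by rewrite mulrCA divff ?mulr1// pnatr_eq0.
rewrite ler_wpM2l//; by apply: le_trans (expR_ge1Dx _); rewrite lerDr.
Qed.

(** The exponential beats the power [size P + 2] of 1/s; the two powers to spare give a vanishing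
    derivative at s = 0. *)
Lemma flat_bound P : exists2 C, 0 <= C & forall s, s <= 1 -> `|flat P s| <= C * s ^+ 2.
Proof.
have [C C0 hC] := poly_bound P.
pose n := (size P).+2.
exists (C * n%:R ^+ n) => [|s s1]; first by rewrite mulr_ge0// exprn_ge0.
rewrite /flat; case: ifPn => s0; last first.
  by rewrite normr0; apply: mulr_ge0; [apply: mulr_ge0 => //; exact: exprn_ge0|exact: sqr_ge0].
have sV : 1 <= s^-1 by rewrite invf_ge1.
have sV0 : 0 <= s^-1 by exact: le_trans sV.
rewrite normrM (ger0_norm (expR_ge0 _)) expRN.
apply: (@le_trans _ _ (C * s^-1 ^+ size P * (expR s^-1)^-1)).
  by rewrite ler_wpM2r ?invr_ge0 ?expR_ge0 ?hC.
rewrite -!mulrA ler_wpM2l// ler_pdivrMr ?expR_gt0//.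
have := @expR_power_bound n _ sV0.
rewrite /n; set E := expR _; set N := _ ^+ _.
set X := s^-1 => h.
have -> : s ^+ 2 = X ^- 2 by rewrite /X exprVn invrK.
have X20 : 0 < X ^+ 2 by rewrite exprn_gt0// invr_gt0.
rewrite mulrA mulrAC ler_pdivlMr// mulrC -exprD add2n.
exact: h.
Qed.

(** Since (1/s)' = -(1/s)^2, differentiating P(1/s) e^(-1/s) replaces P by X^2 (P - P'). *)
Definition flatD P := ('X^2 * (P - P^`()))%R : {poly R}.

Lemma is_derive_flat P s : is_derive s 1 (flat P) (flat (flatD P) s).
Proof.
have [s0|s0|->] := ltgtP s 0.
- have e : {near s, (fun=> 0) =1 flat P}.
    by near=> x; rewrite /flat ltNge ltW//=; near: x; exact: lt_nbhsl.
  rewrite /flat ltNge (ltW s0)/=; apply: (@near_eq_is_derive _ _ _ (fun=> 0)) => //.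
- have e : {near s, (fun x => P.[x^-1] * expR (- x^-1)) =1 flat P}.
    by near=> x; rewrite /flat ifT//; near: x; exact: lt_nbhsr.
  apply: (@near_eq_is_derive _ _ _ (fun x => P.[x^-1] * expR (- x^-1))) => //.
  have sN0 : s != 0 by rewrite gt_eqF.
  have dV : is_derive s 1 (fun x : R => x^-1) (- s ^- 2).
    have := @is_deriveV R id s 1 1 sN0 (is_derive_id _ _).
    by rewrite /= -[X in is_derive _ _ _ X]/(_ * _) mulr1.
  have dP := is_derive1_comp (@is_derive_poly R P s^-1) dV.
  have dN : is_derive s 1 (fun x : R => - x^-1) (s ^- 2).
    by have := is_deriveN dV; rewrite opprK.
  have dE := @is_derive1_comp R expR (fun x => - x^-1) s _ _ (is_derive_expR (- s^-1)) dN.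
  apply: (@is_derive_eq _ _ _ _ _ _ _ _ (is_deriveM dP dE)) => /=.
  rewrite /flat s0 /flatD !hornerE /= /GRing.scale /=.
  rewrite -exprVn; ring.
(* At s = 0 the difference quotient is at most C |h| by [flat_bound]. *)
- rewrite {2}/flat ltxx; have [C C0 hC] := flat_bound P.
  have c : h^-1 *: ((flat P \o shift 0) (h *: (1 : R)) - flat P 0) @[h --> 0^'] --> (0 : R).
    apply/cvgr0Pnorm_le => e e0; near=> h.
    rewrite /= /flat ltxx subr0 addr0 /GRing.scale /= mulr1 -/(flat P h) normrM normfV.
    have h0 : 0 < `|h| by rewrite normr_gt0; near: h; exact: nbhs_dnbhs_neq.
    have h1 : `|h| <= 1.
      by near: h; apply: dnbhs0_le.
    have h2 : `|h| <= e / (C + 1).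
      by near: h; apply: dnbhs0_le; rewrite divr_gt0// ltr_wpDl.
    rewrite mulrC ler_pdivrMr//.
    apply: le_trans (hC _ (le_trans (ler_norm _) h1)) _.
    rewrite -real_normK ?num_real// expr2 mulrA ler_wpM2r//.
    move: h2; rewrite ler_pdivlMr; last by rewrite ltr_wpDl.
    apply: le_trans; rewrite mulrC ler_wpM2l//; lra.
  by apply: DeriveDef; [exact: cvgP c|exact/cvg_lim].
Unshelve. all: by end_near. Qed.

Lemma Ck_flat k P : Ck k (flat P : R^o -> R).
Proof.
elim: k P => [|k ih] P.
  move=> x; apply: differentiable_continuous; apply/derivable1_diffP.
  by have [] := is_derive_flat P x.
have df x : differentiable (flat P : R^o -> R) x.
  by apply/derivable1_diffP; have [] := is_derive_flat P x.
split => // v.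
have -> : (fun x : R^o => 'D_v (flat P : R^o -> R) x) = (fun x => v * flat (flatD P) x).
  apply/funext => x; rewrite deriveE// -[v in LHS]mulr1 -[v * 1]/(v *: (1 : R^o)) linearZ/=.
  by rewrite -deriveE//; congr (_ * _); have [_ ->] := is_derive_flat P x.
exact/CkZ/ih.
Qed.

Lemma CkV (V : normedModType R) k (f : V -> R) : (forall x : V, f x != 0) ->
  Ck k f -> Ck k (fun x : V => (f x)^-1).
Proof.
move=> f0; elim: k f f0 => [|k ih] f f0; first by move=> cf x; exact: cvgV (f0 x) (cf x).
move=> cf; have [df Df] := cf; split => [x|v]; first exact: differentiableV.
have -> : (fun x : V => 'D_v (fun x : V => (f x)^-1) x) =
    (fun x : V => -1 * ((f x)^-1 * (f x)^-1 * 'D_v f x)).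
  apply/funext => x; rewrite deriveV//; last exact: diff_derivable.
  by rewrite /GRing.scale /= -exprVn expr2 mulN1r mulNr.
have cV := ih f f0 (Ck_weaken cf).
apply: CkZ; apply: CkM; last exact: Df.
exact: CkM.
Qed.

(** Smooth step from 0 on x <= 0 to 1 on x >= 1; the denominator is positive because x and 1 - x are
    never both nonpositive. *)
Definition sstep (x : R) : R := flat 1 x / (flat 1 x + flat 1 (1 - x)).

Lemma flat1_ge0 x : 0 <= flat 1 x.
Proof. by rewrite /flat; case: ifPn => // _; rewrite hornerC mul1r expR_ge0. Qed.

Lemma flat1_gt0 x : 0 < x -> 0 < flat 1 x.
Proof. by rewrite /flat => ->; rewrite hornerC mul1r expR_gt0. Qed.

Lemma flat1_eq0 x : x <= 0 -> flat 1 x = 0.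
Proof. by rewrite /flat leNgt => /negPf ->. Qed.

Let den_gt0 x : 0 < flat 1 x + flat 1 (1 - x).
Proof.
have [x0|x0] := ltP 0 x; first by apply: ltr_pwDl; [exact: flat1_gt0|exact: flat1_ge0].
by apply: ltr_wpDl; [exact: flat1_ge0|apply: flat1_gt0; lra].
Qed.

Lemma sstep_ge0 x : 0 <= sstep x.
Proof. by rewrite divr_ge0 ?flat1_ge0// ltW. Qed.

Lemma sstep_le1 x : sstep x <= 1.
Proof. by rewrite ler_pdivrMr// mul1r lerDl flat1_ge0. Qed.

Lemma sstep_eq0 x : x <= 0 -> sstep x = 0.
Proof. by move=> x0; rewrite /sstep flat1_eq0// mul0r. Qed.

Lemma sstep_eq1 x : 1 <= x -> sstep x = 1.
Proof.
by move=> x1; rewrite /sstep (@flat1_eq0 (1 - x)) ?addr0 ?divff ?gt_eqF ?flat1_gt0//; lra.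
Qed.

Lemma Ck_aff k (f : R -> R) (a b : R) : Ck k (f : R^o -> R) ->
  Ck k (fun x : R^o => f (a + b * x)).
Proof.
move=> cf; apply: (@Ck_comp_lin _ R^o R^o (fun x => b * x) a) => //.
  by move=> c u v /=; rewrite mulrDr /GRing.scale /= mulrCA.
by move=> x; apply: cvgMr => //; exact: cvg_id.
Qed.

Lemma Ck_sstep k : Ck k (sstep : R^o -> R).
Proof.
apply: CkM; first exact: Ck_flat.
apply: CkV => [x|]; first by rewrite gt_eqF.
apply: CkD; first exact: Ck_flat.
have := @Ck_aff k (flat 1) 1 (-1) (Ck_flat k 1).
by rewrite (_ : (fun x => _) = (fun x => flat 1 (1 - x)))//; apply/funext => x; rewrite mulN1r.
Qed.

Definition cut (s : R) : R := sstep (2 - s) * sstep (2 + s).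

Lemma Ck_cut k : Ck k (cut : R^o -> R).
Proof.
apply: CkM.
  have := @Ck_aff k sstep 2 (-1) (Ck_sstep k).
  by rewrite (_ : (fun x => _) = (fun x => sstep (2 - x)))//; apply/funext => x; rewrite mulN1r.
have := @Ck_aff k sstep 2 1 (Ck_sstep k).
by rewrite (_ : (fun x => _) = (fun x => sstep (2 + x)))//; apply/funext => x; rewrite mul1r.
Qed.

Lemma cut_ge0 s : 0 <= cut s. Proof. by rewrite mulr_ge0 ?sstep_ge0. Qed.

Lemma cut_le1 s : cut s <= 1.
Proof. by rewrite mulr_ile1 ?sstep_ge0 ?sstep_le1. Qed.

Lemma cutN s : cut (- s) = cut s.
Proof. by rewrite /cut opprK mulrC. Qed.

Lemma cut_eq1 s : `|s| <= 1 -> cut s = 1.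
Proof.
by rewrite ler_norml => /andP[? ?]; rewrite /cut !sstep_eq1 ?mulr1//; lra.
Qed.

Lemma cut_eq0 s : 2 <= `|s| -> cut s = 0.
Proof.
rewrite ler_normr => /orP[h|h]; rewrite /cut.
  by rewrite sstep_eq0 ?mul0r//; lra.
by rewrite (@sstep_eq0 (2 + s)) ?mulr0//; lra.
Qed.

End bump.

End Cutoffs.
Import Cutoffs.

(** * Local integrability and convolution with smooth kernels *)

Module Convolution.

Section convolution.
Context {R : realType} (d : nat).
Local Notation V := 'rV[R]_d.
Local Notation mu := (@leb R d).
Local Notation ig f := (mu.-integrable setT (EFin \o f)).
Implicit Types (f g kap : V -> R) (x y v : V).

(** Reduces continuity to sequences, so that dominated convergence yields continuity of parameter
    integrals. *)
Lemma seq_continuous (W : normedModType R) (f : W -> R) (p : W) :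
  (forall u : nat -> W, u @ \oo --> p -> f \o u @ \oo --> f p) ->
  {for p, continuous f}.
Proof.
move=> h; apply/cvgrPdist_lt => e e0; apply: contrapT => hn.
have : forall n : nat, exists x : W, `|p - x| < n.+1%:R^-1 /\ ~ `|f p - f x| < e.
  move=> n; apply: contrapT => /forallNP hx; apply: hn.
  have : nbhs p (ball p n.+1%:R^-1) by apply: nbhsx_ballx; rewrite invr_gt0.
  apply: filterS => x; rewrite -ball_normE/= => px.
  by have /not_andP[//|/contrapT] := hx x.
move=> /choice[u hu].
have /h : u @ \oo --> p.
  apply/cvgrPdist_lt => r r0.
  have [n _ /(_ _) nr] := near_infty_natSinv_lt (PosNum r0).
  by exists n => // k nk; apply: lt_trans (nr k nk); have [] := hu k.
by move=> /cvgrPdist_lt /(_ e e0)[n _ /(_ n (leqnn n))] /=; have [] := hu n.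
Qed.

Lemma cube_compact r : compact (@cube R d r).
Proof.
apply: bounded_closed_compact.
  by exists r; split; [exact: num_real|move=> M rM y /= yr; exact: le_trans yr (ltW rM)].
have -> : cube r = (fun y : V => `|y|) @^-1` `]-oo, r].
  by apply/seteqP; split => y; rewrite /cube/= in_itv.
apply: closed_comp; last exact: interval_closed.
by move=> y _; exact: norm_continuous.
Qed.

Lemma compact_sub_cube (K : set V) : compact K -> exists r, K `<=` cube r.
Proof.
move=> /compact_bounded[M [_ hM]]; exists (M + 1) => y Ky.
by apply: (hM (M + 1)) => //; rewrite ltrDl.
Qed.

Lemma cube_le r s : r <= s -> @cube R d r `<=` cube s.
Proof. by move=> rs y /= /le_trans; exact. Qed.

Lemma continuous_bounded_cube f r : continuous f ->
  exists2 M : R, 0 <= M & forall y, cube r y -> `|f y| <= M.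
Proof.
move=> cf; have : compact (f @` cube r).
  by apply: continuous_compact (@cube_compact r); exact: continuous_subspaceT.
move=> /compact_bounded[M [_ hM]]; exists (Num.max (M + 1) 0); first by rewrite le_max lexx orbT.
move=> y yr; apply: (hM (Num.max (M + 1) 0)); last by exists y.
by rewrite lt_max ltrDl ltr01.
Qed.

(** Local integrability tested on cubes, together with measurability on the whole space;
    [loc_integrableP] gives the equivalence with the definition by compact sets. *)
Definition lint f := measurable_fun setT f /\
  forall r, ig (fun y => \1_(cube r) y * f y).

Lemma ig_lint f : ig f -> lint f.
Proof.
move=> hf; have mf := ig_meas hf; split => // r.
apply: (@ig_le _ _ _ _ _ (fun y => `|f y|)).
- by apply: measurable_funM => //; apply: measurable_indic; exact: measurable_cube.
- move=> y; rewrite normrM indicE; case: (_ \in _); rewrite ?normr1 ?normr0 ?mul1r//.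
  by rewrite mul0r.
- exact: ig_norm.
Qed.

Lemma lint_mul f (phi : V -> R) M r : lint f -> measurable_fun setT phi ->
  (forall y, `|phi y| <= M) -> (forall y, r < `|y| -> phi y = 0) ->
  ig (fun y => phi y * f y).
Proof.
move=> [mf lf] mphi hM hr.
apply: (@ig_le _ _ _ _ _ (fun y => M * `|\1_(cube r) y * f y|)).
- exact: measurable_funM.
- move=> y; rewrite !normrM indicE.
  have M0 : 0 <= M by apply: le_trans (hM y).
  have [yr|yr] := boolP (y \in cube r); first by rewrite normr1 mul1r ler_wpM2r.
  rewrite hr ?normr0 ?mul0r ?mulr0//; rewrite ltNge; apply: contra yr => yr.
  exact/mem_set.
- exact/igZ/ig_norm/lf.
Qed.

Lemma lint_cube f r : lint f -> lint (fun y => \1_(cube r) y * f y).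
Proof. by move=> [mf lf]; exact/ig_lint/lf. Qed.

Lemma lintD f g : lint f -> lint g -> lint (fun y => f y + g y).
Proof.
move=> [mf lf] [mg lg]; split => [|r]; first exact: measurable_funD.
by under eq_fun do rewrite mulrDr; exact: igD.
Qed.

Lemma lint_bounded_mul f (phi : V -> R) : continuous phi -> lint f ->
  lint (fun y => phi y * f y).
Proof.
move=> cphi [mf lf]; have mphi := continuous_measurable_rV cphi.
split => [|r]; first exact: measurable_funM.
have [M M0 hM] := continuous_bounded_cube r cphi.
apply: (@ig_le _ _ _ _ _ (fun y => M * `|\1_(cube r) y * f y|)).
- apply: measurable_funM; last exact: measurable_funM.
  by apply: measurable_indic; exact: measurable_cube.
- move=> y; rewrite mulrCA normrM [in leRHS]normrM indicE.
  have [/set_mem yr|yr] := boolP (y \in cube r); last first.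
    by rewrite mul0r normr0 mul0r !mulr0.
  by rewrite mul1r normr1 mul1r ler_wpM2r ?hM.
- exact/igZ/ig_norm/lf.
Qed.

Lemma loc_integrableP f : loc_integrable f <-> lint f.
Proof.
split=> [lf|[mf lf] K cK].
  have ic r : ig (fun y => \1_(cube r) y * f y).
    have := lf _ (@cube_compact r).
    rewrite integrable_mkcond; last exact: measurable_cube.
    rewrite (_ : _ \_ _ = EFin \o (fun y => \1_(cube r) y * f y))//.
    apply/funext => y; rewrite /patch /= indicE; case: ifPn => _; rewrite ?mul1r ?mul0r//.
  (* Integrability on cubes gives measurability of the truncations only; [f] is their pointwise
     eventually constant limit. *)
  split => //; apply: (@measurable_fun_cvg _ _ _ _ (fun n y => \1_(cube n%:R) y * f y)).
    by move=> n; exact/ig_meas/ic.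
  move=> y _; apply: cvg_near_cst.
  exists (Num.Def.archi_bound `|y|) => // n /= Nn.
  rewrite indicE mem_set ?mul1r// /cube/=.
  by apply: le_trans (ltW (archi_boundP (normr_ge0 y))) _; rewrite ler_nat.
have [r Kr] := compact_sub_cube cK.
have mK : measurable K.
  have : open (~` K) by apply: closed_openC; apply: compact_closed cK; exact: norm_hausdorff.
  by move=> /open_measurable_rV/measurableC; rewrite setCK.
rewrite integrable_mkcond//.
have -> : (EFin \o f) \_ K = EFin \o (fun y => \1_K y * f y).
  apply/funext => y; rewrite /patch /= indicE; case: ifPn => _; rewrite ?mul1r ?mul0r//.
apply: (@ig_le _ _ _ _ _ (fun y => `|\1_(cube r) y * f y|)).
- by apply: measurable_funM => //; exact: measurable_indic.
- move=> y; rewrite !indicE; have [/set_mem Ky|_] := boolP (y \in K).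
    by rewrite mem_set//; exact: Kr.
  by rewrite mul0r normr0.
- exact/ig_norm/lf.
Qed.

(** Neither sign nor mass is prescribed, so that derivatives of such kernels are again of this
    kind. *)
Definition mol kap := smooth kap /\ forall y, 1 < `|y| -> kap y = 0.

Lemma mol_cont kap : mol kap -> continuous kap.
Proof. by move=> [/(_ 0)]. Qed.

Lemma mol_bounded kap : mol kap -> exists2 M : R, 0 <= M & forall y, `|kap y| <= M.
Proof.
move=> hk; have [M M0 hM] := continuous_bounded_cube 1 (mol_cont hk).
exists M => // y; have [y1|y1] := leP `|y| 1; first exact: hM.
by rewrite hk.2// normr0.
Qed.

Lemma mol_differentiable kap x : mol kap -> differentiable kap x.
Proof. by move=> [/(_ 1)[]]. Qed.

Lemma near_norm_gt (W : normedModType R) (y : W) (c : R) : c < `|y| ->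
  \near y, c < `|y|.
Proof.
move=> cy; apply: (@cvgr_gt R W (nbhs y) _ (fun z : W => `|z|) `|y|) => //.
exact: norm_continuous.
Qed.

Lemma derive_near0 (W : normedModType R) (f : W -> R) (x v : W) :
  (\near x, f x = 0) -> 'D_v f x = 0.
Proof.
move=> h; have [_ ->] // : is_derive x v f 0.
apply: (@near_eq_is_derive _ _ _ (fun=> 0)).
by apply: filterS h => y ->.
Qed.

Lemma mol_derive kap v : mol kap -> mol ('D_v kap).
Proof.
move=> [sk hk]; split => [k|y y1]; first by have [_] := sk k.+1; exact.
apply: derive_near0; have := near_norm_gt y1.
by apply: filterS => z; exact: hk.
Qed.

Definition conv kap f x : R := (\int[mu]_y (kap (x - y) * f y))%R.

Lemma mol_shift0 kap x y : mol kap -> `|x| + 1 < `|y| -> kap (x - y) = 0.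
Proof.
move=> [_ hk] h; apply: hk; have := lerB_dist y x; rewrite distrC => h2.
by apply: lt_le_trans h2; rewrite ltrBrDl.
Qed.

Lemma measurable_mol_shift kap x : mol kap -> measurable_fun setT (fun y => kap (x - y)).
Proof.
move=> hk; apply: measurableT_comp; last exact: measurable_subr.
by apply: continuous_measurable_rV; exact: mol_cont.
Qed.

Lemma ig_conv kap f x : mol kap -> lint f -> ig (fun y => kap (x - y) * f y).
Proof.
move=> hk lf; have [M M0 hM] := mol_bounded hk.
apply: (@lint_mul _ _ M (`|x| + 1)) => //; first exact: measurable_mol_shift.
by move=> y; exact: mol_shift0.
Qed.

(** One integrable majorant for all x in the cube of radius r - 1; it serves both for continuity and
    for differentiation under the integral. *)
Lemma conv_norm_bound kap f M r x : mol kap -> (forall y, `|kap y| <= M) -> `|x| + 1 <= r ->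
  forall y, `|kap (x - y) * f y| <= M * `|\1_(cube r) y * f y|.
Proof.
move=> hk hM xr y; rewrite !normrM indicE.
have M0 : 0 <= M by apply: le_trans (hM 0).
have [yr|yr] := boolP (y \in cube r); first by rewrite normr1 mul1r ler_wpM2r.
rewrite (@mol_shift0 kap)// ?normr0 ?mul0r ?mulr0//.
by apply: le_lt_trans xr _; rewrite ltNge; apply: contra yr => yr; exact/mem_set.
Qed.

Lemma conv_continuous kap f : mol kap -> lint f -> continuous (conv kap f).
Proof.
move=> hk lf x; have [M M0 hM] := mol_bounded hk.
apply: seq_continuous => u ux.
have : \forall n \near \oo, `|u n| <= `|x| + 1.
  have c : `|u n| @[n --> \oo] --> `|x| by exact: cvg_norm.
  by apply: (@cvgr_le R _ _ _ (fun n => `|u n|) _ c); rewrite ltrDl.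
move=> [N _ hN].
(* The majorant is available only once [u n] is close to [x], hence the shift of the sequence. *)
rewrite -(cvg_shiftn N) /=.
have [||_ cf _] := @Rdct _ _ _ mu (fun n y => kap (u (n + N)%N - y) * f y)
  (fun y => kap (x - y) * f y) (fun y => M * `|\1_(cube (`|x| + 2)) y * f y|)
  (fun n => ig_meas (ig_conv _ hk lf)) (ig_meas (ig_conv _ hk lf)) _ (igZ _ (ig_norm (lf.2 _))) _.
- apply: aeW => y; apply: cvgMr_tmp.
  have : u (n + N)%N - y @[n --> \oo] --> x - y.
    by apply: cvgB; [rewrite (cvg_shiftn N)|exact: cvg_cst].
  by apply: continuous_cvg; exact: mol_cont.
- move=> n y; apply: conv_norm_bound => //.
  have := hN (n + N)%N (leq_addl _ _) => /= h; lra.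
- exact: cf.
Qed.

Lemma derive_line (W : normedModType R) (f : W -> R) (x v : W) (s : R) :
  differentiable f (x + s *: v) ->
  is_derive s 1 (fun s : R => f (x + s *: v)) ('D_v f (x + s *: v)).
Proof.
move=> df0; have df : derivable f (x + s *: v) v by exact: diff_derivable.
have E : (fun h : R => h^-1 *: (((fun s : R => f (x + s *: v)) \o shift s) (h *: (1 : R)) - f (x + s *: v))) =
    (fun h => h^-1 *: ((f \o shift (x + s *: v)) (h *: v) - f (x + s *: v))).
  apply/funext => h /=; congr (_ *: (f _ - _)).
  by rewrite -[h%:A]/(h * 1) mulr1 scalerDl addrCA.
by apply: DeriveDef; rewrite /derivable /derive E.
Qed.

(** The derivative falls on the kernel, so local integrability of [f] is enough. It is stated along
    lines, the form in which the integrations by parts below use it. *)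
Lemma conv_derive kap f x v (s : R) : mol kap -> lint f ->
  is_derive s 1 (fun s : R => conv kap f (x + s *: v)) (conv ('D_v kap) f (x + s *: v)).
Proof.
move=> hk lf; have hk' := mol_derive v hk; have [M M0 hM] := mol_bounded hk'.
(* This cube contains the supports of all kernels centred at x + z v with |z - s| < 1. *)
pose r := `|x| + (`|s| + 1) * `|v| + 1.
pose F (s : R) y := kap (x + s *: v - y) * f y.
have dF (z : R) y : is_derive z 1 (F ^~ y) ('D_v kap (x + z *: v - y) * f y).
  have : is_derive z 1 (fun z : R => kap ((x - y) + z *: v)) ('D_v kap ((x - y) + z *: v)).
    by apply: derive_line; exact: mol_differentiable.
  move=> /(@is_deriveM _ _ _ _ _ _ _ _ (is_derive_cst (f y) z 1)) h.
  have E : F ^~ y = (cst (f y) * (fun z : R => kap (x - y + z *: v))).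
    by apply/funext => t; rewrite /F /= mulrC addrAC.
  rewrite E; apply: is_derive_eq h _.
  by rewrite /GRing.scale/= mulr0 addr0 mulrC addrAC.
have Fp z y : partial1of2 F z y = 'D_v kap (x + z *: v - y) * f y.
  by rewrite /partial1of2 derive1E; have [_ ->] := dF z y.
have Is : `]s - 1, s + 1[%classic s by rewrite /= in_itv/=; apply/andP; split; lra.
have := @cvg_differentiation_under_integral R _ _ mu F setT measurableT s (s - 1) (s + 1)
  Is _ _ (fun y => M * `|\1_(cube r) y * f y|) _ (igZ _ (ig_norm (lf.2 _))) _.
have E : (fun h : R => h^-1 *: (((fun s : R => conv kap f (x + s *: v)) \o shift s) (h *: (1 : R)) - conv kap f (x + s *: v))) =
   (fun h => h^-1 *: ((fun x' : R => \int[mu]_(y in setT) F x' y) (h + s) - (fun x' : R => \int[mu]_(y in setT) F x' y) s))%R.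
  by apply/funext => h /=; rewrite /GRing.scale /= mulr1.
rewrite -E => H.
have {}H : h^-1 *: (((fun s : R => conv kap f (x + s *: v)) \o shift s) (h *: (1 : R)) - conv kap f (x + s *: v)) @[h --> 0^'] --> conv ('D_v kap) f (x + s *: v).
  have -> : conv ('D_v kap) f (x + s *: v) = (\int[mu]_(y in setT) partial1of2 F s y)%R.
    by apply: eq_Rintegral => y _; rewrite Fp.
  apply: H.
  - by move=> z _; exact: ig_conv.
  - by move=> z y _ _; have [] := dF z y.
  - by move=> y; rewrite mulr_ge0.
  - move=> z y /= zs _; rewrite Fp; apply: (@conv_norm_bound _ _ _ _ _ hk' hM).
    rewrite /r lerD2r (le_trans (ler_normD _ _))// lerD2l normrZ ler_wpM2r//.
    move: zs; rewrite in_itv/= => /andP[? ?].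
    have := ler_norm s; have := ler_norm (- s); rewrite normrN => ? ?.
    by rewrite ler_norml; apply/andP; split; lra.
by apply: DeriveDef; [exact: cvgP H|exact/cvg_lim].
Qed.

End convolution.

End Convolution.
Import Convolution.

(** * Mollification and its convergence in L^1 *)

Module Mollifier.

Import HBSimple.

Section mollifier.
Context {R : realType} (d : nat).
Local Notation V := 'rV[R]_d.
Local Notation mu := (@leb R d).
Local Notation ig f := (mu.-integrable setT (EFin \o f)).
Implicit Types (f g kap : V -> R) (x y v : V).

Lemma Rint_shift f a : measurable_fun setT f ->
  (\int[mu]_x f (x + a) = \int[mu]_x f x)%R.
Proof.
move=> mf; rewrite /Rintegral; congr fine.
rewrite integralE [RHS]integralE; congr (_ - _)%E.
  rewrite -[RHS](leb_shift a).
  - by apply: eq_integral => x _; rewrite !funeposE.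
  - by apply: measurable_funepos; exact/measurable_EFinP.
  - by move=> x; exact: funepos_ge0.
rewrite -[RHS](leb_shift a).
- by apply: eq_integral => x _; rewrite !funenegE.
- by apply: measurable_funeneg; exact/measurable_EFinP.
- by move=> x; exact: funeneg_ge0.
Qed.

Lemma ig_shift f a : ig f -> ig (fun x => f (x + a)).
Proof.
move=> hf; have mf := ig_meas hf; apply: igP.
  by apply: measurableT_comp => //; exact: measurable_shift.
rewrite (leb_shift a (f := fun x => `|f x|%:E)) => [|//|//].
- by apply: ig_lty; exact: ig_norm.
- by apply/measurable_EFinP; exact: measurableT_comp.
Qed.

(** As [cut] vanishes from 2 on, the factor 2 (n + 1) confines the support to the cube of radius 1 /
    (n + 1). *)
Definition kern n y : R := \prod_(i < d) cut (2 * n.+1%:R * y ord0 i).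

Lemma kern_ge0 n y : 0 <= kern n y.
Proof. by apply: prodr_ge0 => i _; exact: cut_ge0. Qed.

Lemma kernN n y : kern n (- y) = kern n y.
Proof. by apply: eq_bigr => i _; rewrite mxE mulrN cutN. Qed.

Lemma kern_eq0 n y : n.+1%:R^-1 < `|y| -> kern n y = 0.
Proof.
move=> ny; have [i hi] : exists i, n.+1%:R^-1 < `|y ord0 i|.
  apply: contrapT => /forallNP h; move: ny; rewrite ltNge => /negP; apply.
  by apply: normr_le_coord => // i; rewrite leNgt; apply/negP/h.
rewrite /kern (bigD1 i)//= cut_eq0 ?mul0r//.
rewrite !normrM ger0_norm// ger0_norm// -mulrA ler_peMr//.
by rewrite mulrC -ler_pdivrMr// div1r ltW.
Qed.

Lemma Ck_kern k n : Ck k (kern n).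
Proof.
apply: Ck_prod => i.
have := @Ck_comp_lin R R^o V (fun y => 2 * n.+1%:R * y ord0 i) 0 k cut.
rewrite (_ : (fun w : V => cut (0 + _)) = (fun w : V => cut (2 * n.+1%:R * w ord0 i))); last first.
  by apply/funext => w; rewrite add0r.
apply; last exact: Ck_cut.
- by move=> c u w; rewrite !mxE mulrDr /GRing.scale/= mulrCA.
- move=> y; have h : {for y, continuous (fun y : V => y ord0 i)} by exact: coord_continuous.
  exact: (@cvgMl_tmp _ _ _ _ _ _ _ h).
Qed.

Lemma mol_kern n : mol (kern n).
Proof.
split => [k|y y1]; first exact: Ck_kern.
by apply: kern_eq0; apply: le_lt_trans y1; rewrite invf_le1// ler1n.
Qed.

Lemma lint_cst1 : lint (fun _ : V => 1).
Proof.
split => [|r]; first exact: measurable_cst.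
apply: igP.
  by apply: measurable_funM => //; apply: measurable_indic; exact: measurable_cube.
under eq_integral do rewrite mulr1 ger0_norm//.
rewrite integral_indic//; last exact: measurable_cube.
rewrite setIT; have [r0|r0] := leP 0 r; first exact: leb_cube.
rewrite (_ : cube r = set0) ?measure0//.
by apply/seteqP; split => // y; rewrite /cube/= leNgt (lt_le_trans r0).
Qed.

Lemma ig_mol kap : mol kap -> ig kap.
Proof.
move=> hk; have := @ig_conv _ _ kap (fun=> 1) 0 hk lint_cst1.
move=> h; have [M M0 hM] := mol_bounded hk.
have := @lint_mul _ _ (fun=> 1) kap M 1 lint_cst1 (continuous_measurable_rV (mol_cont hk)) hM hk.2.
by under eq_fun do rewrite mulr1.
Qed.

Definition kc n := (\int[mu]_y kern n y)%R.

Lemma kc_gt0 n : 0 < kc n.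
Proof.
(* On the cube of this radius every factor of the kernel equals 1. *)
pose r := (2 * n.+1%:R : R)^-1; have r0 : 0 < r by rewrite invr_gt0 mulr_gt0.
pose B := [set y : V | (`|0 - y| <= r)].
have mB : measurable B.
  rewrite (_ : B = cube r); first exact: measurable_cube.
  by apply/seteqP; split => y; rewrite /B /cube/= sub0r normrN.
have Bk y : \1_B y <= kern n y.
  rewrite indicE; have [/set_mem By|_] := boolP (y \in B); last exact: kern_ge0.
  rewrite /kern big1// => i _; apply: cut_eq1; rewrite normrM gtr0_norm ?mulr_gt0//.
  rewrite mulrC -ler_pdivlMr ?mulr_gt0// mul1r.
  by move: By; rewrite /B/= sub0r normrN; apply: le_trans; exact: norm_coord.
have h : (0 < \int[mu]_y (kern n y)%:E)%E.
  apply: (@lt_le_trans _ _ (\int[mu]_y (\1_B y)%:E)%E).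
    by rewrite integral_indic// setIT; exact: leb_ball_gt0.
  apply: ge0_le_integral => //.
  - by apply/measurable_EFinP; exact: measurable_indic.
  - by apply/measurable_EFinP/ig_meas/ig_mol/mol_kern.
  - by move=> y _; rewrite lee_fin.
by rewrite -lte_fin EFin_Rint//; exact/ig_mol/mol_kern.
Qed.

Definition knl n y := (kc n)^-1 * kern n y.

Lemma mol_knl n : mol (knl n).
Proof.
split => [k|y y1]; first by apply: CkZ; exact: Ck_kern.
by rewrite /knl (mol_kern n).2// mulr0.
Qed.

Lemma knl_ge0 n y : 0 <= knl n y.
Proof. by rewrite mulr_ge0 ?kern_ge0// invr_ge0 ltW// kc_gt0. Qed.

Lemma knlN n y : knl n (- y) = knl n y. Proof. by rewrite /knl kernN. Qed.

Lemma knl_eq0 n y : n.+1%:R^-1 < `|y| -> knl n y = 0.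
Proof. by move=> h; rewrite /knl kern_eq0// mulr0. Qed.

Lemma Rint_knl n : (\int[mu]_y knl n y = 1)%R.
Proof. by rewrite RintZ ?mulVf ?gt_eqF ?kc_gt0//; exact/ig_mol/mol_kern. Qed.

Lemma ig_knl_shift n y : ig (fun x => knl n (x - y)).
Proof. by apply: (@ig_shift (knl n) (- y)); exact/ig_mol/mol_knl. Qed.

Lemma Rint_knl_shift n y : (\int[mu]_x knl n (x - y) = 1)%R.
Proof.
by rewrite (Rint_shift (- y)) ?Rint_knl//; exact/ig_meas/ig_mol/mol_knl.
Qed.

Lemma knlC n x y : knl n (x - y) = knl n (y - x).
Proof. by rewrite -knlN opprB. Qed.

Notation moll n f := (conv (knl n) f).

Lemma measurable_sub2 : measurable_fun setT (fun p : V * V => p.1 - p.2).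
Proof.
apply: measurable_fun_rV => i; under eq_fun do rewrite !mxE.
apply: (@measurable_funB _ _ _ _ (fun p : V * V => p.1 ord0 i) (fun p => p.2 ord0 i)).
  exact: (measurableT_comp (measurable_coord i) measurable_fst).
exact: (measurableT_comp (measurable_coord i) measurable_snd).
Qed.

Lemma moll_tonelli n f : measurable_fun setT f -> (forall x, 0 <= f x) ->
  (\int[mu]_x \int[mu]_y (knl n (x - y) * f y)%:E = \int[mu]_y (f y)%:E)%E.
Proof.
move=> mf f0.
rewrite (fubini_tonelli (fun p : V * V => (knl n (p.1 - p.2) * f p.2)%:E))/=; last 2 first.
- apply/measurable_EFinP; apply: measurable_funM; last exact: measurableT_comp.
  apply: measurableT_comp; last exact: measurable_sub2.
  exact/ig_meas/ig_mol/mol_knl.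
- by move=> p; rewrite lee_fin mulr_ge0 ?knl_ge0.
apply: eq_integral => y _.
under eq_integral do rewrite EFinM.
rewrite ge0_integralZr//; last 3 first.
- by apply/measurable_EFinP; exact/ig_meas/ig_knl_shift.
- by move=> x _; rewrite lee_fin knl_ge0.
- by rewrite lee_fin.
by rewrite -EFin_Rint ?Rint_knl_shift ?mul1e//; exact: ig_knl_shift.
Qed.

Lemma moll_ge0 n f x : (forall y, 0 <= f y) -> 0 <= moll n f x.
Proof. by move=> f0; apply: Rint_ge0 => y; rewrite mulr_ge0 ?knl_ge0. Qed.

Lemma moll_measurable n f : lint f -> measurable_fun setT (moll n f).
Proof. by move=> lf; apply: continuous_measurable_rV; apply: conv_continuous => //; exact: mol_knl. Qed.

Lemma moll_mass n f : ig f -> (forall x, 0 <= f x) ->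
  ig (moll n f) /\ (\int[mu]_x moll n f x = \int[mu]_x f x)%R.
Proof.
move=> hf f0; have lf := ig_lint hf.
have E : (\int[mu]_x (moll n f x)%:E = \int[mu]_y (f y)%:E)%E.
  rewrite -(moll_tonelli n (ig_meas hf) f0); apply: eq_integral => x _.
  by rewrite EFin_Rint//; apply: ig_conv => //; exact: mol_knl.
split; last by rewrite /Rintegral E.
apply: ig_ge0P; first exact: moll_measurable.
  by move=> x; exact: moll_ge0.
by rewrite E; exact: ig_lty.
Qed.

Lemma conv_le_norm n f x : lint f -> `|moll n f x| <= moll n (fun y => `|f y|) x.
Proof.
move=> lf; apply: le_trans (Rint_norm (ig_conv x (mol_knl n) lf)) _.
rewrite le_eqVlt; apply/orP; left; apply/eqP; apply: eq_Rintegral => y _.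
by rewrite normrM ger0_norm// knl_ge0.
Qed.

Lemma moll_contract n f : ig f ->
  ig (moll n f) /\ (\int[mu]_x `|moll n f x| <= \int[mu]_x `|f x|)%R.
Proof.
move=> hf; have [ic E] := moll_mass n (ig_norm hf) (fun x => normr_ge0 _).
have lf := ig_lint hf.
have h : ig (moll n f).
  apply: (ig_le _ _ ic); first exact: moll_measurable.
  by move=> x; exact: conv_le_norm.
split => //; rewrite -E; apply: Rint_le => //; first exact: ig_norm.
by move=> x; exact: conv_le_norm.
Qed.

Lemma convD kap f g x : mol kap -> lint f -> lint g ->
  conv kap (fun y => f y + g y) x = conv kap f x + conv kap g x.
Proof.
move=> hk lf lg; rewrite /conv; under eq_Rintegral do rewrite mulrDr.
by rewrite RintD//; exact: ig_conv.
Qed.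

Lemma convZ kap f c x : mol kap -> lint f ->
  conv kap (fun y => c * f y) x = c * conv kap f x.
Proof.
move=> hk lf; rewrite /conv; under eq_Rintegral do rewrite mulrCA.
by rewrite RintZ//; exact: ig_conv.
Qed.

Definition L1cv f := ig f /\
  (\int[mu]_x `|moll n f x - f x| @[n --> \oo] --> (0 : R))%R.

Lemma L1cvD f g : L1cv f -> L1cv g -> L1cv (fun x => f x + g x).
Proof.
move=> [hf cf] [hg cg]; split; first exact: igD.
have h n k (hk : ig k) : ig (fun x => `|moll n k x - k x|).
  by apply/ig_norm/igB => //; have [] := moll_contract n hk.
apply: (@squeeze_cvgr _ _ _ _ (fun=> 0) (fun n => \int[mu]_x `|moll n f x - f x| + \int[mu]_x `|moll n g x - g x|)%R).
- apply: nearW => n; rewrite Rint_ge0//= -RintD; [|exact: h..].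
  apply: Rint_le; first by apply: h; exact: igD.
    by apply: igD; exact: h.
  move=> x; have -> : moll n (fun x => f x + g x) x = moll n f x + moll n g x.
    by apply: convD; [exact: mol_knl|exact: ig_lint..].
  set a := conv _ _ x; set b := conv _ _ x; rewrite opprD addrACA; exact: ler_normD.
- exact: cvg_cst.
- by rewrite -(addr0 0); exact: cvgD.
Qed.

Lemma L1cvZ c f : L1cv f -> L1cv (fun x => c * f x).
Proof.
move=> [hf cf]; split; first exact: igZ.
have -> : (fun n => \int[mu]_x `|moll n (fun x => c * f x) x - c * f x|)%R =
   (fun n => `|c| * \int[mu]_x `|moll n f x - f x|)%R.
  apply/funext => n; rewrite -RintZ.
    apply: eq_Rintegral => x _; rewrite convZ; [|exact: mol_knl|exact: ig_lint].
    by rewrite -mulrBr normrM.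
  by apply/ig_norm/igB => //; have [] := moll_contract n hf.
by rewrite -(mulr0 `|c|); exact: cvgMl_tmp.
Qed.

(** An epsilon / 3 argument: mollification contracts the L^1 norm, so it does not enlarge the error
    made in replacing [f] by [g]. *)
Lemma L1cv_closed f : ig f ->
  (forall e, 0 < e -> exists2 g, L1cv g & (\int[mu]_x `|f x - g x| <= e)%R) -> L1cv f.
Proof.
move=> hf h; split => //; apply/cvgr0Pnorm_le => e e0.
have [g [hg cg] fg] := h (e / 3) ltac:(lra).
have e3 : 0 < e / 3 by lra.
move/cvgr0Pnorm_le : cg => /(_ _ e3); apply: filterS => n.
have igd k (hk : ig k) : ig (fun x => `|moll n k x - k x|).
  by apply/ig_norm/igB => //; have [] := moll_contract n hk.
rewrite !ger0_norm ?Rint_ge0// => hn.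
have hfg := igB hf hg; have hgf := igB hg hf.
have [icd cd] := moll_contract n hfg.
apply: (@le_trans _ _ (\int[mu]_x (`|moll n (fun x => f x - g x) x| + `|moll n g x - g x| + `|f x - g x|))%R).
  apply: Rint_le; [exact: igd| |].
    by apply: igD; [apply: igD; [exact: ig_norm|exact: igd]|exact: ig_norm].
  move=> x; rewrite [moll n f x](_ : _ = moll n (fun x => f x - g x) x + moll n g x); last first.
    rewrite -convD; [|exact: mol_knl|exact: ig_lint|exact: ig_lint].
    by apply: eq_Rintegral => y _; rewrite subrK.
  set a := conv _ _ x; set b := conv _ _ x.
  have -> : a + b - f x = a + (b - g x) - (f x - g x) by ring.
  by apply: le_trans (ler_normB _ _) _; rewrite lerD2r ler_normD.
rewrite RintD; [|by apply: igD; [exact: ig_norm|exact: igd]|exact: ig_norm].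
rewrite RintD; [|exact: ig_norm|exact: igd].
lra.
Qed.

Lemma fin_indic (A C : set V) : measurable A -> measurable C -> (mu C < +oo)%E ->
  ig (\1_(A `&` C)).
Proof.
move=> mA mC fC; apply: ig_ge0P.
- by apply: measurable_indic; exact: measurableI.
- by move=> x; rewrite indicE.
- rewrite integral_indic//; last exact: measurableI.
  rewrite setIT; apply: le_lt_trans fC; apply: le_measure; rewrite ?inE//.
  exact: measurableI.
Qed.

Lemma L1cv_open (U : set V) : open U -> (mu U < +oo)%E -> L1cv (\1_U).
Proof.
move=> oU fU; have mU := open_measurable_rV oU.
have hU : ig (\1_U) by rewrite -(setIid U); exact: fin_indic.
split => //; have M0 n x : 0 <= moll n (\1_U) x.
  by apply: moll_ge0 => y; rewrite indicE.
have lU := ig_lint hU.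
have M1 n x : moll n (\1_U) x <= 1.
  rewrite -(Rint_knl_shift n x); apply: Rint_le.
  - exact: ig_conv (mol_knl n) lU.
  - exact: ig_knl_shift.
  - move=> y; rewrite knlC ler_piMr ?knl_ge0// indicE; exact: leq_b1.
have ptw x : U x -> moll n (\1_U) x @[n --> \oo] --> (1 : R).
  move=> Ux; apply: cvg_near_cst.
  move: oU; rewrite openE => /(_ x Ux) /nbhs_ballP[e /= e0 eU].
  have [N _ hN] := near_infty_natSinv_lt (PosNum e0).
  exists N => // n /= Nn; rewrite -(Rint_knl_shift n x); apply: eq_Rintegral => y _.
  rewrite knlC indicE; have [yU|yU] := boolP (y \in U); first by rewrite mulr1.
  rewrite mulr0 knl_eq0//; apply: lt_le_trans (hN _ Nn) _; rewrite leNgt; apply/negP => xy.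
  move/negP: yU; apply; apply/mem_set/eU; rewrite -ball_normE/=.
  by rewrite distrC.
have igM n := (moll_contract n hU).1.
have igUM n : ig (fun x => \1_U x * (1 - moll n (\1_U) x)).
  apply: (ig_le _ _ hU) => [|x].
    apply: measurable_funM; first exact: (ig_meas hU).
    by apply: measurable_funB => //; exact: (ig_meas (igM n)).
  rewrite indicE; case: (x \in U); rewrite ?mul0r ?normr0// mul1r ger0_norm.
    by rewrite lerBlDr lerDl.
  by rewrite subr_ge0.
(* By conservation of mass, what leaves U equals what arrives outside, so the error is twice its
   part in U, where dominated convergence applies. *)
have E n : (\int[mu]_x `|moll n (\1_U) x - \1_U x| =
    2 * \int[mu]_x (\1_U x * (1 - moll n (\1_U) x)))%R.
  have I0 x : 0 <= \1_U x :> R by rewrite indicE.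
  have [_ mass] := moll_mass n hU I0.
  transitivity (\int[mu]_x (2 * (\1_U x * (1 - moll n (\1_U) x)) + (moll n (\1_U) x - \1_U x)))%R.
    apply: eq_Rintegral => x _; rewrite indicE; case: (x \in U).
      rewrite ler0_norm; first by rewrite /=; ring.
      by rewrite subr_le0.
    by rewrite mul0r mulr0 add0r subr0 ger0_norm.
  rewrite RintD ?RintZ ?RintB//; [|exact: igZ|exact: igB].
  by rewrite mass subrr addr0.
under eq_fun do rewrite E.
rewrite -(mulr0 2); apply: cvgMl_tmp.
have [|||_ + _] := @Rdct _ _ _ mu (fun n x => \1_U x * (1 - moll n (\1_U) x)) (fun=> 0) (\1_U)
  (fun n => ig_meas (igUM n)) (@measurable_cst _ _ _ _ _ _); last by rewrite Rint0.
- apply: aeW => x; rewrite indicE; have [/set_mem Ux|_] := boolP (x \in U).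
    under eq_fun do rewrite mul1r.
    by rewrite -(subrr 1); apply: cvgB; [exact: cvg_cst|exact: ptw].
  under eq_fun do rewrite mul0r.
  exact: cvg_cst.
- exact: hU.
- move=> n x; rewrite indicE; case: (x \in U); rewrite ?mul0r ?normr0// mul1r ger0_norm.
    by rewrite lerBlDr lerDl.
  by rewrite subr_ge0.
Qed.

Lemma indicC_I (A C : set V) x : (\1_(~` A `&` C) x : R) = \1_C x + -1 * \1_(A `&` C) x.
Proof.
rewrite !indicE !in_setI in_setC; case: (x \in A); case: (x \in C) => /=;
  by rewrite ?mulr1 ?mulr0 ?addr0 ?subrr ?mulN1r.
Qed.

(** Dynkin's lemma starting from the open sets, inside a fixed [C] of finite measure so that
    complements stay integrable. *)
Lemma L1cv_borel (C A : set V) : open C -> (mu C < +oo)%E -> measurable A ->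
  L1cv (\1_(A `&` C)).
Proof.
move=> oC fC; have mC := open_measurable_rV oC; have cC := L1cv_open oC fC.
apply: (@dynkin_induction _ V (@open V) (fun A => L1cv (\1_(A `&` C)))) => //.
- by move=> U W oU oW; exact: openI.
- by rewrite setTI.
- move=> U oU; apply: L1cv_open; first exact: openI.
  apply: le_lt_trans fC; apply: le_measure; rewrite ?inE//.
  by apply: measurableI => //; exact: open_measurable_rV.
- move=> S mS cS; rewrite (_ : \1_(~` S `&` C) = (fun x => \1_C x + -1 * \1_(S `&` C) x)).
    by apply: L1cvD => //; exact: L1cvZ.
  by apply/funext => x; exact: indicC_I.
- move=> F mF tF cF.
  have cS n : L1cv (\1_(\big[setU/set0]_(k < n) F k `&` C)).
    elim: n => [|n ih].
      rewrite big_ord0 set0I (_ : \1_set0 = (fun x => 0 * \1_C x)); first exact: L1cvZ.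
      by apply/funext => x; rewrite indic0 mul0r.
    rewrite big_ord_recr/= (_ : \1_(_ `&` C) =
      (fun x => \1_(\big[setU/set0]_(k < n) F k `&` C) x + \1_(F n `&` C) x)).
      exact: L1cvD.
    apply/funext => x; rewrite !indicE !in_setI in_setU.
    have [/set_mem Sx|_] := boolP (x \in \big[setU/set0]_(k < n) F k); last by rewrite /= add0r.
    have -> : (x \in F n) = false; last by rewrite /= addr0.
    apply/negP => /set_mem Fx; move: Sx; rewrite -bigcup_mkord => -[k /= kn Fk].
    move/trivIsetP : tF => /(_ k n I I); rewrite neq_ltn kn => /(_ isT).
    by move=> /seteqP[+ _] => /(_ x); apply.
  have hF : ig (\1_(\bigcup_k F k `&` C)) by apply: fin_indic => //; exact: bigcup_measurable.
  apply: L1cv_closed => // e e0.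
  have [||_ _ +] := @Rdct _ _ _ mu (fun n => \1_(\big[setU/set0]_(k < n) F k `&` C))
    (\1_(\bigcup_k F k `&` C)) (\1_C) (fun n => ig_meas (cS n).1) (ig_meas hF) _ cC.1.
  + apply: aeW => x; apply: cvg_near_cst.
    have [[k _ Fk]|nF] := pselect ((\bigcup_k F k) x).
      exists k.+1 => // n /= kn; rewrite !indicE !in_setI; congr ((_ && _)%:R).
      rewrite (mem_set (_ : (\bigcup_k F k) x)); last by exists k.
      by apply/mem_set; rewrite -bigcup_mkord; exists k.
    exists 0 => // n _; rewrite !indicE !in_setI; congr ((_ && _)%:R).
    rewrite (memNset nF); apply/negbTE/negP => /set_mem; rewrite -bigcup_mkord => -[k _ Fk].
    by apply: nF; exists k.
  + move=> n x; rewrite !indicE in_setI ger0_norm//; case: (x \in C); rewrite ?andbF//= andbT.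
    by case: (_ \in _); rewrite ?lexx ?ler01.
  move/cvgr0Pnorm_le => /(_ e e0)[N _ /(_ N (leqnn N))] /= hN.
  exists (\1_(\big[setU/set0]_(k < N) F k `&` C)) => //.
  by under eq_Rintegral do rewrite distrC; apply: le_trans hN; exact: ler_norm.
Qed.

Lemma open_cube r : open [set y : V | `|y| < r].
Proof.
have -> : [set y : V | `|y| < r] = (fun y : V => `|y|) @^-1` `]-oo, r[.
  by apply/seteqP; split => y; rewrite /= in_itv.
apply: open_comp; last exact: interval_open.
by move=> y _; exact: norm_continuous.
Qed.

Lemma leb_open_cube r : (mu [set y : V | (`|y| < r)%R] < +oo)%E.
Proof.
apply: le_lt_trans (@leb_cube R d `|r| (normr_ge0 _)); apply: le_measure; rewrite ?inE//.
- by apply: open_measurable_rV; exact: open_cube.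
- exact: measurable_cube.
- by move=> y /= /ltW yr; rewrite /cube/= (le_trans yr)// ler_norm.
Qed.

(* Mollification converges in L^1: pointwise convergence on an open set and
   conservation of mass give it for indicators of bounded open sets. *)
Lemma L1cv_ig f : ig f -> L1cv f.
Proof.
move=> hf; apply: L1cv_closed => // e e0.
have [g [hg _ fg]] := approximation_sfun_integrable measurableT hf.
have [N hN] : exists N, (\int[mu]_x `|f x - g N x| <= e / 2)%R.
  have : (\int[mu]_x `|f x - g n x| @[n --> \oo] --> (0 : R))%R.
    move: fg; rewrite (_ : (fun n => _) = (fun n => (\int[mu]_x `|f x - g n x|)%R%:E)).
      by move/fine_cvgP => [_].
    by apply/funext => n; rewrite EFin_Rint//; apply/ig_norm/igB => //; exact: hg.
  move/cvgr0Pnorm_le => /(_ (e / 2)) []; first lra.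
  by move=> N _ /(_ N (leqnn N)) /= hN; exists N; apply: le_trans hN; exact: ler_norm.
have hgN : ig (g N) := hg N.
(* Restriction to open cubes gives the level sets of the simple function finite measure, as
   [L1cv_borel] requires. *)
pose C n := [set y : V | `|y| < n%:R].
have cC n : L1cv (fun x => \1_(C n) x * g N x).
  rewrite (_ : (fun x => _) = (fun x => \sum_(r <- finmap.enum_fset (fset_set (range (g N))))
     (r * \1_((g N) @^-1` [set r] `&` C n) x))).
    elim: (finmap.enum_fset _) => [|r s ih].
      under eq_fun do rewrite big_nil.
      split; first exact: ig0.
      rewrite (_ : (fun n => _) = fun=> 0); first exact: cvg_cst.
      apply/funext => k; rewrite -[RHS](@Rint0 _ _ _ mu); apply: eq_Rintegral => x _.
      rewrite subr0 /conv (_ : (fun y => _) = fun=> 0) ?Rint0 ?normr0//.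
      by apply/funext => y; rewrite mulr0.
    under eq_fun do rewrite big_cons.
    apply: L1cvD => //; apply/L1cvZ/L1cv_borel; first exact: open_cube.
      exact: leb_open_cube.
    exact: measurable_sfunP.
  have finr : finite_set (range (g N)) by exact: (@fimfunP _ _ (g N)).
  apply/funext => x; rewrite (fimfunE (g N) x) fsbig_finite//=.
  rewrite mulr_sumr; apply: eq_bigr => r _.
  by rewrite !indicE in_setI; case: (x \in C n); rewrite ?andbT ?andbF ?mul1r ?mul0r ?mulr0.
have [||_ _ +] := @Rdct _ _ _ mu (fun n x => \1_(C n) x * g N x) (g N) (fun x => `|g N x|)
  (fun n => ig_meas (cC n).1) (ig_meas hgN) _ (ig_norm hgN).
- apply: aeW => x; apply: cvg_near_cst; exists (Num.Def.archi_bound `|x|) => // n /= Nn.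
  rewrite indicE mem_set ?mul1r// /C /=.
  by apply: lt_le_trans (archi_boundP (normr_ge0 x)) _; rewrite ler_nat.
- move=> n x; rewrite indicE; case: (x \in _); rewrite ?mul1r// mul0r normr0//.
move/cvgr0Pnorm_le => /(_ (e / 2)) []; first lra.
move=> K _ /(_ K (leqnn K)) /= hK; exists (fun x => \1_(C K) x * g N x) => //.
have hd := igB (cC K).1 hgN; have hd2 := igB hf hgN.
apply: (@le_trans _ _ (\int[mu]_x (`|f x - g N x| + `|\1_(C K) x * g N x - g N x|))%R).
  apply: Rint_le.
  - by apply/ig_norm/igB => //; exact: (cC K).1.
  - by apply: igD; exact: ig_norm.
  - move=> x; rewrite [X in _ <= _ + X]distrC.
    by apply: le_trans (ler_normD _ _); rewrite addrA subrK.
rewrite RintD; [|exact: ig_norm..].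
by move: hK; rewrite ger0_norm ?Rint_ge0//; lra.
Qed.

Lemma moll_local n f r x : `|x| <= r -> moll n f x = moll n (fun y => \1_(cube (r + 1)) y * f y) x.
Proof.
move=> xr; apply: eq_Rintegral => y _; rewrite indicE.
have [_|yr] := boolP (y \in cube (r + 1)); first by rewrite mul1r.
rewrite mul0r mulr0 (mol_shift0 (mol_knl n)) ?mul0r//.
apply: le_lt_trans (_ : r + 1 < _); first by rewrite lerD2r.
by rewrite ltNge; apply: contra yr => yr; exact/mem_set.
Qed.

(** On a cube the mollified function sees [f] only on the cube enlarged by 1, where [f] is
    integrable. *)
Lemma moll_cvg_loc f r : lint f ->
  (forall n, ig (fun x => \1_(cube r) x * `|moll n f x - f x|)) /\
  (\int[mu]_x (\1_(cube r) x * `|moll n f x - f x|) @[n --> \oo] --> (0 : R))%R.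
Proof.
move=> lf; pose g y := \1_(cube (r + 1)) y * f y.
have [hg cg] : L1cv g by apply: L1cv_ig; exact: lf.2.
have h n : ig (fun x => `|moll n g x - g x|).
  by apply/ig_norm/igB => //; have [] := moll_contract n hg.
have E n x : \1_(cube r) x * `|moll n f x - f x| <= `|moll n g x - g x|.
  rewrite indicE; have [/set_mem xr|_] := boolP (x \in cube r); last by rewrite mul0r.
  rewrite mul1r (@moll_local n f r x)// /g.
  rewrite [X in _ <= `|_ - X|](_ : _ = f x)// indicE mem_set ?mul1r//.
  by apply: cube_le xr; rewrite lerDl.
have h2 n : ig (fun x => \1_(cube r) x * `|moll n f x - f x|).
  apply: (ig_le _ _ (h n)) => [|x].
    apply: measurable_funM; first by apply: measurable_indic; exact: measurable_cube.
    apply: measurableT_comp => //; apply: measurable_funB; last exact: lf.1.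
    exact: moll_measurable.
  by rewrite ger0_norm ?E// mulr_ge0// indicE.
split => //; apply: (@squeeze_cvgr _ _ _ _ (fun=> 0) (fun n => \int[mu]_x `|moll n g x - g x|)%R) => //.
- apply: nearW => n; apply/andP; split; last by apply: Rint_le.
  by apply: Rint_ge0 => x; rewrite mulr_ge0// indicE.
- exact: cvg_cst.
Qed.

End mollifier.
Notation moll n f := (conv (knl n) f).

End Mollifier.
Import Mollifier.

(** * Calculus along lines and integration by parts *)

Module LineCalculus.

Section line_calculus.
Context {R : realType} (d : nat).
Local Notation V := 'rV[R]_d.
Local Notation mu := (@leb R d).
Local Notation leb1 := (@lebesgue_measure R).
Local Notation ig f := (mu.-integrable setT (EFin \o f)).
Implicit Types (F DF f g kap : V -> R) (x y v : V).

(** [DF] is the derivative of [F] in direction [v], tested along every line; no Frechet differential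
    is asked for, so convolutions with rough functions qualify at once. *)
Definition dline F v DF := forall x (s : R),
  is_derive s 1 (fun s : R => F (x + s *: v)) (DF (x + s *: v)).

Lemma is_derive_FTC (F f : R -> R) (a b : R) : a < b ->
  (forall s : R, is_derive s 1 F (f s)) -> continuous f ->
  (\int[leb1]_(s in `[a, b]) (f s)%:E = (F b)%:E - (F a)%:E)%E.
Proof.
move=> ab dF cf; have cF : continuous F.
  by move=> s; apply: differentiable_continuous; apply/derivable1_diffP; have [] := dF s.
apply: continuous_FTC2 => //.
- exact: continuous_subspaceT.
- split.
  + by move=> s _; have [] := dF s.
  + exact: cvg_at_right_filter (cF a).
  + exact: cvg_at_left_filter (cF b).
- by move=> s _; rewrite derive1E; have [_ ->] := dF s.
Qed.

Lemma continuous_line x v : continuous (fun s : R => x + s *: v).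
Proof.
by move=> s; apply: cvgD; [exact: cvg_cst|apply: cvgZr_tmp; exact: cvg_id].
Qed.

Lemma line_FTC F v DF x : dline F v DF -> continuous DF ->
  (\int[leb1]_(s in `[0%R, 1%R]) (DF (x + s *: v))%:E = (F (x + v) - F x)%:E)%E.
Proof.
move=> dF cD; have := @is_derive_FTC (fun s : R => F (x + s *: v)) _ 0 1 ltr01 (dF x).
rewrite scale1r scale0r addr0 => -> //.
by move=> s; apply: continuous_comp; [exact: continuous_line|exact: cD].
Qed.

Let line2 v (p : V * measurableTypeR R) : V := p.1 + (p.2 : R) *: v.

Let mline2 v : measurable_fun setT (line2 v).
Proof.
apply: measurable_fun_rV => i; under eq_fun do rewrite !mxE.
apply: (@measurable_funD _ _ _ _ (fun p : V * measurableTypeR R => p.1 ord0 i) (fun p => (p.2 : R) * v ord0 i)).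
  exact: (measurableT_comp (measurable_coord i) measurable_fst).
by apply: measurable_funM => //; exact: measurable_snd.
Qed.

Let ind01 := (\1_(`[0%R, 1%R] : set R) : R -> R).

Let m01 : measurable_fun setT ind01. Proof. exact: measurable_indic. Qed.

Let int01 : (\int[leb1]_s (ind01 s)%:E = 1)%E.
Proof.
rewrite integral_indic// setIT; have := @lebesgue_measure_itv R `[0%R, 1%R].
by rewrite /= lte_fin ltr01 oppr0 adde0.
Qed.

(** Averaging over the translations by s v, 0 <= s <= 1, preserves the integral by Tonelli and
    translation invariance. *)
Lemma int_line_ge0 F v : measurable_fun setT F -> (forall x, 0 <= F x) ->
  (\int[mu]_x \int[leb1]_s (ind01 s * F (x + s *: v))%:E = \int[mu]_x (F x)%:E)%E.
Proof.
move=> mF F0.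
have := fubini_tonelli (m1 := mu) (m2 := leb1) (fun p : V * measurableTypeR R => (ind01 p.2 * F (line2 v p))%:E).
rewrite /= => -> //; last 2 first.
- apply/measurable_EFinP; apply: measurable_funM; first exact: measurableT_comp.
  exact: measurableT_comp.
- by move=> p; rewrite lee_fin mulr_ge0// /ind01 indicE.
rewrite /line2/=; under eq_integral => s _.
  under eq_integral do rewrite EFinM.
  rewrite ge0_integralZl//; last 3 first.
  - by apply/measurable_EFinP; apply: measurableT_comp => //; exact: measurable_shift.
  - by move=> x _; rewrite lee_fin.
  - by rewrite lee_fin /ind01 indicE.
  rewrite (leb_shift (s *: v) (f := fun x => (F x)%:E)) => [|//|//]; last exact/measurable_EFinP.
  over.
rewrite ge0_integralZr//; last 3 first.
- exact/measurable_EFinP.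
- by move=> s _; rewrite lee_fin /ind01 indicE.
- by apply: integral_ge0 => x _; rewrite lee_fin.
by rewrite int01 mul1e.
Qed.

Lemma ind01_int (G : R -> R) :
  (\int[leb1]_(s in `[0%R, 1%R]) (G s)%:E = \int[leb1]_s (ind01 s * G s)%:E)%E.
Proof.
rewrite integral_mkcond; apply: eq_integral => s _; rewrite /patch /ind01 indicE.
by case: ifPn => _; rewrite ?mul1r ?mul0r.
Qed.

(** Integrate in x the identity between F(x + v) - F(x) and the integral of DF over the segment:
    translation invariance makes one side 0, and Fubini turns the other into the integral of DF.
    Integrability of F plays the part of compact support. *)
Lemma int_dline F v DF : dline F v DF -> continuous DF -> ig F -> ig DF ->
  (\int[mu]_x DF x = 0)%R.
Proof.
move=> dF cD hF hD.
pose f (p : V * measurableTypeR R) := (ind01 p.2 * DF (line2 v p))%:E.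
have mf : measurable_fun setT f.
  apply/measurable_EFinP; apply: measurable_funM; first exact: measurableT_comp.
  by apply: measurableT_comp => //; exact: ig_meas hD.
have hf : (mu \x leb1)%E.-integrable setT f.
  apply/(@integrable12ltyP _ _ _ _ R mu leb1 f mf).
  rewrite (_ : (\int[mu]_x _)%E = (\int[mu]_x \int[leb1]_s (ind01 s * `|DF (x + s *: v)|)%:E)%E).
    rewrite (int_line_ge0 v (F := fun x => `|DF x|)) => [||//].
      by apply: ig_lty; exact: ig_norm.
    by apply: measurableT_comp => //; exact: ig_meas hD.
  apply: eq_integral => x _; apply: eq_integral => s _.
  by rewrite /f /= normrM ger0_norm// /ind01 indicE.
have := Fubini hf.
have -> : (\int[mu]_x \int[leb1]_y f (x, y) = \int[mu]_x (F (x + v) - F x)%:E)%E.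
  by apply: eq_integral => x _; rewrite -(line_FTC x dF cD) ind01_int.
rewrite -EFin_Rint; last by apply: igB => //; exact: ig_shift.
rewrite RintB//; last exact: ig_shift.
rewrite Rint_shift ?subrr; last exact: ig_meas hF.
have -> : (\int[leb1]_y \int[mu]_x f (x, y) = \int[leb1]_s (ind01 s * \int[mu]_x DF x)%:E)%E.
  apply: eq_integral => s _; rewrite /f /line2/=.
  have hs : ig (fun x => DF (x + s *: v)) by exact: ig_shift.
  by rewrite -EFin_Rint ?RintZ ?Rint_shift//; [exact: ig_meas hD|exact: igZ].
have i01 : leb1.-integrable setT (EFin \o ind01).
  by apply: ig_ge0P => //; rewrite int01 ltry.
under eq_integral do rewrite mulrC.
rewrite -EFin_Rint; last exact: igZ.
rewrite RintZ//; have -> : (\int[leb1]_x ind01 x = 1)%R by rewrite /Rintegral int01.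
by rewrite mulr1 => -[].
Qed.

(** For x in the cube of radius r, the segment from x to x + v stays in the cube of radius r +
    |v|. *)
Lemma int_shift_diff F v DF r : dline F v DF -> continuous DF -> continuous F ->
  (\int[mu]_x (\1_(cube r) x * `|F (x + v) - F x|)%:E <=
   \int[mu]_x (\1_(cube (r + `|v|)) x * `|DF x|)%:E)%E.
Proof.
move=> dF cD cF; have mD := continuous_measurable_rV cD.
have mcube s : measurable_fun setT (\1_(@cube R d s) : V -> R).
  by apply: measurable_indic; exact: measurable_cube.
rewrite -(int_line_ge0 v (F := fun x => \1_(cube (r + `|v|)) x * `|DF x|)); last 2 first.
- by apply: measurable_funM => //; exact: measurableT_comp.
- by move=> x; rewrite mulr_ge0// indicE.
have mline x : measurable_fun setT (fun s : R => DF (x + s *: v)).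
  by apply: continuous_measurable_fun => s; apply: continuous_comp; [exact: continuous_line|exact: cD].
apply: ge0_le_integral => //.
- apply/measurable_EFinP; apply: measurable_funM => //; apply: measurableT_comp => //.
  have mF := continuous_measurable_rV cF.
  by apply: measurable_funB => //; apply: measurableT_comp => //; exact: measurable_shift.
- apply: (measurable_fun_fubini_tonelli_F (fun p : V * measurableTypeR R => (ind01 p.2 * (\1_(cube (r + `|v|)) (line2 v p) * `|DF (line2 v p)|))%:E)).
    apply/measurable_EFinP; apply: measurable_funM; first exact: measurableT_comp.
    apply: measurable_funM; first exact: measurableT_comp.
    by apply: measurableT_comp => //; exact: measurableT_comp.
  by move=> p; rewrite lee_fin !mulr_ge0// ?indicE// /ind01 indicE.
move=> x _; rewrite [in leLHS]indicE.
have [/set_mem xr|_] := boolP (x \in cube r); last first.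
  by rewrite mul0r; apply: integral_ge0 => s _; rewrite lee_fin !mulr_ge0// ?indicE// /ind01 indicE.
rewrite mul1r -abse_EFin -(line_FTC x dF cD).
apply: le_trans (le_abse_integral _ _ _) _ => //.
  by apply/measurable_EFinP; apply: measurable_funTS; exact: mline.
have := ind01_int (fun s => `|DF (x + s *: v)|); rewrite /= => ->.
rewrite le_eqVlt; apply/orP; left; apply/eqP; apply: eq_integral => s _.
rewrite /ind01 indicE; have [/set_mem|_] := boolP (s \in _); last by rewrite !mul0r.
rewrite /= in_itv/= => /andP[s0 s1]; rewrite !mul1r indicE mem_set ?mul1r// /cube/=.
apply: le_trans (ler_normD _ _) _; apply: lerD => //.
by rewrite normrZ ler_piMl// ger0_norm.
Qed.

Lemma dline_diff F v : (forall x, differentiable F x) -> dline F v ('D_v F).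
Proof. by move=> dF x s; exact: derive_line. Qed.

Lemma dline_conv kap f v : mol kap -> lint f -> dline (conv kap f) v (conv ('D_v kap) f).
Proof. by move=> hk lf x s; exact: conv_derive. Qed.

Lemma dlineM F G v DF DG : dline F v DF -> dline G v DG ->
  dline (fun x => F x * G x) v (fun x => F x * DG x + G x * DF x).
Proof. by move=> dF dG x s; exact: is_deriveM. Qed.

Lemma dlineD F G v DF DG : dline F v DF -> dline G v DG ->
  dline (fun x => F x + G x) v (fun x => DF x + DG x).
Proof. by move=> dF dG x s; exact: is_deriveD. Qed.

Lemma dline_comp (h h' : R -> R) F v DF : dline F v DF ->
  (forall x, is_derive (F x) 1 h (h' (F x))) ->
  dline (fun x => h (F x)) v (fun x => h' (F x) * DF x).
Proof.
move=> dF dh x s.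
exact: (@is_derive1_comp R h (fun s => F (x + s *: v)) s _ _ (dh _) (dF x s)).
Qed.

End line_calculus.

End LineCalculus.
Import LineCalculus.

(** * Weak gradients and a chain rule for them *)

Module WeakGradients.

Section weak_gradients.
Context {R : realType} (d : nat).
Local Notation V := 'rV[R]_d.
Local Notation mu := (@leb R d).
Local Notation ig f := (mu.-integrable setT (EFin \o f)).
Local Notation e i := (delta_mx ord0 i : V).
Implicit Types (u w f g phi kap : V -> R) (x y v : V).

Lemma contD (W : normedModType R) (f g : W -> R) : continuous f -> continuous g ->
  continuous (fun x : W => f x + g x).
Proof. exact: (@CkD R W 0). Qed.

Lemma contM (W : normedModType R) (f g : W -> R) : continuous f -> continuous g ->
  continuous (fun x : W => f x * g x).
Proof. exact: (@CkM R W 0). Qed.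

Lemma cont_cst (W : normedModType R) (c : R) : continuous (fun _ : W => c).
Proof. exact: (@Ck_cst R W 0). Qed.

Lemma test_fun_supp (phi : V -> R) r : smooth phi -> (forall y, r < `|y| -> phi y = 0) ->
  test_fun setT phi.
Proof.
move=> sp hp; have cl : closed (@cube R d r).
  by apply: compact_closed (@cube_compact _ _ _); exact: norm_hausdorff.
have sub : fsupport phi `<=` cube r.
  rewrite /fsupport closureE; apply: smallest_sub => // y /=.
  by apply: contraNP => /negP; rewrite -ltNge => /hp ->.
split => //; apply: subclosed_compact sub; first exact: closed_closure.
exact: cube_compact.
Qed.

Lemma test_funP (phi : V -> R) : test_fun setT phi ->
  exists r, forall y, r < `|y| -> phi y = 0.
Proof.
move=> [_ /compact_sub_cube[r hr] _]; exists r => y ry.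
apply: contrapT => /eqP h; have : fsupport phi y by exact: (@subset_closure _ [set x | phi x != 0]).
by move=> /hr; rewrite /cube/= leNgt ry.
Qed.

Lemma smooth_derive (phi : V -> R) v : smooth phi -> smooth ('D_v phi).
Proof. by move=> sp k; have [_] := sp k.+1; exact. Qed.

Lemma derive_supp (phi : V -> R) r v : (forall y, r < `|y| -> phi y = 0) ->
  forall y, r < `|y| -> 'D_v phi y = 0.
Proof.
move=> hp y ry; apply: derive_near0; have := near_norm_gt ry.
by apply: filterS => z; exact: hp.
Qed.

Lemma smooth_refl kap x : smooth kap -> smooth (fun y => kap (x - y)).
Proof.
move=> sk k; apply: (@Ck_comp_lin R V V (fun y => - y) x k kap _ _ (sk k)).
  by move=> c a b; rewrite opprD scalerN.
exact: opp_continuous.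
Qed.

Lemma derive_refl kap x y v : differentiable kap (x - y) ->
  'D_v (fun y => kap (x - y)) y = - 'D_v kap (x - y).
Proof.
move=> dk.
have lin : linear (fun y : V => - y) by move=> c a b; rewrite opprD scalerN.
pose Lm := GRing.isLinear.Build _ _ _ _ _ lin.
pose L' : {linear V -> V} := HB.pack (fun y : V => - y) Lm.
have cL : continuous (L' : V -> V) by exact: opp_continuous.
have [_ /= ->] := @derive_comp_lin R V V L' x kap y v cL dk.
by rewrite !deriveE//= linearN.
Qed.

Lemma lintZ c f : lint f -> lint (fun y => c * f y).
Proof.
move=> [mf lf]; split => [|r]; first exact: measurable_funM.
by under eq_fun do rewrite mulrCA; exact: igZ.
Qed.

Lemma lint_le f g : measurable_fun setT f -> (forall y, `|f y| <= g y) -> lint g -> lint f.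
Proof.
move=> mf fg [mg lg]; split => // r; apply: (ig_le _ _ (lg r)).
  by apply: measurable_funM => //; apply: measurable_indic; exact: measurable_cube.
by move=> y; rewrite normrM ger0_norm ?indicE// ler_wpM2l.
Qed.

Lemma lint_norm f : lint f -> lint (fun y => `|f y|).
Proof.
move=> [mf lf]; split => [|r]; first exact: measurableT_comp.
apply: (ig_le _ _ (ig_norm (lf r))).
  apply: measurable_funM => //; last exact: measurableT_comp.
  by apply: measurable_indic; exact: measurable_cube.
by move=> y; rewrite !normrM normr_id.
Qed.

Lemma lint_test f phi : lint f -> continuous phi ->
  (exists r, forall y, r < `|y| -> phi y = 0) -> ig (fun y => phi y * f y).
Proof.
move=> lf cp [r hr]; have [M M0 hM] := continuous_bounded_cube r cp.
apply: (lint_mul (M := M) lf _ _ hr); first exact: continuous_measurable_rV.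
move=> y; have [yr|yr] := leP `|y| r; first exact: hM.
by rewrite hr// normr0.
Qed.

Lemma ig_cont_supp phi : continuous phi ->
  (exists r, forall y, r < `|y| -> phi y = 0) -> ig phi.
Proof.
move=> cp hp; have := lint_test (lint_cst1 d) cp hp.
by under eq_fun do rewrite mulr1.
Qed.

(** The weak derivative seen through mollifiers only, each reflected kernel being a test function;
    in this form weak gradients enter all approximations. *)
Definition conv_grad u i g := forall kap x, mol kap ->
  conv ('D_(e i) kap) u x = conv kap g x.

Lemma weak_grad_lint u G i : is_weak_grad u G -> lint (fun y => G y ord0 i).
Proof. by move=> wG; apply/loc_integrableP; have [] := wG i. Qed.

Lemma weak_grad_conv u G i : lint u -> is_weak_grad u G ->
  conv_grad u i (fun y => G y ord0 i).
Proof.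
move=> lu wG kap x hk; have [_ h] := wG i.
have tp : test_fun setT (fun y => kap (x - y)).
  apply: (@test_fun_supp _ (`|x| + 1)); first exact: smooth_refl hk.1.
  by move=> y; exact: mol_shift0.
have := h _ tp.
rewrite (_ : (\int[mu]_y _)%R = (\int[mu]_y (- ('D_(e i) kap (x - y) * u y)))%R).
  rewrite RintN; last exact: (ig_conv x (mol_derive (e i) hk) lu).
  move/oppr_inj; rewrite /conv => ->.
  by apply: eq_Rintegral => y _; rewrite mulrC.
apply: eq_Rintegral => y _; rewrite /grad mxE derive_refl; last exact: mol_differentiable.
by rewrite mulrN mulrC.
Qed.

Lemma ae_eq0_cubes (h : V -> R) : measurable_fun setT h ->
  (forall N : nat, (\int[mu]_x (\1_(cube N%:R) x * `|h x|)%:E = 0)%E) ->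
  {ae mu, forall x, h x = 0}.
Proof.
move=> mh hN.
have mi N : measurable_fun setT (fun x => \1_(@cube R d N%:R) x * `|h x|).
  apply: measurable_funM; last exact: measurableT_comp.
  by apply: measurable_indic; exact: measurable_cube.
have H N : {ae mu, forall x, \1_(cube N%:R) x * `|h x| = 0}.
  have := (@ae_eq_integral_abs _ _ _ mu setT measurableT
    (EFin \o (fun x => \1_(cube N%:R) x * `|h x|)) ((measurable_EFinP _ _).2 (mi N))).1.
  rewrite (eq_integral (fun x => (\1_(cube N%:R) x * `|h x|)%:E)); last first.
    by move=> x _; rewrite /= ger0_norm// mulr_ge0// indicE.
  move=> /(_ (hN N)); apply: filterS => x /(_ I) /= [].
  by [].
have := ae_foralln H; apply: filterS => x hx.
have := hx (Num.Def.archi_bound `|x|); rewrite indicE mem_set ?mul1r.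
  by move/normr0_eq0.
by rewrite /cube/= ltW// archi_boundP.
Qed.

(** Both functions are the local L^1 limit of the same mollifications. *)
Lemma moll_unique f g : lint f -> lint g -> (forall n x, moll n f x = moll n g x) ->
  {ae mu, forall x, f x = g x}.
Proof.
move=> lf lg fg.
have ld : lint (fun x => f x - g x).
  have := lintD lf (lintZ (-1) lg).
  by rewrite (_ : (fun y => _) = (fun x => f x - g x))//; apply/funext => x; rewrite mulN1r.
suff : {ae mu, forall x, f x - g x = 0}.
  by apply: filterS => x /eqP; rewrite subr_eq0 => /eqP.
apply: ae_eq0_cubes; first exact: ld.1.
move=> N; have [h1 c1] := moll_cvg_loc N%:R lf; have [h2 c2] := moll_cvg_loc N%:R lg.
have hi : ig (fun x => \1_(cube N%:R) x * `|f x - g x|) := (lint_norm ld).2 _.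
rewrite -EFin_Rint//; congr EFin; apply/eqP; rewrite eq_le; apply/andP; split; last first.
  by apply: Rint_ge0 => x; rewrite mulr_ge0// indicE.
have : (\int[mu]_x (\1_(cube N%:R) x * `|moll n f x - f x|) +
  \int[mu]_x (\1_(cube N%:R) x * `|moll n g x - g x|) @[n --> \oo] --> (0 : R))%R.
  by rewrite -(addr0 0); exact: cvgD.
move/cvgr_to_ge; apply.
apply: nearW => n /=; rewrite -RintD//; apply: Rint_le => //; first exact: igD.
move=> x; rewrite -mulrDr ler_wpM2l ?indicE// fg [X in _ <= X + _]distrC.
by apply: le_trans (ler_normD _ _); rewrite addrA subrK.
Qed.

Lemma weak_grad_unique u G G' i : lint u -> is_weak_grad u G -> is_weak_grad u G' ->
  {ae mu, forall y, G y ord0 i = G' y ord0 i}.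
Proof.
move=> lu wG wG'; apply: moll_unique; [exact: weak_grad_lint..|].
move=> n x; rewrite -(weak_grad_conv i lu wG x (mol_knl d n)).
by rewrite -(weak_grad_conv i lu wG' x (mol_knl d n)).
Qed.

Section chain_rule.
Variables (w g : V -> R) (i : 'I_d) (f f' : R -> R) (L : R).
Hypotheses (lw : lint w) (lg : lint g) (w0 : forall y, 0 <= w y)
  (wg : conv_grad w i g)
  (df : forall s : R, 0 < s -> is_derive s 1 f (f' s))
  (fL : forall s t, 0 <= s -> 0 <= t -> `|f s - f t| <= L * `|s - t|)
  (f'L : forall s, 0 <= s -> `|f' s| <= L)
  (cf' : forall (s : nat -> R) (l : R), (forall n, 0 < s n) -> 0 <= l ->
     s n @[n --> \oo] --> l -> f' (s n) @[n --> \oo] --> f' l)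
  (mfw : measurable_fun setT (f \o w)) (mf'w : measurable_fun setT (f' \o w)).

Let L0 : 0 <= L. Proof. by apply: le_trans (f'L (lexx 0)). Qed.

Let cf (s : nat -> R) (l : R) : (forall n, 0 < s n) -> 0 <= l ->
  s n @[n --> \oo] --> l -> f (s n) @[n --> \oo] --> f l.
Proof.
move=> s0 l0 sl; apply/cvgrPdist_le => r r0.
have L1 : 0 < L + 1 by rewrite ltr_wpDl.
move/cvgrPdist_le : sl => /(_ (r / (L + 1))) []; first by rewrite divr_gt0.
move=> N _ hN; exists N => // n /hN /= h; apply: le_trans (fL l0 (ltW (s0 n))) _.
apply: (@le_trans _ _ ((L + 1) * `|l - s n|)); first by rewrite ler_wpM2r// lerDl.
by rewrite mulrC -ler_pdivlMr.
Qed.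

Let lfw : lint (f \o w).
Proof.
apply: (@lint_le _ (fun y => `|f 0| * 1 + L * w y)) => //.
  move=> y /=; rewrite mulr1 -lerBlDl; apply: le_trans (lerB_dist _ _) _.
  by have := fL (w0 y) (lexx 0); rewrite subr0 (ger0_norm (w0 y)).
by apply: lintD; apply: lintZ => //; exact: lint_cst1.
Qed.

Let wn n x := moll n w x + n.+1%:R^-1.

Let wn_gt0 n x : 0 < wn n x.
Proof. by rewrite ltr_wpDl ?invr_gt0//; exact: moll_ge0. Qed.

Let cwn n : continuous (wn n).
Proof.
by apply: contD; [exact: (conv_continuous (mol_knl d n) lw)|exact: cont_cst].
Qed.

Let dwn n : dline (wn n) (e i) (moll n g).
Proof.
move=> x s; have := dlineD (dline_conv (e i) (mol_knl d n) lw)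
  (dline_diff (e i) (fun x : V => differentiable_cst (n.+1%:R^-1 : R) x)) x s.
by move=> h; apply: is_derive_eq h _; rewrite derive_cst addr0 wg//; exact: mol_knl.
Qed.

Let seqc (h : R -> R) (q : V -> R) : continuous q -> (forall x, 0 < q x) ->
  (forall (s : nat -> R) (l : R), (forall n, 0 < s n) -> 0 <= l ->
    s n @[n --> \oo] --> l -> h (s n) @[n --> \oo] --> h l) ->
  continuous (fun x => h (q x)).
Proof.
move=> cq q0 hh x; apply: seq_continuous => u ux; apply: hh => //.
- exact: ltW.
- by apply: (@continuous_cvg _ _ _ _ _ _ q) => //; exact: cq.
Qed.

(** The classical chain rule applies to [wn n], the mollified [w] raised by 1 / (n + 1): it is
    positive, so [f] is evaluated only where it is differentiable. At 0 just the Lipschitz bound on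
    [f] and the limits of [f'] along positive sequences enter, which suits the inverse of the
    pressure. *)
Lemma weak_chain_rule (phi : V -> R) : test_fun setT phi ->
  (\int[mu]_y (f (w y) * 'D_(e i) phi y) = - \int[mu]_y (f' (w y) * g y * phi y))%R.
Proof.
move=> tp; have [r hr] := test_funP tp; have [sp _ _] := tp.
have cp : continuous phi := sp 0.
have cDp : continuous ('D_(e i) phi) := smooth_derive (e i) sp 0.
have hDr := derive_supp (e i) hr.
have [C1 C10 hC1] := continuous_bounded_cube r cp.
have [C2 C20 hC2] := continuous_bounded_cube r cDp.
pose C := Num.max C1 C2.
have bp y : `|phi y| <= C * \1_(cube r) y.
  rewrite indicE; have [/set_mem yr|yr] := boolP (y \in cube r).
    by rewrite mulr1 le_max hC1.
  by rewrite mulr0 hr ?normr0// ltNge; apply: contra yr => yr; exact/mem_set.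
have bDp y : `|'D_(e i) phi y| <= C * \1_(cube r) y.
  rewrite indicE; have [/set_mem yr|yr] := boolP (y \in cube r).
    by rewrite mulr1 le_max hC2 ?orbT.
  by rewrite mulr0 hDr ?normr0// ltNge; apply: contra yr => yr; exact/mem_set.
have C0 : 0 <= C by rewrite le_max C10.
have lf'g : lint (fun y => f' (w y) * g y).
  apply: (@lint_le _ (fun y => L * `|g y|)); last by apply: lintZ; exact: lint_norm.
    by apply: measurable_funM => //; exact: lg.1.
  by move=> y; rewrite normrM ler_wpM2r// f'L.
pose T y := f (w y) * 'D_(e i) phi y + f' (w y) * g y * phi y.
pose Tn n y := f (wn n y) * 'D_(e i) phi y + phi y * (f' (wn n y) * moll n g y).
have igT1 : ig (fun y => f (w y) * 'D_(e i) phi y).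
  have := lint_test lfw cDp (ex_intro _ r hDr).
  by under eq_fun do rewrite mulrC.
have igT2 : ig (fun y => f' (w y) * g y * phi y).
  have := lint_test lf'g cp (ex_intro _ r hr).
  by under eq_fun do rewrite mulrC.
suff T0 : (\int[mu]_y T y = 0)%R.
  by apply/eqP; rewrite -addr_eq0 -RintD//; apply/eqP.
have cmg n : continuous (moll n g) := conv_continuous (mol_knl d n) lg.
have cfn n : continuous (fun y => f (wn n y)) by exact: (seqc (@cwn n) (wn_gt0 n) cf).
have cf'n n : continuous (fun y => f' (wn n y)) by exact: (seqc (@cwn n) (wn_gt0 n) cf').
have cTn n : continuous (Tn n).
  by apply: contD; apply: contM => //; apply: contM.
have igTn n : ig (Tn n).
  apply: ig_cont_supp => //; exists r => y yr.
  by rewrite /Tn hDr// hr// mulr0 mul0r addr0.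
have Tn0 n : (\int[mu]_y Tn n y = 0)%R.
  apply: (@int_dline _ _ (fun y => f (wn n y) * phi y) (e i)) => //.
  - apply: dlineM; last by apply: dline_diff => x; exact: (sp 1).1.
    exact: (dline_comp (@dwn n) (fun x => df (wn_gt0 n x))).
  - apply: ig_cont_supp; last by exists r => y yr; rewrite hr// mulr0.
    exact: contM.
have [ha ca] := moll_cvg_loc r lw; have [hb cb] := moll_cvg_loc r lg.
pose a n y := \1_(cube r) y * `|moll n w y - w y| + \1_(cube r) y * `|moll n g y - g y|.
have iga n : ig (a n) by exact: igD.
have a0 n y : 0 <= a n y by rewrite addr_ge0// mulr_ge0// indicE.
have cva : (\int[mu]_y a n y @[n --> \oo] --> (0 : R))%R.
  under eq_fun do rewrite RintD//.
  by rewrite -(addr0 0); exact: cvgD.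
(* Only [f' (wn n)] has to converge pointwise, which requires a subsequence; the other errors are
   controlled in L^1. *)
have [s hs cs] := L1_ae_subseq iga a0 cva.
pose c n y := \1_(cube r) y * (`|f' (wn n y) - f' (w y)| * `|g y|).
have mcube : measurable_fun setT (\1_(@cube R d r) : V -> R).
  by apply: measurable_indic; exact: measurable_cube.
have mc n : measurable_fun setT (c n).
  apply: measurable_funM => //; apply: measurable_funM; last first.
    by apply: measurableT_comp => //; exact: lg.1.
  apply: measurableT_comp => //; apply: measurable_funB => //.
  exact: continuous_measurable_rV.
have cb2 n y : `|c n y| <= 2 * L * (\1_(cube r) y * `|g y|).
  rewrite /c !normrM !normr_id (ger0_norm (_ : 0 <= \1_(cube r) y)) ?indicE//.
  rewrite [leRHS]mulrCA ler_wpM2l// ler_wpM2r//.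
  apply: le_trans (ler_normB _ _) _; rewrite mulrDl mul1r.
  by apply: lerD; apply: f'L => //; exact: ltW.
have igdom : ig (fun y => 2 * L * (\1_(cube r) y * `|g y|)).
  by apply: igZ; exact: (lint_norm lg).2.
have igc n : ig (c n) by apply: (ig_le (mc n) (cb2 n)).
have invn : n.+1%:R^-1 @[n --> \oo] --> (0 : R) by exact: cvg_harmonic.
have invs : (s n).+1%:R^-1 @[n --> \oo] --> (0 : R)  by exact: (cvg_subs invn hs).
have [|_ cvc _] := @Rdct _ _ _ mu (fun n => c (s n)) (fun=> 0) _ (fun n => mc (s n))
  (measurable_cst _) _ igdom (fun n => cb2 (s n)).
  move: cs; apply: filterS => y hy.
  rewrite /c indicE; have [yr|_] := boolP (y \in cube r); last first.
    by under eq_fun do rewrite mul0r; exact: cvg_cst.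
  under eq_fun do rewrite mul1r.
  rewrite -(mul0r `|g y|); apply: cvgMr_tmp.
  have cw : wn (s n) y @[n --> \oo] --> w y.
    rewrite /wn -(addr0 (w y)); apply: cvgD; last exact: invs.
    apply/cvgrPdist_le => q q0; move/cvgr0Pnorm_le : hy => /(_ q q0).
    apply: filterS => n; rewrite /a indicE yr !mul1r ger0_norm ?addr_ge0// => h.
    by rewrite distrC; apply: le_trans h; rewrite lerDl.
  have := cf' (fun n => wn_gt0 (s n) y) (w0 y) cw.
  by move=> /cvgrPdist_le h; apply/cvgr0Pnorm_le => q q0; have := h q q0;
    apply: filterS => n; rewrite normr_id distrC.
have bnd n : `|\int[mu]_y T y|%R <= 
   (C * (L * \int[mu]_y a n y) + C * (L * (n.+1%:R^-1 * \int[mu]_y \1_(cube r) y)) + C * \int[mu]_y c n y)%R.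
  have ig1 : ig (\1_(@cube R d r)).
    have := (lint_cst1 d).2 r; by under eq_fun do rewrite mulr1.
  have g1 : ig (fun y => C * (L * a n y)) by do 2!apply: igZ.
  have g2 : ig (fun y => C * (L * (n.+1%:R^-1 * \1_(cube r) y))) by do 3!apply: igZ.
  have g3 : ig (fun y => C * c n y) by apply: igZ.
  have g12 := igD g1 g2.
  have <- : (\int[mu]_y (C * (L * a n y) + C * (L * (n.+1%:R^-1 * \1_(cube r) y)) + C * c n y) =
    C * (L * \int[mu]_y a n y) + C * (L * (n.+1%:R^-1 * \int[mu]_y \1_(cube r) y)) + C * \int[mu]_y c n y)%R.
    rewrite RintD// RintD// !RintZ//; do ?exact: igZ.
    by apply: igZ; exact: igZ.
  have -> : (\int[mu]_y T y = \int[mu]_y (T y - Tn n y))%R.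
    by rewrite RintB// ?Tn0 ?subr0//; exact: igD.
  have igd : ig (fun y => T y - Tn n y) by apply: igB => //; exact: igD.
  apply: le_trans (Rint_norm igd) _; apply: Rint_le; first exact: ig_norm.
    exact: igD.
  move=> y; rewrite /T /Tn /a /c.
  have [yr|yr] := boolP (y \in cube r); last first.
    have yr' : r < `|y| by rewrite ltNge; apply: contra yr => yr; exact/mem_set.
    by rewrite hr// hDr// !indicE (negPf yr) !(mul0r, mulr0, addr0, subrr, normr0).
  have {bp} bp : `|phi y| <= C by have := bp y; rewrite indicE yr mulr1.
  have {bDp} bDp : `|'D_(e i) phi y| <= C by have := bDp y; rewrite indicE yr mulr1.
  rewrite !indicE yr !mul1r mulr1.
  have hw : `|w y - wn n y| <= `|moll n w y - w y| + n.+1%:R^-1.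
    rewrite /wn opprD addrA (le_trans (ler_normB _ _))// distrC.
    by rewrite lerD2l ger0_norm.
  have hf := fL (w0 y) (ltW (wn_gt0 n y)).
  have hf' := f'L (ltW (wn_gt0 n y)).
  set A := f (w y); set B := f (wn n y); set A' := f' (w y); set B' := f' (wn n y) in hf' *.
  set P := phi y in bp *; set Q := 'D_(e i) phi y in bDp *; set M := moll n g y.
  (* The three differences are paid for by the Lipschitz bound on [f], by the L^1 error of the
     mollified [g], and by [c n]. *)
  have -> : A * Q + A' * g y * P - (B * Q + P * (B' * M)) =
    (A - B) * Q - P * (B' * (M - g y)) - P * ((B' - A') * g y) by ring.
  apply: le_trans (ler_normB _ _) _; apply: lerD; last first.
    by rewrite !normrM ler_wpM2r// mulr_ge0.
  apply: le_trans (ler_normB _ _) _.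
  have t1 : `|(A - B) * Q| <= C * (L * (`|moll n w y - w y| + n.+1%:R^-1)).
    rewrite normrM mulrC; apply: ler_pM => //; apply: le_trans hf _.
    by rewrite ler_wpM2l.
  have t2 : `|P * (B' * (M - g y))| <= C * (L * `|M - g y|).
    by rewrite !normrM; apply: ler_pM => //; apply: ler_wpM2r.
  by apply: le_trans (lerD t1 t2) _; rewrite -!mulrDr addrAC.
have lim0 : (C * (L * \int[mu]_y a (s n) y) + C * (L * ((s n).+1%:R^-1 * \int[mu]_y \1_(cube r) y)) +
    C * \int[mu]_y c (s n) y)%R @[n --> \oo] --> (0 : R).
  have -> : (0 : R) = C * (L * 0) + C * (L * (0 * (\int[mu]_y \1_(cube r) y)%R)) + C * (\int[mu]_y 0)%R.
    by rewrite Rint0 !(mul0r, mulr0, addr0).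
  apply: cvgD; [apply: cvgD|].
  - apply: cvgMl_tmp; apply: cvgMl_tmp.
    exact: (cvg_subs cva hs).
  - apply: cvgMl_tmp; apply: cvgMl_tmp; apply: cvgMr_tmp.
    exact: invs.
  - by apply: cvgMl_tmp.
apply/eqP; rewrite -normr_le0; apply: (cvgr_to_ge lim0).
by apply: nearW => n; exact: bnd.
Qed.

End chain_rule.

End weak_gradients.

End WeakGradients.
Import WeakGradients.

(** * A Poincare inequality in L^1 on cubes *)

Module Poincare.

Section poincare.
Context {R : realType} (d : nat).
Local Notation V := 'rV[R]_d.
Local Notation mu := (@leb R d).
Local Notation ig f := (mu.-integrable setT (EFin \o f)).
Local Notation e i := (delta_mx ord0 i : V).

Lemma derive_sum (f : V -> R) x v : differentiable f x ->
  'D_v f x = \sum_i v ord0 i * 'D_(e i) f x.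
Proof.
move=> df; rewrite deriveE// {1}(row_sum_delta v) linear_sum.
by apply: eq_bigr => i _; rewrite linearZ /= deriveE.
Qed.

Lemma ig_cube r : ig (\1_(@cube R d r) : V -> R).
Proof.
apply: ig_ge0P => //; first by apply: measurable_indic; exact: measurable_cube.
rewrite integral_indic//; last exact: measurable_cube.
rewrite setIT; have [r0|r0] := leP 0 r; first exact: leb_cube.
suff -> : @cube R d r = set0 by rewrite measure0.
by apply/seteqP; split => // x; rewrite /cube/= => h; have := le_trans (normr_ge0 x) h; rewrite leNgt r0.
Qed.

Definition vol r : R := (\int[mu]_x (\1_(@cube R d r) x))%R.

Lemma vol_ge0 r : 0 <= vol r. Proof. exact: Rint_ge0. Qed.

Lemma vol_gt0 r : 0 < r -> 0 < vol r.
Proof.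
move=> r0; rewrite -lte_fin EFin_Rint; last exact: ig_cube.
rewrite integral_indic//; last exact: measurable_cube.
rewrite setIT; have := @leb_ball_gt0 R d 0 r r0; congr (_ < leb d _)%E.
by apply/seteqP; split => x; rewrite /cube/= sub0r normrN.
Qed.

Lemma ig_cube_cont (F : V -> R) r : continuous F -> ig (fun x => \1_(cube r) x * F x).
Proof.
move=> cF; have [M M0 hM] := continuous_bounded_cube r cF.
apply: (@ig_le _ _ _ mu _ (fun x => M * \1_(cube r) x)); last exact/igZ/ig_cube.
  by apply: measurable_funM; [exact: ig_meas (ig_cube r)|exact: continuous_measurable_rV].
move=> x; rewrite normrM ger0_norm// mulrC indicE.
by have [/set_mem/hM h|_] := boolP (x \in cube r); rewrite ?mulr1 ?mulr0.
Qed.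

Lemma cont_norm (F : V -> R) : continuous F -> continuous (fun x => `|F x|).
Proof. by move=> cF x; exact: (cvg_norm (cF x)). Qed.

Let maddv : measurable_fun setT (fun p : V * V => p.1 + p.2).
Proof.
apply: measurable_fun_rV => i; rewrite (_ : (fun _ => _) = (fun p : V * V => p.1 ord0 i + p.2 ord0 i)).
  by apply: measurable_funD;
    [exact: (measurableT_comp (measurable_coord i) measurable_fst)|
     exact: (measurableT_comp (measurable_coord i) measurable_snd)].
by apply/funext => p; rewrite mxE.
Qed.

(** [osc] is the oscillation over pairs of points in the cube. After the substitution of x + y for
    the second point, |y| <= 2 r, and [osc2] no longer asks x + y to lie in the cube. *)
Let osc (F : V -> R) r (p : V * V) : R := \1_(cube r) p.1 * (\1_(cube r) p.2 * `|F p.1 - F p.2|).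
Let osc2 (F : V -> R) r (p : V * V) : R := \1_(cube (2 * r)) p.2 * (\1_(cube r) p.1 * `|F (p.1 + p.2) - F p.1|).

Let mcube r : measurable_fun setT (\1_(@cube R d r) : V -> R) := ig_meas (ig_cube r).

Let osc_le F r x y : osc F r (x, x + y) <= osc2 F r (x, y).
Proof.
rewrite /osc /osc2 /= !indicE.
have [xr|_] := boolP (x \in cube r); last by rewrite !(mul0r, mulr0).
have [yr|_] := boolP (x + y \in cube r); last by rewrite mul0r mulr0 mulr_ge0// mulr_ge0.
have y2 : y \in cube (2 * r).
  rewrite inE /cube /= in xr; rewrite inE /cube /= in yr.
  rewrite inE /cube /= (_ : y = (x + y) - x); last by rewrite addrC addKr.
  by apply: (le_trans (ler_normB _ _)); rewrite mulr_natl mulr2n; apply: lerD.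
by rewrite y2 !mul1r distrC.
Qed.

Let mosc2 F r : measurable_fun setT F -> measurable_fun setT (osc2 F r).
Proof.
move=> mF.
apply: measurable_funM; first exact: (measurableT_comp (mcube _) measurable_snd).
apply: measurable_funM; first exact: (measurableT_comp (mcube _) measurable_fst).
apply: measurableT_comp => //; apply: measurable_funB; first exact: (measurableT_comp mF maddv).
exact: (measurableT_comp mF measurable_fst).
Qed.

Let mosc F r : measurable_fun setT F -> measurable_fun setT (osc F r).
Proof.
move=> mF.
apply: measurable_funM; first exact: (measurableT_comp (mcube _) measurable_fst).
apply: measurable_funM; first exact: (measurableT_comp (mcube _) measurable_snd).
apply: measurableT_comp => //; apply: measurable_funB; first exact: (measurableT_comp mF measurable_fst).
exact: (measurableT_comp mF measurable_snd).
Qed.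

(** For fixed x the inner variable is translated by x; Tonelli then puts the increment y outside. *)
Let osc_int F r : measurable_fun setT F ->
  (\int[mu]_x \int[mu]_y (osc F r (x, y))%:E <= \int[mu]_y \int[mu]_x (osc2 F r (x, y))%:E)%E.
Proof.
move=> mF.
have m2 := mosc2 r mF.
have m1 := mosc r mF.
have p1 p : 0 <= osc F r p by rewrite mulr_ge0// mulr_ge0.
have p2 p : 0 <= osc2 F r p by rewrite mulr_ge0// mulr_ge0.
rewrite -(fubini_tonelli (m1 := mu) (m2 := mu) (fun p : V * V => (osc2 F r p)%:E)) //; last exact/measurable_EFinP.
have me1 : measurable_fun setT (fun p : V * V => (osc F r p)%:E) by exact/measurable_EFinP.
have me2 : measurable_fun setT (fun p : V * V => (osc2 F r p)%:E) by exact/measurable_EFinP.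
apply: ge0_le_integral => //.
- by move=> x _; apply: integral_ge0 => y _; rewrite lee_fin.
- by apply: (@measurable_fun_fubini_tonelli_F _ _ _ _ _ mu (fun p : V * V => (osc F r p)%:E)) => // p; rewrite lee_fin.
- by apply: (@measurable_fun_fubini_tonelli_F _ _ _ _ _ mu (fun p : V * V => (osc2 F r p)%:E)) => // p; rewrite lee_fin.
move=> x _.
have s1 : measurable_fun setT (fun y => osc F r (x, y)).
  by have := measurableT_comp m1 (@measurable_pair1 _ _ _ _ x); exact.
have s2 : measurable_fun setT (fun y => osc2 F r (x, y)).
  by have := measurableT_comp m2 (@measurable_pair1 _ _ _ _ x); exact.
rewrite -(@leb_shift R d x (fun y => (osc F r (x, y))%:E)); last 2 first.
- exact/measurable_EFinP.
- by move=> y; rewrite lee_fin.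
apply: ge0_le_integral => //.
- by move=> y _; rewrite lee_fin.
- apply/measurable_EFinP; exact: (measurableT_comp s1 (measurable_shift x)).
- exact/measurable_EFinP.
by move=> y _; rewrite lee_fin addrC; exact: osc_le.
Qed.

(** The deviation from the mean is at most the mean of |F(x) - F(x')|. By [osc_int] this becomes an
    integral of |F(x + y) - F(x)| with |y| <= 2 r, and [int_shift_diff] bounds it by the gradient on
    the cube of radius r + 2 r. *)
Lemma poincare (F : V -> R) (DF : V -> V -> R) (H : V -> R) r : 0 < r ->
  continuous F -> (forall v, dline F v (DF v)) -> (forall v, continuous (DF v)) ->
  continuous H -> (forall x, 0 <= H x) -> (forall v x, `|DF v x| <= `|v| * H x) ->
  vol r * \int[mu]_x (\1_(cube r) x * `|F x - (\int[mu]_y (\1_(cube r) y * F y)) / vol r|) <=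
  vol (2 * r) * (2 * r * \int[mu]_x (\1_(cube (3 * r)) x * H x)).
Proof.
move=> r0 cF dF cDF cH H0 hH; have mF := continuous_measurable_rV cF.
have v0 := vol_gt0 r0; set c := _ / vol r.
have cFc (c0 : R) : continuous (fun x => `|F x - c0|).
  have h : continuous (fun y => F y + (- c0)) by apply: contD => //; exact: cont_cst.
  exact: cont_norm h.
have cFd (c0 : R) : continuous (fun x => `|c0 - F x|).
  by rewrite (_ : (fun x => _) = (fun x => `|F x - c0|))//; apply/funext => x; rewrite distrC.
have iosc (x : V) : ig (fun y => \1_(cube r) x * (\1_(cube r) y * `|F x - F y|)).
  by apply: igZ; apply: ig_cube_cont; exact: cFd.
have r20 : 0 <= 2 * r by rewrite mulr_ge0// ltW.
rewrite -RintZ; last exact: ig_cube_cont.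
rewrite -lee_fin EFin_Rint; last exact/igZ/ig_cube_cont.
apply: (@le_trans _ _ (\int[mu]_x \int[mu]_y (osc F r (x, y))%:E)%E).
  have m1 := mosc r mF.
  have p1 p : 0 <= osc F r p by rewrite mulr_ge0// mulr_ge0.
  have me1 : measurable_fun setT (fun p : V * V => (osc F r p)%:E) by exact/measurable_EFinP.
  apply: ge0_le_integral => //.
  - by move=> x _; rewrite lee_fin mulr_ge0 ?(ltW v0)// mulr_ge0.
  - by apply/measurable_EFinP/ig_meas/igZ/ig_cube_cont.
  - by apply: (@measurable_fun_fubini_tonelli_F _ _ _ _ _ mu (fun p : V * V => (osc F r p)%:E)) => // p; rewrite lee_fin.
  move=> x _; rewrite -EFin_Rint; last exact: iosc.
  rewrite lee_fin /osc /= RintZ; last exact: ig_cube_cont.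
  rewrite mulrCA ler_wpM2l//.
  have i1 := ig_cube_cont r cF; have i2 := igZ (F x) (ig_cube r).
  have -> : vol r * `|F x - c| = `|\int[mu]_y (F x * \1_(cube r) y - \1_(cube r) y * F y)|.
    rewrite RintB// RintZ; last exact: ig_cube.
    have vne : vol r != 0 by rewrite gt_eqF.
    have cE : \int[mu]_y (\1_(cube r) y * F y) = c * vol r by rewrite /c divfK.
    rewrite cE -[X in F x * X]/(vol r) -mulrBl normrM mulrC.
    by rewrite (gtr0_norm v0).
  apply: (le_trans (Rint_norm (igB i2 i1))).
  apply: Rint_le; [exact/ig_norm/igB|exact: ig_cube_cont|move=> y].
  by rewrite mulrC -mulrBr normrM ger0_norm// distrC.
apply: (le_trans (osc_int r mF)).
rewrite EFinM /vol EFin_Rint; last exact: ig_cube.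
have IH : (0 <= \int[mu]_x (\1_(cube (3 * r)) x * H x))%R.
  by apply: Rint_ge0 => x; exact: mulr_ge0.
rewrite -ge0_integralZr//; last 2 first.
- exact/measurable_EFinP.
- by rewrite lee_fin mulr_ge0.
apply: ge0_le_integral => //.
- by move=> y _; apply: integral_ge0 => x _; rewrite lee_fin mulr_ge0// mulr_ge0.
- by apply: (@measurable_fun_fubini_tonelli_G _ _ _ _ _ mu (fun p : V * V => (osc2 F r p)%:E)) => [|p]; [apply/measurable_EFinP; exact: mosc2|rewrite lee_fin mulr_ge0// mulr_ge0].
- by apply: emeasurable_funM => //; exact/measurable_EFinP.
move=> y _; rewrite /osc2 /=.
rewrite indicE; have [yr|_] := boolP (y \in cube (2 * r)); last first.
  by under eq_integral do rewrite mul0r; rewrite integral0 mul0e.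
under eq_integral do rewrite mul1r.
apply: (le_trans (int_shift_diff r (dF y) (cDF y) cF)).
rewrite mul1e -EFin_Rint; last by apply: ig_cube_cont; apply: cont_norm; exact: cDF.
rewrite lee_fin -RintZ; last exact: ig_cube_cont.
rewrite inE /cube /= in yr.
apply: Rint_le; [by apply: ig_cube_cont; apply: cont_norm; exact: cDF|exact/igZ/ig_cube_cont|move=> x].
rewrite !indicE; have [xr|_] := boolP (x \in cube (r + `|y|)); last by rewrite mul0r mulr_ge0// mulr_ge0.
rewrite (_ : x \in cube (3 * r)); last first.
  have xr' : `|x| <= r + `|y| by rewrite inE in xr.
  rewrite inE /cube /=; apply: (le_trans xr').
  have -> : 3 * r = r + 2 * r by ring.
  by rewrite lerD2l.
by rewrite !mul1r; apply: (le_trans (hH y x)); rewrite ler_wpM2r.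
Qed.

End poincare.

End Poincare.
Import Poincare.

(** * The pressure, its inverse, and the weak gradients it determines *)

Module ChainRule.

Lemma measurable_invge0 dd (T : measurableType dd) (R : realType) (f : T -> R) :
  measurable_fun setT f -> (forall x, 0 <= f x) -> measurable_fun setT (fun x => (f x)^-1).
Proof.
move=> mf f0; rewrite (_ : (fun x => _) = (fun x => f x `^ (-1))).
  exact: (measurableT_comp (measurable_powR (-1)) mf).
by apply/funext => x; rewrite powR_inv1.
Qed.

Section pressure.
Context {R : realType}.
Variables (lam eta m : R).
Hypotheses (lam_gt0 : 0 < lam) (eta_gt0 : 0 < eta) (m_gt1 : 1 < m).
Local Notation LF := (LF lam eta m).

(** Power of the positive part: for p > 0 it is continuous and monotone on the whole line, so that
    no sign conditions have to be carried along. *)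
Definition pw (p s : R) : R := (Num.max s 0) `^ p.

Lemma pwE p s : 0 <= s -> pw p s = s `^ p.
Proof. by move=> s0; rewrite /pw max_l. Qed.

Lemma pw_ge0 p s : 0 <= pw p s. Proof. exact: powR_ge0. Qed.

Lemma pw_le p s t : 0 <= p -> s <= t -> pw p s <= pw p t.
Proof.
move=> p0 st; rewrite /pw ge0_ler_powR ?nnegrE ?le_max ?lexx ?orbT//.
by rewrite -!le_max ge_max !le_max st lexx !orbT.
Qed.

Lemma pw_continuous p : 0 < p -> continuous (pw p).
Proof.
move=> p0 s; have [s0|s0|->] := ltgtP s 0.
- apply: (@near_cst_continuous _ _ 0); near=> t.
  rewrite /pw max_r; first by rewrite powR0// gt_eqF.
  by apply: ltW; near: t; exact: lt_nbhsl.
- have c : x `^ p @[x --> s] --> pw p s.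
    rewrite /pw max_l ?(ltW s0)//.
    have [dp _] := is_derive1_powR p s0; move/derivable1_diffP : dp.
    exact: differentiable_continuous.
  apply: cvg_trans c; apply: near_eq_cvg; near=> t; rewrite pwE//.
  by apply: ltW; near: t; exact: lt_nbhsr.
- apply/cvgrPdist_le => e e0; near=> t.
  rewrite {1}/pw maxxx powR0 ?gt_eqF// sub0r normrN ger0_norm ?pw_ge0//.
  have -> : e = pw p (e `^ p^-1).
    by rewrite pwE ?powR_ge0// -powRrM mulVf ?gt_eqF// powRr1// ltW.
  apply: pw_le; first exact: ltW.
  by apply: ltW; near: t; apply: lt_nbhsl; rewrite powR_gt0.
Unshelve. all: by end_near. Qed.

Let m0 : 0 < m. Proof. exact: lt_trans m_gt1. Qed.
Let m1 : 0 < m - 1. Proof. by rewrite subr_gt0. Qed.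

(** The power term only adds to the linear one, so [LF] has slope at least lam and its inverse is
    Lipschitz with constant 1 / lam. *)
Lemma LF_incr s t : 0 <= s -> s <= t -> lam * (t - s) <= LF t - LF s.
Proof.
move=> s0 st; rewrite /Defs.LF opprD addrACA -mulrBr lerDl -mulrBr mulr_ge0 ?(ltW eta_gt0)//.
by rewrite subr_ge0 ge0_ler_powR ?nnegrE// ?(ltW m0)// (le_trans s0).
Qed.

Lemma LF0 : LF 0 = 0.
Proof. by rewrite /Defs.LF mulr0 powR0 ?gt_eqF// mulr0 addr0. Qed.

Lemma LF_ge0 s : 0 <= s -> 0 <= LF s.
Proof. by move=> s0; rewrite addr_ge0// mulr_ge0 ?powR_ge0// ltW. Qed.

Lemma LF_inj s t : 0 <= s -> 0 <= t -> LF s = LF t -> s = t.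
Proof.
wlog st : s t / s <= t.
  by move=> h s0 t0 E; have [/h->//|/ltW/h h2] := leP s t; apply/esym/h2.
move=> s0 _ E; have := LF_incr s0 st; rewrite E subrr pmulr_rle0// subr_le0 => ts.
by apply/eqP; rewrite eq_le st.
Qed.

Lemma LF_pw s : 0 <= s -> LF s = lam * s + eta * pw m s.
Proof. by move=> s0; rewrite /Defs.LF pwE. Qed.

Lemma LFpw_continuous : continuous (fun s => lam * s + eta * pw m s).
Proof.
apply: (@contD R R^o); apply: (@contM R R^o).
- exact: (@cont_cst R R^o).
- by move=> x; exact: cvg_id.
- exact: (@cont_cst R R^o).
- exact: pw_continuous.
Qed.

Definition LFinv w : R := xget 0 [set s | 0 <= s /\ LF s = w].

Lemma LFinvP w : 0 <= w -> 0 <= LFinv w /\ LF (LFinv w) = w.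
Proof.
move=> w0; apply: (@xgetPex _ 0 [set s | 0 <= s /\ LF s = w]).
have wl : 0 <= w / lam by rewrite divr_ge0// ltW.
(* At w / lam the linear part of [LF] alone already reaches w. *)
have [] := @IVT R (fun s => lam * s + eta * pw m s) 0 (w / lam) w wl.
- exact/continuous_subspaceT/LFpw_continuous.
- rewrite mulr0 add0r /pw maxxx powR0 ?gt_eqF// mulr0 mulrC divfK ?gt_eqF//.
  by rewrite ge_min w0/= le_max lerDl mulr_ge0 ?pw_ge0 ?orbT// ltW.
move=> c; rewrite in_itv/= => /andP[c0 _] h; exists c; split => //.
by rewrite LF_pw.
Qed.

Lemma LFinvK s : 0 <= s -> LFinv (LF s) = s.
Proof.
by move=> s0; have [? ?] := LFinvP (LF_ge0 s0); apply: LF_inj.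
Qed.

Lemma LFinv_lip s t : 0 <= s -> 0 <= t -> `|LFinv s - LFinv t| <= lam^-1 * `|s - t|.
Proof.
wlog st : s t / s <= t.
  move=> h s0 t0; have [/h h2|/ltW/h h2] := leP s t; first exact: h2.
  by rewrite distrC [X in _ * X]distrC; exact: h2.
move=> s0 t0; have [a0 aE] := LFinvP s0; have [b0 bE] := LFinvP t0.
have ab : LFinv s <= LFinv t.
  rewrite leNgt; apply/negP => ba; have := LF_incr b0 (ltW ba).
  rewrite aE bE => h; have : 0 < lam * (LFinv s - LFinv t) by rewrite mulr_gt0// subr_gt0.
  by rewrite ltNge (le_trans h)// subr_le0.
rewrite distrC ger0_norm ?subr_ge0// distrC ger0_norm ?subr_ge0//.
by rewrite mulrC ler_pdivlMr// mulrC -[X in _ <= X - _]bE -[X in _ <= _ - X]aE; exact: LF_incr.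
Qed.

(** Derivative of [LF] on ]0, oo[, continued by the constant lam to s <= 0. *)
Definition DLF s : R := lam + eta * (m * pw (m - 1) s).

Lemma DLF_gt0 s : 0 < DLF s.
Proof. by rewrite ltr_pwDl// mulr_ge0 ?(ltW eta_gt0)// mulr_ge0 ?pw_ge0// ltW. Qed.

Lemma DLF_ge s : lam <= DLF s.
Proof. by rewrite lerDl mulr_ge0 ?(ltW eta_gt0)// mulr_ge0 ?pw_ge0// ltW. Qed.

Lemma DLF_continuous : continuous DLF.
Proof.
apply: (@contD R R^o); first exact: (@cont_cst R R^o).
apply: (@contM R R^o); first exact: (@cont_cst R R^o).
by apply: (@contM R R^o); [exact: (@cont_cst R R^o)|exact: pw_continuous].
Qed.

Lemma is_derive_LF (s : R) : 0 < s -> is_derive s 1 LF (DLF s).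
Proof.
move=> s0; have h := is_derive1_powR m s0.
have h1 : is_derive s 1 (fun x : R => lam * x) (lam * 1).
  by apply: (@is_derive_eq _ _ _ _ _ _ _ _ (is_deriveM (is_derive_cst lam s 1) (is_derive_id s 1)));
   rewrite /GRing.scale/= mulr0 addr0.
have h2 : is_derive s 1 (fun x : R => eta * x `^ m) (eta * (m * s `^ (m - 1))).
  by apply: (@is_derive_eq _ _ _ _ _ _ _ _ (is_deriveM (is_derive_cst eta s 1) h));
   rewrite /GRing.scale/= mulr0 addr0.
by apply: is_derive_eq (is_deriveD h1 h2) _; rewrite mulr1 /DLF pwE// ltW.
Qed.

Lemma is_derive_LFinv (w : R) : 0 < w -> is_derive w 1 LFinv (DLF (LFinv w))^-1.
Proof.
move=> w0; have [s0 sE] := LFinvP (ltW w0).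
have {}s0 : 0 < LFinv w.
  by rewrite lt_neqAle s0 andbT; apply: contraTneq w0 => h; rewrite -sE -h LF0 ltxx.
rewrite -{1}sE; apply: (@is_derive_inverse R LF LFinv).
- by near=> x; apply: LFinvK; apply: ltW; near: x; exact: lt_nbhsr.
- near=> x; apply: differentiable_continuous; apply/derivable1_diffP.
  have x0 : 0 < x by near: x; exact: lt_nbhsr.
  by have [] := is_derive_LF x0.
- exact: is_derive_LF.
- by rewrite gt_eqF// DLF_gt0.
Unshelve. all: by end_near. Qed.

Section density.
Variable d : nat.
Local Notation V := 'rV[R]_d.
Local Notation mu := (@leb R d).
Local Notation e i := (delta_mx ord0 i : V).
Variables (u : V -> R) (G : V -> V).
Hypotheses (mu_ : measurable_fun setT u) (u0 : forall y, 0 <= u y)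
  (lw : lint (fun y => LF (u y))) (wG : is_weak_grad (fun y => LF (u y)) G).

Let w0 y : 0 <= LF (u y). Proof. exact: LF_ge0. Qed.

Let lG i : lint (fun y => G y ord0 i). Proof. exact: (weak_grad_lint i wG). Qed.

Let wGi i : conv_grad (fun y => LF (u y)) i (fun y => G y ord0 i).
Proof. exact: weak_grad_conv. Qed.

Lemma measurable_DLF : measurable_fun setT (fun y => (DLF (u y))^-1).
Proof.
apply: (@measurableT_comp _ _ _ _ _ _ (fun s : R => (DLF s)^-1)) => //.
apply: continuous_measurable_fun => s; apply: cvgV; first by rewrite gt_eqF// DLF_gt0.
exact: DLF_continuous.
Qed.

Lemma LFinv_seq (s : nat -> R) (l : R) : (forall n, 0 < s n) -> 0 <= l ->
  s n @[n --> \oo] --> l -> LFinv (s n) @[n --> \oo] --> LFinv l.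
Proof.
move=> s0 l0 sl; apply/cvgrPdist_le => r r0.
move/cvgrPdist_le : sl => /(_ (r * lam)) []; first by rewrite mulr_gt0.
move=> N _ hN; exists N => // n /hN /= h; apply: le_trans (LFinv_lip l0 (ltW (s0 n))) _.
by rewrite mulrC ler_pdivrMr.
Qed.

Lemma lint_u : lint u.
Proof.
apply: (@lint_le _ _ _ (fun y => lam^-1 * LF (u y))) => //; last exact: lintZ.
move=> y; rewrite ger0_norm// mulrC ler_pdivlMr// mulrC /Defs.LF lerDl.
by rewrite mulr_ge0 ?powR_ge0// ltW.
Qed.

(** Weak differentiability is known for [LF u] only; u is recovered as [LFinv (LF u)], to which the
    chain rule applies because [LFinv] is Lipschitz. *)
Lemma weak_grad_u : is_weak_grad u (fun y => (DLF (u y))^-1 *: G y).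
Proof.
move=> i; split.
  apply/loc_integrableP; apply: (@lint_le _ _ _ (fun y => lam^-1 * `|G y ord0 i|)).
  - under eq_fun do rewrite mxE; apply: measurable_funM; last exact: (lG i).1.
    exact: measurable_DLF.
  - move=> y; rewrite mxE normrM ler_wpM2r// ger0_norm ?invr_ge0 ?(ltW (DLF_gt0 _))//.
    by rewrite lef_pV2 ?posrE ?DLF_gt0// DLF_ge.
  - by apply: lintZ; exact: lint_norm.
move=> phi tp.
have := @weak_chain_rule R d (fun y => LF (u y)) (fun y => G y ord0 i) i LFinv
  (fun w => (DLF (LFinv w))^-1) lam^-1 lw (lG i) w0 (wGi i) is_derive_LFinv LFinv_lip _ _ _ _ phi tp.
move=> h; transitivity (\int[mu]_y (LFinv (LF (u y)) * 'D_(e i) phi y))%R.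
  by apply: eq_Rintegral => y _; rewrite LFinvK// /grad mxE.
rewrite h.
- by congr (- _); apply: eq_Rintegral => y _; rewrite LFinvK// mxE.
- move=> s s0; rewrite ger0_norm ?invr_ge0 ?(ltW (DLF_gt0 _))//.
  by rewrite lef_pV2 ?posrE ?DLF_gt0// DLF_ge.
- move=> s l s0 l0 sl; apply: cvgV; first by rewrite gt_eqF// DLF_gt0.
  apply: continuous_cvg; first exact: DLF_continuous.
  exact: LFinv_seq.
- by rewrite (_ : _ \o _ = u)//; apply/funext => y /=; exact: LFinvK.
- rewrite (_ : _ \o _ = (fun y => (DLF (u y))^-1)); first exact: measurable_DLF.
  by apply/funext => y /=; rewrite LFinvK.
Qed.

(** Linear combination of the two gradients already known, because u^m = (LF u - lam u) / eta. *)
Lemma weak_grad_um : is_weak_grad (fun y => u y `^ m)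
  (fun y => eta^-1 *: (G y - lam *: ((DLF (u y))^-1 *: G y))).
Proof.
move=> i; have [lu hu] := weak_grad_u i; have [_ hw] := wG i.
have lu' : lint (fun y => ((DLF (u y))^-1 *: G y) ord0 i) by apply/loc_integrableP.
have E y : (eta^-1 *: (G y - lam *: ((DLF (u y))^-1 *: G y))) ord0 i =
  eta^-1 * (G y ord0 i + - lam * ((DLF (u y))^-1 *: G y) ord0 i) by rewrite !mxE mulNr.
split.
  apply/loc_integrableP; under eq_fun do rewrite E.
  by apply: lintZ; apply: lintD => //; exact: lintZ.
move=> phi tp; have [r hr] := test_funP tp; have [sp _ _] := tp.
have cD : continuous (fun y => grad phi y ord0 i).
  have := smooth_derive (e i) sp 0.
  by rewrite (_ : 'D_(e i) phi = (fun y => grad phi y ord0 i))//; apply/funext => y; rewrite mxE.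
have hD : exists r, forall y, r < `|y| -> grad phi y ord0 i = 0.
  by exists r => y yr; rewrite mxE; exact: (derive_supp _ hr).
have i1 := lint_test lw cD hD; have i2 := lint_test lint_u cD hD.
have i3 := lint_test (lG i) (sp 0) (ex_intro _ r hr).
have i4 := lint_test lu' (sp 0) (ex_intro _ r hr).
transitivity (eta^-1 * (\int[mu]_y (LF (u y) * grad phi y ord0 i) - lam * \int[mu]_y (u y * grad phi y ord0 i)))%R.
  rewrite -RintZ; last by under eq_fun do rewrite mulrC.
  rewrite -RintB; last 2 first.
  - by under eq_fun do rewrite mulrC.
  - by apply: igZ; under eq_fun do rewrite mulrC.
  rewrite -RintZ; last first.
    by apply: igB; [|apply: igZ]; under eq_fun do rewrite mulrC.
  apply: eq_Rintegral => y _; rewrite /Defs.LF; field; rewrite ?gt_eqF//.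
rewrite hw// hu//.
under [in RHS]eq_Rintegral do rewrite E -mulrA mulrDl -mulrA.
rewrite RintZ ?RintD ?RintZ//.
- by ring.
- by under eq_fun do rewrite mulrC.
- by under eq_fun do rewrite mulrC.
- by apply: igZ; under eq_fun do rewrite mulrC.
- apply: igD; first by under eq_fun do rewrite mulrC.
  by apply: igZ; under eq_fun do rewrite mulrC.
Qed.

(** On s >= 0, [fd dl s] tends to s as dl -> 0, while its derivative [fd' dl s] tends to the
    indicator of s > 0. *)
Let fd (dl s : R) := s ^+ 2 / (s + dl).
Let fd' (dl s : R) := 1 - dl ^+ 2 / (s + dl) ^+ 2.

Let fd'_bound dl s : 0 < dl -> 0 <= s -> 0 <= fd' dl s <= 1.
Proof.
move=> d0 s0; have sd : 0 < (s + dl) ^+ 2 by rewrite exprn_gt0// ltr_wpDl.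
have h : 0 <= dl ^+ 2 / (s + dl) ^+ 2 by rewrite divr_ge0 ?exprn_ge0 ?addr_ge0 ?(ltW d0).
have h2 : dl ^+ 2 / (s + dl) ^+ 2 <= 1.
  by rewrite ler_pdivrMr// mul1r lerXn2r ?nnegrE ?addr_ge0 ?(ltW d0)// lerDr.
by rewrite /fd'; apply/andP; split; lra.
Qed.

Let fd_derive dl (s : R) : 0 < dl -> 0 < s -> is_derive s 1 (fd dl) (fd' dl s).
Proof.
move=> d0 s0; have sd : s + dl != 0 by rewrite gt_eqF// addr_gt0.
have hd : is_derive s 1 (fun x : R => x + dl) (1 + 0).
  exact: (is_deriveD (is_derive_id s 1) (is_derive_cst dl s 1)).
have hX : is_derive s 1 (fun x : R => x ^+ 2) (s * 1 + s * 1).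
  have -> : (fun x : R => x ^+ 2) = id * id by apply/funext => x; rewrite expr2.
  exact: (is_deriveM (is_derive_id s 1) (is_derive_id s 1)).
have hV := @is_deriveV R (fun x => x + dl) s _ _ sd hd.
apply: (@is_derive_eq _ _ _ _ _ _ _ _ (is_deriveM hX hV)).
by rewrite /GRing.scale/= /fd'; field.
Qed.

Let fd_lip dl s t : 0 < dl -> 0 <= s -> 0 <= t -> `|fd dl s - fd dl t| <= 1 * `|s - t|.
Proof.
move=> d0 s0 t0; have sd : 0 < s + dl by rewrite ltr_wpDl.
have td : 0 < t + dl by rewrite ltr_wpDl.
have -> : fd dl s - fd dl t = (1 - dl ^+ 2 / ((s + dl) * (t + dl))) * (s - t).
  by rewrite /fd; field; rewrite !gt_eqF.
rewrite normrM ler_wpM2r// ger0_norm.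
  by rewrite lerBlDr lerDl divr_ge0 ?exprn_ge0 ?mulr_ge0 ?ltW.
rewrite subr_ge0 ler_pdivrMr ?mulr_gt0// mul1r expr2.
by rewrite ler_pM ?(ltW d0)// lerDr.
Qed.

(** The limit dl -> 0 in the chain rule for [fd dl] produces a second weak gradient of [LF u], cut
    off to the set where u > 0; uniqueness then forces G = 0 almost everywhere on u = 0. *)
Lemma weak_grad_trunc : is_weak_grad (fun y => LF (u y)) (fun y => (0 < u y)%R%:R *: G y).
Proof.
move=> i; have mpos : measurable_fun setT (fun y => (0 < u y)%R%:R : R).
  have : measurable_fun setT (fun y => 0 < u y) by apply: measurable_fun_ltr.
  move=> h; apply: (@measurableT_comp _ _ _ _ _ _ (fun b : bool => b%:R : R)) h => //.
have lp : lint (fun y => ((0 < u y)%R%:R *: G y) ord0 i).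
  under eq_fun do rewrite mxE; apply: (@lint_le _ _ _ (fun y => `|G y ord0 i|)).
  - by apply: measurable_funM => //; exact: (lG i).1.
  - by move=> y; rewrite normrM; case: (0 < u y); rewrite ?normr1 ?mul1r// normr0 mul0r.
  - exact: lint_norm.
split; first exact/loc_integrableP.
move=> phi tp; have [r hr] := test_funP tp; have [sp _ _] := tp.
pose dl n : R := n.+1%:R^-1.
have dl0 n : 0 < dl n by rewrite invr_gt0.
have cdl : dl n @[n --> \oo] --> (0 : R) by exact: cvg_harmonic.
have mfd n : measurable_fun setT (fd (dl n) \o (fun y => LF (u y))).
  apply: measurable_funM; first by apply: measurable_funX; exact: lw.1.
  apply: measurable_invge0; last by move=> y; rewrite addr_ge0 ?(ltW (dl0 n)).
  by apply: measurable_funD => //; exact: lw.1.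
have mfd' n : measurable_fun setT (fd' (dl n) \o (fun y => LF (u y))).
  apply: measurable_funB => //; apply: measurable_funM => //.
  apply: measurable_invge0; last by move=> y; rewrite exprn_ge0// addr_ge0 ?(ltW (dl0 n)).
  by apply: measurable_funX; apply: measurable_funD => //; exact: lw.1.
have E n := @weak_chain_rule R d (fun y => LF (u y)) (fun y => G y ord0 i) i (fd (dl n))
  (fd' (dl n)) 1 lw (lG i) w0 (wGi i) (fun s => @fd_derive (dl n) s (dl0 n))
  (fun s t => @fd_lip (dl n) s t (dl0 n)) _ _ (mfd n) (mfd' n) phi tp.
have {}E n : (\int[mu]_y (fd (dl n) (LF (u y)) * 'D_(e i) phi y) =
  - \int[mu]_y (fd' (dl n) (LF (u y)) * G y ord0 i * phi y))%R.
  apply: E.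
    by move=> k s s0; have /andP[? ?] := fd'_bound (dl0 k) s0; rewrite ger0_norm.
  move=> k s l s0 l0 sl; apply: cvgB; first exact: cvg_cst.
  apply: cvgMl_tmp; apply: cvgV; first by rewrite gt_eqF// exprn_gt0// ltr_wpDl.
  rewrite expr2; under eq_fun do rewrite expr2.
  by apply: cvgM; apply: cvgD => //; exact: cvg_cst.
have cD : continuous ('D_(e i) phi) := smooth_derive (e i) sp 0.
have hD := derive_supp (e i) hr.
have i1 := lint_test lw cD (ex_intro _ r hD).
have i3 := lint_test (lG i) (sp 0) (ex_intro _ r hr).
have mphi := continuous_measurable_rV (sp 0 : continuous phi).
have mDphi := continuous_measurable_rV cD.
have [||||_ c1 _] := @Rdct _ _ _ mu (fun n y => fd (dl n) (LF (u y)) * 'D_(e i) phi y)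
  (fun y => LF (u y) * 'D_(e i) phi y) (fun y => `|'D_(e i) phi y * LF (u y)|) _ _ _ (ig_norm i1).
- by move=> n; apply: measurable_funM => //; exact: mfd.
- by apply: measurable_funM => //; exact: lw.1.
- apply: aeW => y; apply: cvgMr_tmp.
  have [->|uy] := eqVneq (u y) 0.
    by rewrite LF0 /fd; under eq_fun do rewrite expr0n/= mul0r; exact: cvg_cst.
  have wy : LF (u y) != 0 by apply: contra uy => /eqP h; rewrite (@LF_inj (u y) 0) ?LF0.
  have E2 : LF (u y) = LF (u y) ^+ 2 / (LF (u y) + 0) by rewrite addr0 expr2 mulfK.
  rewrite [X in _ --> X]E2; apply: cvgMl_tmp; apply: cvgV; first by rewrite addr0.
  by apply: cvgD; [exact: cvg_cst|exact: cdl].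
- move=> n y; rewrite normrM [leRHS]normrM mulrC ler_wpM2l// [leRHS](ger0_norm (w0 y)) ger0_norm; last first.
    by apply: divr_ge0; [apply: exprn_ge0; exact: w0|apply: addr_ge0; [exact: w0|exact: ltW]].
  rewrite /fd ler_pdivrMr ?ltr_wpDl// expr2 ler_wpM2l// lerDl; exact: ltW.
have [||||_ c2 _] := @Rdct _ _ _ mu (fun n y => fd' (dl n) (LF (u y)) * G y ord0 i * phi y)
  (fun y => (0 < u y)%R%:R * G y ord0 i * phi y) (fun y => `|phi y * G y ord0 i|) _ _ _ (ig_norm i3).
- move=> n; apply: measurable_funM => //; apply: measurable_funM; last exact: (lG i).1.
  exact: mfd'.
- by apply: measurable_funM => //; apply: measurable_funM => //; exact: (lG i).1.
- apply: aeW => y; apply: cvgMr_tmp; apply: cvgMr_tmp.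
  have [uy|uy|uy] := ltgtP (u y) 0; first by move: (u0 y); rewrite leNgt uy.
    have wy : 0 < LF (u y).
      by rewrite lt_neqAle w0 andbT; apply: contraTneq uy => /esym h; rewrite (@LF_inj (u y) 0) ?LF0 ?ltxx.
    rewrite -[X in _ --> X](subr0 1); apply: cvgB; first exact: cvg_cst.
    rewrite -(mul0r ((LF (u y) + 0) ^+ 2)^-1); apply: cvgM.
      by rewrite -(mulr0 0); under eq_fun do rewrite expr2; apply: cvgM.
    apply: cvgV; first by rewrite addr0 expf_neq0// gt_eqF.
    rewrite expr2; under eq_fun do rewrite expr2.
    by apply: cvgM; (apply: cvgD; [exact: cvg_cst|exact: cdl]).
  rewrite uy LF0 /fd'; under eq_fun do rewrite add0r divff ?expf_neq0 ?gt_eqF// subrr.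
  exact: cvg_cst.
- move=> n y; rewrite !normrM mulrC ler_wpM2l//.
  by have /andP[h1 h2] := fd'_bound (dl0 n) (w0 y); rewrite ger0_norm// ler_piMl.
transitivity (\int[mu]_y (LF (u y) * 'D_(e i) phi y))%R.
  by apply: eq_Rintegral => y _; rewrite mxE.
move: c1; under eq_fun do rewrite E.
move=> c1.
have := cvgN c2 => {}c2.
rewrite (cvg_unique _ c1 (c2 _))//.
by congr (- _); apply: eq_Rintegral => y _; rewrite mxE.
Qed.

Lemma weak_grad_zero : {ae mu, forall y, u y = 0 -> G y = 0}.
Proof.
have h i := weak_grad_unique i lw wG weak_grad_trunc.
have : {ae mu, forall y, forall i, G y ord0 i = ((0 < u y)%R%:R *: G y) ord0 i}.
  (* The finitely many coordinates are indexed by nat through [insub], to use the stability of null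
     sets under countable unions. *)
  have := @ae_foralln _ _ _ mu (fun n y => if insub n is Some i then G y ord0 i = ((0 < u y)%R%:R *: G y) ord0 i else True).
  have H n : {ae mu, forall y, if insub n is Some i then G y ord0 i = ((0 < u y)%R%:R *: G y) ord0 i else True}.
    by case: insubP => [i _ _|_]; [exact: h|exact: aeW].
  move=> /(_ H); apply: filterS => y hy i.
  by have := hy (val i); rewrite valK.
apply: filterS => y hy uy; apply/rowP => i; rewrite hy mxE uy ltxx mul0r !mxE//.
Qed.

End density.

Lemma wgradP d (u : 'rV[R]_d -> R) G : is_weak_grad u G -> is_weak_grad u (wgrad u).
Proof. by move=> h; apply: (@xgetPex _ (fun=> 0) [set G | is_weak_grad u G]); exists G. Qed.

Lemma ae_coord d (u v : 'rV[R]_d -> 'rV[R]_d) :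
  (forall i, {ae leb d, forall y, u y ord0 i = v y ord0 i}) ->
  {ae leb d, forall y, u y = v y}.
Proof.
move=> h.
have H n : {ae leb d, forall y, if insub n is Some i then u y ord0 i = v y ord0 i else True}.
  by case: insubP => [i _ _|_]; [exact: h|exact: aeW].
have := ae_foralln H; apply: filterS => y hy; apply/rowP => i.
by have := hy (val i); rewrite valK.
Qed.

(** The weak gradients chosen inside [velocity] agree almost everywhere with those computed from G,
    and weighted by lam / u and eta / u they add up to G / u. So u times the velocity is minus the
    flux. *)
Lemma velocityE d (Psi : 'rV[R]_d -> R) (rho : R -> density R d) t :
  W11loc (fun y => LF (rho t y)) ->
  let G := wgrad (fun y => LF (rho t y)) in
  [/\ is_weak_grad (fun y => LF (rho t y)) G, lint (fun y => LF (rho t y)),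
     is_weak_grad (rho t) (fun y => (DLF (rho t y))^-1 *: G y) &
     {ae leb d, forall y, (rho t y = 0 -> G y = 0) /\ (0 < rho t y ->
       velocity lam eta m Psi rho t y = - (grad Psi y + (rho t y)^-1 *: G y))}].
Proof.
move=> [/loc_integrableP lw [G0 wG0]] G; have wG : is_weak_grad _ G := wgradP wG0.
have mr := density_measurable (rho t); have r0 := @density_ge0 _ _ (rho t).
have w1 := weak_grad_u mr r0 lw wG; have w2 := weak_grad_um mr r0 lw wG.
have lu := lint_u mr r0 lw.
have lum : lint (fun y => rho t y `^ m).
  apply: (@lint_le _ _ _ (fun y => eta^-1 * LF (rho t y))); last exact: lintZ.
    exact: (measurableT_comp (measurable_powR m) mr).
  move=> y; rewrite ger0_norm ?powR_ge0// mulrC ler_pdivlMr// mulrC /Defs.LF lerDr.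
  by rewrite mulr_ge0// ltW.
have a1 := ae_coord (fun i => weak_grad_unique i lu (wgradP w1) w1).
have a2 := ae_coord (fun i => weak_grad_unique i lum (wgradP w2) w2).
split => //; have a3 := weak_grad_zero mr r0 lw wG.
near=> y; split; first by near: y.
move=> ry; rewrite /velocity.
have -> : wgrad (rho t) y = (DLF (rho t y))^-1 *: G y by near: y.
have -> : wgrad (fun z => rho t z `^ m) y = eta^-1 *: (G y - lam *: ((DLF (rho t y))^-1 *: G y)) by near: y.
apply/rowP => i; rewrite !mxE; field.
by rewrite !gt_eqF// DLF_gt0.
Unshelve. all: by end_near. Qed.

End pressure.

End ChainRule.
Import ChainRule.

(** * Limit theorems, integrals against densities, joint measurability *)

Module DominatedLimits.

Section general_dct.
Context d (T : measurableType d) (R : realType).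
Variable mu : {measure set T -> \bar R}.
Local Notation ig f := (mu.-integrable setT (EFin \o f)).

(** Dominated convergence with majorants [a n] that move but converge in L^1, with error [b n].
    Pointwise convergence is asked only along subsequences on which [b] tends to 0, which is what
    mollified quantities satisfy. *)
Lemma Rint_domdct (F a b : nat -> T -> R) (f aL : T -> R) :
  (forall n, measurable_fun setT (F n)) -> measurable_fun setT f ->
  (forall n x, `|F n x| <= a n x) -> (forall n, ig (a n)) -> ig aL ->
  (forall n, ig (b n)) -> (forall n x, `|a n x - aL x| <= b n x) ->
  (\int[mu]_x b n x @[n --> \oo] --> (0 : R))%R ->
  {ae mu, forall x, forall s : nat -> nat, (forall n, (n <= s n)%N) ->
     b (s n) x @[n --> \oo] --> (0 : R) -> F (s n) x @[n --> \oo] --> f x} ->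
  [/\ ig f, (\int[mu]_x `|F n x - f x| @[n --> \oo] --> (0 : R))%R &
     (\int[mu]_x F n x @[n --> \oo] --> \int[mu]_x f x)%R].
Proof.
move=> mF mf Fa iga igaL igb ab b0 h.
have b_ge0 n x : 0 <= b n x by apply: le_trans (ab n x).
have a_ge0 n x : 0 <= a n x by apply: le_trans (Fa n x).
have igF n : ig (F n) by apply: ig_le (iga n).
pose g x := `|aL x|; have igg : ig g by exact: ig_norm.
have gb n x : `|a n x - g x| <= b n x.
  by apply: le_trans (ab n x); rewrite -{1}(ger0_norm (a_ge0 n x)) ler_dist_dist.
have Ia n : (\int[mu]_x a n x <= \int[mu]_x g x + \int[mu]_x b n x)%R.
  rewrite -(RintD igg (igb n)); apply: Rint_le => //; first exact: igD.
  by move=> x; rewrite -lerBlDl; apply: le_trans (gb n x); exact: ler_norm.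
have bev e : 0 < e -> exists N, forall n, (N <= n)%N -> (\int[mu]_x b n x <= e)%R.
  move=> e0; have /cvgr0Pnorm_le /(_ e e0)[N _ hN] := b0.
  by exists N => n /hN; rewrite ger0_norm// Rint_ge0.
have acv x (s : nat -> nat) : b (s n) x @[n --> \oo] --> (0 : R) -> a (s n) x @[n --> \oo] --> g x.
  move=> /cvgr0Pnorm_le hb; apply/cvgrPdist_le => e e0; have := hb e e0.
  by apply: filterS => n; rewrite ger0_norm// distrC; exact: le_trans.
have igf : ig f.
  apply: igP => //.
  have := @fatou_subseq _ _ _ mu (fun n x => `|F n x|) (fun x => `|f x|) b.
  move=> /(_ _ _ igb b_ge0 b0) H; apply: le_lt_trans (H _ _ _ _ _) _ => //.
  - by move=> n; exact: measurableT_comp.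
  - exact: measurableT_comp.
  - by apply: filterS h => x hx; right => s sn bs; apply: cvg_norm; exact: hx.
  apply: (@le_lt_trans _ _ (\int[mu]_x g x + 1)%R%:E); last by rewrite ltry.
  apply: einf_le => N; have [N1 hN1] := bev 1 ltr01.
  exists (maxn N N1); first exact: leq_maxl.
  rewrite -EFin_Rint ?lee_fin; last exact: ig_norm.
  apply: le_trans (_ : _ <= \int[mu]_x a (maxn N N1) x)%R _.
    by apply: Rint_le => //; exact: ig_norm.
  by apply: le_trans (Ia _) _; rewrite lerD2l hN1// leq_maxr.
have D0 : (\int[mu]_x `|F n x - f x| @[n --> \oo] --> (0 : R))%R.
  apply/cvgr0Pnorm_le => e e0; apply: contrapT => nh.
  have fr N : exists2 n, (N <= n)%N & (e < \int[mu]_x `|F n x - f x|)%R.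
    apply: contrapT => hN; apply: nh; exists N => // n /= Nn.
    rewrite ger0_norm ?Rint_ge0//; apply: contrapT => /negP; rewrite -ltNge => en.
    by apply: hN; exists n.
  have igd n : ig (fun x => `|F n x - f x|) by apply: ig_norm; exact: igB.
  (* Nonnegative, with limit g + |f| wherever [b] tends to 0. An error above e infinitely often
     would push the liminf of its integrals below what Fatou allows. *)
  pose hh n x := a n x + `|f x| - `|F n x - f x|.
  have igh n : ig (hh n) by apply: igB => //; apply: igD => //; exact: ig_norm.
  have igL : ig (fun x => g x + `|f x|) by apply: igD => //; exact: ig_norm.
  have := @fatou_subseq _ _ _ mu hh (fun x => g x + `|f x|) b.
  move=> /(_ _ _ igb b_ge0 b0) H.
  have {H} : (\int[mu]_x (g x + `|f x|)%R%:E <= limn_einf (fun n => \int[mu]_x (hh n x)%:E))%E.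
    apply: H.
    - by move=> n; exact: (ig_meas (igh n)).
    - move=> n x; rewrite subr_ge0 (le_trans (ler_normB _ _))// lerD2r; exact: Fa.
    - exact: (ig_meas igL).
    - by move=> x; rewrite addr_ge0// /g.
    - apply: filterS h => x hx; right => s sn bs.
      rewrite -[X in _ --> X]subr0; apply: cvgB.
        by apply: cvgD; [exact: acv|exact: cvg_cst].
      rewrite -(normr0 R) -(subrr (f x)); apply: cvg_norm.
      by apply: cvgB; [exact: hx|exact: cvg_cst].
  rewrite leNgt => /negP; apply.
  apply: (@le_lt_trans _ _ (\int[mu]_x g x + \int[mu]_x `|f x| - e / 2)%R%:E).
    apply: einf_le => N; have [N1 hN1] := bev _ (divr_gt0 e0 (ltr0Sn R 1)).
    have [n nN en] := fr (maxn N N1).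
    exists n; first by apply: leq_trans nN; exact: leq_maxl.
    rewrite -EFin_Rint// lee_fin RintB//; last by apply: igD => //; exact: ig_norm.
    rewrite RintD//; last exact: ig_norm.
    have := Ia n; have := hN1 n (leq_trans (leq_maxr _ _) nN); move: en; clear; lra.
  rewrite -EFin_Rint// lte_fin RintD//; last exact: ig_norm.
  by rewrite gtrBl divr_gt0.
split => //; apply/cvgrPdist_le => e e0; have /cvgr0Pnorm_le /(_ e e0) := D0.
apply: filterS => n; rewrite ger0_norm ?Rint_ge0// distrC -RintB//; apply: le_trans.
by apply: Rint_norm; exact: igB.
Qed.

End general_dct.

Section density_integrals.
Context {R : realType} (d : nat).
Local Notation V := 'rV[R]_d.
Local Notation mu := (@leb R d).
Local Notation ig f := (mu.-integrable setT (EFin \o f)).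
Implicit Types (u : density R d) (f : V -> R).

Lemma ig_density u : ig u.
Proof.
apply: ig_ge0P; [exact: density_measurable|exact: density_ge0|].
by rewrite density_int ltry.
Qed.

Lemma Rint_density u : (\int[mu]_y u y = 1)%R.
Proof. by apply: EFin_inj; rewrite EFin_Rint ?density_int//; exact: ig_density. Qed.

(** The Radon-Nikodym derivative of [dprob u] coincides with [u] almost everywhere, so the change of
    variables formula applies. *)
Lemma dprob_ge0_int u f : measurable_fun setT f -> (forall y, 0 <= f y) ->
  (\int[dprob u]_y (f y)%:E = \int[mu]_y (f y * u y)%:E)%E.
Proof.
move=> mf f0; have dom : dprob u `<< mu.
  apply/null_content_dominatesP => A mA A0; rewrite /= /dmeas null_set_integral//.
  by apply/measurable_funTS/measurable_EFinP; exact: density_measurable.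
rewrite -(@Radon_Nikodym_SigmaFinite.change_of_variables _ _ _ _ mu dom (fun y => (f y)%:E))//; last first.
  exact/measurable_EFinP.
have mr := measurable_int _ (Radon_Nikodym_SigmaFinite.f_integrable dom).
apply: ae_eq_integral => //.
- by apply: emeasurable_funM => //; exact/measurable_EFinP.
- by apply/measurable_EFinP/measurable_funM => //; exact: density_measurable.
have : ae_eq mu setT (Radon_Nikodym_SigmaFinite.f (dprob u) mu) (EFin \o u).
  apply: integral_ae_eq => //; first exact: Radon_Nikodym_SigmaFinite.f_integrable.
    by apply/measurable_EFinP; exact: density_measurable.
  by move=> E _ mE; rewrite -Radon_Nikodym_SigmaFinite.f_integral.
by apply: filterS => y /= h _; rewrite h// EFinM.
Qed.

Lemma dprob_int u f : measurable_fun setT f -> (exists M : R, forall y, `|f y| <= M) ->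
  (\int[dprob u]_y f y = \int[mu]_y (f y * u y))%R.
Proof.
move=> mf [M fM].
have m0 : 0 <= M by apply: le_trans (fM 0).
have igM (g : V -> R) : measurable_fun setT g -> (forall y, `|g y| <= M) -> ig (fun y => g y * u y).
  move=> mg gM; apply: (@ig_le _ _ _ mu _ (fun y => M * u y)).
  - apply: measurable_funM => //; exact: density_measurable.
  - by move=> y; rewrite normrM (ger0_norm (density_ge0 u y)) ler_wpM2r// density_ge0.
  - exact/igZ/ig_density.
have igp (g : V -> R) : measurable_fun setT g -> (forall y, `|g y| <= M) ->
    (dprob u).-integrable setT (EFin \o g).
  move=> mg gM; apply: (@ig_le _ _ _ (dprob u) _ (fun=> M)) => //.
  by apply: finite_measure_integrable_cst; exact: measurableT.
have key (g : V -> R) (mg : measurable_fun setT g) : (forall y, 0 <= g y <= M) ->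
   (\int[dprob u]_y g y = \int[mu]_y (g y * u y))%R.
  move=> gM; apply: EFin_inj.
  have gM' y : `|g y| <= M by have /andP[? ?] := gM y; rewrite ger0_norm.
  rewrite (EFin_Rint (igp _ mg gM')) (EFin_Rint (igM _ mg gM')).
  by apply: dprob_ge0_int => // y; have /andP[] := gM y.
have E y : f y = (Num.max (f y) 0) - (Num.max (- f y) 0).
  have [h|h] := leP 0 (f y).
    have -> : Num.max (- f y) 0 = 0 by apply/max_idPr; rewrite oppr_le0.
    by rewrite subr0.
  have -> : Num.max (- f y) 0 = - f y by apply/max_idPl; rewrite oppr_ge0 ltW.
  by rewrite sub0r opprK.
have mp : measurable_fun setT (fun y => Num.max (f y) 0) by exact: measurable_maxr.
have mn : measurable_fun setT (fun y => Num.max (- f y) 0).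
  by apply: measurable_maxr => //; exact: measurableT_comp.
have bp y : 0 <= Num.max (f y) 0 <= M.
  by have := fM y; rewrite ler_norml => /andP[h1 h2]; rewrite le_max ge_max lexx orbT h2 m0.
have bn y : 0 <= Num.max (- f y) 0 <= M.
  by have := fM y; rewrite ler_norml => /andP[h1 h2]; rewrite le_max ge_max lexx orbT lerNl h1 m0.
have bp' y : `|Num.max (f y) 0| <= M by have /andP[? ?] := bp y; rewrite ger0_norm.
have bn' y : `|Num.max (- f y) 0| <= M by have /andP[? ?] := bn y; rewrite ger0_norm.
transitivity (\int[dprob u]_y (Num.max (f y) 0 - Num.max (- f y) 0))%R.
  by apply: eq_Rintegral => y _; exact: E.
rewrite (RintB (igp _ mp bp') (igp _ mn bn')) !key// -RintB; [|exact: igM|exact: igM].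
by apply: eq_Rintegral => y _; rewrite -mulrBl -E.
Qed.

End density_integrals.

Section caratheodory.
Context {R : realType} (d : nat).
Local Notation V := 'rV[R]_d.

Lemma rat_dense (x : V) (e : R) : 0 < e ->
  exists q : 'rV[rat]_d, `|map_mx ratr q - x| < e.
Proof.
move=> e0; have rq i : exists q : rat, `|ratr q - x ord0 i| < e / 2.
  have [|q] := @rat_in_itvoo R (x ord0 i - e / 2) (x ord0 i + e / 2).
    by rewrite ltrD2l gtrN// divr_gt0.
  by rewrite in_itv/= => qx; exists q; rewrite ltr_distl.
exists (\row_i xchoose (rq i)).
apply: (@le_lt_trans _ _ (e / 2)); last by rewrite gtr_pMr ?invf_lt1 ?ltr1n.
apply: normr_le_coord => [|i]; first by rewrite divr_ge0// ltW.
by rewrite !mxE; apply/ltW; exact: (xchooseP (rq i)).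
Qed.

(* f t x > a iff f t >= a + 1/(k+1) at all rational points of some ball around x. *)
Lemma caratheodory d1 (T : measurableType d1) (f : T -> V -> R) :
  (forall x, measurable_fun setT (f^~ x)) -> (forall t, continuous (f t)) ->
  measurable_fun setT (fun p : T * V => f p.1 p.2).
Proof.
move=> mf cf.
apply: (measurability _ (RGenOInfty.measurableE R)).
move=> _ [_ [a ->] <-]; rewrite setTI.
have mq (z : V) : measurable_fun setT (fun y : V => `|z - y|).
  have mn : measurable_fun setT (fun z : V => `|z|).
    by apply: continuous_measurable_rV; exact: norm_continuous.
  exact: measurableT_comp mn (measurable_subr z).
pose A (k N : nat) (q : 'rV[rat]_d) : set (T * V) :=
  [set p | (N.+1%:R^-1 <= `|map_mx ratr q - p.2|) || (a + k.+1%:R^-1 <= f p.1 (map_mx ratr q))].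
(* The countable intersection over the rational points q is written as the complement of a union. *)
have -> : (fun p : T * V => f p.1 p.2) @^-1` `]a, +oo[ =
    \bigcup_k \bigcup_N ~` \bigcup_q ~` A k N q.
  apply/seteqP; split => [[t x]|[t x]] /=; rewrite in_itv/= andbT.
    move=> ax.
    have [k _ /(_ k (leqnn k)) hk] : \forall k \near \oo, (k.+1%:R^-1 : R) < f t x - a.
      have f0 : 0 < f t x - a by rewrite subr_gt0.
      exact: near_infty_natSinv_lt (PosNum f0).
    rewrite ltrBrDl in hk.
    have /cvgr_ge /(_ (a + k.+1%:R^-1) hk) := cf t x.
    move=> /nbhs_ballP [e /= e0 he].
    have [N _ /(_ N (leqnn N)) hN] := near_infty_natSinv_lt (PosNum e0).
    exists k => //; exists N => // -[q _]; apply; rewrite /A /=.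
    have [//|/= h] := leP _ `|_|; apply: he.
    by rewrite -ball_normE /= distrC; apply: lt_trans h hN.
  move=> [k _ [N _ hq]]; apply: contrapT => /negP; rewrite -leNgt => fa.
  have fk : f t x < a + k.+1%:R^-1 by rewrite (le_lt_trans fa)// ltrDl invr_gt0.
  have /cvgr_lt /(_ _ fk) := cf t x.
  move=> /nbhs_ballP [e /= e0 he].
  have m0 : 0 < Num.min e N.+1%:R^-1 by rewrite lt_min e0 /= invr_gt0 ltr0n.
  have [q] := rat_dense x m0; rewrite lt_min => /andP[qe qN].
  apply: hq; exists q => //; rewrite /A /= => /orP[|]; first by rewrite leNgt qN.
  by rewrite leNgt he// -ball_normE /= distrC.
apply: bigcupT_measurable => k; apply: bigcupT_measurable => N.
apply: measurableC; apply: countable_bigcupT_measurable => // q.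
apply: measurableC.
have mb : measurable_fun setT (fun p : T * V =>
   (N.+1%:R^-1 <= `|map_mx ratr q - p.2|) || (a + k.+1%:R^-1 <= f p.1 (map_mx ratr q))).
  apply: measurable_or; apply: measurable_fun_ler => //.
    apply: (@measurableT_comp _ _ _ _ _ _ (fun y : V => `|map_mx ratr q - y|) _ snd).
      exact: mq.
    exact: measurable_snd.
  exact: (measurableT_comp (mf (map_mx ratr q)) measurable_fst).
have mt : measurable [set true] by [].
by rewrite -[A k N q]setTI; exact: (mb measurableT _ mt).
Qed.

End caratheodory.

Section partition.
Context {R : realType}.
Local Notation leb1 := (@lebesgue_measure R).
Local Notation ig f := (leb1.-integrable setT (EFin \o f)).
Local Notation ind a b := (\1_(`]a, b] : set R) : R -> R).

Lemma indE (a b x : R) : ind a b x = (a < x <= b)%R%:R.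
Proof. by rewrite indicE mem_setE in_itv. Qed.

(* E is controlled on ]a, b] by an integrand N b frozen at the right end point;
   refining the partition of ]s, t] replaces it by its diagonal value. *)
Lemma partition_dct (E : R -> R) (N : R -> R -> R) (I L : R -> R) (s t : R) :
  s < t ->
  (forall a b, s <= a -> a < b -> b <= t ->
     E b - E a <= \int[leb1]_x (ind a b x * N b x)) ->
  (forall b, measurable_fun setT (N b)) -> measurable_fun setT (fun x => ind s t x * I x) ->
  (forall b x, s < x -> x <= b -> b <= t -> `|N b x| <= L x) ->
  ig (fun x => ind s t x * L x) ->
  (forall x (b : nat -> R), s < x -> (forall n, x <= b n <= t) -> b n @[n --> \oo] --> x ->
     N (b n) x @[n --> \oo] --> I x) ->
  ig (fun x => ind s t x * I x) /\ E t - E s <= \int[leb1]_x (ind s t x * I x).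
Proof.
move=> st EN mN mI NL igL cN.
pose h n : R := (t - s) / n.+1%:R.
have h0 n : 0 < h n by rewrite divr_gt0// subr_gt0.
pose p n i : R := s + i%:R * h n.
have pS n i : p n i < p n i.+1 by rewrite ltrD2l ltr_pM2r ?ltr_nat.
have ple n i j : (i <= j)%N -> p n i <= p n j by move=> ij; rewrite lerD2l ler_pM2r ?ler_nat.
have p0 n : p n 0 = s by rewrite /p mul0r addr0.
have pn n : p n n.+1 = t by rewrite /p /h mulrC divfK ?pnatr_eq0// addrC subrK.
pose F n x := \sum_(i < n.+1) ind (p n i) (p n i.+1) x * N (p n i.+1) x.
have Fout n x : ~~ (s < x <= t) -> F n x = 0.
  move=> hx; rewrite /F big1// => i _; rewrite indE.
  case: andP => [[h1 h2]|]; last by rewrite mul0r.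
  exfalso; move/negP: hx; apply; rewrite (le_lt_trans _ h1) -?(p0 n) ?ple//=.
  by rewrite (le_trans h2)// -(pn n) ple.
(* Only the cell containing x contributes to the sum; b is its right end point, at distance at most
   the mesh [h n]. *)
have Fin n x : s < x <= t -> exists b, [/\ x <= b, b <= t, b <= x + h n & F n x = N b x].
  move=> /andP[sx xt].
  have ex : exists i, x <= p n i.+1 by exists n; rewrite pn.
  case: (ex_minnP ex) => i xi imin.
  have iln : (i < n.+1)%N by rewrite ltnS; apply: imin; rewrite pn.
  have pix : p n i < x.
    case: i xi imin iln => [|i] xi imin iln; first by rewrite p0.
    by rewrite ltNge; apply/negP => /imin; rewrite ltnn.
  exists (p n i.+1); split => //; first by rewrite -(pn n) ple.
    by rewrite /p -addn1 natrD mulrDl mul1r addrA lerD2r; exact: ltW.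
  rewrite /F (bigD1 (Ordinal iln))//= indE pix xi mul1r big1 ?addr0// => j ji.
  rewrite indE; case: (ltngtP (val j) i) => [lt|gt|eq].
  - have : p n j.+1 < x by apply: le_lt_trans pix; exact: ple.
    by rewrite ltNge => /negbTE ->; rewrite andbF mul0r.
  - by rewrite ltNge (le_trans xi (ple n _ _ gt)) mul0r.
  - by move/eqP: ji => []; exact: val_inj.
have FL n x : `|F n x| <= ind s t x * L x.
  rewrite indE; case: (boolP (s < x <= t)) => hx; last by rewrite Fout// normr0 mul0r.
  have [b [xb bt _ ->]] := Fin n x hx; rewrite mul1r; apply: NL => //.
  by case/andP : hx.
have mF n : measurable_fun setT (F n).
  by apply: measurable_sum => i; apply: measurable_funM.
have cF x : F n x @[n --> \oo] --> ind s t x * I x.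
  rewrite indE; case: (boolP (s < x <= t)) => hx; last first.
    by rewrite mul0r; under eq_fun do rewrite Fout//; exact: cvg_cst.
  rewrite mul1r; have H n := Fin n x hx.
  have /choice[b hb] := H.
  have Eb n : F n x = N (b n) x by have [] := hb n.
  under eq_fun do rewrite Eb.
  apply: cN; first by case/andP : hx.
    by move=> n; have [-> -> _ _] := hb n.
  apply: (@squeeze_cvgr _ _ _ _ (fun=> x) (fun n => x + h n)).
  - by apply: nearW => n; have [-> _ -> _] := hb n.
  - exact: cvg_cst.
  - rewrite -[X in _ --> X]addr0; apply: cvgD; first exact: cvg_cst.
    rewrite -(mulr0 (t - s)); apply: cvgMl_tmp; exact: cvg_harmonic.
have igT n i : (i <= n)%N -> ig (fun x => ind (p n i) (p n i.+1) x * N (p n i.+1) x).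
  move=> iln; apply: (ig_le _ _ igL); first by (apply: measurable_funM; [exact: measurable_indic|exact: mN]).
  move=> x; rewrite !indE; case: andP => [[h1 h2]|_]; last first.
    rewrite mul0r normr0; case: andP => [[h3 h4]|]; last by rewrite mul0r.
    by rewrite mul1r; apply: le_trans (NL t x h3 h4 _).
  have h3 : s < x by apply: le_lt_trans h1; rewrite -(p0 n) ple.
  have h4 : p n i.+1 <= t by rewrite -(pn n) ple.
  by rewrite h3 (le_trans h2 h4) !mul1r; apply: NL.
have [||||ii c _] := @Rdct _ _ _ leb1 F (fun x => ind s t x * I x) (fun x => ind s t x * L x) _ _ _ igL.
- exact: mF.
- exact: mI.
- exact: aeW.
- exact: FL.
split => //; apply: (cvgr_to_ge c); apply: nearW => n.
rewrite /F (@Rint_sum _ _ _ leb1 _ _ (fun (i : 'I_n.+1) x => ind (p n i) (p n i.+1) x * N (p n i.+1) x)); last first.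
  by move=> i; apply: igT; rewrite -ltnS.
have -> : E t - E s = \sum_(i < n.+1) (E (p n i.+1) - E (p n i)).
  by rewrite -{1}(pn n) -{1}(p0 n) -(big_mkord xpredT (fun i => E (p n i.+1) - E (p n i))) telescope_sumr.
apply: ler_sum => i _; apply: EN => //.
  by rewrite -(p0 n) ple.
by rewrite -(pn n) ple.
Qed.

End partition.

End DominatedLimits.
Import DominatedLimits.

(** * The solution as a curve of densities: flux and measurability in time *)

Module SolutionCurve.

Section curve.
Context {R : realType} (d : nat).
Local Notation V := 'rV[R]_d.
Local Notation mu := (@leb R d).
Local Notation leb1 := (@lebesgue_measure R).
Local Notation ig f := (mu.-integrable setT (EFin \o f)).
Local Notation e i := (delta_mx ord0 i : V).
Variables (lam eta m : R) (Psi : V -> R) (rho : R -> density R d).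
Hypotheses (lam_gt0 : 0 < lam) (eta_gt0 : 0 < eta) (m_gt1 : 1 < m).
Hypotheses (Psi1 : Ck 1 Psi)
  (rho_cont : forall t : R, 0 <= t ->
     weak_cvg (within (`[0, +oo[ : set R) (nbhs t)) (fun s => dprob (rho s)) (dprob (rho t)))
  (rho_W : forall t : R, 0 < t -> W11loc (fun y => LF lam eta m (rho t y))).
Local Notation LF := (LF lam eta m).
Implicit Types (kap : V -> R).

(* ptime t = t for t > 0 and ptime t = 1 otherwise. *)
Definition ptime (t : R) : R := expR (ln t).

Lemma ptimeE t : 0 < t -> ptime t = t.
Proof. by move=> t0; rewrite /ptime lnK. Qed.

(** Every real index carries a density at a positive time, so that measurability in time can be
    stated on the whole line; for t > 0 this is [rho t]. *)
Definition uu (t : R) : density R d := rho (ptime t).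
Definition GG (t : R) : V -> V := wgrad (fun y => LF (uu t y)).
(* The i-th coordinate of - u v_rho. *)
Definition jj (i : 'I_d) (t : R) (y : V) : R := uu t y * 'D_(e i) Psi y + GG t y ord0 i.

Lemma DPsi_cont i : continuous (fun y => 'D_(e i) Psi y).
Proof. by have [_ h] := Psi1; exact: h. Qed.

Lemma uu_meas t : measurable_fun setT (uu t).
Proof. exact: density_measurable. Qed.

Lemma uu_lint t : lint (uu t).
Proof. exact/ig_lint/ig_density. Qed.

Lemma uu_W t : lint (fun y => LF (uu t y)) /\ is_weak_grad (fun y => LF (uu t y)) (GG t).
Proof.
have [h [G0 wG0]] := rho_W (expR_gt0 (ln t)).
by split; [exact/loc_integrableP|exact: wgradP wG0].
Qed.

Lemma GG_lint i t : lint (fun y => GG t y ord0 i).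
Proof. exact: weak_grad_lint (uu_W t).2. Qed.

Lemma uDPsi_lint i t : lint (fun y => uu t y * 'D_(e i) Psi y).
Proof.
under eq_fun do rewrite mulrC; apply: lint_bounded_mul; last exact: uu_lint.
exact: DPsi_cont.
Qed.

Lemma jj_lint i t : lint (jj i t).
Proof. by apply: lintD; [exact: uDPsi_lint|exact: GG_lint]. Qed.

(** The substitution t = e^s maps the line onto ]0, oo[ and turns continuity within [0, oo[ into
    ordinary continuity. *)
Lemma uint_exp_continuous kap : continuous kap -> (exists M : R, forall y, `|kap y| <= M) ->
  continuous (fun s : R => (\int[mu]_y (kap y * rho (expR s) y))%R).
Proof.
move=> ck [M kM] s; have mk := continuous_measurable_rV ck.
have bk : bounded_fun kap.
  exists M; split; first exact: num_real.
  by move=> x Mx y _; apply: le_trans (kM y) _; exact: ltW.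
have := rho_cont (ltW (expR_gt0 s)) ck bk.
have E t : (\int[dprob (rho t)]_y kap y = \int[mu]_y (kap y * rho t y))%R.
  by apply: dprob_int => //; exists M.
under eq_fun do rewrite E; rewrite E => h.
apply: (@cvg_comp _ _ _ expR (fun t => (\int[mu]_y (kap y * rho t y))%R) _ _ _ _ h).
move=> P /= hP; have h2 : \forall t \near s, `[0, +oo[%classic (expR t) -> P (expR t).
  exact: (@continuous_expR R s _ hP).
change (nbhs s (expR @^-1` P)); apply: (@filterS _ (nbhs s) _ _ _ _ h2) => t /=; apply.
by rewrite /= in_itv /= andbT expR_ge0.
Qed.

Lemma measurable_exp_ln (f : R -> R) : continuous (f \o expR) ->
  measurable_fun setT (fun t => f (ptime t)).
Proof.
move=> cf; apply: (@measurableT_comp _ _ _ _ _ _ (f \o expR) _ (@ln R)).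
  exact: continuous_measurable_fun.
exact: measurable_ln.
Qed.

Lemma uint_measurable kap : continuous kap -> (exists M : R, forall y, `|kap y| <= M) ->
  measurable_fun setT (fun t : R => (\int[mu]_y (kap y * uu t y))%R).
Proof.
move=> ck bk; apply: (@measurable_exp_ln (fun t => (\int[mu]_y (kap y * rho t y))%R)).
exact: uint_exp_continuous.
Qed.

Lemma uint_continuous_pos kap t : continuous kap -> (exists M : R, forall y, `|kap y| <= M) ->
  0 < t -> {for t, continuous (fun t : R => (\int[mu]_y (kap y * uu t y))%R)}.
Proof.
move=> ck bk t0; rewrite /prop_for /continuous_at /uu.
apply: (@cvg_comp _ _ _ (@ln R) (fun s : R => (\int[mu]_y (kap y * rho (expR s) y))%R)).
  exact: continuous_ln.
exact: uint_exp_continuous.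
Qed.

Lemma bounded_supp kap r : continuous kap -> (forall y, r < `|y| -> kap y = 0) ->
  exists M : R, forall y, `|kap y| <= M.
Proof.
move=> ck hk; have [M M0 hM] := continuous_bounded_cube r ck; exists M => y.
by have [yr|yr] := leP `|y| r; [exact: hM|rewrite hk// normr0].
Qed.

Let Lp s : R := lam * s + eta * pw m s.

(** Bounded truncation of the pressure: at most N + 1, at most [Lp], and tending to [Lp] as N
    grows. *)
Let gN (N : nat) s := Lp s / (1 + Lp s / N.+1%:R).

Let Lp_ge0 s : 0 <= s -> 0 <= Lp s.
Proof. by move=> s0; rewrite addr_ge0 ?mulr_ge0 ?(ltW lam_gt0) ?(ltW eta_gt0) ?pw_ge0. Qed.

Let Lp_den N s : 0 <= s -> 0 < 1 + Lp s / N.+1%:R.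
Proof. by move=> s0; rewrite ltr_pwDl// divr_ge0// Lp_ge0. Qed.

Let gN_ge0 N s : 0 <= s -> 0 <= gN N s.
Proof. by move=> s0; rewrite divr_ge0 ?Lp_ge0// ltW// Lp_den. Qed.

Let gN_leN N s : 0 <= s -> gN N s <= N.+1%:R.
Proof.
move=> s0; rewrite ler_pdivrMr ?Lp_den// mulrDr mulr1 mulrCA divff ?pnatr_eq0// mulr1.
by rewrite lerDr.
Qed.

Let gN_leL N s : 0 <= s -> gN N s <= Lp s.
Proof.
move=> s0; rewrite ler_pdivrMr ?Lp_den// ler_peMr ?Lp_ge0// lerDl divr_ge0// Lp_ge0//.
Qed.

Let Lp_cont : continuous Lp.
Proof. exact: LFpw_continuous. Qed.

Let gN_cvg N (s : nat -> R) (l : R) : 0 <= l -> s n @[n --> \oo] --> l ->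
  gN N (s n) @[n --> \oo] --> gN N l.
Proof.
move=> l0 sl; have c : Lp (s n) @[n --> \oo] --> Lp l by apply: continuous_cvg => //; exact: Lp_cont.
apply: cvgM => //; apply: cvgV; first by rewrite gt_eqF// Lp_den.
by apply: cvgD; [exact: cvg_cst|apply: cvgMr_tmp].
Qed.

Let gN_meas N (f : V -> R) : measurable_fun setT f -> (forall y, 0 <= f y) ->
  measurable_fun setT (fun y => gN N (f y)).
Proof.
move=> mf f0; have mL : measurable_fun setT (fun y => Lp (f y)).
  by apply: measurableT_comp mf; exact: continuous_measurable_fun.
apply: measurable_funM => //; apply: measurable_invge0; last by move=> y; rewrite ltW// Lp_den.
by apply: measurable_funD => //; exact: measurable_funM.
Qed.

Lemma moll_u_ge0 n t x : 0 <= moll n (uu t) x.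
Proof. by apply: moll_ge0 => y; exact: density_ge0. Qed.

Lemma knl_refl_cont n (x : V) : continuous (fun y : V => knl n (x - y)).
Proof. by have [sk _] := @mol_knl R d n; exact: (smooth_refl x sk 0). Qed.

(** Weak continuity in time controls only integrals linear in u. So the pressure is truncated by
    [gN] and u is mollified in space: the values of u_n are continuous in time, and measurability
    survives the limits n -> oo and then N -> oo. *)
Lemma LFint_measurable kap r : continuous kap -> (forall y, r < `|y| -> kap y = 0) ->
  measurable_fun setT (fun t : R => (\int[mu]_y (kap y * LF (uu t y)))%R).
Proof.
move=> ck hk; have mk := continuous_measurable_rV ck.
have igk : ig kap by apply: ig_cont_supp => //; exists r.
have knlb n (x : V) : exists M : R, forall y : V, `|knl n (x - y)| <= M.
  by have [M _ h] := mol_bounded (@mol_knl R d n); exists M.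
have m1 N n : measurable_fun setT (fun t : R => (\int[mu]_y (kap y * gN N (moll n (uu t) y)))%R).
  apply: (@measurable_exp_ln (fun t => (\int[mu]_y (kap y * gN N (moll n (rho t) y)))%R)).
  move=> s; apply: (@seq_continuous R R^o) => v vs.
  have [||||_ c _] := @Rdct _ _ _ mu (fun k y => kap y * gN N (moll n (rho (expR (v k))) y))
    (fun y => kap y * gN N (moll n (rho (expR s)) y)) (fun y => N.+1%:R * `|kap y|) _ _ _ (igZ _ (ig_norm igk)).
  - move=> k; apply: measurable_funM => //; apply: gN_meas.
      by apply: moll_measurable; exact/ig_lint/ig_density.
    by move=> y; apply: moll_ge0 => z; exact: density_ge0.
  - apply: measurable_funM => //; apply: gN_meas.
      by apply: moll_measurable; exact/ig_lint/ig_density.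
    by move=> y; apply: moll_ge0 => z; exact: density_ge0.
  - apply: aeW => y; apply: cvgMl_tmp; apply: gN_cvg.
      by apply: moll_ge0 => z; exact: density_ge0.
    have h := @uint_exp_continuous (fun z => knl n (y - z)) (@knl_refl_cont n y) (knlb n y) s.
    exact: (@cvg_comp _ _ _ (v : nat -> R) (fun s : R => moll n (rho (expR s)) y) \oo (nbhs (s : R)) _ vs h).
  - move=> k y; have h0 : 0 <= moll n (rho (expR (v k))) y.
      by apply: moll_ge0 => z; exact: density_ge0.
    by rewrite normrM mulrC ler_wpM2r// ger0_norm ?gN_ge0// gN_leN.
  exact: c.
have m2 N : measurable_fun setT (fun t : R => (\int[mu]_y (kap y * gN N (uu t y)))%R).
  apply: (@measurable_fun_cvg _ _ _ setT (fun n t => (\int[mu]_y (kap y * gN N (moll n (uu t) y)))%R)).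
    by move=> n; exact: m1.
  move=> t _; have [igb b0] := moll_cvg_loc r (uu_lint t).
  have [|||||||_ _ //] := @Rint_domdct _ _ _ mu (fun n y => kap y * gN N (moll n (uu t) y))
    (fun n y => N.+1%:R * `|kap y|) (fun n x => \1_(cube r) x * `|moll n (uu t) x - uu t x|)
    (fun y => kap y * gN N (uu t y)) (fun y => N.+1%:R * `|kap y|) _ _ _ _ _ igb _ b0.
  - move=> n; apply: measurable_funM => //; apply: gN_meas.
      by apply: moll_measurable; exact: uu_lint.
    by move=> y; exact: moll_u_ge0.
  - apply: measurable_funM => //; apply: gN_meas; first exact: uu_meas.
    by move=> y; exact: density_ge0.
  - move=> n y; rewrite normrM mulrC ler_wpM2r// ger0_norm ?gN_ge0 ?gN_leN//; exact: moll_u_ge0.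
  - by move=> n; exact/igZ/ig_norm.
  - exact/igZ/ig_norm.
  - by move=> n x; rewrite subrr normr0 mulr_ge0.
  - apply: aeW => y s sn hs; have [yr|yr] := leP `|y| r; last first.
      by rewrite (hk y yr) mul0r; under eq_fun do rewrite mul0r; exact: cvg_cst.
    apply: cvgMl_tmp; apply: gN_cvg; first exact: density_ge0.
    apply/cvgrPdist_le => ep e0; have /cvgr0Pnorm_le /(_ ep e0) := hs.
    by apply: filterS => n; rewrite indicE mem_set// mul1r normr_id distrC.
apply: (@measurable_fun_cvg _ _ _ setT (fun N t => (\int[mu]_y (kap y * gN N (uu t y)))%R)).
  by move=> n; exact: m2.
move=> t _; have u0 y := @density_ge0 _ _ (uu t) y.
have LE y : LF (uu t y) = Lp (uu t y) by rewrite LF_pw.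
have lW := (uu_W t).1.
have [|||||_ c _] := @Rdct _ _ _ mu (fun N y => kap y * gN N (uu t y))
    (fun y => kap y * LF (uu t y)) (fun y => `|kap y * LF (uu t y)|) _ _ _ _.
- by move=> n; apply: measurable_funM => //; apply: gN_meas; first exact: uu_meas.
- by apply: measurable_funM => //; exact: lW.1.
- apply: aeW => y; apply: cvgMl_tmp; rewrite LE -[X in _ --> X]divr1.
  apply: cvgMl_tmp; apply: cvgV; first exact: oner_neq0.
  rewrite -[X in _ --> X]addr0; apply: cvgD; first exact: cvg_cst.
  rewrite -(mulr0 (Lp (uu t y))); apply: cvgMl_tmp; exact: cvg_harmonic.
- by apply: ig_norm; apply: lint_test => //; exists r.
- move=> N y; rewrite normrM [leRHS]normrM ler_wpM2l// LE (ger0_norm (gN_ge0 N (u0 y))) (ger0_norm (Lp_ge0 (u0 y))).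
  exact: gN_leL.
exact: c.
Qed.

(** An integration by parts moves the weak gradient to the test function and leaves integrals of u
    and of [LF u]. *)
Lemma jint_measurable i kap r : smooth kap -> (forall y, r < `|y| -> kap y = 0) ->
  measurable_fun setT (fun t : R => (\int[mu]_y (kap y * jj i t y))%R).
Proof.
move=> sk hk; have ck := sk 0 : continuous kap.
have cD := smooth_derive (e i) sk 0 : continuous ('D_(e i) kap).
have hD := derive_supp (e i) hk.
have cPk : continuous (fun y => kap y * 'D_(e i) Psi y) by apply: contM => //; exact: DPsi_cont.
have E t : (\int[mu]_y (kap y * jj i t y) = \int[mu]_y ((kap y * 'D_(e i) Psi y) * uu t y)
   - \int[mu]_y ('D_(e i) kap y * LF (uu t y)))%R.
  have [_ wG] := uu_W t; have [_ /(_ kap (test_fun_supp sk hk))] := wG i.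
  have -> : (\int[mu]_y (LF (uu t y) * grad kap y ord0 i) = \int[mu]_y ('D_(e i) kap y * LF (uu t y)))%R.
    by apply: eq_Rintegral => y _; rewrite mxE mulrC.
  move=> ->; rewrite opprK -RintD.
  - by apply: eq_Rintegral => y _; rewrite /jj; ring.
  - by apply: lint_test => //; [exact: uu_lint|exists r => y ry; rewrite hk// mul0r].
  - have := @lint_test _ _ _ kap (GG_lint i t) ck (ex_intro _ r hk).
    by under eq_fun do rewrite mulrC.
under eq_fun do rewrite E; apply: measurable_funB; last exact: LFint_measurable hD.
apply: uint_measurable => //; apply: (@bounded_supp _ r) => // y ry.
by rewrite hk// mul0r.
Qed.

End curve.

End SolutionCurve.
Import SolutionCurve.

(** * The flux energy, Jensen's inequality for it, and its measurability in time *)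

Module FluxEnergy.

Lemma Rcvg_sum (R : realType) (I : Type) (s : seq I) (F : I -> nat -> R) (l : I -> R) :
  (forall i, F i n @[n --> \oo] --> l i) ->
  \sum_(i <- s) F i n @[n --> \oo] --> \sum_(i <- s) l i.
Proof.
move=> h; elim: s => [|i s IH].
  by rewrite big_nil; under eq_fun do rewrite big_nil; exact: cvg_cst.
by rewrite big_cons; under eq_fun do rewrite big_cons; exact: cvgD.
Qed.

Section ae_order.
Context d (T : measurableType d) (R : realType).
Variable mu : {measure set T -> \bar R}.
Local Notation ig f := (mu.-integrable setT (EFin \o f)).

Lemma Rint_le_ae (f g : T -> R) : ig f -> ig g -> {ae mu, forall x, f x <= g x} ->
  (\int[mu]_x f x <= \int[mu]_x g x)%R.
Proof.
move=> igf igg h; have mf := ig_meas igf; have mg := ig_meas igg.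
pose k x := Num.max (f x) (g x); have mk : measurable_fun setT k by exact: measurable_maxr.
have E : {ae mu, forall x, g x = k x}.
  by apply: filterS h => x h; rewrite /k; apply/esym/max_idPr.
rewrite (Rint_ae mg mk E); apply: Rint_le => //; first exact: ig_ae E igg.
by move=> x; rewrite le_max lexx.
Qed.

(** For n >= N the term [u n] lies between [v N n] and D, so its liminf is squeezed to D. In the
    application N indexes cubes and n mollifications. *)
Lemma limn_einf_ge_lim (u w : (\bar R)^nat) (v : nat -> (\bar R)^nat) (D : \bar R) :
  (0 <= D)%E -> (forall n, 0 <= u n)%E -> (forall n, u n <= D)%E ->
  (forall N n, (N <= n)%N -> (v N n <= u n)%E) ->
  (forall N, w N <= limn_einf (v N))%E -> (D <= limn_einf w)%E -> limn_einf u = D.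
Proof.
move=> D0 u0 uD vu wv hD; apply/eqP; rewrite eq_le; apply/andP; split.
  by apply: einf_le => N; exists N.
rewrite leNgt; apply/negP => uD'.
have lu0 : (0 <= limn_einf u)%E by exact: einf_ge.
have [c uc cD] := ereal_ge0_dense lu0 uD'.
have fr := einf_lt_freq uc.
suff : (D <= c%:E)%E by rewrite leNgt cD.
apply: (le_trans hD); apply: einf_le => N; exists N => //.
apply: (le_trans (wv N)); apply: einf_le => k; have [n [kn un]] := fr (maxn k N).
exists n; first exact: leq_trans (leq_maxl _ _) kn.
by rewrite (le_trans (vu _ _ _)) ?(leq_trans (leq_maxr _ _) kn)// ltW.
Qed.

End ae_order.

Section jensen.
Context {R : realType} (d : nat).
Local Notation V := 'rV[R]_d.
Local Notation mu := (@leb R d).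
Local Notation ig f := (mu.-integrable setT (EFin \o f)).
Implicit Types (a u q : V -> R).

(** Cauchy-Schwarz recovered from Young's inequality by optimising th: th = a / u is exact, and for
    u = 0 a large th contradicts a > 0. *)
Lemma sq_le_of_young (a u q : R) : 0 <= a -> 0 <= u -> 0 <= q ->
  (forall th, 0 < th -> a <= (th * u + q / th) / 2) -> a ^+ 2 <= u * q.
Proof.
move=> a0 u0 q0 h; have [->|an] := eqVneq a 0; first by rewrite expr0n mulr_ge0.
have ap : 0 < a by rewrite lt_neqAle eq_sym an.
have [u_eq0|un] := eqVneq u 0.
  have th0 : 0 < (q + 1) / a by rewrite divr_gt0// ltr_wpDl.
  have := h _ th0; rewrite u_eq0 mulr0 add0r invf_div mulrA -ler_pdivrMr//.
  move=> h1; exfalso; move: h1; rewrite leNgt => /negP; apply.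
  rewrite !ltr_pdivrMr ?ltr_wpDl//; nra.
have up : 0 < u by rewrite lt_neqAle eq_sym un.
have := h (a / u) (divr_gt0 ap up).
rewrite divfK// invf_div ler_pdivlMr// mulrA -lerBlDl.
rewrite (_ : a * 2 - a = a); last by ring.
by rewrite ler_pdivlMr// mulrC -expr2 mulrC.
Qed.

Lemma moll_young n a u q x th : lint a -> lint u -> lint q -> 0 < th ->
  {ae mu, forall y, `|a y| <= (th * u y + q y / th) / 2} ->
  moll n (fun y => `|a y|) x <= (th * moll n u x + moll n q x / th) / 2.
Proof.
move=> la lu lq th0 h; have mk := @mol_knl R d n.
have E : (th * moll n u x + moll n q x / th) / 2 =
    moll n (fun y => 2^-1 * (th * u y + th^-1 * q y)) x.
  rewrite !(convZ, convD)//; [by rewrite mulrC (mulrC (moll n q x))| | |].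
  - exact: lintZ.
  - exact: lintZ.
  - by apply: lintD; exact: lintZ.
rewrite E; apply: Rint_le_ae.
- by apply: ig_conv => //; exact: lint_norm.
- by apply: ig_conv => //; apply/lintZ/lintD; exact: lintZ.
apply: filterS h => y h; rewrite ler_wpM2l ?knl_ge0//.
by move: h; rewrite mulrC (mulrC (q y)).
Qed.

(** The hypothesis is Young's inequality for every th rather than a^2 <= u q, because it is linear
    in u and q and therefore passes through the mollification. *)
Lemma moll_jensen n a u q x : lint a -> lint u -> lint q ->
  (forall y, 0 <= u y) -> (forall y, 0 <= q y) ->
  (forall th, 0 < th -> {ae mu, forall y, `|a y| <= (th * u y + q y / th) / 2}) ->
  moll n (fun y => `|a y|) x ^+ 2 <= moll n u x * moll n q x.
Proof.
move=> la lu lq u0 q0 h; apply: sq_le_of_young; [exact: moll_ge0| exact: moll_ge0| exact: moll_ge0|].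
by move=> th th0; exact: moll_young (h th th0).
Qed.

End jensen.

Section curve2.
Context {R : realType} (d : nat).
Local Notation V := 'rV[R]_d.
Local Notation mu := (@leb R d).
Local Notation leb1 := (@lebesgue_measure R).
Local Notation ig f := (mu.-integrable setT (EFin \o f)).
Local Notation e i := (delta_mx ord0 i : V).
Variables (lam eta m : R) (Psi : V -> R) (rho : R -> density R d).
Hypotheses (lam_gt0 : 0 < lam) (eta_gt0 : 0 < eta) (m_gt1 : 1 < m).
Hypotheses (Psi1 : Ck 1 Psi)
  (rho_cont : forall t : R, 0 <= t ->
     weak_cvg (within (`[0, +oo[ : set R) (nbhs t)) (fun s => dprob (rho s)) (dprob (rho t)))
  (rho_W : forall t : R, 0 < t -> W11loc (fun y => LF lam eta m (rho t y))).
Local Notation LF := (LF lam eta m).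
Local Notation uu := (uu rho).
Local Notation GG := (GG lam eta m rho).
Local Notation jj := (jj lam eta m Psi rho).
Implicit Types (kap : V -> R).

Let jl i t : lint (jj i t) := jj_lint Psi1 rho_W i t.
Let u0 t y : 0 <= uu t y := density_ge0 (uu t) y.

Lemma jj_zero t : {ae mu, forall y, uu t y = 0 -> forall i, jj i t y = 0}.
Proof.
have [lw wG] := uu_W rho_W t.
have := weak_grad_zero lam_gt0 eta_gt0 m_gt1 (uu_meas rho t) (u0 t) lw wG.
by apply: filterS => y h uy i; rewrite /SolutionCurve.jj uy mul0r add0r h// mxE.
Qed.

(** One component of |j|^2 / u = |v|^2 u. Where u = 0 the inverse is 0 by convention, and there the
    flux vanishes almost everywhere by [jj_zero]. *)
Definition qi i t y := (uu t y)^-1 * jj i t y ^+ 2.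
Definition qq t y := \sum_i qi i t y.
Definition DD t : \bar R := (\int[mu]_y (qq t y)%:E)%E.

Lemma qi_ge0 i t y : 0 <= qi i t y.
Proof. by rewrite mulr_ge0 ?sqr_ge0// invr_ge0. Qed.

Lemma qq_ge0 t y : 0 <= qq t y.
Proof. by apply: sumr_ge0 => i _; exact: qi_ge0. Qed.

Lemma qi_le i t y : qi i t y <= qq t y.
Proof. by rewrite /qq (bigD1 i)//= lerDl sumr_ge0// => k _; exact: qi_ge0. Qed.

Lemma qi_meas i t : measurable_fun setT (qi i t).
Proof.
apply: measurable_funM; last by apply: measurable_funX; exact: (jl i t).1.
by apply: measurable_invge0; [exact: uu_meas|exact: u0].
Qed.

Lemma qq_meas t : measurable_fun setT (qq t).
Proof. by apply: measurable_sum => i; exact: qi_meas. Qed.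

Lemma young_ae i t th : 0 < th ->
  {ae mu, forall y, `|jj i t y| <= (th * uu t y + qi i t y / th) / 2}.
Proof.
move=> th0; apply: filterS (jj_zero t) => y h.
have [uy|uy] := eqVneq (uu t y) 0.
  rewrite h// normr0; apply: divr_ge0 => //; apply: addr_ge0.
    by apply: mulr_ge0 => //; exact: ltW.
  by apply: divr_ge0; [exact: qi_ge0|exact: ltW].
have up : 0 < uu t y by rewrite lt_neqAle eq_sym uy u0.
rewrite ler_pdivlMr// /qi -real_normK ?num_real//.
set a := `|jj i t y|; set u := uu t y; have a0 : 0 <= a by rewrite /a.
have -> : th * u + u^-1 * a ^+ 2 / th = a * 2 + (th * u - a) ^+ 2 / (th * u).
  by field; rewrite !gt_eqF.
by rewrite lerDl divr_ge0 ?sqr_ge0// mulr_ge0// ltW.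
Qed.

Lemma DD_ge0 t : (0 <= DD t)%E.
Proof. by apply: integral_ge0 => y _; rewrite lee_fin qq_ge0. Qed.

Lemma qq_ig t : (DD t < +oo)%E -> ig (qq t).
Proof. by move=> h; apply: ig_ge0P => //; [exact: qq_meas|exact: qq_ge0]. Qed.

Lemma qi_ig i t : (DD t < +oo)%E -> ig (qi i t).
Proof.
move=> /qq_ig; apply: ig_le; first exact: qi_meas.
by move=> y; rewrite ger0_norm ?qi_le ?qi_ge0.
Qed.

Lemma DDE t : (DD t < +oo)%E -> (\int[mu]_y qq t y)%R = fine (DD t).
Proof. by move=> h; rewrite /DD -EFin_Rint//; exact: qq_ig. Qed.

(** Young's inequality with th = 1 bounds |j_i| by (u + q) / 2 almost everywhere, and u has mass
    1. *)
Lemma jj_ig i t : (DD t < +oo)%E -> ig (jj i t) /\ \int[mu]_y `|jj i t y| <= fine (DD t) + 1.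
Proof.
move=> h; have ib : ig (fun y => 2^-1 * (uu t y + qq t y)).
  by apply/igZ/igD; [exact: ig_density|exact: qq_ig].
have ae1 : {ae mu, forall y, `|jj i t y| <= 2^-1 * (uu t y + qq t y)}.
  apply: filterS (young_ae i t ltr01) => y; rewrite mul1r divr1 mulrC => /le_trans; apply.
  by rewrite ler_pM2l// lerD2l qi_le.
have igj : ig (jj i t).
  (* The bound holds almost everywhere only, so integrability is first obtained for this minimum,
     which agrees with |j_i| almost everywhere. *)
  pose k y := Num.min `|jj i t y| (2^-1 * (uu t y + qq t y)).
  have mk : measurable_fun setT k.
    by apply: measurable_minr; [apply: measurableT_comp => //; exact: (jl i t).1|exact: (ig_meas ib)].
  have k0 y : 0 <= k y by rewrite le_min normr_ge0 mulr_ge0// addr_ge0// qq_ge0.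
  have igk : ig k.
    by apply: ig_le ib => // y; rewrite ger0_norm// ge_min lexx orbT.
  have : ig (fun y => `|jj i t y|).
    apply: (ig_ae _ _ igk); first by apply: measurableT_comp => //; exact: (jl i t).1.
    by apply: filterS ae1 => y h1; apply/min_idPl.
  by apply: ig_le; [exact: (jl i t).1|].
split => //.
apply: (@le_trans _ _ (\int[mu]_y (2^-1 * (uu t y + qq t y)))%R).
  by apply: Rint_le_ae => //; exact: ig_norm.
rewrite RintZ; last by apply: igD; [exact: ig_density|exact: qq_ig].
rewrite RintD; [|exact: ig_density|exact: qq_ig].
rewrite Rint_density DDE//.
have : 0 <= fine (DD t) by rewrite fine_ge0// DD_ge0.
move: (fine _) => z; lra.
Qed.

Lemma jj_jensen i n t x : (DD t < +oo)%E ->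
  moll n (fun y => `|jj i t y|) x ^+ 2 <= moll n (uu t) x * moll n (qi i t) x.
Proof.
move=> h; apply: moll_jensen.
- exact: jl.
- exact: uu_lint.
- exact/ig_lint/qi_ig.
- exact: u0.
- exact: qi_ge0.
- by move=> th; exact: young_ae.
Qed.

Lemma jj_conv_measurable i kap : mol kap ->
  measurable_fun setT (fun p : R * V => conv kap (jj i p.1) p.2).
Proof.
move=> hk; apply: (@caratheodory _ _ _ _ (fun t x => conv kap (jj i t) x)) => [x|t].
  apply: (jint_measurable lam_gt0 eta_gt0 m_gt1 Psi1 rho_cont rho_W i (kap := fun y => kap (x - y)) (r := `|x| + 1)).
    by apply: smooth_refl; exact: hk.1.
  by move=> y xy; exact: (mol_shift0 hk).
by apply: conv_continuous => //; exact: jl.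
Qed.

Lemma conv_refl_cont kap (x : V) : mol kap -> continuous (fun y : V => kap (x - y)).
Proof. by move=> [sk _]; exact: (smooth_refl x sk 0). Qed.

Lemma conv_refl_bounded kap (x : V) : mol kap -> exists M : R, forall y : V, `|kap (x - y)| <= M.
Proof. by move=> hk; have [M _ h] := mol_bounded hk; exists M. Qed.

Lemma uu_conv_measurable kap : mol kap ->
  measurable_fun setT (fun p : R * V => conv kap (uu p.1) p.2).
Proof.
move=> hk; apply: (@caratheodory _ _ _ _ (fun t x => conv kap (uu t) x)) => [x|t].
  apply: (uint_measurable rho_cont (kap := fun y => kap (x - y))).
    exact: conv_refl_cont.
  exact: conv_refl_bounded.
by apply: conv_continuous => //; exact: uu_lint.
Qed.

(** [DD t] is the liminf of the integrals of |j_n|^2 / u_n over the cube of radius n, whose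
    integrands are jointly measurable. Jensen and conservation of mass bound them by [DD t]; Fatou
    gives the converse, first on a fixed cube, then as the cube grows. *)
Lemma DD_measurable : measurable_fun setT DD.
Proof.
pose Q n t x := \sum_i ((moll n (uu t) x)^-1 * moll n (jj i t) x ^+ 2).
have U0 n t x : 0 <= moll n (uu t) x by apply: moll_ge0.
have Q0 n t x : 0 <= Q n t x.
  by apply: sumr_ge0 => i _; rewrite mulr_ge0 ?sqr_ge0// invr_ge0.
have mi (N : nat) : measurable_fun setT (\1_(@cube R d N%:R) : V -> R).
  by apply: measurable_indic; exact: measurable_cube.
pose S N n t : \bar R := (\int[mu]_x (\1_(cube N%:R) x * Q n t x)%:E)%E.
have mQ n : measurable_fun setT (fun p : R * V => Q n p.1 p.2).
  apply: measurable_sum => i; apply: measurable_funM.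
    apply: measurable_invge0; first exact: uu_conv_measurable (@mol_knl R d n).
    by move=> p; exact: U0.
  by apply: measurable_funX; exact: jj_conv_measurable (@mol_knl R d n).
have mQt n t : measurable_fun setT (Q n t).
  apply: measurable_sum => i; apply: measurable_funM.
    apply: measurable_invge0; first by apply: moll_measurable; exact: uu_lint.
    by move=> x; exact: U0.
  by apply: measurable_funX; apply: moll_measurable; exact: jl.
have mS N n : measurable_fun setT (S N n).
  apply: (@measurable_fun_fubini_tonelli_F _ _ _ _ R mu
    (fun p => (\1_(cube N%:R) p.2 * Q n p.1 p.2)%:E)).
    apply/measurable_EFinP; apply: measurable_funM => //.
    exact: (measurableT_comp (mi N) measurable_snd).
  by move=> p; rewrite lee_fin mulr_ge0.
have -> : DD = (fun t => limn_einf (fun n => S n n t)); last first.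
  by apply: measurable_limn_einf => n; exact: mS.
apply/funext => t; apply/esym; apply: (@limn_einf_ge_lim _ _
  (fun N => \int[mu]_x (\1_(cube N%:R) x * qq t x)%:E)%E (fun N n => S N n t)) => //.
- exact: DD_ge0.
- by move=> n; apply: integral_ge0 => y _; rewrite lee_fin mulr_ge0.
- move=> n; have [Doo|Dfin] := leP +oo%E (DD t).
    by move: Doo; rewrite leye_eq => /eqP ->; rewrite leey.
  have igM i := moll_mass n (qi_ig i Dfin) (@qi_ge0 i t).
  have -> : DD t = (\int[mu]_x (\sum_i moll n (qi i t) x)%:E)%E.
    rewrite -EFin_Rint; last by apply: ig_sum => i; exact: (igM i).1.
    rewrite (@Rint_sum _ _ _ mu _ _ (fun i => moll n (qi i t))); last by move=> i; exact: (igM i).1.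
    under eq_bigr do rewrite (igM _).2.
    rewrite -(@Rint_sum _ _ _ mu _ _ (fun i => qi i t)); last by move=> i; exact: qi_ig.
    by rewrite EFin_Rint//; exact: qq_ig.
  apply: ge0_le_integral => //.
  + by move=> x _; rewrite lee_fin mulr_ge0.
  + by apply/measurable_EFinP; exact: (measurable_funM (mi _) (mQt _ _)).
  + by apply/measurable_EFinP; apply: measurable_sum => i; exact: (ig_meas (igM i).1).
  move=> x _; rewrite lee_fin; apply: (@le_trans _ _ (Q n t x)).
    by rewrite ler_piMl// indicE; case: (_ \in _).
  apply: ler_sum => i _; have q0 : 0 <= moll n (qi i t) x by apply: moll_ge0 => y; exact: qi_ge0.
  have [->|Un] := eqVneq (moll n (uu t) x) 0; first by rewrite invr0 mul0r.
  rewrite mulrC ler_pdivrMr ?lt_neqAle 1?eq_sym ?Un ?U0// mulrC.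
  apply: le_trans (jj_jensen i n x Dfin).
  by rewrite -(real_normK (num_real (moll n (jj i t) x))) lerXn2r ?nnegrE ?moll_ge0 ?conv_le_norm.
- move=> N n Nn; apply: ge0_le_integral => //.
  + by move=> x _; rewrite lee_fin mulr_ge0.
  + by apply/measurable_EFinP; exact: (measurable_funM (mi _) (mQt _ _)).
  + by apply/measurable_EFinP; exact: (measurable_funM (mi _) (mQt _ _)).
  + move=> x _; rewrite lee_fin ler_wpM2r// !indicE.
    have [xN|//] := boolP (x \in cube N%:R); rewrite mem_set//.
    by move: xN; rewrite inE; apply: cube_le; rewrite ler_nat.
- move=> N.
  have [igb b0] := moll_cvg_loc N%:R (uu_lint rho t).
  have B i := moll_cvg_loc N%:R (jl i t).
  pose b n x := \1_(cube N%:R) x * `|moll n (uu t) x - uu t x| +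
    \sum_i \1_(cube N%:R) x * `|moll n (jj i t) x - jj i t x|.
  apply: (@fatou_subseq _ _ _ mu (fun n x => \1_(cube N%:R) x * Q n t x) _ b).
  + by move=> n; exact: (measurable_funM (mi _) (mQt _ _)).
  + by move=> n x; rewrite mulr_ge0.
  + by move=> n; apply: igD => //; apply: ig_sum => i; exact: (B i).1.
  + by move=> n x; rewrite addr_ge0// ?mulr_ge0// sumr_ge0// => i _; rewrite mulr_ge0.
  + have E n : (\int[mu]_x b n x = \int[mu]_x (\1_(cube N%:R) x * `|moll n (uu t) x - uu t x|) +
       \sum_i \int[mu]_x (\1_(cube N%:R) x * `|moll n (jj i t) x - jj i t x|))%R.
      rewrite RintD//; last by apply: ig_sum => i; exact: (B i).1.
      by congr (_ + _); rewrite Rint_sum// => i; exact: (B i).1.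
    under eq_fun do rewrite E; 
    have Z : 0 + \sum_(i < d) (0 : R) = 0 by rewrite big1 ?addr0.
    have := cvgD b0 (@Rcvg_sum R _ (index_enum 'I_d) _ _ (fun i => (B i).2)).
    by rewrite Z; apply.
  + by apply: measurable_funM => //; exact: qq_meas.
  + by move=> x; rewrite mulr_ge0// qq_ge0.
  apply: aeW => x; rewrite indicE; case: (boolP (x \in cube N%:R)) => xN; last by left; rewrite mul0r.
  have [ux|ux] := eqVneq (uu t x) 0.
    left; rewrite /qq big1 ?mulr0// => i _; by rewrite /qi ux invr0 mul0r.
  right => s sn hs; rewrite mul1r; under eq_fun do rewrite mul1r.
  have le0 n : `|moll n (uu t) x - uu t x| <= b n x.
    rewrite /b indicE xN mul1r lerDl sumr_ge0// => i _; by rewrite mulr_ge0.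
  have lei i n : `|moll n (jj i t) x - jj i t x| <= b n x.
    rewrite /b indicE xN; under eq_bigr do rewrite mul1r.
    by rewrite (bigD1 i)//= mul1r addrCA lerDl addr_ge0// sumr_ge0.
  have cv (f : nat -> V -> R) (l : R) : (forall n, `|f n x - l| <= b n x) ->
      f (s n) x @[n --> \oo] --> l.
    move=> fb; apply/cvgrPdist_le => ep e0; have /cvgr0Pnorm_le /(_ ep e0) := hs.
    apply: filterS => n; rewrite distrC => h; apply: (le_trans (fb _)).
    exact: le_trans (ler_norm _) h.
  apply: Rcvg_sum => i; apply: cvgM.
    by apply: cvgV => //; apply: (cv (fun n => moll n (uu t))).
  rewrite expr2; under eq_fun do rewrite expr2.
  by apply: cvgM; apply: (cv (fun n => moll n (jj i t))).
(* Only the cube varies here, so the error sequence is 0. *)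
- apply: (@fatou_subseq _ _ _ mu (fun N x => \1_(cube N%:R) x * qq t x) _ (fun _ _ => 0)) => //.
  + by move=> n; apply: measurable_funM => //; exact: qq_meas.
  + by move=> n x; rewrite mulr_ge0// qq_ge0.
  + by move=> n; exact: ig0.
  + by under eq_fun do rewrite Rint0; exact: cvg_cst.
  + exact: qq_meas.
  + exact: qq_ge0.
  apply: aeW => x; right => s sn _.
  apply: (@cvg_near_cst _ _ _ _ _ _ _).
  have [k _ hk] := nbhs_infty_ger `|x|; exists k => // n /= kn.
  rewrite indicE mem_set ?mul1r// /cube /=; apply: (hk (s n)).
  by apply: leq_trans kn (sn n).
Qed.

Lemma enorm_sq (y : V) : enorm y ^+ 2 = \sum_i y ord0 i ^+ 2.
Proof. by rewrite /enorm sqr_sqrtr// sumr_ge0// => i _; rewrite sqr_ge0. Qed.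

Lemma DD_velocity t : 0 < t ->
  (\int[mu]_y (enorm (velocity lam eta m Psi rho t y) ^+ 2 * rho t y)%:E = DD t)%E.
Proof.
move=> t0; have ut : uu t = rho t by rewrite /SolutionCurve.uu ptimeE.
have [wG lw w1 hae] := velocityE lam_gt0 eta_gt0 m_gt1 Psi (rho_W t0).
have mr := density_measurable (rho t); have r0 := @density_ge0 _ _ (rho t).
have wum := wgradP (weak_grad_um lam_gt0 eta_gt0 m_gt1 mr r0 lw wG).
have GE : GG t = wgrad (fun y => LF (rho t y)) by rewrite /SolutionCurve.GG ut.
have minv : measurable_fun setT (fun y => (rho t y)^-1) by exact: measurable_invge0.
have mv i : measurable_fun setT (fun y => velocity lam eta m Psi rho t y ord0 i).
  under eq_fun do rewrite !mxE -mulN1r.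
  have m1 : measurable_fun setT (fun y => 'D_(e i) Psi y).
    by apply: continuous_measurable_rV; exact: (DPsi_cont Psi1).
  have m2 := (@weak_grad_lint R d _ _ i (wgradP w1)).1.
  have m3 := (@weak_grad_lint R d _ _ i wum).1.
  have mc (c : R) : measurable_fun [set: V] (fun=> c) by exact: measurable_cst.
  exact: (measurable_funM (mc (-1)) (measurable_funD (measurable_funD m1
    (measurable_funM (measurable_funM (mc lam) minv) m2))
    (measurable_funM (measurable_funM (mc eta) minv) m3))).
apply: ae_eq_integral; first exact: measurableT.
- apply/measurable_EFinP; under eq_fun do rewrite enorm_sq.
  have mE : measurable_fun setT (fun y => \sum_i velocity lam eta m Psi rho t y ord0 i ^+ 2).
    by apply: measurable_sum => i; exact: (measurable_funX _ (mv i)).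
  exact: (measurable_funM mE mr).
- by apply/measurable_EFinP; exact: qq_meas.
apply: filterS hae => y [h0 h1] _; congr EFin.
rewrite enorm_sq mulr_suml /qq; apply: eq_bigr => i _.
rewrite /qi /SolutionCurve.jj ut GE; have [ry|ry] := eqVneq (rho t y) 0; first by rewrite ry mulr0 invr0 mul0r.
have rp : 0 < rho t y by rewrite lt_neqAle eq_sym ry r0.
rewrite (h1 rp) !mxE; move: ('D_(e i) Psi y) (wgrad _ y ord0 i) => a g.
by move: (rho t y) ry => r rn; field.
Qed.

End curve2.

End FluxEnergy.
Import FluxEnergy.

(** * Smooth time steps and the unit masses they approximate *)

Module TimeSteps.

Section time_steps.
Context {R : realType}.
Local Notation leb1 := (@lebesgue_measure R).
Local Notation ig f := (leb1.-integrable setT (EFin \o f)).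
Local Notation Icc a b := (\1_(`[a, b] : set R) : R -> R).

Lemma IccE (a b x : R) : Icc a b x = (a <= x <= b)%R%:R.
Proof. by rewrite indicE mem_setE in_itv. Qed.

Lemma ig_Icc (a b : R) : ig (Icc a b).
Proof.
apply: ig_ge0P => //; rewrite integral_indic// setIT; have := @lebesgue_measure_itv R `[a, b].
rewrite /= => ->.
by case: ifP => _; rewrite ?ltry// -EFinB ltry.
Qed.

Lemma Rint_Icc (a b : R) : a <= b -> (\int[leb1]_x Icc a b x = b - a)%R.
Proof.
move=> ab; apply: EFin_inj; rewrite EFin_Rint; last exact: ig_Icc.
rewrite integral_indic// setIT; have := @lebesgue_measure_itv R `[a, b].
rewrite /= lte_fin => ->.
case: ltP => // ba; have E : a = b by apply/eqP; rewrite eq_le ab ba.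
by rewrite E subrr.
Qed.

Definition dsstep : R -> R := 'D_1 (sstep : R^o -> R).

Lemma is_derive_sstep (x : R) : is_derive x 1 (sstep : R -> R) (dsstep x).
Proof.
have [df _] := @Ck_sstep R 1.
by apply/derivableP; exact: (diff_derivable (df x)).
Qed.

Lemma dsstep_continuous : continuous dsstep.
Proof. by have [_ h] := @Ck_sstep R 1; exact: (h 1). Qed.

Lemma dsstep_eq0 x : (x < 0) || (1 < x) -> dsstep x = 0.
Proof.
case/orP => hx.
  have [_ <-] := is_derive_sstep x; apply: (@derive_near0 R R^o sstep x 1).
  by near=> y; apply: sstep_eq0; apply: ltW; near: y; exact: lt_nbhsl.
have h : is_derive x 1 (fun y => sstep y - 1 : R) (dsstep x).
  have := is_deriveB (is_derive_sstep x) (is_derive_cst (1 : R) x 1).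
  by rewrite subr0.
have [_ <-] := h; apply: (@derive_near0 R R^o _ x 1).
near=> y; rewrite sstep_eq1 ?subrr//; apply: ltW; near: y; exact: lt_nbhsr.
Unshelve. all: by end_near.
Qed.

Lemma dsstep_bounded : exists2 K : R, 0 <= K & forall x, `|dsstep x| <= K.
Proof.
have cn : continuous (fun x : R => `|dsstep x|).
  by move=> x; apply: continuous_comp; [exact: dsstep_continuous|exact: (@norm_continuous _ R^o)].
have cw : {within `[0, 1], continuous (fun x : R => `|dsstep x|)}.
  by move: cn; exact: continuous_subspaceT.
have [c _ hc] := EVT_max (@ler01 R) cw.
exists `|dsstep c|; first exact: normr_ge0.
move=> x; have [x01|x01] := boolP (x \in `[0, 1]); first exact: hc.
rewrite dsstep_eq0 ?normr0//; move: x01; rewrite in_itv /= negb_and -!ltNge.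
by [].
Qed.

(** Passes from 0 to 1 on [a, a + 1 / (n + 1)]; its derivative [dtstep] approximates the unit mass
    at a from the right. *)
Definition tstep (a : R) (n : nat) (x : R) : R := sstep (- (n.+1%:R * a) + n.+1%:R * x).
Definition dtstep (a : R) (n : nat) (x : R) : R :=
  n.+1%:R * dsstep (- (n.+1%:R * a) + n.+1%:R * x).

Lemma Ck_tstep k a n : Ck k (tstep a n : R^o -> R).
Proof. exact: Ck_aff (Ck_sstep k). Qed.

Lemma is_derive_tstep a n (x : R) : is_derive x 1 (tstep a n) (dtstep a n x).
Proof.
have h1 : is_derive x 1 (fun x : R => - (n.+1%:R * a) + n.+1%:R * x) (n.+1%:R : R).
  have h := is_deriveM (is_derive_cst (n.+1%:R : R) x 1) (is_derive_id x 1).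
  have H := is_deriveD (is_derive_cst (- (n.+1%:R * a) : R) x 1) h.
  by apply: (@is_derive_eq _ _ _ _ _ _ _ _ H); rewrite /GRing.scale /= mulr0 addr0 add0r mulr1.
have H := @is_derive1_comp R sstep _ x _ _ (is_derive_sstep _) h1.
by apply: (@is_derive_eq _ _ _ _ _ _ _ _ H); rewrite mulrC.
Qed.

Lemma dtstep_continuous a n : continuous (dtstep a n).
Proof.
move=> x; apply: cvgMl_tmp.
apply: (@continuous_comp R R R (fun x => - (n.+1%:R * a) + n.+1%:R * x) dsstep).
  by apply: cvgD; [exact: cvg_cst|apply: cvgMl_tmp].
exact: dsstep_continuous.
Qed.

Lemma tstep_eq0 a n x : x <= a -> tstep a n x = 0.
Proof. by move=> xa; rewrite /tstep sstep_eq0// addrC subr_le0 ler_pM2l. Qed.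

Lemma tstep_eq1 a n x : a + n.+1%:R^-1 <= x -> tstep a n x = 1.
Proof.
move=> xa; rewrite /tstep sstep_eq1// addrC -mulrBr.
by rewrite -ler_pdivrMl// mulr1 lerBrDl.
Qed.

Lemma dtstep_eq0 a n x : (x < a) || (a + n.+1%:R^-1 < x) -> dtstep a n x = 0.
Proof.
move=> h; rewrite /dtstep dsstep_eq0 ?mulr0// addrC -mulrBr.
case/orP : h => h; apply/orP; [left|right].
  by rewrite pmulr_rlt0// subr_lt0.
by rewrite -ltr_pdivrMl// mulr1 ltrBrDl.
Qed.

Lemma dtstep_le a n x (K : R) : 0 <= K -> (forall x, `|dsstep x| <= K) ->
  `|dtstep a n x| <= K * (n.+1%:R * Icc a (a + n.+1%:R^-1) x).
Proof.
move=> K0 hK; rewrite IccE; have [h|h] := boolP (a <= x <= _).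
  by rewrite mulr1 normrM mulrC (ger0_norm (ler0n _ _)) ler_wpM2r.
rewrite dtstep_eq0 ?normr0 ?mulr0//.
by move: h; rewrite negb_and -!ltNge.
Qed.

Lemma dtstep_ig a n : ig (dtstep a n).
Proof.
have [K K0 hK] := dsstep_bounded.
apply: (@ig_le _ _ _ leb1 _ (fun x => K * (n.+1%:R * Icc a (a + n.+1%:R^-1) x))).
- exact: continuous_measurable_fun (@dtstep_continuous a n).
- by move=> x; exact: dtstep_le.
- exact/igZ/igZ/ig_Icc.
Qed.

Lemma Rint_dtstep a n : (\int[leb1]_x dtstep a n x = 1)%R.
Proof.
apply: EFin_inj; rewrite EFin_Rint; last exact: dtstep_ig.
(* This interval contains the support of [dtstep] for every n. *)
have ab : a - 1 < a + 1 by lra.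
have := is_derive_FTC ab (is_derive_tstep a n) (@dtstep_continuous a n).
have -> : tstep a n (a + 1) = 1 by apply: tstep_eq1; rewrite lerD2l invf_le1// ler1n.
have -> : tstep a n (a - 1) = 0 by apply: tstep_eq0; rewrite gerBl.
rewrite sube0 => <-; rewrite [RHS]integral_mkcond; apply: eq_integral => x _.
rewrite patchE mem_setE in_itv /=; case: ifPn => // h.
rewrite dtstep_eq0//; move: h; rewrite negb_and -!ltNge => /orP[h|h]; apply/orP; [left|right].
  by apply: lt_trans h _; lra.
apply: le_lt_trans h; rewrite lerD2l invf_le1// ler1n//.
Qed.

Lemma dtstep_cvg (M : R -> R) (B a : R) : measurable_fun setT M -> (forall x, `|M x| <= B) ->
  {for a, continuous M} -> (\int[leb1]_x (dtstep a n x * M x) @[n --> \oo] --> M a)%R.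
Proof.
move=> mM MB cM; have [K K0 hK] := dsstep_bounded.
have B0 : 0 <= B by apply: le_trans (MB 0).
have igM n : ig (fun x => dtstep a n x * M x).
  apply: (@ig_le _ _ _ leb1 _ (fun x => B * `|dtstep a n x|)).
  - by apply: measurable_funM => //; exact: (ig_meas (dtstep_ig a n)).
  - by move=> x; rewrite normrM mulrC ler_wpM2r.
  - exact/igZ/ig_norm/dtstep_ig.
apply/cvgrPdist_le => ep e0.
(* [K] bounds the L^1 norm of [dtstep], hence this tolerance for the oscillation of M near a. *)
have e1 : 0 < ep / (K + 1) by rewrite divr_gt0// ltr_wpDl.
have /cvgrPdist_le /(_ _ e1) /nbhs_ballP [dl /= dl0 hdl] := cM.
near=> n.
have ndl : n.+1%:R^-1 < dl.
  by near: n; exact: near_infty_natSinv_lt (PosNum dl0).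
have -> : M a - (\int[leb1]_x (dtstep a n x * M x))%R = (\int[leb1]_x (dtstep a n x * (M a - M x)))%R.
  rewrite -[X in X - _]mulr1 -(Rint_dtstep a n) -RintZ; last exact: dtstep_ig.
  rewrite -RintB//; last exact/igZ/dtstep_ig.
  by apply: eq_Rintegral => x _; ring.
have igd : ig (fun x => dtstep a n x * (M a - M x)).
  have := igB (igZ (M a) (dtstep_ig a n)) (igM n).
  by congr (leb1.-integrable _ _); apply/funext => x /=; congr EFin; ring.
apply: le_trans (Rint_norm igd) _.
apply: (@le_trans _ _ (\int[leb1]_x (ep / (K + 1) * (K * (n.+1%:R * Icc a (a + n.+1%:R^-1) x))))%R).
  apply: Rint_le; [exact: ig_norm|exact/igZ/igZ/igZ/ig_Icc|move=> x].
  rewrite normrM mulrC; have [h|h] := boolP (a <= x <= a + n.+1%:R^-1).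
    apply: ler_pM => //; last exact: dtstep_le.
    apply: hdl; rewrite -ball_normE /= distrC.
    case/andP: h => h1 h2; rewrite ger0_norm ?subr_ge0//.
    by apply: le_lt_trans ndl; rewrite lerBlDl.
  rewrite dtstep_eq0 ?normr0 ?mulr0; last by move: h; rewrite negb_and -!ltNge.
  by rewrite mulr_ge0 ?(ltW e1)// mulr_ge0// mulr_ge0// indicE.
rewrite RintZ; last exact/igZ/igZ/ig_Icc.
rewrite RintZ; last exact/igZ/ig_Icc.
rewrite RintZ; last exact: ig_Icc.
rewrite Rint_Icc; last by rewrite lerDl.
rewrite addrAC subrr add0r divff ?pnatr_eq0// mulr1 mulrAC.
rewrite ler_pdivrMr ?ltr_wpDl//; apply: ler_wpM2l; first exact: ltW.
by rewrite lerDl.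
Unshelve. all: by end_near.
Qed.

End time_steps.

End TimeSteps.
Import TimeSteps.

(** * Time increments of linear functionals of the solution *)

Module TimeWeakForm.

Section weak_form.
Context {R : realType} (d : nat).
Local Notation V := 'rV[R]_d.
Local Notation mu := (@leb R d).
Local Notation leb1 := (@lebesgue_measure R).
Local Notation ig f := (mu.-integrable setT (EFin \o f)).
Local Notation ig1 f := (leb1.-integrable setT (EFin \o f)).
Local Notation e i := (delta_mx ord0 i : V).
Local Notation ind a b := (\1_(`]a, b] : set R) : R -> R).
Variables (lam eta m : R) (Psi : V -> R) (rho : R -> density R d).
Hypotheses (lam_gt0 : 0 < lam) (eta_gt0 : 0 < eta) (m_gt1 : 1 < m).
Hypotheses (Psi1 : Ck 1 Psi)
  (rho_cont : forall t : R, 0 <= t ->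
     weak_cvg (within (`[0, +oo[ : set R) (nbhs t)) (fun s => dprob (rho s)) (dprob (rho t)))
  (rho_W : forall t : R, 0 < t -> W11loc (fun y => LF lam eta m (rho t y)))
  (rho_weak : forall phi : (R^o * V)%type -> R,
     test_fun [set p : R^o * V | 0 < p.1 :> R] phi ->
     (\int[leb1]_(t in (`]0%R, +oo[ : set R))
       (\int[mu]_y
         (rho t y * derive1 (fun s : R => phi (s, y)) t
          - edot (rho t y *: grad Psi y + wgrad (fun z => LF lam eta m (rho t z)) y)
                 (grad (fun z => phi (t, z)) y)))%R%:E = 0)%E)
  (rho_energy : forall T : R, 0 < T ->
     (\int[leb1]_(t in (`]0%R, T] : set R)) \int[mu]_y
        (enorm (velocity lam eta m Psi rho t y) ^+ 2 * rho t y)%:E < +oo)%E).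
Local Notation LF := (LF lam eta m).
Local Notation uu := (uu rho).
Local Notation GG := (GG lam eta m rho).
Local Notation jj := (jj lam eta m Psi rho).
Local Notation DD := (DD lam eta m Psi rho).
Implicit Types (kap : V -> R).

(** Real version of [DD], equal to 0 at times of infinite energy; these are negligible by
    [DD_ae]. *)
Definition Dr t : R := fine (DD t).

Lemma Dr_ge0 t : 0 <= Dr t.
Proof. by rewrite fine_ge0// DD_ge0. Qed.

Let mDD : measurable_fun setT DD := DD_measurable lam_gt0 eta_gt0 m_gt1 Psi1 rho_cont rho_W.

Lemma DD_time T : 0 < T -> (\int[leb1]_(t in (`]0%R, T] : set R)) DD t < +oo)%E.
Proof.
move=> T0; apply: le_lt_trans (rho_energy T0).
rewrite le_eqVlt; apply/orP; left; apply/eqP; apply: eq_integral => t.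
rewrite inE /= in_itv /= => /andP[t0 _].
by rewrite (DD_velocity lam_gt0 eta_gt0 m_gt1 Psi1 rho_W).
Qed.

Lemma DD_ae T : 0 < T -> {ae leb1, forall t, 0 < t -> t <= T -> (DD t < +oo)%E}.
Proof.
move=> T0; have iD : leb1.-integrable (`]0%R, T] : set R) DD.
  apply/integrableP; split; first exact: measurable_funTS.
  under eq_integral do rewrite gee0_abs ?DD_ge0//.
  exact: DD_time.
have hae : {ae leb1, forall t, (`]0%R, T]%classic : set R) t -> DD t \is a fin_num} by exact: integrable_ae iD.
move: hae; apply: (@filterS _ (almost_everywhere leb1) _) => t h t0 tT.
have := h _; rewrite /= in_itv /= t0 tT => /(_ isT); rewrite ge0_fin_numE ?DD_ge0//.
Qed.

Lemma Dr_meas : measurable_fun setT Dr.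
Proof. exact: measurableT_comp mDD. Qed.

Lemma Dr_ig T : 0 < T -> ig1 (fun t => ind 0 T t * Dr t).
Proof.
move=> T0; apply: ig_ge0P.
- by apply: measurable_funM; [exact: measurable_indic|exact: Dr_meas].
- by move=> t; rewrite mulr_ge0// Dr_ge0.
apply: le_lt_trans (DD_time T0); rewrite [leRHS]integral_mkcond.
apply: ge0_le_integral => //.
- by move=> t _; rewrite lee_fin mulr_ge0// Dr_ge0.
- by apply/measurable_EFinP/measurable_funM; [exact: measurable_indic|exact: Dr_meas].
- by apply/(measurable_restrictT _ _).1 => //; exact: measurable_funTS.
move=> t _; rewrite patchE indicE; case: ifPn => _; last by rewrite mul0r.
rewrite mul1r /Dr; have := DD_ge0 lam eta m Psi rho t; by case: (DD t) => //= ?.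
Qed.

Definition Mk kap t : R := (\int[mu]_y (kap y * uu t y))%R.
(** Formally [- Nk kap] is the time derivative of [Mk kap]. *)
Definition Nk kap t : R := (\int[mu]_y (\sum_i 'D_(e i) kap y * jj i t y))%R.

Section one_test.
Variables (kap : V -> R) (r B : R).
Hypotheses (sk : smooth kap) (hk : forall y, r < `|y| -> kap y = 0)
  (hB : forall i y, `|'D_(e i) kap y| <= B).

Let jl i t : lint (jj i t) := jj_lint Psi1 rho_W i t.
Let ck : continuous kap := sk 0.
Let cD i : continuous ('D_(e i) kap) := smooth_derive (e i) sk 0.
Let hD i := derive_supp (e i) hk.

Lemma Dkj_ig i t : ig (fun y => 'D_(e i) kap y * jj i t y).
Proof. by apply: lint_test => //; exists r; exact: hD. Qed.

Lemma NkE t : Nk kap t = \sum_i (\int[mu]_y ('D_(e i) kap y * jj i t y))%R.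
Proof. by rewrite /Nk Rint_sum// => i; exact: Dkj_ig. Qed.

Lemma Nk_meas : measurable_fun setT (Nk kap).
Proof.
rewrite (_ : Nk kap = fun t => \sum_i (\int[mu]_y ('D_(e i) kap y * jj i t y))%R); last first.
  by apply/funext => t; exact: NkE.
apply: measurable_sum => i.
exact: (jint_measurable lam_gt0 eta_gt0 m_gt1 Psi1 rho_cont rho_W i (smooth_derive (e i) sk) (hD i)).
Qed.

Lemma Nk_le t : (DD t < +oo)%E -> `|Nk kap t| <= d%:R * (B * (Dr t + 1)).
Proof.
move=> Dt; rewrite NkE; apply: (le_trans (ler_norm_sum _ _ _)).
apply: (@le_trans _ _ (\sum_(i < d) B * (Dr t + 1))); last first.
  by rewrite sumr_const card_ord (mulr_natl _ d).
apply: ler_sum => i _; have [igj hj] := jj_ig lam_gt0 eta_gt0 m_gt1 Psi1 rho_W i Dt.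
have B0 : 0 <= B by apply: le_trans (hB i 0).
apply: (le_trans (Rint_norm (Dkj_ig i t))).
apply: (@le_trans _ _ (\int[mu]_y (B * `|jj i t y|))%R); last first.
  by rewrite RintZ; [rewrite ler_wpM2l|exact: ig_norm].
apply: Rint_le; [exact/ig_norm/Dkj_ig|exact/igZ/ig_norm|].
by move=> y; rewrite normrM ler_wpM2r.
Qed.

Lemma Nk_ig s t : 0 <= s -> 0 < t -> ig1 (fun x => ind s t x * Nk kap x).
Proof.
move=> s0 t0.
have mN : measurable_fun setT (fun x => ind s t x * Nk kap x).
  by apply: measurable_funM; [exact: measurable_indic|exact: Nk_meas].
pose g x : R := `|d%:R * (B * (ind 0 t x * Dr x + ind 0 t x))|.
have ig_g : ig1 g.
  apply/ig_norm/igZ/igZ/igD; first exact: Dr_ig.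
  apply: ig_ge0P => //; rewrite integral_indic// setIT.
  by have := @lebesgue_measure_itv R `]0, t]; rewrite /= lte_fin t0 => ->; rewrite -EFinB ltry.
(* The bound by g holds at almost every time only, so integrability is shown for the function
   clamped between -g and g. *)
have gae : {ae leb1, forall x, ind s t x * Nk kap x = Num.max (Num.min (ind s t x * Nk kap x) (g x)) (- g x)}.
  have := DD_ae t0; apply: (@filterS _ (almost_everywhere leb1) _) => x hx.
  have : `|ind s t x * Nk kap x| <= g x.
    rewrite normrM (indE s t) /g (indE 0 t); have [/andP[h1 h2]|_] := boolP (s < x <= t); last first.
      by rewrite normr0 mul0r.
    have x0 : 0 < x by apply: le_lt_trans h1.
    rewrite x0 h2 normr1 !mul1r; apply: le_trans (Nk_le (hx x0 h2)) _; exact: ler_norm.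
  rewrite ler_norml => /andP[h1 h2].
  by rewrite (min_idPl h2) (max_idPl h1).
apply: (@ig_ae _ _ _ leb1 (fun x => Num.max (Num.min (ind s t x * Nk kap x) (g x)) (- g x))) => //.
  by move: gae; apply: (@filterS _ (almost_everywhere leb1) _) => x; exact: esym.
apply: (ig_le _ _ ig_g).
  apply: measurable_maxr; last by apply: measurableT_comp => //; exact: (ig_meas ig_g).
  by apply: measurable_minr => //; exact: (ig_meas ig_g).
move=> x; have g0 : 0 <= g x by rewrite /g.
rewrite ler_norml le_max lexx orbT /= ge_max ge_min lexx orbT /=.
by rewrite lerNl (le_trans _ g0)// oppr_le0.
Qed.

End one_test.

Section weak_time.
Variables (kap : V -> R) (r : R).
Hypotheses (sk : smooth kap) (hk : forall y, r < `|y| -> kap y = 0).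
Let ck : continuous kap := sk 0.

Let chi s t n (x : R) : R := tstep s n x - tstep t n x.
Let dchi s t n (x : R) : R := dtstep s n x - dtstep t n x.

Lemma chi_test s t n : 0 < s -> s < t ->
  test_fun [set p : R^o * V | 0 < p.1 :> R] (fun p : R^o * V => chi s t n p.1 * kap p.2).
Proof.
(* The step at t is over by t + 1 / (n + 1) <= t + 1. *)
move=> s0 st; pose Kt : set (R^o * V) := (`[s, t + 1] : set R) `*` cube r.
have cK : compact Kt.
  by apply: compact_setX; [exact: segment_compact|exact: cube_compact].
have sub : [set p : R^o * V | chi s t n p.1 * kap p.2 != 0] `<=` Kt.
  move=> [x y] /=; rewrite mulf_eq0 negb_or => /andP[h1 h2]; split => /=.
    rewrite in_itv /=; apply: contraR h1; rewrite negb_and -!ltNge => /orP[h|h].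
      by rewrite /chi !tstep_eq0 ?subrr//; [apply: ltW; apply: lt_trans st|exact: ltW].
    have n1 : n.+1%:R^-1 <= 1 :> R by rewrite invf_le1// ler1n.
    by rewrite /chi !tstep_eq1 ?subrr//; move: h n1 st; move: (_^-1) => z; lra.
  by rewrite /cube /= leNgt; apply: contra h2 => /hk ->.
have sub2 : fsupport (fun p : R^o * V => chi s t n p.1 * kap p.2) `<=` Kt.
  have clK : closed Kt by apply: compact_closed => //; exact: norm_hausdorff.
  by rewrite (closure_id Kt).1//; exact: closureS.
split.
- move=> k; apply: CkM.
    have c1 : Ck k (chi s t n : R^o -> R).
      have := CkD (Ck_tstep k s n) (CkZ (-1) (Ck_tstep k t n)).
      by congr (Ck k _); apply/funext => x; rewrite mulN1r.
    have := @Ck_comp_lin R R^o (R^o * V)%type fst 0 k _ _ _ c1.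
    under [X in _ -> _ -> Ck k X]eq_fun do rewrite add0r.
    by apply; [move=> a u v|move=> p; exact: cvg_fst].
  have := @Ck_comp_lin R V (R^o * V)%type snd 0 k _ _ _ (sk k).
  under [X in _ -> _ -> Ck k X]eq_fun do rewrite add0r.
  by apply; [move=> a u v|move=> p; exact: cvg_snd].
- by apply: (subclosed_compact _ cK) => //; exact: closed_closure.
- by move=> p /sub2 [] /=; rewrite in_itv /= => /andP[h _] _; apply: lt_le_trans h.
Qed.

(** The test function is chi(t) kap(y), with chi the difference of the smooth steps at s and t. Its
    derivative tends to the difference of unit masses at s and t, where weak continuity evaluates
    [Mk]. *)
Lemma weak_time s t : 0 < s -> s < t ->
  ig1 (fun x => ind s t x * Nk kap x) /\
  Mk kap t - Mk kap s = - \int[leb1]_x (ind s t x * Nk kap x).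
Proof.
move=> s0 st; have t0 : 0 < t by apply: lt_trans st.
have [B _ hB] : exists2 B : R, 0 <= B & forall i y, `|'D_(e i) kap y| <= B.
  have h i : exists B : R, forall y, `|'D_(e i) kap y| <= B.
    by apply: (@bounded_supp _ _ _ r); [exact: (smooth_derive (e i) sk 0)|exact: derive_supp].
  have [b hb] := choice h; exists (\sum_i `|b i|); first exact: sumr_ge0.
  move=> i y; apply: le_trans (hb i y) _; apply: le_trans (ler_norm _) _.
  by rewrite (bigD1 i)//= lerDl sumr_ge0.
have iN a b : 0 <= a -> 0 < b -> ig1 (fun x => ind a b x * Nk kap x) by exact: (Nk_ig sk hk hB).
split; first by apply: iN => //; exact: ltW.
have [bM hM] := bounded_supp ck hk.
have mM : measurable_fun setT (Mk kap) by apply: (uint_measurable rho_cont ck); exists bM.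
have bMk x : `|Mk kap x| <= bM.
  have igku : ig (fun y => kap y * uu x y).
    by apply: lint_test => //; [exact: uu_lint|exists r].
  apply: le_trans (Rint_norm igku) _.
  apply: (@le_trans _ _ (\int[mu]_y (bM * uu x y))%R).
    apply: Rint_le; [exact: ig_norm|exact/igZ/ig_density|move=> y].
    by rewrite normrM (ger0_norm (density_ge0 _ _)) ler_wpM2r// density_ge0.
  by rewrite RintZ ?Rint_density ?mulr1//; exact: ig_density.
have cM a : 0 < a -> {for a, continuous (Mk kap)}.
  by move=> a0; apply: (uint_continuous_pos rho_cont ck) => //; exists bM.
have chi0 n x : ~~ (s < x <= t + 1) -> chi s t n x = 0.
  rewrite negb_and -leNgt -ltNge => /orP[h|h].
    by rewrite /chi !tstep_eq0 ?subrr//; apply: (le_trans h); exact: ltW.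
  have n1 : n.+1%:R^-1 <= 1 :> R by rewrite invf_le1// ler1n.
  by rewrite /chi !tstep_eq1 ?subrr//; move: h n1 st; move: (_^-1) => z; lra.
have chi2 n x : `|chi s t n x| <= 2.
  rewrite (le_trans (ler_normB _ _))//.
  have h a : `|tstep a n x| <= 1 by rewrite ger0_norm ?sstep_le1 ?sstep_ge0.
  by have := lerD (h s) (h t); rewrite -[1 + 1]/(2%:R).
have t1 : 0 < t + 1 by rewrite addr_gt0.
have iN1 := iN _ _ (ltW s0) t1.
have chib n x : `|chi s t n x * Nk kap x| <= 2 * `|ind s (t + 1) x * Nk kap x|.
  rewrite indE; have [h|h] := boolP (s < x <= t + 1); first by rewrite mul1r normrM ler_wpM2r.
  by rewrite chi0// !mul0r normr0 mulr0.
have mtstep a n : measurable_fun setT (tstep a n : R -> R).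
  exact: continuous_measurable_fun (Ck_tstep 0 a n : continuous _).
have mcN n : measurable_fun setT (fun x => chi s t n x * Nk kap x).
  by apply: measurable_funM; [exact: measurable_funB|exact: (Nk_meas sk hk)].
have igc n : ig1 (fun x => chi s t n x * Nk kap x).
  by apply: (@ig_le _ _ _ leb1 _ _ (mcN n) (chib n)); exact/igZ/ig_norm.
have igdt a n : ig1 (fun x => dtstep a n x * Mk kap x).
  apply: (@ig_le _ _ _ leb1 _ (fun x => bM * `|dtstep a n x|)).
  - by apply: measurable_funM => //; exact: (ig_meas (dtstep_ig a n)).
  - by move=> x; rewrite normrM mulrC ler_wpM2r.
  - exact/igZ/ig_norm/dtstep_ig.
have Ed n : (\int[leb1]_x (dchi s t n x * Mk kap x) =
    \int[leb1]_x (dtstep s n x * Mk kap x) - \int[leb1]_x (dtstep t n x * Mk kap x))%R.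
  by rewrite -RintB//; apply: eq_Rintegral => x _; rewrite mulrBl.
have igd n : ig1 (fun x => dchi s t n x * Mk kap x).
  have := igB (igdt s n) (igdt t n).
  by congr (leb1.-integrable _ _); apply/funext => x /=; rewrite mulrBl.
have inner n x : 0 < x -> (\int[mu]_y
    (rho x y * derive1 (fun s' : R => chi s t n s' * kap y) x
      - edot (rho x y *: grad Psi y + wgrad (fun z => LF (rho x z)) y)
             (grad (fun z => chi s t n x * kap z) y)) =
    dchi s t n x * Mk kap x - chi s t n x * Nk kap x)%R.
  move=> x0; have ux : uu x = rho x by rewrite /SolutionCurve.uu ptimeE.
  have ik : ig (fun y => kap y * uu x y) by apply: lint_test => //; [exact: uu_lint|exists r].
  have iS : ig (fun y => \sum_i 'D_(e i) kap y * jj i x y).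
    by apply: ig_sum => i; exact: (Dkj_ig sk hk).
  rewrite /Mk /Nk -RintZ// -RintZ// -RintB; [|exact: igZ|exact: igZ].
  apply: eq_Rintegral => y _; congr (_ - _).
    have h1 : is_derive x 1 (chi s t n) (dchi s t n x).
      exact: is_deriveB (is_derive_tstep s n x) (is_derive_tstep t n x).
    have h2 := is_deriveM h1 (is_derive_cst (kap y) x 1).
    rewrite derive1E; have [_ E] := h2.
    rewrite [X in _ * X](_ : _ = chi s t n x *: 0 + kap y *: dchi s t n x); last exact: E.
    by rewrite ux /GRing.scale /= mulr0 add0r; ring.
  rewrite /edot mulr_sumr; apply: eq_bigr => i _; rewrite !mxE.
  have [dk _] := sk 1; have dky : derivable kap y (e i) by exact: diff_derivable.
  have E : 'D_(e i) (fun z => chi s t n x * kap z) y = chi s t n x * 'D_(e i) kap y.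
    exact: (@deriveZ _ _ _ kap (chi s t n x) y (e i) dky).
  by rewrite E /SolutionCurve.jj /SolutionCurve.GG ux; ring.
have key n : (\int[leb1]_x (dchi s t n x * Mk kap x) = \int[leb1]_x (chi s t n x * Nk kap x))%R.
  apply/eqP; rewrite -subr_eq0 -RintB//; apply/eqP; apply: EFin_inj.
  rewrite EFin_Rint; last exact: igB.
  have W := rho_weak (chi_test n s0 st).
  apply: etrans W; rewrite [RHS]integral_mkcond; apply: eq_integral => x _.
  rewrite patchE mem_setE in_itv /= andbT; case: ltP => x0; first by rewrite inner.
  have xs : x < s by apply: le_lt_trans s0.
  rewrite chi0 ?mul0r ?subr0; last by rewrite ltNge (ltW xs).
  by rewrite /dchi !dtstep_eq0 ?subrr ?mul0r// ?xs// (lt_trans xs st).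
have l1 : (\int[leb1]_x (dchi s t n x * Mk kap x) @[n --> \oo] --> Mk kap s - Mk kap t)%R.
  under eq_fun do rewrite Ed.
  by apply: cvgB; apply: dtstep_cvg => //; exact: cM.
have l2 : (\int[leb1]_x (chi s t n x * Nk kap x) @[n --> \oo] --> \int[leb1]_x (ind s t x * Nk kap x))%R.
  have [||||_ c _] := @Rdct _ _ _ leb1 (fun n x => chi s t n x * Nk kap x) (fun x => ind s t x * Nk kap x)
    (fun x => 2 * `|ind s (t + 1) x * Nk kap x|) _ _ _ (igZ _ (ig_norm iN1)).
  - exact: mcN.
  - by apply: measurable_funM; [exact: measurable_indic|exact: (Nk_meas sk hk)].
  (* Each step vanishes at its own starting point, so the limit is exactly the indicator of ]s,
     t]. *)
  - apply: aeW => x; apply: cvgMr_tmp; rewrite indE.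
    have T1 a : a < x -> tstep a n x @[n --> \oo] --> (1 : R).
      move=> ax; apply: cvg_near_cst; near=> n; apply: tstep_eq1.
      rewrite addrC -lerBrDr; apply: ltW; near: n.
      have ax0 : 0 < x - a by rewrite subr_gt0.
      exact: near_infty_natSinv_lt (PosNum ax0).
    have T0 a : x <= a -> tstep a n x @[n --> \oo] --> (0 : R).
      by move=> xa; under eq_fun do rewrite tstep_eq0//; exact: cvg_cst.
    have [sx|xs] := ltP s x; last first.
      by have := cvgB (T0 s xs) (T0 t (le_trans xs (ltW st))); rewrite subrr; exact.
    have [xt|tx] := leP x t.
      by have := cvgB (T1 s sx) (T0 t xt); rewrite subr0; exact.
    by have := cvgB (T1 s sx) (T1 t tx); rewrite subrr; exact.
  - exact: chib.
  exact: c.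
move: l1; under eq_fun do rewrite key; move=> l1.
by rewrite -(cvg_unique _ l1 l2)// opprB.
Unshelve. all: by end_near.
Qed.

End weak_time.

End weak_form.

End TimeWeakForm.
Import TimeWeakForm.

(** * The entropy density with logistic derivative *)

Module EntropyKernel.

(** Case analysis behind [PH_step]: p, q, r stand for 0 <= s, s <= b, s <= a, and the sign of the
    difference of indicators tells on which side of b the point s lies. *)
Lemma bool_step (R : realType) (A B : R) (p q r : bool) :
  (p -> q -> A <= B) -> (p -> ~~ q -> B <= A) ->
  A * ((p && q)%:R - (p && r)%:R) <= B * ((p && q)%:R - (p && r)%:R).
Proof.
by case: p; case: q; case: r => /= P2 P3;
  rewrite ?(subr0, sub0r, subrr, mulr0, mulr1, mulrN1, lerN2) ?lexx// ?P2 ?P3.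
Qed.

Section entropy.
Context {R : realType}.
Local Notation leb1 := (@lebesgue_measure R).
Local Notation ig1 f := (leb1.-integrable setT (EFin \o f)).
Variables (lam eta m : R).
Hypotheses (lam_gt0 : 0 < lam) (eta_gt0 : 0 < eta) (m_gt1 : 1 < m).
Let m0 : 0 < m. Proof. by apply: lt_trans m_gt1. Qed.
Let m1 : 0 < m - 1. Proof. by rewrite subr_gt0. Qed.
Local Notation DLF := (DLF lam eta m).

(** The coefficient of the power term in [hfun]. *)
Definition kp : R := eta * m / (m - 1).
Definition ez (r : R) : R := expR (kp * pw (m - 1) r / lam).
(* gz (u x) * wt C x = exp ((h (u x) + Psi x - C) / lam), with wt as in EntropyWeights. *)
Definition gz (r : R) : R := r * ez r.
(** The logarithmic derivative of [gz] is h'(r) / lam = DLF r / (lam r); multiplying by [gz] removes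
    the singularity at r = 0. *)
Definition dgz (r : R) : R := ez r * (DLF r / lam).

Lemma kp_gt0 : 0 < kp.
Proof. by rewrite divr_gt0// mulr_gt0. Qed.

Lemma ez_gt0 r : 0 < ez r. Proof. exact: expR_gt0. Qed.

Lemma ez_continuous : continuous ez.
Proof.
move=> r; apply: (@continuous_comp R R R (fun r => kp * pw (m - 1) r / lam) expR).
  by apply: cvgMr_tmp; apply: cvgMl_tmp; exact: pw_continuous.
exact: continuous_expR.
Qed.

Lemma ez_le a b : a <= b -> ez a <= ez b.
Proof.
move=> ab; rewrite ler_expR ler_wpM2r ?invr_ge0 ?(ltW lam_gt0)//.
by rewrite ler_wpM2l ?(ltW kp_gt0)// pw_le// ltW.
Qed.

Lemma ez_ge1 r : 1 <= ez r.
Proof.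
rewrite /ez -expR0 ler_expR divr_ge0 ?(ltW lam_gt0)// mulr_ge0 ?(ltW kp_gt0)//.
exact: pw_ge0.
Qed.

Lemma ez0 r : r <= 0 -> ez r = 1.
Proof.
by move=> s0; rewrite /ez /pw (max_idPr s0) powR0 ?gt_eqF// mulr0 mul0r expR0.
Qed.

Lemma ezE r : 0 <= r -> ez r = expR (kp / lam * r `^ (m - 1)).
Proof. by move=> r0; rewrite /ez pwE//; congr expR; ring. Qed.

Lemma ez_ge r : kp * pw (m - 1) r / lam <= ez r.
Proof. by apply: le_trans (expR_ge1Dx _); rewrite lerDr. Qed.

Opaque ez.

Lemma gz_continuous : continuous gz.
Proof. by move=> r; apply: cvgM; [exact: cvg_id|exact: ez_continuous]. Qed.

Lemma dgz_continuous : continuous dgz.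
Proof.
move=> r; apply: cvgM; first exact: ez_continuous.
by apply: cvgMr_tmp; exact: DLF_continuous.
Qed.

Lemma gz_ge0 r : 0 <= r -> 0 <= gz r.
Proof. by move=> r0; apply: mulr_ge0; [exact: r0|apply: ltW; exact: ez_gt0]. Qed.

Lemma gz_le a b : 0 <= a -> a <= b -> gz a <= gz b.
Proof. by move=> a0 ab; apply: ler_pM; [exact: a0|apply: ltW; exact: ez_gt0|exact: ab|exact: ez_le]. Qed.

Lemma gz_lt a b : 0 <= a -> a < b -> gz a < gz b.
Proof.
move=> a0 ab; apply: (@le_lt_trans _ _ (a * ez b)); last by rewrite (ltr_pM2r (ez_gt0 b)).
by apply: (ler_wpM2l a0); apply: ez_le; exact: ltW.
Qed.

(** For r <= 0 the positive part in [pw] makes [gz] the identity, and at 0 the difference quotient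
    is [ez] itself; so [gz] is differentiable everywhere and composes without sign conditions. *)
Lemma is_derive_gz (r : R) : is_derive r 1 gz (dgz r).
Proof.
have pw0 s : s <= 0 -> pw (m - 1) s = 0.
  by move=> s0; rewrite /pw (max_idPr s0) powR0// gt_eqF.
have [r0|r0|->] := ltgtP r 0.
- have e : {near r, id =1 gz}.
    near=> x; rewrite /gz ez0 ?mulr1//.
    by apply: ltW; near: x; exact: lt_nbhsl.
  have -> : dgz r = 1.
    rewrite /dgz (ez0 (ltW r0)) /ChainRule.DLF (pw0 r (ltW r0)) !mulr0 mul1r addr0 divff//.
    by rewrite gt_eqF.
  by apply: (@near_eq_is_derive _ _ _ id); exact: e.
- pose q x := x * expR (kp / lam * x `^ (m - 1)).
  have e : {near r, q =1 gz}.
    near=> x; have x0 : 0 < x by near: x; exact: lt_nbhsr.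
    by rewrite /q /gz ezE ?ltW.
  apply: (@near_eq_is_derive _ _ _ q); first exact: e.
  have h1 := is_deriveM (is_derive_cst (kp / lam : R) r 1) (is_derive1_powR (m - 1) r0).
  have h2 := @is_derive1_comp R expR _ r _ _ (is_derive_expR _) h1.
  have h3 := is_deriveM (is_derive_id r 1) h2.
  apply: (@is_derive_eq _ _ _ _ _ _ _ _ h3).
  rewrite /dgz (ezE (ltW r0)) /ChainRule.DLF /GRing.scale /= mulr0 addr0 mulr1 pwE ?(ltW r0)//.
  rewrite -[X in eta * (m * X)](mulr_powRB1 (ltW r0) m1).
  move: (expR _) (r `^ _) => E Q; rewrite /kp; field.
  by rewrite !gt_eqF.
have -> : dgz 0 = ez 0.
  by rewrite /dgz /ChainRule.DLF pw0// !mulr0 addr0 divff ?mulr1// gt_eqF.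
have c : h^-1 *: ((gz \o shift 0) (h *: (1 : R)) - gz 0) @[h --> 0^'] --> ez 0.
  have E : {near 0^', (fun h : R => ez h) =1 (fun h => h^-1 *: ((gz \o shift 0) (h *: (1 : R)) - gz 0))}.
    near=> h; rewrite /= addr0 /GRing.scale /= mulr1 /gz mul0r subr0 mulKf//.
    by near: h; exact: nbhs_dnbhs_neq.
  apply: cvg_trans (near_eq_cvg E) _.
  by apply: cvg_within_filter; exact: ez_continuous.
by apply: DeriveDef; [exact: cvgP c|exact/cvg_lim].
Unshelve. all: by end_near. Qed.

Definition PP (z : R) : R := z / (1 + z).

Lemma PPE z : 0 <= z -> PP z = 1 - (1 + z)^-1.
Proof. by move=> z0; rewrite /PP; field; rewrite gt_eqF// ltr_wpDr. Qed.

Lemma PP_ge0 z : 0 <= z -> 0 <= PP z.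
Proof. by move=> z0; rewrite divr_ge0// addr_ge0. Qed.

Lemma PP_le1 z : 0 <= z -> PP z <= 1.
Proof. by move=> z0; rewrite PPE// gerBl invr_ge0 addr_ge0. Qed.

Lemma PP_le a b : 0 <= a -> a <= b -> PP a <= PP b.
Proof.
move=> a0 ab; have b0 := le_trans a0 ab; rewrite !PPE// lerD2l lerN2 lef_pV2 ?posrE ?ltr_wpDr//.
by rewrite lerD2l.
Qed.

Lemma is_derive_PP (z : R) : 0 <= z -> is_derive z 1 PP ((1 + z) ^- 2).
Proof.
move=> z0; have zn : 1 + z != 0 by rewrite gt_eqF// ltr_wpDr.
have h1 : is_derive z 1 (fun x : R => 1 + x) (1 : R).
  have H := is_deriveD (is_derive_cst (1 : R) z 1) (is_derive_id z 1).
  by apply: (@is_derive_eq _ _ _ _ _ _ _ _ H); rewrite add0r.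
have h2 := @is_deriveV R _ z 1 _ zn h1.
have h3 := is_deriveM (is_derive_id z 1) h2.
apply: (@is_derive_eq _ _ _ _ _ _ _ _ h3).
by rewrite /GRing.scale /= mulr1; field.
Qed.

Local Notation Icc a b := (\1_(`[a, b] : set R) : R -> R).

(** Convex in r >= 0, with derivative [PP (gz r * w)] in [0, 1]. The maximum makes the logistic
    factor continuous on the whole line without changing the integral. *)
Definition PH (w r : R) : R := (\int[leb1]_s (Icc 0 r s * PP (gz (Num.max s 0) * w)))%R.

Lemma PH_meas1 w : 0 <= w -> measurable_fun setT (fun s : R => PP (gz (Num.max s 0) * w)).
Proof.
move=> w0; apply: continuous_measurable_fun => s.
have c : continuous (fun s : R => gz (Num.max s 0) * w).
  move=> x; apply: cvgMr_tmp; apply: (@continuous_comp R R R (fun x => Num.max x 0) gz).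
    by apply: (@continuous_max R R id (cst 0)); [exact: cvg_id|exact: cvg_cst].
  exact: gz_continuous.
apply: cvgM; first exact: c.
apply: cvgV; last by apply: cvgD; [exact: cvg_cst|exact: c].
by rewrite gt_eqF// ltr_wpDr// mulr_ge0// gz_ge0// le_max lexx orbT.
Qed.

Lemma PH_ig w r : 0 <= w -> ig1 (fun s => Icc 0 r s * PP (gz (Num.max s 0) * w)).
Proof.
move=> w0; apply: (@ig_le _ _ _ leb1 _ (Icc 0 r)).
- by apply: measurable_funM; [exact: measurable_indic|exact: PH_meas1].
- move=> s; have z0 : 0 <= gz (Num.max s 0) * w.
    by rewrite mulr_ge0// gz_ge0// le_max lexx orbT.
  have p0 : 0 <= Icc 0 r s by rewrite indicE.
  have p1 := PP_ge0 z0.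
  by rewrite (ger0_norm (mulr_ge0 p0 p1)); apply: (ler_piMr p0); exact: PP_le1.
- exact: ig_Icc.
Qed.

Lemma PH_step w a b (s : R) : 0 <= w -> 0 <= a -> 0 <= b ->
  PP (gz (Num.max s 0) * w) * (Icc 0 b s - Icc 0 a s) <= PP (gz b * w) * (Icc 0 b s - Icc 0 a s).
Proof.
move=> w0 a0 b0; rewrite !IccE.
have P1 c : 0 <= c -> 0 <= gz c * w by move=> c0; apply: mulr_ge0 => //; exact: gz_ge0.
have P2 : 0 <= s -> s <= b -> PP (gz (Num.max s 0) * w) <= PP (gz b * w).
  move=> s0 sb; rewrite (max_idPl s0); apply: PP_le; first exact: P1.
  by apply: (ler_wpM2r w0); exact: gz_le.
have P3 : 0 <= s -> ~~ (s <= b) -> PP (gz b * w) <= PP (gz (Num.max s 0) * w).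
  rewrite -ltNge => s0 bs; rewrite (max_idPl s0); apply: PP_le; first exact: P1.
  by apply: (ler_wpM2r w0); apply: gz_le => //; exact: ltW.
exact: bool_step P2 P3.
Qed.

(** The integrand between a and b is compared with its value at b, in either order of a and b. This
    supporting line is the only form in which the derivative of [PH] is used. *)
Lemma PH_convex w a b : 0 <= w -> 0 <= a -> 0 <= b ->
  PH w b - PH w a <= PP (gz b * w) * (b - a).
Proof.
move=> w0 a0 b0; rewrite /PH -RintB; [|exact: PH_ig|exact: PH_ig].
have -> : PP (gz b * w) * (b - a) = (\int[leb1]_s (PP (gz b * w) * (Icc 0 b s - Icc 0 a s)))%R.
  rewrite RintZ; last by apply: igB; exact: ig_Icc.
  rewrite RintB; [|exact: ig_Icc|exact: ig_Icc].
  by rewrite !Rint_Icc// !subr0.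
apply: Rint_le.
- by apply: igB; exact: PH_ig.
- by apply/igZ/igB; exact: ig_Icc.
move=> s; rewrite -mulrBl mulrC; exact: PH_step.
Qed.

Lemma PH0 w : PH w 0 = 0.
Proof.
rewrite /PH; transitivity (\int[leb1]_s (0 : R))%R; last exact: Rint0.
apply: eq_Rintegral => s _; rewrite IccE.
case: (boolP (0 <= (s : R) <= 0)) => h; last by rewrite mul0r.
have -> : s = 0 by apply/eqP; rewrite eq_le andbC.
by rewrite maxxx /gz mul0r mul0r /PP mul0r mulr0.
Qed.

Lemma PH_ge0 w r : 0 <= w -> 0 <= PH w r.
Proof.
move=> w0; apply: Rint_ge0 => s; apply: mulr_ge0 => //; apply: PP_ge0.
by rewrite mulr_ge0// gz_ge0// le_max lexx orbT.
Qed.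

Lemma PH_le_phi w r : 0 <= w -> 0 <= r -> PH w r <= PP (gz r * w) * r.
Proof. by move=> w0 r0; have := PH_convex w0 (lexx 0) r0; rewrite PH0 !subr0. Qed.

Lemma PH_le w r : 0 <= w -> 0 <= r -> PH w r <= r.
Proof.
move=> w0 r0; apply: le_trans (PH_le_phi w0 r0) _.
by rewrite ler_piMl// PP_le1// mulr_ge0// gz_ge0.
Qed.

Lemma PH_lip w a b : 0 <= w -> 0 <= a -> 0 <= b -> `|PH w a - PH w b| <= `|a - b|.
Proof.
move=> w0; wlog ba : a b / b <= a => [h a0 b0|a0 b0].
  have [ba|ab] := leP b a; first exact: h.
  by rewrite distrC [leRHS]distrC; apply: h => //; exact: ltW.
rewrite [leRHS]ger0_norm ?subr_ge0// ler_norml; apply/andP; split.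
  rewrite lerNl opprB; apply: le_trans (PH_convex w0 a0 b0) _.
  apply: (@le_trans _ _ 0); last by rewrite subr_ge0.
  rewrite mulr_ge0_le0 ?subr_le0//; apply: PP_ge0; apply: mulr_ge0 => //; exact: gz_ge0.
apply: le_trans (PH_convex w0 b0 a0) _.
by rewrite ler_piMl ?subr_ge0// PP_le1// mulr_ge0// gz_ge0.
Qed.

(** The supporting line at U, where z = 1 and the slope is 1/2. *)
Lemma PH_lower w U r : 0 <= w -> 0 <= U -> gz U * w = 1 -> 0 <= r -> (r - U) / 2 <= PH w r.
Proof.
move=> w0 U0 E r0; have := PH_convex w0 r0 U0; rewrite E /PP -[1 + 1]/(2%:R) mul1r.
have := PH_ge0 U w0; move: (PH w U) (PH w r) => A B; lra.
Qed.

End entropy.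

End EntropyKernel.
Import EntropyKernel.

(** * Partial derivatives of the logistic function and their bounds *)

Module EntropyDerivatives.

Opaque ez.

Lemma cvg_cont_seq (R : realType) (h : R -> R) (s : nat -> R) (l : R) : continuous h ->
  s n @[n --> \oo] --> l -> h (s n) @[n --> \oo] --> h l.
Proof. by move=> ch sl; exact: (@cvg_comp _ _ _ s h \oo (nbhs l) _ sl (ch l)). Qed.

Lemma cvg_sqV (R : realType) (a : nat -> R) (b : R) : b != 0 ->
  a n @[n --> \oo] --> b -> ((a n) ^+ 2)^-1 @[n --> \oo] --> (b ^+ 2)^-1.
Proof.
move=> b0 ab; apply: cvgV; first by rewrite expf_neq0.
by rewrite expr2; under eq_fun do rewrite expr2; exact: cvgM.
Qed.

Section entropy_bounds.
Context {R : realType}.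
Variables (lam eta m : R).
Hypotheses (lam_gt0 : 0 < lam) (eta_gt0 : 0 < eta) (m_gt1 : 1 < m).
Let m0 : 0 < m. Proof. by apply: lt_trans m_gt1. Qed.
Let m1 : 0 < m - 1. Proof. by rewrite subr_gt0. Qed.
Local Notation DLF := (DLF lam eta m).
Local Notation gz := (gz lam eta m).
Local Notation dgz := (dgz lam eta m).
Local Notation ez := (ez lam eta m).
Local Notation kp := (kp eta m).

Let ez0 r : 0 < ez r := ez_gt0 lam eta m r.
Let gz0 r : 0 <= r -> 0 <= gz r := @gz_ge0 _ lam eta m r.

Let cgz : continuous gz. Proof. by apply: gz_continuous. Qed.

Let cdgz : continuous dgz. Proof. by apply: dgz_continuous. Qed.

(** [phi] is the derivative of the entropy density; [phr] is its derivative in r, and [lamb] its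
    derivative with respect to Psi, which enters through the weight w. *)
Definition phi (w r : R) : R := PP (gz r * w).
Definition lamb (w r : R) : R := gz r * w / (1 + gz r * w) ^+ 2 / lam.
Definition phr (w r : R) : R := w * dgz r / (1 + gz r * w) ^+ 2.

Lemma dgz_gt0 r : 0 < dgz r.
Proof. by apply: mulr_gt0 => //; apply: divr_gt0 => //; exact: DLF_gt0. Qed.

(** This cancellation makes the gradient of phi(u) proportional to the flux: phr grad u + lamb grad
    Psi = lamb j / u. *)
Lemma phr_lamb w r : phr w r * r = lamb w r * DLF r.
Proof.
rewrite /phr /lamb /EntropyKernel.gz /EntropyKernel.dgz; move: (ez r) (DLF r) (_ ^+ 2)^-1 => E D Q.
by field; rewrite gt_eqF.
Qed.

Lemma lamb_ge0 w r : 0 <= w -> 0 <= r -> 0 <= lamb w r.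
Proof.
move=> w0 r0; have z0 : 0 <= gz r * w by apply: mulr_ge0 => //; exact: gz0.
by rewrite !divr_ge0// ?(ltW lam_gt0)// exprn_ge0// addr_ge0.
Qed.

Lemma phr_ge0 w r : 0 <= w -> 0 <= r -> 0 <= phr w r.
Proof.
move=> w0 r0; have z0 : 0 <= gz r * w by apply: mulr_ge0 => //; exact: gz0.
apply: divr_ge0; last by rewrite exprn_ge0// addr_ge0.
by apply: mulr_ge0 => //; apply: ltW; exact: dgz_gt0.
Qed.

Lemma phi_ge0 w r : 0 <= w -> 0 <= r -> 0 <= phi w r.
Proof. by move=> w0 r0; apply: PP_ge0; apply: mulr_ge0 => //; exact: gz0. Qed.

Lemma phi_le1 w r : 0 <= w -> 0 <= r -> phi w r <= 1.
Proof. by move=> w0 r0; apply: PP_le1; apply: mulr_ge0 => //; exact: gz0. Qed.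

(** The quadratic denominator absorbs the linear growth in z that [DLF_le_z] allows for [DLF]. *)
Lemma sq_frac_le (a b z : R) : 0 <= a -> 0 <= b -> 0 <= z ->
  z / (1 + z) ^+ 2 * (a + b * z) <= a + b.
Proof.
move=> a0 b0 z0; have p : 0 < 1 + z by rewrite ltr_wpDr.
rewrite mulrAC ler_pdivrMr ?exprn_gt0//; nra.
Qed.

(* z = r * ez r * w grows at least like r^(m-1), which compensates DLF. *)
Lemma DLF_le_z (w1 w r : R) : 0 < w1 -> w1 <= w -> 0 <= r ->
  DLF r <= (lam + eta * m) + (m - 1) * lam / w1 * (gz r * w).
Proof.
move=> w10 w1w r0; have w0 : 0 <= w by apply: le_trans w1w; exact: ltW.
rewrite /ChainRule.DLF -addrA lerD2l; have c0 : 0 <= (m - 1) * lam / w1.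
  by rewrite divr_ge0 ?mulr_ge0 ?ltW.
have [r1|r1] := leP r 1.
  apply: (@le_trans _ _ (eta * m)).
    rewrite (ler_pM2l eta_gt0) ler_piMr ?(ltW m0)//.
    by apply: le_trans (pw_le (ltW m1) r1) _; rewrite pwE// powR1.
  by rewrite lerDl; apply: mulr_ge0 => //; apply: mulr_ge0 => //; exact: gz0.
apply: (@le_trans _ _ ((m - 1) * lam / w1 * (gz r * w))); last first.
  by rewrite lerDr mulr_ge0 ?ltW.
have h : kp * pw (m - 1) r / lam <= ez r := ez_ge lam eta m r.
have h2 : kp * pw (m - 1) r / lam * w1 <= gz r * w.
  apply: (@le_trans _ _ (ez r * w1)); first by rewrite (ler_pM2r w10).
  apply: ler_pM => //; [exact: ltW|exact: ltW|].
  by rewrite /EntropyKernel.gz ler_peMl// ltW.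
have h3 : (m - 1) * lam / w1 * (kp * pw (m - 1) r / lam * w1) <= (m - 1) * lam / w1 * (gz r * w).
  exact: ler_wpM2l.
apply: le_trans h3; rewrite le_eqVlt; apply/orP; left; apply/eqP.
by rewrite /EntropyKernel.kp; move: (pw _ _) => Q; field; rewrite !gt_eqF.
Qed.

(** Uniform for weights between w1 > 0 and w2, hence on cubes. For r <= 1 one uses z = O(r); for r >
    1 the bounds follow from those of [lamb] and of [phr * r], the latter by [phr_lamb] and
    [DLF_le_z]. *)
Lemma entropy_bounds (w1 w2 : R) : 0 < w1 -> exists2 K : R, 0 < K &
  forall w r, w1 <= w -> w <= w2 -> 0 <= r ->
   [/\ lamb w r <= K, lamb w r <= K * r, phr w r <= K & phr w r * r <= K].
Proof.
move=> w10.
pose a := lam + eta * m; pose b := (m - 1) * lam / w1.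
have a0 : 0 <= a by rewrite addr_ge0 ?mulr_ge0 ?ltW.
have b0 : 0 <= b by rewrite divr_ge0 ?mulr_ge0 ?ltW.
pose W := `|w2|; have W0 : 0 <= W by rewrite /W.
have e1 : 0 <= ez 1 by exact: ltW.
pose K := lam^-1 * (1 + ez 1 * W + (a + b) + ez 1 * W * a).
have t1 : 0 <= ez 1 * W by exact: mulr_ge0.
have t2 : 0 <= ez 1 * W * a by exact: mulr_ge0.
have il : 0 < lam^-1 by rewrite invr_gt0.
have K0 : 0 < K.
  by apply: mulr_gt0 => //; apply: ltr_wpDr => //; apply: ltr_wpDr; [exact: addr_ge0|exact: ltr_wpDr].
exists K => // w r w1w ww2 r0.
have w0 : 0 <= w by apply: le_trans w1w; exact: ltW.
have wW : w <= W by apply: le_trans ww2 _; exact: ler_norm.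
have z0 : 0 <= gz r * w by apply: mulr_ge0 => //; exact: gz0.
have zle : r <= 1 -> gz r * w <= r * (ez 1 * W).
  move=> r1; rewrite /EntropyKernel.gz -mulrA; apply: (ler_wpM2l r0); apply: ler_pM; [exact: ltW|exact: w0| |exact: wW].
  exact: ez_le.
have DL := DLF_le_z w10 w1w r0; rewrite -/a -/b in DL.
have Lz : lamb w r <= lam^-1 * (gz r * w).
  rewrite /lamb mulrC (ler_pM2l il) ler_pdivrMr ?exprn_gt0 ?ltr_wpDr//.
  by rewrite ler_peMr// exprn_ege1// lerDl.
have L1 : lamb w r <= lam^-1.
  rewrite /lamb -[leRHS]mul1r; apply: (ler_wpM2r (ltW il)).
  rewrite ler_pdivrMr ?exprn_gt0 ?ltr_wpDr// mul1r.
  move: (gz r * w) z0 => z z0; nra.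
have PR : phr w r * r <= lam^-1 * (a + b).
  rewrite phr_lamb /lamb; move: (gz r * w) z0 DL => z z0 DL.
  have h := sq_frac_le a0 b0 z0.
  rewrite mulrAC [leLHS]mulrC (ler_pM2l il); apply: le_trans h.
  by apply: ler_wpM2l => //; rewrite divr_ge0// exprn_ge0// addr_ge0.
have Kge (c : R) : c <= 1 + ez 1 * W + (a + b) + ez 1 * W * a -> lam^-1 * c <= K.
  by move=> h; rewrite (ler_pM2l il).
split.
- by apply: le_trans L1 _; rewrite -[leLHS]mulr1; apply: Kge; move: t1 t2 a0 b0; lra.
- have [r1|r1] := leP r 1.
    apply: le_trans Lz _; apply: (@le_trans _ _ (lam^-1 * (r * (ez 1 * W)))).
      by rewrite (ler_pM2l il); exact: zle.
    rewrite mulrCA mulrC; apply: (ler_wpM2r r0); apply: Kge.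
    by move: t1 t2 a0 b0; lra.
  apply: le_trans L1 _; apply: (@le_trans _ _ K).
    by rewrite -[leLHS]mulr1; apply: Kge; move: t1 t2 a0 b0; lra.
  by rewrite ler_peMr ?ltW.
- have [r1|r1] := leP r 1; last first.
    apply: (@le_trans _ _ (phr w r * r)).
      by rewrite ler_peMr ?(ltW r1)//; exact: phr_ge0.
    by apply: (le_trans PR); apply: Kge; move: t1 t2; lra.
  apply: (@le_trans _ _ (lam^-1 * (ez 1 * W * a))); last first.
    by apply: Kge; move: t1 a0 b0; lra.
  rewrite /phr ler_pdivrMr ?exprn_gt0 ?ltr_wpDr//.
  apply: (@le_trans _ _ (lam^-1 * (ez 1 * W * a))); last first.
    by rewrite ler_peMr// ?exprn_ege1 ?lerDl//; apply: mulr_ge0 => //; exact: ltW.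
  have Da : DLF r <= a.
    rewrite /ChainRule.DLF lerD2l (ler_pM2l eta_gt0) ler_piMr ?(ltW m0)//.
    by apply: le_trans (pw_le (ltW m1) r1) _; rewrite pwE// powR1.
  have D0 : 0 <= DLF r by apply: ltW; exact: DLF_gt0.
  have e2 : ez r <= ez 1 by exact: ez_le.
  have h1 : ez r * w <= ez 1 * W := ler_pM (ltW (ez0 r)) w0 e2 wW.
  have h0 : 0 <= ez r * w := mulr_ge0 (ltW (ez0 r)) w0.
  have h2 : ez r * w * DLF r <= ez 1 * W * a.
    exact: ler_pM h0 D0 h1 Da.
  rewrite /EntropyKernel.dgz (_ : w * _ = lam^-1 * (ez r * w * DLF r)); last by ring.
  by rewrite (ler_pM2l il).
- by apply: (le_trans PR); apply: Kge; move: t1 t2; lra.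
Qed.

Lemma ent_den w r : 0 <= w -> 0 <= r -> 0 < 1 + gz r * w.
Proof. by move=> w0 r0; apply: ltr_wpDr => //; apply: mulr_ge0 => //; exact: gz0. Qed.

Section limits.
Variables (w : R) (s : nat -> R) (l : R).
Hypotheses (w0 : 0 <= w) (l0 : 0 <= l) (sl : s n @[n --> \oo] --> l).

Let gzl : gz (s n) @[n --> \oo] --> gz l.
Proof. exact: cvg_cont_seq cgz sl. Qed.

Let dgzl : dgz (s n) @[n --> \oo] --> dgz l.
Proof. exact: cvg_cont_seq cdgz sl. Qed.

Let zl : gz (s n) * w @[n --> \oo] --> gz l * w.
Proof. by apply: cvgMr_tmp; exact: gzl. Qed.

Let zl1 : 1 + gz (s n) * w @[n --> \oo] --> 1 + gz l * w.
Proof. by apply: cvgD; [exact: cvg_cst|exact: zl]. Qed.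

Let denl : (1 + gz (s n) * w)^-1 @[n --> \oo] --> (1 + gz l * w)^-1.
Proof.
apply: cvgV; first by rewrite gt_eqF// ent_den.
exact: zl1.
Qed.

Let den2l : ((1 + gz (s n) * w) ^+ 2)^-1 @[n --> \oo] --> ((1 + gz l * w) ^+ 2)^-1.
Proof.
apply: cvg_sqV zl1; by rewrite gt_eqF// ent_den.
Qed.

Lemma phi_cvg : phi w (s n) @[n --> \oo] --> phi w l.
Proof. exact: cvgM zl denl. Qed.

Lemma lamb_cvg : lamb w (s n) @[n --> \oo] --> lamb w l.
Proof. by apply: cvgMr_tmp; exact: cvgM zl den2l. Qed.

Lemma phr_cvg : phr w (s n) @[n --> \oo] --> phr w l.
Proof. by apply: (@cvgM _ _ _ _ (fun n => w * dgz (s n))); [apply: cvgMl_tmp; exact: dgzl|exact: den2l]. Qed.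

End limits.

Section measurability.
Context dd (T : measurableType dd).
Variables (w r : T -> R).
Hypotheses (mw : measurable_fun setT w) (mr : measurable_fun setT r)
  (w0 : forall x, 0 <= w x) (r0 : forall x, 0 <= r x).

Let mz : measurable_fun setT (fun x => gz (r x) * w x).
Proof.
apply: measurable_funM => //; apply: (@measurableT_comp _ _ _ _ _ _ gz _ r) => //.
exact: continuous_measurable_fun cgz.
Qed.

Let mden : measurable_fun setT (fun x => (1 + gz (r x) * w x)^-1).
Proof.
apply: measurable_invge0; first exact: measurable_funD (measurable_cst _) mz.
by move=> x; apply: ltW; exact: ent_den.
Qed.

Let mden2 : measurable_fun setT (fun x => ((1 + gz (r x) * w x) ^+ 2)^-1).
Proof. by under eq_fun do rewrite -exprVn; exact: measurable_funX _ mden. Qed.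

Lemma phi_meas : measurable_fun setT (fun x => phi (w x) (r x)).
Proof. exact: measurable_funM mz mden. Qed.

Lemma lamb_meas : measurable_fun setT (fun x => lamb (w x) (r x)).
Proof. by apply: measurable_funM => //; exact: measurable_funM mz mden2. Qed.

Lemma phr_meas : measurable_fun setT (fun x => phr (w x) (r x)).
Proof.
apply: (measurable_funM _ mden2); apply: (measurable_funM mw).
apply: (@measurableT_comp _ _ _ _ _ _ dgz _ r) => //.
exact: continuous_measurable_fun cdgz.
Qed.

End measurability.

End entropy_bounds.

End EntropyDerivatives.
Import EntropyDerivatives.

(** * Time increments of the mollified solution *)

Module TimeIncrements.

Opaque ez.

Section parametric.
Context d1 d2 (T1 : measurableType d1) (T2 : measurableType d2) (R : realType).
Variable m2 : {sigma_finite_measure set T2 -> \bar R}.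

Lemma param_meas (F : T1 * T2 -> R) : measurable_fun setT F ->
  measurable_fun setT (fun x => (\int[m2]_y F (x, y))%R).
Proof.
move=> mF; have mE : measurable_fun setT (EFin \o F) by exact/measurable_EFinP.
have h x : (\int[m2]_y F (x, y))%R = fine (\int[m2]_y ((EFin \o F)^\+ (x, y)) - \int[m2]_y ((EFin \o F)^\- (x, y)))%E.
  rewrite /Rintegral integralE; congr (fine (_ - _)%E); apply: eq_integral => y _.
    by rewrite !funeposE.
  by rewrite !funenegE.
under eq_fun do rewrite h.
apply: measurableT_comp => //; apply: emeasurable_funB.
  apply: (@measurable_fun_fubini_tonelli_F _ _ _ _ R m2 ((EFin \o F)^\+)%E) => //.
  exact: measurable_funepos.
apply: (@measurable_fun_fubini_tonelli_F _ _ _ _ R m2 ((EFin \o F)^\-)%E) => //.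
exact: measurable_funeneg.
Qed.

Variable m1 : {sigma_finite_measure set T1 -> \bar R}.

(** Integrability of every section is assumed, so that the real inner integrals are genuine at every
    point. *)
Lemma Rint_fubini (F : T1 * T2 -> R) : measurable_fun setT F ->
  (\int[m1]_x \int[m2]_y `|F (x, y)|%:E < +oo)%E ->
  (forall x, m2.-integrable setT (fun y => (F (x, y))%:E)) ->
  (forall y, m1.-integrable setT (fun x => (F (x, y))%:E)) ->
  (\int[m1]_x \int[m2]_y F (x, y) = \int[m2]_y \int[m1]_x F (x, y))%R.
Proof.
move=> mF fin i2 i1.
have mE : measurable_fun setT (EFin \o F) by exact/measurable_EFinP.
have ii : (m1 \x m2)%E.-integrable setT (EFin \o F).
  exact: (@integrable12ltyP _ _ _ _ R m1 m2 (EFin \o F) mE).2.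
have h := Fubini ii.
rewrite /Rintegral; congr fine.
transitivity (\int[m1]_x \int[m2]_y (EFin \o F) (x, y))%E.
  apply: eq_integral => x _; rewrite fineK//.
  by apply: integrable_fin_num => //; exact: i2.
rewrite h; apply: eq_integral => y _; rewrite fineK//.
by apply: integrable_fin_num => //; exact: i1.
Qed.

End parametric.

Section dissipation.
Context {R : realType} (d : nat).
Local Notation V := 'rV[R]_d.
Local Notation mu := (@leb R d).
Local Notation leb1 := (@lebesgue_measure R).
Local Notation ig f := (mu.-integrable setT (EFin \o f)).
Local Notation ig1 f := (leb1.-integrable setT (EFin \o f)).
Local Notation e i := (delta_mx ord0 i : V).
Local Notation ind a b := (\1_(`]a, b] : set R) : R -> R).
Variables (lam eta m : R) (Psi : V -> R) (rho : R -> density R d).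
Hypotheses (lam_gt0 : 0 < lam) (eta_gt0 : 0 < eta) (m_gt1 : 1 < m).
Hypotheses (Psi1 : Ck 1 Psi)
  (rho_cont : forall t : R, 0 <= t ->
     weak_cvg (within (`[0, +oo[ : set R) (nbhs t)) (fun s => dprob (rho s)) (dprob (rho t)))
  (rho_W : forall t : R, 0 < t -> W11loc (fun y => LF lam eta m (rho t y)))
  (rho_weak : forall phi : (R^o * V)%type -> R,
     test_fun [set p : R^o * V | 0 < p.1 :> R] phi ->
     (\int[leb1]_(t in (`]0%R, +oo[ : set R))
       (\int[mu]_y
         (rho t y * derive1 (fun s : R => phi (s, y)) t
          - edot (rho t y *: grad Psi y + wgrad (fun z => LF lam eta m (rho t z)) y)
                 (grad (fun z => phi (t, z)) y)))%R%:E = 0)%E)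
  (rho_energy : forall T : R, 0 < T ->
     (\int[leb1]_(t in (`]0%R, T] : set R)) \int[mu]_y
        (enorm (velocity lam eta m Psi rho t y) ^+ 2 * rho t y)%:E < +oo)%E).
Local Notation LF := (LF lam eta m).
Local Notation uu := (uu rho).
Local Notation GG := (GG lam eta m rho).
Local Notation jj := (jj lam eta m Psi rho).
Local Notation DD := (DD lam eta m Psi rho).
Local Notation Dr := (Dr lam eta m Psi rho).
Implicit Types (kap : V -> R).

Let jl i t : lint (jj i t) := jj_lint Psi1 rho_W i t.
Let mk n : mol (@knl R d n) := @mol_knl R d n.
Let mdk i n : mol ('D_(e i) (@knl R d n)) := mol_derive (e i) (mk n).

(** Indicator of the times of finite flux energy. Multiplied by it, bounds in terms of [Dr] hold at
    every time, and no integral over positive times changes. *)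
Definition gd (t : R) : R := (DD t < +oo)%E%:R.
(** Divergence of the mollified flux, with the derivatives on the kernel; by [U_diff] it is the time
    derivative of u_n. *)
Definition dvJ n t x := \sum_i conv ('D_(e i) (knl n)) (jj i t) x.

Lemma gd_meas : measurable_fun setT gd.
Proof.
have h : measurable_fun setT (fun t => (DD t < +oo)%E).
  by apply: measurable_fun_lte => //; exact: DD_measurable.
exact: (@measurableT_comp _ _ _ _ _ _ (fun b : bool => b%:R : R)) h.
Qed.

Lemma gdP t : gd t = 1 /\ (DD t < +oo)%E \/ gd t = 0.
Proof. by rewrite /gd; case: (boolP (DD t < +oo)%E) => h; [left|right]. Qed.

Lemma conv_jj_le i kap B t x : mol kap -> (forall y, `|kap y| <= B) -> (DD t < +oo)%E ->
  `|conv kap (jj i t) x| <= B * (Dr t + 1).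
Proof.
move=> hk hB Dt; have [igj hj] := jj_ig lam_gt0 eta_gt0 m_gt1 Psi1 rho_W i Dt.
have B0 : 0 <= B by apply: le_trans (hB 0).
have ic := ig_conv x hk (jl i t).
apply: (le_trans (Rint_norm ic)).
apply: (@le_trans _ _ (\int[mu]_y (B * `|jj i t y|))%R); last first.
  by rewrite RintZ; [rewrite ler_wpM2l|exact: ig_norm].
apply: Rint_le; [exact/ig_norm|exact/igZ/ig_norm|].
by move=> y; rewrite normrM ler_wpM2r.
Qed.

Lemma dvJ_bound n : exists2 B : R, 0 <= B & forall t x, (DD t < +oo)%E ->
  `|dvJ n t x| <= B * (Dr t + 1).
Proof.
have h i : exists B : R, 0 <= B /\ forall y : V, `|'D_(e i) (knl n) y| <= B.
  by have [B B0 hB] := mol_bounded (mdk i n); exists B.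
have [b hb] := choice h; exists (\sum_i b i); first by apply: sumr_ge0 => i _; have [] := hb i.
move=> t x Dt; rewrite mulr_suml; apply: (le_trans (ler_norm_sum _ _ _)).
by apply: ler_sum => i _; apply: conv_jj_le => //; have [] := hb i.
Qed.

Lemma dvJ_meas n : measurable_fun setT (fun p : R * V => dvJ n p.1 p.2).
Proof. by apply: measurable_sum => i; apply: jj_conv_measurable => //; exact: mdk. Qed.

Lemma dvJ_meas1 n x : measurable_fun setT (fun t : R => dvJ n t x).
Proof. by have := measurableT_comp (dvJ_meas n) (@measurable_pair2 _ _ _ _ x); exact. Qed.

Lemma dvJ_cont n t : continuous (dvJ n t).
Proof.
have H (s : seq 'I_d) : continuous (fun x => \sum_(i <- s) conv ('D_(e i) (knl n)) (jj i t) x).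
  elim: s => [|i s IH].
    by under eq_fun do rewrite big_nil; exact: cont_cst.
  under eq_fun do rewrite big_cons; apply: contD => //.
  by apply: conv_continuous => //; exact: mdk.
exact: H.
Qed.

(** [weak_time] for the kernel reflected at x; the minus signs from [weak_time] and from the
    reflection cancel. *)
Lemma U_diff n x s t : 0 < s -> s < t ->
  moll n (uu t) x - moll n (uu s) x = \int[leb1]_z (ind s t z * (gd z * dvJ n z x)).
Proof.
move=> s0 st; pose kap (y : V) := knl n (x - y).
have sk : smooth kap by apply: smooth_refl; exact: (mk n).1.
have hk y : `|x| + 1 < `|y| -> kap y = 0 by move=> h; exact: (mol_shift0 (mk n)).
have [_ E] := weak_time lam_gt0 eta_gt0 m_gt1 Psi1 rho_cont rho_W rho_weak rho_energy sk hk s0 st.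
have t0 : 0 < t by apply: lt_trans st.
transitivity (Mk rho kap t - Mk rho kap s) => //; rewrite E.
have N z : Nk lam eta m Psi rho kap z = - dvJ n z x.
  rewrite (NkE Psi1 rho_W sk hk) /dvJ -sumrN; apply: eq_bigr => i _.
  rewrite /conv -(RintN (ig_conv x (mdk i n) (jl i z))).
  apply: eq_Rintegral => y _; rewrite /kap derive_refl ?mulNr//.
  exact: (mol_differentiable _ (mk n)).
have -> : (\int[leb1]_z (ind s t z * Nk lam eta m Psi rho kap z) = \int[leb1]_z (- (ind s t z * dvJ n z x)))%R.
  by apply: eq_Rintegral => z _; rewrite N mulrN.
have mi : measurable_fun setT (fun z : R => ind s t z * dvJ n z x).
  by apply: measurable_funM; [exact: measurable_indic|exact: dvJ_meas1].
have mg : measurable_fun setT (fun z : R => ind s t z * (gd z * dvJ n z x)).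
  apply: measurable_funM; first exact: measurable_indic.
  by apply: measurable_funM; [exact: gd_meas|exact: dvJ_meas1].
have [iN _] := weak_time lam_gt0 eta_gt0 m_gt1 Psi1 rho_cont rho_W rho_weak rho_energy sk hk s0 st.
have iD : ig1 (fun z => ind s t z * dvJ n z x).
  have := igN iN; congr (leb1.-integrable _ _); apply/funext => z /=.
  by rewrite N mulrN opprK.
rewrite RintN// opprK; apply: (@Rint_ae _ _ _ leb1 _ _ mi mg).
have := DD_ae lam_gt0 eta_gt0 m_gt1 Psi1 rho_cont rho_W rho_energy t0.
apply: (@filterS _ (almost_everywhere leb1) _) => z hz.
rewrite indE; have [/andP[h1 h2]|_] := boolP (s < z <= t); last by rewrite !mul0r.
by congr (_ * _); rewrite /gd (hz (lt_trans s0 h1) h2) mul1r.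
Qed.

Lemma ind_Dr_ig s t c : 0 <= s -> 0 < t -> ig1 (fun z => ind s t z * (c * (Dr z + 1))).
Proof.
move=> s0 t0.
have i0 : ig1 (fun z => `|c| * (ind 0 t z * Dr z + ind 0 t z)).
  apply/igZ/igD; first exact: (Dr_ig lam_gt0 eta_gt0 m_gt1 Psi1 rho_cont rho_W rho_energy t0).
  apply: ig_ge0P => //; rewrite integral_indic// setIT.
  by have := @lebesgue_measure_itv R `]0, t]; rewrite /= lte_fin t0 => ->; rewrite -EFinB ltry.
apply: (ig_le _ _ i0).
  apply: measurable_funM; first exact: measurable_indic.
  apply: measurable_funM => //; apply: measurable_funD => //; exact: Dr_meas.
move=> z; have D0 : 0 <= Dr z := Dr_ge0 lam eta m Psi rho z.
rewrite (indE s t) (indE 0 t); have [/andP[h1 h2]|_] := boolP (s < z <= t).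
  rewrite (le_lt_trans s0 h1) h2 !mul1r normrM ler_wpM2l// ger0_norm// addr_ge0//.
rewrite mul0r normr0 mulr_ge0// addr_ge0// ?mulr_ge0//.
Qed.

(** Fubini in time and space. The bound B (Dr + 1) on [dvJ] is integrable in time but merely
    constant in space, hence the bounded support of zeta. *)
Lemma zeta_int n (zeta : V -> R) M r0 s t : measurable_fun setT zeta -> 0 <= r0 ->
  (forall x, `|zeta x| <= M * \1_(cube r0) x) -> 0 < s -> s < t ->
  (\int[mu]_x (zeta x * (moll n (uu t) x - moll n (uu s) x)) =
   \int[leb1]_z (ind s t z * (gd z * \int[mu]_x (zeta x * dvJ n z x))))%R.
Proof.
move=> mz r00 hz s0 st; have t0 : 0 < t by apply: lt_trans st.
have [B B0 hB] := dvJ_bound n.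
have M0 : 0 <= M.
  have := hz 0; rewrite indicE mem_set ?mulr1; first exact: le_trans.
  by rewrite /cube /= normr0.
have iC : ig (\1_(@cube R d r0) : V -> R).
  apply: ig_ge0P => //; first by apply: measurable_indic; exact: measurable_cube.
  rewrite integral_indic//; last exact: measurable_cube.
  by rewrite setIT; exact: leb_cube.
pose F (p : R * V) : R := ind s t p.1 * (gd p.1 * (zeta p.2 * dvJ n p.1 p.2)).
have mF : measurable_fun setT F.
  apply: measurable_funM.
    have mi : measurable_fun setT (ind s t) by exact: measurable_indic.
    exact: (measurableT_comp mi measurable_fst).
  apply: measurable_funM; first exact: (measurableT_comp gd_meas measurable_fst).
  apply: measurable_funM; last exact: dvJ_meas.
  exact: (measurableT_comp mz measurable_snd).
have FB p : `|F p| <= ind s t p.1 * (M * B * (Dr p.1 + 1)) * \1_(cube r0) p.2.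
  have D0 : 0 <= Dr p.1 := Dr_ge0 lam eta m Psi rho p.1.
  rewrite /F normrM ger0_norm// -mulrA ler_wpM2l//.
  have [[-> Dt]|->] := gdP p.1; last first.
    by rewrite mul0r normr0 !mulr_ge0// addr_ge0.
  rewrite mul1r normrM (_ : M * B * _ * _ = M * \1_(cube r0) p.2 * (B * (Dr p.1 + 1))); last by ring.
  by apply: ler_pM => //; exact: hB.
have mF1 z : measurable_fun setT (fun x => F (z, x)).
  by have := measurableT_comp mF (@measurable_pair1 _ _ _ _ z); exact.
have mF2 x : measurable_fun setT (fun z => F (z, x)).
  by have := measurableT_comp mF (@measurable_pair2 _ _ _ _ x); exact.
have i1 z : mu.-integrable setT (fun x => (F (z, x))%:E).
  apply: (@ig_le _ _ _ mu (fun x => F (z, x)) _ (mF1 z) (fun x => FB (z, x))).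
  exact: (igZ (ind s t z * (M * B * (Dr z + 1))) iC).
have iI := ind_Dr_ig (M * B) (ltW s0) t0.
have i2 x : leb1.-integrable setT (fun z => (F (z, x))%:E).
  apply: (@ig_le _ _ _ leb1 (fun z => F (z, x)) _ (mF2 x) (fun z => FB (z, x))).
  have := igZ (\1_(cube r0) x) iI; congr (leb1.-integrable _ _); apply/funext => z /=.
  by congr EFin; rewrite mulrC.
have fin : (\int[leb1]_z \int[mu]_x `|F (z, x)|%:E < +oo)%E.
  pose c := (\int[mu]_x \1_(@cube R d r0) x)%R.
  have icc := igZ c iI.
  apply: le_lt_trans (ig_lty icc).
  apply: ge0_le_integral => //.
  - by move=> z _; apply: integral_ge0.
  - apply: (@measurable_fun_fubini_tonelli_F _ _ _ _ R mu (fun p => `|F p|%:E)) => //.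
    by apply/measurable_EFinP; exact: measurableT_comp.
  - exact: (measurable_int _ icc).
  move=> z _; apply: (@le_trans _ _ (\int[mu]_x (ind s t z * (M * B * (Dr z + 1)) * \1_(cube r0) x)%:E)%E).
    apply: ge0_le_integral => //.
    - by apply/measurable_EFinP; exact: (measurableT_comp _ (mF1 z)).
    - by apply/measurable_EFinP/measurable_funM => //; exact: (ig_meas iC).
    - by move=> x _; rewrite lee_fin; exact: (FB (z, x)).
  rewrite -EFin_Rint; last exact: (igZ _ iC).
  by rewrite RintZ// lee_fin mulrC.
have := @Rint_fubini _ _ _ _ R mu leb1 F mF fin i1 i2.
move=> h; transitivity (\int[mu]_x \int[leb1]_z F (z, x))%R.
  apply: eq_Rintegral => x _; rewrite U_diff//.
  (* Integrability in time of the factor without zeta is obtained by dividing F by zeta x, so zeros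
     of zeta are treated apart. *)
  have [zx|zn] := eqVneq (zeta x) 0.
    rewrite zx mul0r; transitivity (\int[leb1]_z (0 : R))%R; first by rewrite Rint0.
    by apply: eq_Rintegral => z _; rewrite /F /= zx mul0r !mulr0.
  rewrite -RintZ; last first.
    have := igZ (zeta x)^-1 (i2 x); congr (leb1.-integrable _ _); apply/funext => z /=.
    by congr EFin; rewrite /F /=; field.
  by apply: eq_Rintegral => z _; rewrite /F /=; ring.
rewrite -h; apply: eq_Rintegral => z _.
have iz : (DD z < +oo)%E -> ig (fun x => zeta x * dvJ n z x).
  move=> Dz; apply: (@ig_le _ _ _ mu _ (fun x => (B * (Dr z + 1)) * (M * \1_(cube r0) x))).
  - by apply: measurable_funM => //; apply: continuous_measurable_rV; exact: dvJ_cont.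
  - by move=> x; rewrite normrM mulrC; apply: ler_pM => //; exact: hB.
  - exact: (igZ _ (igZ _ iC)).
have [[Eg Dz]|Eg] := gdP z; last first.
  rewrite Eg mul0r mulr0; transitivity (\int[mu]_x (0 : R))%R; last by rewrite Rint0.
  by apply: eq_Rintegral => x _; rewrite /F /= Eg mul0r mulr0.
rewrite -RintZ; last exact: iz.
rewrite -RintZ; last exact/igZ/iz.
by apply: eq_Rintegral => x _.
Qed.

Lemma zeta_ibp n t (zeta : V -> R) (dz : 'I_d -> V -> R) r0 :
  continuous zeta -> (forall i, continuous (dz i)) -> (forall i, dline zeta (e i) (dz i)) ->
  (forall x, r0 < `|x| -> zeta x = 0) -> (forall i x, r0 < `|x| -> dz i x = 0) ->
  (\int[mu]_x (zeta x * dvJ n t x) = - \sum_i \int[mu]_x (dz i x * moll n (jj i t) x))%R.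
Proof.
move=> cz cdz dl z0 dz0.
have cJ i : continuous (moll n (jj i t)) by apply: conv_continuous.
have cD i : continuous (conv ('D_(e i) (knl n)) (jj i t)) by apply: conv_continuous.
have i1 i : ig (fun x => zeta x * conv ('D_(e i) (knl n)) (jj i t) x).
  by apply: ig_cont_supp; [exact: contM|exists r0 => x h; rewrite z0// mul0r].
have i2 i : ig (fun x => dz i x * moll n (jj i t) x).
  by apply: ig_cont_supp; [exact: contM|exists r0 => x h; rewrite dz0// mul0r].
have -> : (\int[mu]_x (zeta x * dvJ n t x) =
    \sum_i \int[mu]_x (zeta x * conv ('D_(e i) (knl n)) (jj i t) x))%R.
  by rewrite -Rint_sum//; apply: eq_Rintegral => x _; rewrite /dvJ mulr_sumr.
rewrite -sumrN; apply: eq_bigr => i _.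
have dJ := dline_conv (e i) (mk n) (jl i t).
have d2 := dlineM (dl i) dJ.
have i3 : ig (fun x => moll n (jj i t) x * dz i x).
  by have := i2 i; congr (mu.-integrable _ _); apply/funext => x /=; rewrite mulrC.
have iF : ig (fun x => zeta x * moll n (jj i t) x).
  by apply: ig_cont_supp; [exact: contM|exists r0 => x h; rewrite z0// mul0r].
have cDF := contD (contM cz (cD i)) (contM (cJ i) (cdz i)).
have H := int_dline d2 cDF iF (igD (i1 i) i3).
have E : (\int[mu]_x (dz i x * moll n (jj i t) x) = \int[mu]_x (moll n (jj i t) x * dz i x))%R.
  by apply: eq_Rintegral => x _; rewrite mulrC.
by apply/eqP; rewrite E -addr_eq0 -RintD//; apply/eqP; exact: H.
Qed.

End dissipation.

End TimeIncrements.
Import TimeIncrements.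

(** * The weight carrying the potential, and spatial derivatives of phi *)

Module EntropyWeights.

Opaque ez.

Section weights.
Context {R : realType} (d : nat).
Local Notation V := 'rV[R]_d.
Local Notation mu := (@leb R d).
Local Notation leb1 := (@lebesgue_measure R).
Local Notation ig f := (mu.-integrable setT (EFin \o f)).
Local Notation e i := (delta_mx ord0 i : V).
Variables (lam eta m : R) (Psi : V -> R).
Hypotheses (lam_gt0 : 0 < lam) (eta_gt0 : 0 < eta) (m_gt1 : 1 < m) (Psi1 : Ck 1 Psi).
Local Notation gz := (gz lam eta m).
Local Notation dgz := (dgz lam eta m).
Local Notation PH := (PH lam eta m).
Local Notation phi := (phi lam eta m).
Local Notation lamb := (lamb lam eta m).
Local Notation phr := (phr lam eta m).
Variable C : R.

(** Subtracting [kp] accounts for the constant -1 inside [hfun], so that gz r * wt x = 1 is exactly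
    the equation h(r) = C - Psi(x). *)
Definition wt (x : V) : R := expR ((Psi x - C - kp eta m) / lam).

Let cPsi : continuous Psi := Ck_continuous Psi1.
Let cgz : continuous gz. Proof. by apply: gz_continuous. Qed.
Let cdgz : continuous dgz. Proof. by apply: dgz_continuous. Qed.

Lemma cont_h (h : R -> R) (f : V -> R) : continuous h -> continuous f -> continuous (fun x => h (f x)).
Proof. by move=> ch cf x; apply: (@continuous_comp V R R f h); [exact: cf|exact: ch]. Qed.

Lemma cont_inv (f : V -> R) : continuous f -> (forall x, f x != 0) -> continuous (fun x => (f x)^-1).
Proof. by move=> cf f0 x; exact: (cvgV (f0 x) (cf x)). Qed.

Lemma wt_gt0 x : 0 < wt x. Proof. exact: expR_gt0. Qed.
Let wt0 x : 0 <= wt x := ltW (wt_gt0 x).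

Lemma wt_cont : continuous wt.
Proof.
apply: (@cont_h (fun s => expR ((s - C - kp eta m) / lam))) => // s.
apply: (@continuous_comp R R R (fun s => (s - C - kp eta m) / lam) expR); last exact: continuous_expR.
apply: cvgMr_tmp; apply: cvgB; last exact: cvg_cst.
by apply: cvgB; [exact: cvg_id|exact: cvg_cst].
Qed.

Lemma wt_meas : measurable_fun setT wt.
Proof. exact: continuous_measurable_rV wt_cont. Qed.

Lemma wt_dline v : dline wt v (fun x => wt x * ('D_v Psi x / lam)).
Proof.
have dP : dline Psi v ('D_v Psi).
  by apply: dline_diff; have [] := Psi1.
pose h s := expR ((s - C - kp eta m) / lam); pose h' s := h s / lam.
have dh (s : R) : is_derive s 1 (h : R -> R) (h' s).
  have h1 : is_derive s 1 (fun s : R => (s - C - kp eta m) / lam) (lam^-1).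
    have a1 := is_deriveB (is_derive_id s 1) (is_derive_cst (C : R) s 1).
    have a2 := is_deriveB a1 (is_derive_cst (kp eta m : R) s 1).
    have a3 := is_deriveM a2 (is_derive_cst (lam^-1 : R) s 1).
    by apply: (@is_derive_eq _ _ _ _ _ _ _ _ a3); rewrite /GRing.scale /= mulr0 add0r !subr0 mulr1.
  exact: (@is_derive1_comp R expR _ s _ _ (is_derive_expR _) h1).
have := dline_comp dP (fun x => dh (Psi x)).
by congr (dline _ _ _); apply/funext => x; rewrite /h' -mulrA (mulrC lam^-1).
Qed.

Lemma wt_bounds r0 : exists w1 w2 : R, 0 < w1 /\ forall x, cube r0 x -> w1 <= wt x /\ wt x <= w2.
Proof.
have [M M0 hM] := continuous_bounded_cube r0 cPsi.
exists (expR ((- M - C - kp eta m) / lam)), (expR ((M - C - kp eta m) / lam)).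
split; first exact: expR_gt0.
move=> x /hM; rewrite ler_norml => /andP[h1 h2]; rewrite !ler_expR !ler_pM2r ?invr_gt0//.
by rewrite !lerD2r.
Qed.

Section one_density.
Variables (U : V -> R).
Hypotheses (cU : continuous U) (U0 : forall x, 0 <= U x).

Let z x := gz (U x) * wt x.
Let cz : continuous z.
Proof. by apply: contM; [exact: cont_h|exact: wt_cont]. Qed.
Let den x : 0 < 1 + z x. Proof. exact: ent_den. Qed.
Let cden : continuous (fun x => (1 + z x)^-1).
Proof.
apply: cont_inv; last by move=> x; rewrite gt_eqF.
by apply: contD; [exact: cont_cst|exact: cz].
Qed.
Let cden2 : continuous (fun x => ((1 + z x) ^+ 2)^-1).
Proof. by under eq_fun do rewrite -exprVn expr2; exact: contM. Qed.

Lemma phi_cont : continuous (fun x => phi (wt x) (U x)).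
Proof. exact: contM cz cden. Qed.

Lemma lamb_cont : continuous (fun x => lamb (wt x) (U x)).
Proof. by apply: contM; [exact: contM cz cden2|exact: cont_cst]. Qed.

Lemma phr_cont : continuous (fun x => phr (wt x) (U x)).
Proof.
apply: contM; last exact: cden2.
by apply: contM; [exact: wt_cont|exact: cont_h].
Qed.

Lemma phi_dline v DU : dline U v DU -> dline (fun x => phi (wt x) (U x)) v
  (fun x => phr (wt x) (U x) * DU x + lamb (wt x) (U x) * 'D_v Psi x).
Proof.
move=> dU.
have dg := dline_comp dU (fun x => @is_derive_gz _ lam eta m lam_gt0 m_gt1 (U x)).
have dz := dlineM dg (wt_dline v).
have z0 x : 0 <= z x by apply: mulr_ge0 => //; exact: gz_ge0.
have dP := @dline_comp R d (@PP R) (fun s => (1 + s) ^- 2) _ _ _ dz (fun x => is_derive_PP (z0 x)).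
have := dP; congr (dline _ _ _); apply/funext => x.
rewrite /EntropyDerivatives.phr /EntropyDerivatives.lamb /=.
move: (gz (U x)) (wt x) (dgz (U x)) (DU x) ('D_v Psi x) (_ ^- 2) => g w dg' DU' P Q.
by ring.
Qed.

End one_density.

(** A parameter integral: with the interval of integration written as a Boolean condition on the
    pair (x, s), the integrand is jointly measurable. *)
Lemma PH_meas dd (T : measurableType dd) (w r : T -> R) :
  measurable_fun setT w -> measurable_fun setT r -> (forall x, 0 <= w x) ->
  measurable_fun setT (fun x => PH (w x) (r x)).
Proof.
move=> mw mr w0.
pose F (p : T * R) : R := ((0 <= p.2) && (p.2 <= r p.1))%:R * phi (w p.1) (Num.max p.2 0).
have m2 : measurable_fun setT (fun p : T * R => p.2) by exact: measurable_snd.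
have mF : measurable_fun setT F.
  apply: measurable_funM.
    have h : measurable_fun setT (fun p : T * R => (0 <= p.2) && (p.2 <= r p.1)).
      apply: measurable_and; apply: measurable_fun_ler => //.
      exact: (measurableT_comp mr measurable_fst).
    exact: (@measurableT_comp _ _ _ _ _ _ (fun b : bool => b%:R : R)) h.
  apply: phi_meas => //.
  - exact: (measurableT_comp mw measurable_fst).
  - exact: measurable_maxr.
  - by move=> p; rewrite le_max lexx orbT.
have := @param_meas _ _ T _ R (@lebesgue_measure R) F mF.
congr (measurable_fun _ _); apply/funext => x.
by apply: eq_Rintegral => s _; rewrite IccE.
Qed.

End weights.

End EntropyWeights.
Import EntropyWeights.

(** * The entropy dissipation inequality with a cutoff *)

Module EntropyDissipation.

Opaque ez.

(** Here a and Q are the mollified |j_i| and j_i^2 / u, J the mollified flux, DU and DP the partial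
    derivatives of u_n and Psi. Jensen's a^2 <= U Q with ph U <= K and la <= K leaves a bound linear
    in Q and U, and these converge in L^1. *)
Lemma main_term_le (R : realType) (lam K MP U Q a J DU DP ph la : R) : 0 < lam -> 0 <= K -> 0 <= MP ->
  0 <= U -> 0 <= Q -> `|J| <= a -> a ^+ 2 <= U * Q -> `|DU| <= lam^-1 * (a + MP * U) ->
  `|DP| <= MP -> 0 <= ph -> ph * U <= K -> 0 <= la -> la <= K ->
  `|(ph * DU + la * DP) * J| <= K * (lam^-1 * (1 + MP) + MP) * (Q + U).
Proof.
move=> l0 K0 MP0 U0 Q0 Ja a2 hDU hDP ph0 phU la0 laK.
have a0 : 0 <= a by apply: le_trans Ja.
have il : 0 < lam^-1 by rewrite invr_gt0.
have aUQ : a <= (Q + U) / 2.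
  rewrite -(ler_pXn2r (ltn0Sn 1)) ?nnegrE ?divr_ge0 ?addr_ge0//; apply: le_trans a2 _.
  by have := sqr_ge0 (Q - U); nra.
have e1 : ph * a ^+ 2 <= K * Q.
  apply: (@le_trans _ _ (ph * (U * Q))); first exact: ler_wpM2l.
  by rewrite mulrA; exact: ler_wpM2r.
have e2 : ph * U * a <= K * ((Q + U) / 2).
  by apply: ler_pM => //; exact: mulr_ge0.
have e3 : la * a <= K * ((Q + U) / 2) by exact: ler_pM.
have t1 : `|ph * DU * J| <= lam^-1 * (ph * a ^+ 2 + MP * (ph * U * a)).
  rewrite !normrM (ger0_norm ph0).
  have h : `|DU| * `|J| <= lam^-1 * (a + MP * U) * a by exact: ler_pM.
  rewrite -mulrA; apply: le_trans (ler_wpM2l ph0 h) _.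
  by rewrite le_eqVlt; apply/orP; left; apply/eqP; ring.
have t2 : `|la * DP * J| <= MP * (la * a).
  rewrite !normrM (ger0_norm la0) (_ : MP * (la * a) = la * MP * a); last by ring.
  by apply: ler_pM => //; [exact: mulr_ge0|exact: ler_wpM2l].
have t3 : MP * (ph * U * a) <= MP * (K * ((Q + U) / 2)) by exact: ler_wpM2l.
have t4 : MP * (la * a) <= MP * (K * ((Q + U) / 2)) by exact: ler_wpM2l.
have t5 : lam^-1 * (ph * a ^+ 2 + MP * (ph * U * a)) <= lam^-1 * (K * Q + MP * (K * ((Q + U) / 2))).
  by rewrite ler_pM2l// lerD.
rewrite mulrDl; apply: le_trans (ler_normD _ _) _.
apply: le_trans (lerD (le_trans t1 t5) (le_trans t2 t4)) _.
have -> : K * (lam^-1 * (1 + MP) + MP) * (Q + U) =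
  lam^-1 * (K * Q + MP * (K * ((Q + U) / 2))) + MP * (K * ((Q + U) / 2)) +
  (lam^-1 * (K * U + MP * (K * ((Q + U) / 2))) + MP * (K * ((Q + U) / 2))) by field; rewrite gt_eqF.
rewrite lerDl; have q0 : 0 <= K * ((Q + U) / 2) by rewrite mulr_ge0 ?divr_ge0 ?addr_ge0.
apply: addr_ge0; last exact: mulr_ge0.
apply: mulr_ge0; first exact: ltW.
by apply: addr_ge0; exact: mulr_ge0.
Qed.

Lemma le_sub_oppD (R : realType) (a b c : R) : - c <= b -> a <= c - (- a - b).
Proof. lra. Qed.

Lemma le_subD_of_sub (R : realType) (a b i c j : R) : a - b <= i -> j <= c - i -> j <= b - a + c.
Proof. lra. Qed.

Lemma cvgMl_zero (R : realType) (a : R) (f : nat -> R) (l : R) : a = 0 ->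
  a * f n @[n --> \oo] --> a * l.
Proof. by move=> ->; rewrite mul0r; under eq_fun do rewrite mul0r; exact: cvg_cst. Qed.

Section dissipation.
Context {R : realType} (d : nat).
Local Notation V := 'rV[R]_d.
Local Notation mu := (@leb R d).
Local Notation leb1 := (@lebesgue_measure R).
Local Notation ig f := (mu.-integrable setT (EFin \o f)).
Local Notation ig1 f := (leb1.-integrable setT (EFin \o f)).
Local Notation e i := (delta_mx ord0 i : V).
Local Notation ind a b := (\1_(`]a, b] : set R) : R -> R).
Variables (lam eta m : R) (Psi : V -> R) (rho : R -> density R d).
Hypotheses (lam_gt0 : 0 < lam) (eta_gt0 : 0 < eta) (m_gt1 : 1 < m).
Hypotheses (Psi1 : Ck 1 Psi)
  (rho_cont : forall t : R, 0 <= t ->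
     weak_cvg (within (`[0, +oo[ : set R) (nbhs t)) (fun s => dprob (rho s)) (dprob (rho t)))
  (rho_W : forall t : R, 0 < t -> W11loc (fun y => LF lam eta m (rho t y)))
  (rho_weak : forall phi : (R^o * V)%type -> R,
     test_fun [set p : R^o * V | 0 < p.1 :> R] phi ->
     (\int[leb1]_(t in (`]0%R, +oo[ : set R))
       (\int[mu]_y
         (rho t y * derive1 (fun s : R => phi (s, y)) t
          - edot (rho t y *: grad Psi y + wgrad (fun z => LF lam eta m (rho t z)) y)
                 (grad (fun z => phi (t, z)) y)))%R%:E = 0)%E)
  (rho_energy : forall T : R, 0 < T ->
     (\int[leb1]_(t in (`]0%R, T] : set R)) \int[mu]_y
        (enorm (velocity lam eta m Psi rho t y) ^+ 2 * rho t y)%:E < +oo)%E).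
Local Notation LF := (LF lam eta m).
Local Notation uu := (uu rho).
Local Notation GG := (GG lam eta m rho).
Local Notation jj := (jj lam eta m Psi rho).
Local Notation DD := (DD lam eta m Psi rho).
Local Notation Dr := (Dr lam eta m Psi rho).
Implicit Types (kap : V -> R).
Local Notation phi := (phi lam eta m).
Local Notation lamb := (lamb lam eta m).
Local Notation phr := (phr lam eta m).
Local Notation PH := (PH lam eta m).
Local Notation dvJ := (dvJ lam eta m Psi rho).
Local Notation gd := (gd lam eta m Psi rho).
Local Notation qq := (qq lam eta m Psi rho).
Local Notation qi := (qi lam eta m Psi rho).

Let jl i t : lint (jj i t) := jj_lint Psi1 rho_W i t.
Let mk n : mol (@knl R d n) := @mol_knl R d n.
Let mdk i n : mol ('D_(e i) (@knl R d n)) := mol_derive (e i) (mk n).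
Let u0 t y : 0 <= uu t y := density_ge0 (uu t) y.

Variable C : R.
Local Notation wt := (wt lam eta m Psi C).
Let wt0 x : 0 <= wt x := ltW (wt_gt0 lam eta m Psi C x).
Let mwt : measurable_fun setT wt. Proof. by apply: wt_meas. Qed.

Variables (psi : V -> R) (dpsi : 'I_d -> V -> R) (r0 Md : R).
Hypotheses (r00 : 0 <= r0) (Md0 : 0 <= Md) (cpsi : continuous psi) (cdpsi : forall i, continuous (dpsi i))
  (dlpsi : forall i, dline psi (e i) (dpsi i))
  (psi0 : forall x, 0 <= psi x) (psi1 : forall x, psi x <= 1)
  (psis : forall x, r0 < `|x| -> psi x = 0)
  (dpsis : forall i x, r0 < `|x| -> dpsi i x = 0)
  (dpsib : forall i x, `|dpsi i x| <= Md).

Let psi_ind x : psi x <= \1_(cube r0) x.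
Proof.
rewrite indicE; have [h|h] := leP `|x| r0; first by rewrite mem_set.
by rewrite psis.
Qed.

Let iC : ig (\1_(@cube R d r0) : V -> R).
Proof.
apply: ig_ge0P => //; first by apply: measurable_indic; exact: measurable_cube.
rewrite integral_indic//; last exact: measurable_cube.
by rewrite setIT; exact: leb_cube.
Qed.

Let mpsi : measurable_fun setT psi := continuous_measurable_rV cpsi.

Let ipsi : ig psi.
Proof. by apply: ig_cont_supp => //; exists r0. Qed.

Local Notation Un n t := (moll n (uu t)).
Local Notation DU n i t := (conv ('D_(e i) (knl n)) (uu t)).

Let Un0 n t x : 0 <= Un n t x.
Proof. by apply: moll_ge0. Qed.
Let cUn n t : continuous (Un n t).
Proof. by apply: conv_continuous => //; exact: uu_lint. Qed.
Let cDU n i t : continuous (DU n i t).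
Proof. by apply: conv_continuous; [exact: mdk|exact: uu_lint]. Qed.

(** [psi] is the cutoff, and [dmain] the i-th partial derivative of phi(u_n), which depends on x
    through u_n and through Psi in the weight. *)
Definition zeta n t x := psi x * phi (wt x) (Un n t x).
Definition dmain n i t x := phr (wt x) (Un n t x) * DU n i t x + lamb (wt x) (Un n t x) * 'D_(e i) Psi x.
Definition dzeta n i t x := psi x * dmain n i t x + phi (wt x) (Un n t x) * dpsi i x.

Lemma zeta_cont n t : continuous (zeta n t).
Proof. by apply: contM => //; apply: phi_cont. Qed.

Lemma dmain_cont n i t : continuous (dmain n i t).
Proof.
apply: contD; apply: contM.
- by apply: phr_cont.
- exact: cDU.
- by apply: lamb_cont.
- exact: DPsi_cont.
Qed.

Lemma dzeta_cont n i t : continuous (dzeta n i t).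
Proof.
apply: contD; apply: contM => //; first exact: dmain_cont.
by apply: phi_cont.
Qed.

Lemma zeta_dline n i t : dline (zeta n t) (e i) (dzeta n i t).
Proof.
have dU : dline (Un n t) (e i) (DU n i t) by apply: dline_conv => //; exact: uu_lint.
have dP : dline (fun x => phi (wt x) (Un n t x)) (e i) (dmain n i t) by apply: phi_dline.
exact: dlineM (dlpsi i) dP.
Qed.

Let phi01 n t x : 0 <= phi (wt x) (Un n t x) <= 1.
Proof. by rewrite phi_ge0 ?phi_le1. Qed.

Lemma zeta_le n t x : `|zeta n t x| <= psi x.
Proof.
by have /andP[h1 h2] := phi01 n t x; rewrite /zeta (ger0_norm (mulr_ge0 (psi0 x) h1)) ler_piMr.
Qed.

Definition EE_ f := (\int[mu]_x (psi x * PH (wt x) (f x)))%R.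

Lemma EE_ig f : lint f -> (forall x, 0 <= f x) -> ig (fun x => psi x * PH (wt x) (f x)).
Proof.
move=> lf f0; apply: (@ig_le _ _ _ mu _ (fun x => psi x * f x)).
- apply: measurable_funM => //; apply: PH_meas => //; exact: lf.1.
- move=> x; rewrite ger0_norm ?mulr_ge0 ?PH_ge0// ler_wpM2l//.
  exact: PH_le.
- by apply: lint_test => //; exists r0.
Qed.

(** Convexity in place of a chain rule in time: with the tangent of [PH] taken at the later time b,
    phi is frozen at b while u_n moves from a to b. *)
Lemma E_step n a b : 0 < a -> a < b ->
  EE_ (Un n b) - EE_ (Un n a) <=
  \int[leb1]_z (ind a b z * (gd z * \int[mu]_x (zeta n b x * dvJ n z x))).
Proof.
move=> a0 ab.
have hz x : `|zeta n b x| <= 1 * \1_(cube r0) x.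
  by rewrite mul1r; apply: le_trans (psi_ind x); exact: zeta_le.
have mz : measurable_fun setT (zeta n b) := continuous_measurable_rV (zeta_cont (n := n) (t := b)).
have := zeta_int lam_gt0 eta_gt0 m_gt1 Psi1 rho_cont rho_W rho_weak rho_energy n mz r00 hz a0 ab.
have cB : continuous (fun x => Un n b x - Un n a x).
  under eq_fun do rewrite -mulN1r; apply: contD => //; apply: contM => //; exact: cont_cst.
move=> <-; have lU t : lint (Un n t).
  by apply/ig_lint; exact: (moll_mass n (ig_density (uu t)) (u0 t)).1.
rewrite /EE_ -RintB; [|exact: EE_ig|exact: EE_ig].
apply: Rint_le.
- by apply: igB; exact: EE_ig.
- apply: ig_cont_supp; first by apply: contM; [exact: zeta_cont|exact: cB].
  by exists r0 => x h; rewrite /zeta psis// !mul0r.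
move=> x; rewrite -mulrBr /zeta -mulrA; apply: ler_wpM2l => //.
exact: PH_convex.
Qed.

Lemma UU_cvg kap (b : nat -> R) (z : R) (x : V) : mol kap -> 0 < z -> b n @[n --> \oo] --> z ->
  conv kap (uu (b n)) x @[n --> \oo] --> conv kap (uu z) x.
Proof.
move=> hk z0 bz.
have h := @uint_continuous_pos _ _ _ rho_cont (fun y => kap (x - y)) z (conv_refl_cont (x := x) hk) (conv_refl_bounded x hk) z0.
exact: (@cvg_comp _ _ _ b (fun s : R => conv kap (uu s) x) \oo (nbhs z) _ bz h).
Qed.

Lemma E_ineq n s t : 0 < s -> s < t ->
  ig1 (fun z => ind s t z * (gd z * \int[mu]_x (zeta n z x * dvJ n z x))) /\
  EE_ (Un n t) - EE_ (Un n s) <=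
  \int[leb1]_z (ind s t z * (gd z * \int[mu]_x (zeta n z x * dvJ n z x))).
Proof.
move=> s0 st; have t0 : 0 < t by apply: lt_trans st.
have [B B0 hB] := dvJ_bound lam_gt0 eta_gt0 m_gt1 Psi1 rho_W n.
have mgd := gd_meas lam_gt0 eta_gt0 m_gt1 Psi1 rho_cont rho_W.
have mdv := dvJ_meas lam_gt0 eta_gt0 m_gt1 Psi1 rho_cont rho_W n.
have bd z : (DD z < +oo)%E -> ig (fun x => (B * (Dr z + 1)) * psi x) by move=> _; exact: igZ.
have zb b z x : (DD z < +oo)%E -> `|zeta n b x * dvJ n z x| <= (B * (Dr z + 1)) * psi x.
  move=> Dz; rewrite normrM mulrC; apply: ler_pM => //; last exact: zeta_le.
  exact: hB.
have mzd b z : measurable_fun setT (fun x => zeta n b x * dvJ n z x).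
  apply: continuous_measurable_rV; apply: contM; first exact: zeta_cont.
  exact: dvJ_cont.
have izd b z : (DD z < +oo)%E -> ig (fun x => zeta n b x * dvJ n z x).
  by move=> Dz; apply: (ig_le (mzd b z) (zb b z ^~ Dz)); exact: bd.
apply: (@partition_dct R (fun t => EE_ (Un n t))
  (fun b z => gd z * \int[mu]_x (zeta n b x * dvJ n z x))
  (fun z => gd z * \int[mu]_x (zeta n z x * dvJ n z x))
  (fun z => (B * \int[mu]_x psi x) * (Dr z + 1)) s t st).
- by move=> a b sa ab bt; apply: E_step => //; exact: lt_le_trans sa.
- move=> b; apply: measurable_funM => //.
  apply: (@param_meas _ _ _ _ R mu (fun p : R * V => zeta n b p.2 * dvJ n p.1 p.2)).
  apply: measurable_funM => //.
  exact: (measurableT_comp (continuous_measurable_rV (zeta_cont (n := n) (t := b))) measurable_snd).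
- apply: measurable_funM; first exact: measurable_indic.
  apply: measurable_funM => //.
  apply: (@param_meas _ _ _ _ R mu (fun p : R * V => zeta n p.1 p.2 * dvJ n p.1 p.2)).
  apply: measurable_funM => //; apply: measurable_funM.
    exact: (measurableT_comp mpsi measurable_snd).
  apply: phi_meas => //; last exact: uu_conv_measurable.
  exact: (measurableT_comp mwt measurable_snd).
- move=> b z sz zb' bt; have D0 : 0 <= Dr z := Dr_ge0 lam eta m Psi rho z.
  have p0 : 0 <= (\int[mu]_x psi x)%R by exact: Rint_ge0.
  have [[-> Dz]|->] := gdP lam eta m Psi rho z; last first.
    by rewrite mul0r normr0 !mulr_ge0// addr_ge0.
  rewrite mul1r; apply: (le_trans (Rint_norm (izd b z Dz))).
  rewrite mulrAC -RintZ//; apply: Rint_le; [exact/ig_norm/izd|exact: bd|].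
  by move=> x; exact: zb.
- exact: ind_Dr_ig (ltW s0) t0.
- move=> z b sz zb' bz; have [[Eg Dz]|E0] := gdP lam eta m Psi rho z; last first.
    exact: cvgMl_zero E0.
  apply: cvgMl_tmp.
  have [||||_ c _] := @Rdct _ _ _ mu (fun k x => zeta n (b k) x * dvJ n z x)
    (fun x => zeta n z x * dvJ n z x) (fun x => (B * (Dr z + 1)) * psi x) _ _ _ (bd z Dz).
  + by move=> k; exact: mzd.
  + exact: mzd.
  + apply: aeW => x; apply: cvgMr_tmp; apply: cvgMl_tmp; apply: phi_cvg => //.
    by apply: UU_cvg => //; exact: lt_trans sz.
  + by move=> k x; exact: zb.
  exact: c.
Qed.

(** After integration by parts [MM] carries the gradient of phi and [RR] that of the cutoff; [AA] is
    the dissipation, the limit of [MM]. *)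
Definition mainF n z x := psi x * \sum_i dmain n i z x * moll n (jj i z) x.
Definition MM n z := (\int[mu]_x mainF n z x)%R.
Definition AA z := (\int[mu]_x (psi x * (lamb (wt x) (uu z x) * qq z x)))%R.
Definition RR n z := \sum_i (\int[mu]_x (phi (wt x) (Un n z x) * dpsi i x * moll n (jj i z) x))%R.

Let cJ n i z : continuous (moll n (jj i z)).
Proof. by apply: conv_continuous. Qed.

Lemma ibp_main n z : (\int[mu]_x (zeta n z x * dvJ n z x))%R = - MM n z - RR n z.
Proof.
rewrite (zeta_ibp Psi1 rho_W (r0 := r0) n z (zeta_cont (n := n) (t := z))
  (fun i => dzeta_cont (n := n) (i := i) (t := z)) (fun i => @zeta_dline n i z)); last 2 first.
- by move=> x h; rewrite /zeta psis// mul0r.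
- by move=> i x h; rewrite /dzeta psis// dpsis// mul0r mulr0 addr0.
rewrite -opprD; congr (- _).
have i1 i : ig (fun x => psi x * (dmain n i z x * moll n (jj i z) x)).
  apply: ig_cont_supp; last by exists r0 => x h; rewrite psis// mul0r.
  by apply: contM => //; apply: contM => //; exact: dmain_cont.
have i2 i : ig (fun x => phi (wt x) (Un n z x) * dpsi i x * moll n (jj i z) x).
  apply: ig_cont_supp; last by exists r0 => x h; rewrite dpsis// mulr0 mul0r.
  by apply: contM => //; apply: contM => //; apply: phi_cont.
have -> : MM n z = \sum_i (\int[mu]_x (psi x * (dmain n i z x * moll n (jj i z) x)))%R.
  rewrite -Rint_sum//; apply: eq_Rintegral => x _; rewrite /mainF mulr_sumr.
  by apply: eq_bigr => i _; rewrite mulrA.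
rewrite -big_split; apply: eq_bigr => i _ /=.
rewrite -RintD//; apply: eq_Rintegral => x _; rewrite /dzeta; ring.
Qed.

Lemma RR_le n z : (DD z < +oo)%E -> `|RR n z| <= d%:R * Md * (Dr z + 1).
Proof.
move=> Dz; apply: (le_trans (ler_norm_sum _ _ _)).
apply: (@le_trans _ _ (\sum_(i < d) Md * (Dr z + 1))); last first.
  by rewrite sumr_const card_ord -mulrA (mulr_natl _ d).
apply: ler_sum => i _; have [igj hj] := jj_ig lam_gt0 eta_gt0 m_gt1 Psi1 rho_W i Dz.
have [im hm] := moll_contract n igj.
have i2 : ig (fun x => phi (wt x) (Un n z x) * dpsi i x * moll n (jj i z) x).
  apply: ig_cont_supp; last by exists r0 => x h; rewrite dpsis// mulr0 mul0r.
  by apply: contM => //; apply: contM => //; apply: phi_cont.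
apply: (le_trans (Rint_norm i2)).
apply: (@le_trans _ _ (\int[mu]_x (Md * `|moll n (jj i z) x|))%R).
  apply: Rint_le; [exact: ig_norm|exact/igZ/ig_norm|move=> x].
  rewrite normrM ler_wpM2r// normrM.
  have /andP[h1 h2] := phi01 n z x; rewrite (ger0_norm h1).
  by apply: le_trans (dpsib i x); rewrite ler_piMl.
rewrite RintZ; last exact: ig_norm.
by apply: ler_wpM2l => //; exact: le_trans hm hj.
Qed.

(** The i-th weak partial derivative of u; by [DUE] its mollification is the derivative of u_n. *)
Definition gg i z y := (ChainRule.DLF lam eta m (uu z y))^-1 * GG z y ord0 i.

Lemma gg_lint i z : lint (gg i z).
Proof.
have [lw wG] := uu_W rho_W z.
have := @weak_grad_lint R d _ _ i (weak_grad_u lam_gt0 eta_gt0 m_gt1 (uu_meas rho z) (u0 z) lw wG).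
by congr lint; apply/funext => y; rewrite mxE.
Qed.

Lemma DUE n i z x : DU n i z x = moll n (gg i z) x.
Proof.
have [lw wG] := uu_W rho_W z.
have := weak_grad_conv i (uu_lint rho z) (weak_grad_u lam_gt0 eta_gt0 m_gt1 (uu_meas rho z) (u0 z) lw wG).
move=> /(_ _ x (mk n)) ->; rewrite /conv; apply: eq_Rintegral => y _.
by rewrite mxE.
Qed.

(** On the support of the cutoff the weight lies between positive constants, so [entropy_bounds]
    applies. The gradient of u is expressed by flux and density, |gg| <= (|j| + MP u) / lam, and
    [main_term_le] concludes. *)
Lemma main_bound : exists2 C1 : R, 0 <= C1 & forall n z x, (DD z < +oo)%E ->
  `|mainF n z x| <= C1 * (\1_(cube r0) x * (moll n (qq z) x + Un n z x)).
Proof.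
have [w1 [w2 [w10 hw]]] : exists w1 w2 : R, 0 < w1 /\ forall x, cube r0 x -> w1 <= wt x /\ wt x <= w2.
  by apply: wt_bounds.
have [K K0 hK] := entropy_bounds lam_gt0 eta_gt0 m_gt1 w2 w10.
(* The extra 1 in the radius accounts for the support of the kernel. *)
have hMP i : exists M : R, 0 <= M /\ forall y, cube (r0 + 1) y -> `|'D_(e i) Psi y| <= M.
  by have [M M0 hM] := continuous_bounded_cube (r0 + 1) (DPsi_cont Psi1 (i := i)); exists M.
have [mp hmp] := choice hMP; pose MP := \sum_i mp i.
have MP0 : 0 <= MP by apply: sumr_ge0 => i _; have [] := hmp i.
have hM i y : cube (r0 + 1) y -> `|'D_(e i) Psi y| <= MP.
  move=> hy; have [_ /(_ y hy) h] := hmp i; apply: (le_trans h).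
  by rewrite /MP (bigD1 i)//= lerDl sumr_ge0// => j _; have [] := hmp j.
pose c := K * (lam^-1 * (1 + MP) + MP).
have c0 : 0 <= c.
  by rewrite mulr_ge0 ?(ltW K0)// addr_ge0// mulr_ge0 ?invr_ge0 ?(ltW lam_gt0)// addr_ge0.
exists (d%:R * c); first by rewrite mulr_ge0.
move=> n z x Dz; have q0 : 0 <= moll n (qq z) x.
  by apply: moll_ge0 => y; exact: qq_ge0.
rewrite /mainF indicE; have [hx|hx] := leP `|x| r0; last first.
  rewrite psis// mul0r normr0; apply: mulr_ge0; first exact: mulr_ge0.
  by apply: mulr_ge0 => //; exact: addr_ge0.
rewrite mem_set// mul1r normrM (ger0_norm (psi0 x)).
apply: (@le_trans _ _ (`|\sum_i dmain n i z x * moll n (jj i z) x|)); first by rewrite ler_piMl.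
apply: (le_trans (ler_norm_sum _ _ _)).
apply: (@le_trans _ _ (\sum_(i < d) c * (moll n (qq z) x + Un n z x))); last first.
  by rewrite sumr_const card_ord -mulrA (mulr_natl _ d).
apply: ler_sum => i _.
have [hw1 hw2] := hw x hx; have [b1 _ _ b4] := hK _ _ hw1 hw2 (Un0 n z x).
have qi0 : 0 <= moll n (qi i z) x by apply: moll_ge0 => y; exact: qi_ge0.
have lq : lint (qi i z) by apply/ig_lint; exact: qi_ig.
have lqq : lint (qq z) by apply/ig_lint; exact: qq_ig.
have qiqq : moll n (qi i z) x <= moll n (qq z) x.
  apply: Rint_le; [exact: ig_conv|exact: ig_conv|move=> y].
  by apply: ler_wpM2l; [exact: knl_ge0|exact: qi_le].
apply: (@le_trans _ _ (c * (moll n (qi i z) x + Un n z x))); last first.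
  by apply: ler_wpM2l => //; rewrite lerD2r.
have lj := lint_norm (jl i z).
apply: (@main_term_le R lam K MP (Un n z x) (moll n (qi i z) x) (moll n (fun y => `|jj i z y|) x)) => //.
- exact: ltW.
- exact: conv_le_norm.
- exact: jj_jensen.
- rewrite DUE; apply: le_trans (conv_le_norm _ _ (gg_lint i z)) _.
  rewrite (@moll_local R d n (fun y => `|gg i z y|) r0 x hx).
  have -> : lam^-1 * (moll n (fun y => `|jj i z y|) x + MP * Un n z x) =
      moll n (fun y => lam^-1 * (`|jj i z y| + MP * uu z y)) x.
    have lu := uu_lint rho z.
    rewrite convZ//; last by apply: lintD => //; exact: lintZ.
    by rewrite convD// ?convZ//; exact: lintZ.
  have lu := uu_lint rho z.
  apply: Rint_le.
  + by apply: ig_conv => //; apply/lint_cube/lint_norm/gg_lint.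
  + by apply: ig_conv => //; apply/lintZ/lintD => //; exact: lintZ.
  move=> y; apply: ler_wpM2l; first exact: knl_ge0.
  have r1 : 0 <= lam^-1 * (`|jj i z y| + MP * uu z y).
    by rewrite mulr_ge0 ?invr_ge0 ?(ltW lam_gt0)// addr_ge0// mulr_ge0.
  rewrite indicE; have [hy|hy] := boolP (y \in cube (r0 + 1)); last by rewrite mul0r.
  rewrite mul1r /gg normrM.
  have Dl : 0 < ChainRule.DLF lam eta m (uu z y) := DLF_gt0 lam_gt0 eta_gt0 m_gt1 _.
  rewrite ger0_norm ?invr_ge0 ?(ltW Dl)//.
  apply: ler_pM => //; first by rewrite invr_ge0 ltW.
    by rewrite lef_pV2 ?posrE//; exact: DLF_ge.
  have -> : GG z y ord0 i = jj i z y - uu z y * 'D_(e i) Psi y by rewrite /SolutionCurve.jj addrAC subrr add0r.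
  apply: (le_trans (ler_normB _ _)); rewrite lerD2l normrM (ger0_norm (u0 z y)) mulrC.
  by apply: ler_wpM2r => //; apply: hM; rewrite inE in hy.
- by apply: hM; rewrite /cube /= (le_trans hx)// lerDl.
- by apply: phr_ge0.
- exact: lamb_ge0.
Qed.

Lemma main_meas n z : measurable_fun setT (mainF n z).
Proof.
apply: measurable_funM => //; apply: measurable_sum => i; apply: measurable_funM.
  by apply: continuous_measurable_rV; exact: dmain_cont.
exact: continuous_measurable_rV (cJ (n := n) (i := i) (z := z)).
Qed.

Lemma MM_meas n : measurable_fun setT (MM n).
Proof.
apply: (@param_meas _ _ _ _ R mu (fun p : R * V => mainF n p.1 p.2)).
apply: measurable_funM; first exact: (measurableT_comp mpsi measurable_snd).
have mw : measurable_fun setT (fun p : R * V => wt p.2) by exact: (measurableT_comp mwt measurable_snd).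
have mU : measurable_fun setT (fun p : R * V => Un n p.1 p.2) by exact: uu_conv_measurable.
apply: measurable_sum => i; apply: measurable_funM; last first.
  exact: (jj_conv_measurable lam_gt0 eta_gt0 m_gt1 Psi1 rho_cont rho_W i (mk n)).
apply: measurable_funD; apply: measurable_funM.
- by apply: phr_meas.
- exact: uu_conv_measurable (mdk i n).
- by apply: lamb_meas.
- have mD : measurable_fun setT ('D_(e i) Psi).
    by apply: continuous_measurable_rV; exact: (DPsi_cont Psi1).
  exact: (measurableT_comp mD measurable_snd).
Qed.

(** Joint L^1 error on the cube of all mollified quantities in [mainF] and its majorant: where it
    tends to 0, all of them converge. *)
Let bn z n x := \1_(cube r0) x * (`|moll n (qq z) x - qq z x| + `|Un n z x - uu z x|) +
  \sum_i \1_(cube r0) x * (`|moll n (jj i z) x - jj i z x| + `|moll n (gg i z) x - gg i z x|).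

Let i2cv f g n : lint f -> lint g ->
  ig (fun x => \1_(cube r0) x * (`|moll n f x - f x| + `|moll n g x - g x|)).
Proof.
move=> lf lg; have := igD ((moll_cvg_loc r0 lf).1 n) ((moll_cvg_loc r0 lg).1 n).
by congr (mu.-integrable _ _); apply/funext => x /=; congr EFin; rewrite mulrDr.
Qed.

Let c2cv f g : lint f -> lint g ->
  (\int[mu]_x (\1_(cube r0) x * (`|moll n f x - f x| + `|moll n g x - g x|)) @[n --> \oo] --> (0 : R))%R.
Proof.
move=> lf lg; have [i1 c1] := moll_cvg_loc r0 lf; have [i2 c2] := moll_cvg_loc r0 lg.
have E n : (\int[mu]_x (\1_(cube r0) x * (`|moll n f x - f x| + `|moll n g x - g x|)) =
    \int[mu]_x (\1_(cube r0) x * `|moll n f x - f x|) + \int[mu]_x (\1_(cube r0) x * `|moll n g x - g x|))%R.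
  by rewrite -RintD//; apply: eq_Rintegral => x _; rewrite mulrDr.
by under eq_fun do rewrite E; have := cvgD c1 c2; rewrite addr0; exact.
Qed.

(** In the limit [phr_lamb] merges the two gradients into lamb j / u; multiplied by j this is the
    dissipation density. *)
Lemma main_id i z x : (uu z x = 0 -> jj i z x = 0) ->
  (phr (wt x) (uu z x) * gg i z x + lamb (wt x) (uu z x) * 'D_(e i) Psi x) * jj i z x =
  lamb (wt x) (uu z x) * qi i z x.
Proof.
move=> jz; rewrite /qi; have [/jz ->|un] := eqVneq (uu z x) 0; first by rewrite expr0n /= !mulr0.
have D0 : ChainRule.DLF lam eta m (uu z x) != 0 by rewrite gt_eqF//; exact: DLF_gt0.
have -> : phr (wt x) (uu z x) = lamb (wt x) (uu z x) * ChainRule.DLF lam eta m (uu z x) / uu z x.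
  by rewrite -phr_lamb// mulfK.
have -> : gg i z x = (ChainRule.DLF lam eta m (uu z x))^-1 * (jj i z x - uu z x * 'D_(e i) Psi x).
  by rewrite /gg /SolutionCurve.jj addrAC subrr add0r.
by field; rewrite un.
Qed.

(** [Rint_domdct] with the majorant of [main_bound]. The last clause is uniform in n and in time, in
    view of dominated convergence in time. *)
Lemma main_cvg z : (DD z < +oo)%E ->
  [/\ forall n, ig (mainF n z), MM n z @[n --> \oo] --> AA z &
      exists2 C1 : R, 0 <= C1 & forall n z, (DD z < +oo)%E -> `|MM n z| <= C1 * (Dr z + 1)].
Proof.
move=> Dz; have [C1 C10 hC1] := main_bound.
have bnd n z' x : (DD z' < +oo)%E -> `|mainF n z' x| <= C1 * (moll n (qq z') x + Un n z' x).
  move=> Dz'; apply: le_trans (hC1 n z' x Dz') _; apply: ler_wpM2l => //.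
  have q0 : 0 <= moll n (qq z') x by apply: moll_ge0 => y; exact: qq_ge0.
  by rewrite indicE; case: (_ \in _); rewrite ?mul1r// mul0r addr_ge0.
have iq z' : (DD z' < +oo)%E -> ig (qq z') by move=> Dz'; exact: qq_ig.
have ib n z' : (DD z' < +oo)%E -> ig (fun x => C1 * (moll n (qq z') x + Un n z' x)).
  move=> Dz'; apply/igZ/igD.
    by have [] := moll_mass n (iq z' Dz') (@qq_ge0 _ _ lam eta m Psi rho z').
  by have [] := moll_mass n (ig_density (uu z')) (u0 z').
have iF n z' : (DD z' < +oo)%E -> ig (mainF n z').
  move=> Dz'; apply: (@ig_le _ _ _ mu _ _ (main_meas n z') (fun x => bnd n z' x Dz')).
  exact: ib.
split; [by move=> n; exact: iF| |]; last first.
  exists C1 => // n z' Dz'.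
  apply: (le_trans (Rint_norm (iF n z' Dz'))).
  apply: (@le_trans _ _ (\int[mu]_x (C1 * (moll n (qq z') x + Un n z' x)))%R).
    by apply: Rint_le; [exact/ig_norm/iF|exact: ib|move=> x; exact: bnd].
  have [i1 e1] := moll_mass n (iq z' Dz') (@qq_ge0 _ _ lam eta m Psi rho z').
  have [i2 e2] := moll_mass n (ig_density (uu z')) (u0 z').
  rewrite RintZ; last exact: igD.
  by rewrite RintD// e1 e2 Rint_density (DDE Psi1 rho_W Dz').
have lq : lint (qq z) by exact/ig_lint/iq.
have lu := uu_lint rho z.
have b_ig n : ig (bn z n).
  by apply: igD; [exact: i2cv|apply: ig_sum => i; exact: (i2cv n (jl i z) (gg_lint i z))].
have b_cv : (\int[mu]_x bn z n x @[n --> \oo] --> (0 : R))%R.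
  have E n : (\int[mu]_x bn z n x = \int[mu]_x (\1_(cube r0) x * (`|moll n (qq z) x - qq z x| + `|Un n z x - uu z x|)) +
    \sum_i \int[mu]_x (\1_(cube r0) x * (`|moll n (jj i z) x - jj i z x| + `|moll n (gg i z) x - gg i z x|)))%R.
    rewrite /bn RintD; [|exact: i2cv|by apply: ig_sum => i; exact: (i2cv n (jl i z) (gg_lint i z))].
    by congr (_ + _); rewrite Rint_sum// => i; exact: (i2cv n (jl i z) (gg_lint i z)).
  under eq_fun do rewrite E.
  have Z : 0 + \sum_(i < d) (0 : R) = 0 by rewrite big1 ?addr0.
  have := cvgD (c2cv lq lu) (@Rcvg_sum R _ (index_enum 'I_d) _ _ (fun i => c2cv (jl i z) (gg_lint i z))).
  by rewrite Z; apply.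
have b0 n x : 0 <= bn z n x.
  by apply: addr_ge0; [apply: mulr_ge0 => //; exact: addr_ge0|apply: sumr_ge0 => i _; apply: mulr_ge0 => //; exact: addr_ge0].
pose an n x := C1 * (\1_(cube r0) x * (moll n (qq z) x + Un n z x)).
pose aL x := C1 * (\1_(cube r0) x * (qq z x + uu z x)).
have mcube : measurable_fun setT (\1_(@cube R d r0) : V -> R) by exact: (ig_meas iC).
have clint f : lint f -> ig (fun x => \1_(cube r0) x * f x) by move=> lf; exact: lf.2.
have ia n : ig (an n).
  by apply/igZ/clint/lintD; apply/ig_lint; [have [] := moll_mass n (iq z Dz) (@qq_ge0 _ _ lam eta m Psi rho z)|have [] := moll_mass n (ig_density (uu z)) (u0 z)].
have iaL : ig aL by apply/igZ/clint/lintD.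
have aab n x : `|an n x - aL x| <= C1 * bn z n x.
  rewrite /an /aL -mulrBr normrM (ger0_norm C10) ler_wpM2l// -mulrBr normrM ger0_norm//.
  rewrite /bn (_ : moll n (qq z) x + Un n z x - (qq z x + uu z x) = (moll n (qq z) x - qq z x) + (Un n z x - uu z x)); last by ring.
  apply: ler_wpDr; first by apply: sumr_ge0 => i _; apply: mulr_ge0 => //; exact: addr_ge0.
  by apply: ler_wpM2l => //; exact: ler_normD.
have aab' n x : `|an n x - aL x| <= bn z n x + C1 * bn z n x.
  by apply: le_trans (aab n x) _; rewrite lerDr.
have mA : measurable_fun setT (fun x => psi x * (lamb (wt x) (uu z x) * qq z x)).
  apply: measurable_funM => //; apply: measurable_funM; last by exact: lq.1.
  by apply: lamb_meas => //; exact: uu_meas.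
have [||||_ _ c] := @Rint_domdct _ _ _ mu (fun n => mainF n z) an (fun n x => bn z n x + C1 * bn z n x)
   (fun x => psi x * (lamb (wt x) (uu z x) * qq z x)) aL _ mA _ ia iaL (fun n => igD (b_ig n) (igZ C1 (b_ig n))) aab'.
- by move=> n; exact: main_meas.
- by move=> n x; exact: hC1.
- have E n : (\int[mu]_x (bn z n x + C1 * bn z n x) = \int[mu]_x bn z n x + C1 * \int[mu]_x bn z n x)%R.
    by rewrite RintD ?RintZ//; exact: igZ.
  have c1 : (C1 * \int[mu]_x bn z n x @[n --> \oo] --> C1 * (0 : R))%R by exact: cvgMl_tmp.
  by under eq_fun do rewrite E; have := cvgD b_cv c1; rewrite mulr0 addr0; exact.
- have jz0 : {ae mu, forall y, uu z y = 0 -> forall i, jj i z y = 0}.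
    by apply: jj_zero.
  apply: (@filterS _ (almost_everywhere mu) _ _ _ _ jz0) => x jz s sn hs'.
  have [hx|hx] := leP `|x| r0; last first.
    by rewrite psis// mul0r /mainF psis//; under eq_fun do rewrite mul0r; exact: cvg_cst.
  have I1 : \1_(@cube R d r0) x = 1 :> R by rewrite indicE mem_set.
  have sq (h : nat -> R) l : (forall n, `|h n - l| <= bn z (s n) x) -> h n @[n --> \oo] --> l.
    move=> hl; apply/cvgrPdist_lt => eps e0; move/cvgrPdist_lt : hs' => /(_ eps e0).
    apply: filterS => n; rewrite sub0r normrN => h'; rewrite distrC.
    apply: le_lt_trans (hl n) _; apply: le_lt_trans h'; rewrite ger0_norm ?lerDl ?mulr_ge0//.
    by rewrite addr_ge0 ?mulr_ge0.
  have bS n i : \1_(cube r0) x * (`|moll n (jj i z) x - jj i z x| + `|moll n (gg i z) x - gg i z x|) <= bn z n x.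
    apply: ler_wpDl; first by rewrite mulr_ge0// addr_ge0.
    rewrite (bigD1 i)//= lerDl sumr_ge0// => k _; rewrite mulr_ge0// addr_ge0//.
  have cU : Un (s n) z x @[n --> \oo] --> uu z x.
    apply: sq => n; apply: ler_wpDr; first by apply: sumr_ge0 => i _; apply: mulr_ge0 => //; exact: addr_ge0.
    by rewrite I1 mul1r lerDr.
  have cj i : moll (s n) (jj i z) x @[n --> \oo] --> jj i z x.
    by apply: sq => n; apply: le_trans (bS (s n) i); rewrite I1 mul1r lerDl.
  have cg i : moll (s n) (gg i z) x @[n --> \oo] --> gg i z x.
    by apply: sq => n; apply: le_trans (bS (s n) i); rewrite I1 mul1r lerDr.
  have -> : lamb (wt x) (uu z x) * qq z x =
     \sum_i (phr (wt x) (uu z x) * gg i z x + lamb (wt x) (uu z x) * 'D_(e i) Psi x) * jj i z x.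
    by rewrite mulr_sumr; apply: eq_bigr => i _; rewrite -main_id// => /jz.
  apply: cvgMl_tmp; apply: (@Rcvg_sum R _ (index_enum 'I_d) (fun i n => dmain (s n) i z x * moll (s n) (jj i z) x)) => i.
  apply: cvgM => //; rewrite /dmain; under eq_fun do rewrite DUE.
  apply: cvgD; last by apply: cvgMr_tmp; apply: lamb_cvg.
  by apply: cvgM => //; apply: phr_cvg.
exact: c.
Qed.

(** The limit n -> oo in [E_ineq] after integration by parts: the entropies converge because [PH] is
    1-Lipschitz, [MM] by dominated convergence in time, while the cutoff term is merely bounded by
    the energy. *)
Lemma dissipation_ineq s t : 0 < s -> s < t ->
  ig1 (fun z => ind s t z * (gd z * AA z)) /\
  \int[leb1]_z (ind s t z * (gd z * AA z)) <=
  EE_ (uu s) - EE_ (uu t) + \int[leb1]_z (ind s t z * (d%:R * Md * (Dr z + 1))).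
Proof.
move=> s0 st; have t0 : 0 < t by apply: lt_trans st.
have mgd := gd_meas lam_gt0 eta_gt0 m_gt1 Psi1 rho_cont rho_W.
have mi : measurable_fun setT (ind s t) by exact: measurable_indic.
have gcv z : gd z * MM n z @[n --> \oo] --> gd z * AA z.
  have [[Eg Dz]|E0] := gdP lam eta m Psi rho z; last exact: cvgMl_zero E0.
  by apply: cvgMl_tmp; have [] := main_cvg Dz.
have [C1 C10 hC1] : exists2 C1 : R, 0 <= C1 & forall n z, `|gd z * MM n z| <= C1 * (Dr z + 1).
  have D1 z : 0 <= Dr z + 1 by rewrite addr_ge0// Dr_ge0.
  (* The uniform constant is read off at one time of finite energy; if there is none, [gd] vanishes
     identically. *)
  have [[z Dz]|nz] := pselect (exists z, (DD z < +oo)%E); last first.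
    exists 0 => // n z; have [[_ Dz]|->] := gdP lam eta m Psi rho z; first by exfalso; apply: nz; exists z.
    by rewrite !mul0r normr0.
  have [_ _ [C1 C10 h]] := main_cvg Dz; exists C1 => // n z'.
  have [[-> Dz']|->] := gdP lam eta m Psi rho z'; first by rewrite mul1r; exact: h.
  by rewrite mul0r normr0 mulr_ge0.
have mA : measurable_fun setT (fun z => gd z * AA z).
  apply: (@measurable_fun_cvg _ _ _ setT (fun n z => gd z * MM n z)) => [n|z _]; last exact: gcv.
  by apply: measurable_funM => //; exact: MM_meas.
have iD c : ig1 (fun z => ind s t z * (c * (Dr z + 1))) := ind_Dr_ig lam_gt0 eta_gt0 m_gt1 Psi1 rho_cont rho_W rho_energy c (ltW s0) t0.
have [||||iA cA _] := @Rdct _ _ _ leb1 (fun n z => ind s t z * (gd z * MM n z)) (fun z => ind s t z * (gd z * AA z))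
  (fun z => ind s t z * (C1 * (Dr z + 1))) _ _ _ (iD C1).
- by move=> n; do 2 apply: measurable_funM => //; exact: MM_meas.
- exact: measurable_funM.
- by apply: aeW => z; apply: cvgMl_tmp.
- by move=> n z; rewrite normrM ger0_norm// ler_wpM2l.
split => //.
have cE a : EE_ (Un n a) @[n --> \oo] --> EE_ (uu a).
  have lu := uu_lint rho a; have [ic c] := moll_cvg_loc r0 lu.
  have lU n : lint (Un n a).
    by apply/ig_lint; exact: (moll_mass n (ig_density (uu a)) (u0 a)).1.
  apply/cvgrPdist_le => eps e0; move/cvgrPdist_le : c => /(_ eps e0).
  apply: filterS => n; rewrite sub0r normrN => h; apply: le_trans h.
  rewrite distrC /EE_ -RintB; [|exact: EE_ig|exact: EE_ig].
  rewrite [leRHS]ger0_norm; last by apply: Rint_ge0 => x; rewrite mulr_ge0.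
  apply: (le_trans (Rint_norm (igB (EE_ig (lU n) (Un0 n a)) (EE_ig lu (u0 a))))).
  apply: Rint_le; [by apply/ig_norm/igB; exact: EE_ig|exact: ic|move=> x].
  rewrite -mulrBr normrM (ger0_norm (psi0 x)); apply: ler_pM => //.
  exact: PH_lip.
have bd n : \int[leb1]_z (ind s t z * (gd z * MM n z)) <=
    EE_ (Un n s) - EE_ (Un n t) + \int[leb1]_z (ind s t z * (d%:R * Md * (Dr z + 1))).
  have [i1 h1] := E_ineq n s0 st.
  have iM : ig1 (fun z => ind s t z * (gd z * MM n z)).
    apply: (@ig_le _ _ _ leb1 _ _ _ _ (iD C1)); first by do 2 apply: measurable_funM => //; exact: MM_meas.
    by move=> z; rewrite normrM ger0_norm// ler_wpM2l.
  have h2 : \int[leb1]_z (ind s t z * (gd z * MM n z)) <= \int[leb1]_z (ind s t z * (d%:R * Md * (Dr z + 1)) -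
     ind s t z * (gd z * \int[mu]_x (zeta n z x * dvJ n z x))).
    apply: (@Rint_le _ _ _ leb1 _ _ iM (igB (iD _) i1)) => z.
    rewrite -mulrBr ler_wpM2l//.
    have [[-> Dz]|->] := gdP lam eta m Psi rho z; last first.
      by rewrite !mul0r subr0 !mulr_ge0// addr_ge0// Dr_ge0.
    rewrite !mul1r ibp_main; have := RR_le n Dz; rewrite ler_norml => /andP[a1 a2].
    exact: le_sub_oppD a1.
  rewrite RintB// in h2; exact: le_subD_of_sub h1 h2.
have c2 : EE_ (Un n s) - EE_ (Un n t) + \int[leb1]_z (ind s t z * (d%:R * Md * (Dr z + 1))) @[n --> \oo] -->
    EE_ (uu s) - EE_ (uu t) + \int[leb1]_z (ind s t z * (d%:R * Md * (Dr z + 1))).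
  by apply: cvgD; [apply: cvgB; exact: cE|exact: cvg_cst].
exact: (ler_cvg_to cA c2 (nearW _ bd)).
Qed.

End dissipation.

End EntropyDissipation.
Import EntropyDissipation.

(** * Removal of the cutoff, decay of the entropy, times of small dissipation *)

Module EntropyDecay.

Opaque ez.

Lemma dline_scale (R : realType) (d : nat) (F : 'rV[R]_d -> R) v DF c : dline F v DF ->
  dline (fun x => F (c *: x)) v (fun x => c * DF (c *: x)).
Proof.
move=> dF x s.
have h1 : is_derive s 1 (fun s : R => c * s) c.
  have a := is_deriveM (is_derive_cst (c : R) s 1) (is_derive_id s 1).
  by apply: (@is_derive_eq _ _ _ _ _ _ _ _ a); rewrite /GRing.scale /= mulr0 addr0 mulr1.
have h := @is_derive1_comp R (fun s => F (c *: x + s *: v)) (fun s : R => c * s) s _ _ (dF _ _) h1.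
have E (t : R) : c *: (x + t *: v) = c *: x + (c * t) *: v by rewrite scalerDr scalerA.
rewrite E mulrC; move: h; congr (is_derive _ _ _ _).
by apply/funext => t /=; rewrite E.
Qed.

Section cutoff.
Context {R : realType} (d : nat).
Local Notation V := 'rV[R]_d.
Local Notation e i := (delta_mx ord0 i : V).

Definition hcut (y : V) : R := \prod_(i < d) cut (y ord0 i).
(** Equal to 1 on the cube of radius k + 1 and to 0 outside that of radius 2 (k + 1), with gradient
    O(1 / (k + 1)). *)
Definition cutK k (y : V) : R := hcut (k.+1%:R^-1 *: y).
Definition dcutK k i (y : V) : R := k.+1%:R^-1 * 'D_(e i) hcut (k.+1%:R^-1 *: y).

Let hcut_Ck k : Ck k hcut.
Proof.
apply: Ck_prod => i.
have := @Ck_comp_lin R R^o V (fun y => y ord0 i) 0 k cut.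
rewrite (_ : (fun w : V => cut (0 + _)) = (fun w : V => cut (w ord0 i))); last first.
  by apply/funext => w; rewrite add0r.
apply; last exact: Ck_cut.
- by move=> c u w; rewrite !mxE.
- by move=> y; exact: coord_continuous.
Qed.

Lemma hcut0 y : 2 < `|y| -> hcut y = 0.
Proof.
move=> h; have [i hi] : exists i, 2 < `|y ord0 i|.
  apply: contrapT => hn; move: h; rewrite ltNge => /negP; apply.
  by apply: normr_le_coord => // i; rewrite leNgt; apply/negP => hi; apply: hn; exists i.
by rewrite /hcut (bigD1 i)//= cut_eq0 ?mul0r// ltW.
Qed.

Let scale_gt k c (y : V) : c * k.+1%:R < `|y| -> c < `|k.+1%:R^-1 *: y|.
Proof.
move=> h; rewrite normrZ ger0_norm ?invr_ge0// mulrC ltr_pdivlMr//.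
Qed.

Lemma cutK_cont k : continuous (cutK k).
Proof.
move=> y; apply: (@continuous_comp _ _ _ (fun y : V => k.+1%:R^-1 *: y) hcut).
  exact: scaler_continuous.
exact: (hcut_Ck 0).
Qed.

Lemma dcutK_cont k i : continuous (dcutK k i).
Proof.
apply: contM; first exact: cont_cst.
move=> y; apply: (@continuous_comp _ _ _ (fun y : V => k.+1%:R^-1 *: y) ('D_(e i) hcut)).
  exact: scaler_continuous.
by have [_ h] := hcut_Ck 1; exact: h.
Qed.

Lemma cutK_dline k i : dline (cutK k) (e i) (dcutK k i).
Proof. by apply: (@dline_scale R d hcut (e i) ('D_(e i) hcut) k.+1%:R^-1); apply: dline_diff; have [] := hcut_Ck 1. Qed.

Lemma cutK_ge0 k y : 0 <= cutK k y.
Proof. by apply: prodr_ge0 => i _; exact: cut_ge0. Qed.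

Lemma cutK_le1 k y : cutK k y <= 1.
Proof.
suff /andP[] : 0 <= cutK k y <= 1 by [].
apply: (big_ind (fun z : R => 0 <= z <= 1)) => [|a b /andP[a0 a1] /andP[b0 b1]|i _].
- by rewrite ler01 lexx.
- by rewrite mulr_ge0// mulr_ile1.
- by rewrite cut_ge0 cut_le1.
Qed.

Lemma cutK_eq0 k y : 2 * k.+1%:R < `|y| -> cutK k y = 0.
Proof. by move=> h; apply: hcut0; exact: scale_gt. Qed.

Lemma cutK_eq1 k y : `|y| <= k.+1%:R -> cutK k y = 1.
Proof.
move=> h; rewrite /cutK /hcut big1// => i _; apply: cut_eq1; rewrite mxE.
rewrite normrM ger0_norm ?invr_ge0// mulrC ler_pdivrMr// mul1r.
exact: le_trans (norm_coord _ _) h.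
Qed.

Lemma dcutK_eq0 k i y : 2 * k.+1%:R < `|y| -> dcutK k i y = 0.
Proof.
move=> h; rewrite /dcutK derive_near0 ?mulr0//.
by have := near_norm_gt (scale_gt h); apply: filterS => z; exact: hcut0.
Qed.

Lemma dcutK_bound : exists2 M : R, 0 <= M & forall k i y, `|dcutK k i y| <= M / k.+1%:R.
Proof.
have h i : exists M : R, 0 <= M /\ forall y, `|'D_(e i) hcut y| <= M.
  have cD : continuous ('D_(e i) hcut) by have [_ h] := hcut_Ck 1; exact: h.
  have [M M0 hM] := continuous_bounded_cube 2 cD; exists M; split => // y.
  have [y2|y2] := leP `|y| 2; first exact: hM.
  rewrite derive_near0 ?normr0//.
  by have := near_norm_gt y2; apply: filterS => z; exact: hcut0.
have [b hb] := choice h; exists (\sum_i b i); first by apply: sumr_ge0 => i _; have [] := hb i.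
move=> k i y; rewrite normrM ger0_norm ?invr_ge0// mulrC ler_wpM2r ?invr_ge0//.
have [_ /(_ (k.+1%:R^-1 *: y)) h1] := hb i; apply: le_trans h1 _.
by rewrite (bigD1 i)//= lerDl sumr_ge0// => j _; have [] := hb j.
Qed.

End cutoff.

Lemma le2_of_le_sub (R : realType) (I a b c : R) : 2 <= I -> I <= a - b + c -> 0 <= b -> a <= 1 -> 2 <= 1 + c.
Proof. lra. Qed.

Lemma cvg_eventually (R : realType) (f : nat -> R) l N :
  (forall n, (N <= n)%N -> f n = l) -> f n @[n --> \oo] --> l.
Proof.
move=> h; apply/cvgrPdist_le => eps e0; exists N => // n /= hn.
by rewrite h// subrr normr0 ltW.
Qed.

Lemma cvg0_le (R : realType) (f g : nat -> R) : (forall n, 0 <= f n <= g n) ->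
  g n @[n --> \oo] --> (0 : R) -> f n @[n --> \oo] --> (0 : R).
Proof.
move=> h /cvgrPdist_le c; apply/cvgrPdist_le => eps e0; apply: filterS (c _ e0) => n.
have /andP[f0 fg] := h n; rewrite !sub0r !normrN !ger0_norm//; last exact: le_trans fg.
exact: le_trans.
Qed.

Lemma le_of_ge0_sub (R : realType) (I a b c : R) : 0 <= I -> I <= a - b + c -> b <= a + c.
Proof. lra. Qed.

Lemma PP_le_id (R : realType) (z : R) : 0 <= z -> PP z <= z.
Proof.
by move=> z0; rewrite /PP ler_pdivrMr ?ltr_pwDl// mulrDr mulr1 lerDl mulr_ge0.
Qed.

Section entropy_decay.
Context {R : realType} (d : nat).
Local Notation V := 'rV[R]_d.
Local Notation mu := (@leb R d).
Local Notation leb1 := (@lebesgue_measure R).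
Local Notation ig f := (mu.-integrable setT (EFin \o f)).
Local Notation ig1 f := (leb1.-integrable setT (EFin \o f)).
Local Notation e i := (delta_mx ord0 i : V).
Local Notation ind a b := (\1_(`]a, b] : set R) : R -> R).
Variables (lam eta m : R) (Psi : V -> R) (rho : R -> density R d).
Hypotheses (lam_gt0 : 0 < lam) (eta_gt0 : 0 < eta) (m_gt1 : 1 < m).
Hypotheses (Psi1 : Ck 1 Psi)
  (rho_cont : forall t : R, 0 <= t ->
     weak_cvg (within (`[0, +oo[ : set R) (nbhs t)) (fun s => dprob (rho s)) (dprob (rho t)))
  (rho_W : forall t : R, 0 < t -> W11loc (fun y => LF lam eta m (rho t y)))
  (rho_weak : forall phi : (R^o * V)%type -> R,
     test_fun [set p : R^o * V | 0 < p.1 :> R] phi ->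
     (\int[leb1]_(t in (`]0%R, +oo[ : set R))
       (\int[mu]_y
         (rho t y * derive1 (fun s : R => phi (s, y)) t
          - edot (rho t y *: grad Psi y + wgrad (fun z => LF lam eta m (rho t z)) y)
                 (grad (fun z => phi (t, z)) y)))%R%:E = 0)%E)
  (rho_energy : forall T : R, 0 < T ->
     (\int[leb1]_(t in (`]0%R, T] : set R)) \int[mu]_y
        (enorm (velocity lam eta m Psi rho t y) ^+ 2 * rho t y)%:E < +oo)%E).
Local Notation LF := (LF lam eta m).
Local Notation uu := (uu rho).
Local Notation GG := (GG lam eta m rho).
Local Notation jj := (jj lam eta m Psi rho).
Local Notation DD := (DD lam eta m Psi rho).
Local Notation Dr := (Dr lam eta m Psi rho).
Implicit Types (kap : V -> R).
Local Notation phi := (phi lam eta m).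
Local Notation lamb := (lamb lam eta m).
Local Notation phr := (phr lam eta m).
Local Notation PH := (PH lam eta m).
Local Notation dvJ := (dvJ lam eta m Psi rho).
Local Notation gd := (gd lam eta m Psi rho).
Local Notation qq := (qq lam eta m Psi rho).
Local Notation qi := (qi lam eta m Psi rho).
Local Notation wt := (wt lam eta m Psi).
Local Notation EE C := (EE_ lam eta m Psi C).
Local Notation AA C := (AA lam eta m Psi rho C).

Let u0 t y : 0 <= uu t y := density_ge0 (uu t) y.
Let wt0 C x : 0 <= wt C x := ltW (wt_gt0 lam eta m Psi C x).
Let mwt C : measurable_fun setT (wt C). Proof. by apply: wt_meas. Qed.
Let mcut k : measurable_fun setT (@cutK R d k).
Proof. by apply: continuous_measurable_rV; exact: cutK_cont. Qed.

Definition ET C f := (\int[mu]_x (PH (wt C x) (f x)))%R.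

Lemma PH_ig C t : ig (fun x => PH (wt C x) (uu t x)).
Proof.
apply: (@ig_le _ _ _ mu _ (fun x => uu t x)); last exact: ig_density.
- by apply: PH_meas => //; exact: uu_meas.
- by move=> x; rewrite ger0_norm ?PH_ge0//; exact: PH_le.
Qed.

Lemma lambqq_ge0 C t x : 0 <= lamb (wt C x) (uu t x) * qq t x.
Proof. by apply: mulr_ge0; [exact: lamb_ge0|exact: qq_ge0]. Qed.

Lemma AA_ge0 C k t : 0 <= AA C (cutK k) t.
Proof. by apply: Rint_ge0 => x; apply: mulr_ge0; [exact: cutK_ge0|exact: lambqq_ge0]. Qed.

Lemma EE_cvg C t : EE C (cutK k) (uu t) @[k --> \oo] --> ET C (uu t).
Proof.
have mP : measurable_fun setT (fun x => PH (wt C x) (uu t x)) := ig_meas (PH_ig C t).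
have [|||_ c _] := @Rdct _ _ _ mu (fun k x => cutK k x * PH (wt C x) (uu t x))
   (fun x => PH (wt C x) (uu t x)) (fun x => PH (wt C x) (uu t x)) _ mP _ (PH_ig C t).
- by move=> k; apply: measurable_funM.
- apply: aeW => x; apply: (@cvg_eventually _ _ _ (Num.bound `|x|)) => k hk.
  rewrite cutK_eq1 ?mul1r//.
  apply: ltW; apply: lt_le_trans (archi_boundP (normr_ge0 x)) _; rewrite ler_nat.
  exact: leqW.
- move=> k x; rewrite ger0_norm; last by rewrite mulr_ge0 ?cutK_ge0 ?PH_ge0.
  by rewrite ler_piMl ?cutK_le1 ?PH_ge0.
exact: c.
Qed.

Lemma EE_ge0 C k t : 0 <= EE C (cutK k) (uu t).
Proof. by apply: Rint_ge0 => x; rewrite mulr_ge0 ?cutK_ge0 ?PH_ge0. Qed.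

Lemma EE_le1 C k t : EE C (cutK k) (uu t) <= 1.
Proof.
rewrite -(Rint_density (uu t)); apply: Rint_le; [|exact: ig_density|].
- apply: (@EE_ig R d lam eta m Psi lam_gt0 eta_gt0 m_gt1 Psi1 C (cutK k) (2 * k.+1%:R)) => //.
  + exact: cutK_cont.
  + by move=> x; exact: cutK_ge0.
  + by move=> x; exact: cutK_eq0.
  + exact: uu_lint.
- move=> x; apply: le_trans (_ : PH (wt C x) (uu t x) <= _); last exact: PH_le.
  by rewrite ler_piMl ?cutK_le1 ?PH_ge0.
Qed.

(** The constant c is the same for all C, k and times, so on a fixed time interval the cutoff error
    disappears as k -> oo. *)
Lemma cut_dissipation : exists2 c : R, 0 <= c & forall C k s t, 0 < s -> s < t ->
  ig1 (fun z => ind s t z * (gd z * AA C (cutK k) z)) /\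
  \int[leb1]_z (ind s t z * (gd z * AA C (cutK k) z)) <=
  EE C (cutK k) (uu s) - EE C (cutK k) (uu t) +
  c / k.+1%:R * \int[leb1]_z (ind s t z * (1 * (Dr z + 1))).
Proof.
have [M M0 hM] := @dcutK_bound R d; exists (d%:R * M); first exact: mulr_ge0.
move=> C k s t s0 st; have t0 : 0 < t by apply: lt_trans st.
have iD c : ig1 (fun z => ind s t z * (c * (Dr z + 1))) := ind_Dr_ig lam_gt0 eta_gt0 m_gt1 Psi1 rho_cont rho_W rho_energy c (ltW s0) t0.
rewrite -RintZ//.
have [||||||||||i1 h1] := @dissipation_ineq R d lam eta m Psi rho lam_gt0 eta_gt0 m_gt1 Psi1 rho_cont rho_W rho_weak rho_energy C
  (cutK k) (dcutK k) (2 * k.+1%:R) (M / k.+1%:R) _ _ _ _ _ _ _ _ _ _ s t s0 st.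
- by rewrite mulr_ge0.
- by rewrite divr_ge0.
- exact: cutK_cont.
- by move=> i; exact: dcutK_cont.
- by move=> i; exact: cutK_dline.
- by move=> x; exact: cutK_ge0.
- by move=> x; exact: cutK_le1.
- by move=> x; exact: cutK_eq0.
- by move=> i x; exact: dcutK_eq0.
- by move=> i x; exact: hM.
split => //; apply: le_trans h1 _; rewrite lerD2l.
apply: (@Rint_le _ _ _ leb1 _ _ (iD _) (igZ _ (iD 1))) => z.
by rewrite mul1r mulrCA -!mulrA.
Qed.

Let cvg_divn (c x : R) : c / k.+1%:R * x @[k --> \oo] --> 0.
Proof.
have h : (k.+1%:R^-1 : R) @[k --> \oo] --> 0 by exact: cvg_harmonic.
have h2 : c / k.+1%:R @[k --> \oo] --> c * (0 : R) by apply: cvgMl_tmp.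
have h3 : c / k.+1%:R * x @[k --> \oo] --> c * (0 : R) * x by apply: cvgMr_tmp.
by rewrite mulr0 mul0r in h3.
Qed.

Lemma ET_le C s t : 0 < s -> s <= t -> ET C (uu t) <= ET C (uu s).
Proof.
move=> s0; rewrite le_eqVlt => /predU1P[->//|st].
have [c c0 hc] := cut_dissipation; set X := \int[leb1]_z (ind s t z * (1 * (Dr z + 1))).
have c1 : EE C (cutK k) (uu s) + c / k.+1%:R * X @[k --> \oo] --> ET C (uu s).
  by have := cvgD (@EE_cvg C s) (cvg_divn c X); rewrite addr0; exact.
have h k : EE C (cutK k) (uu t) <= EE C (cutK k) (uu s) + c / k.+1%:R * X.
  have [_ h] := hc C k s t s0 st.
  have p : 0 <= \int[leb1]_z (ind s t z * (gd z * AA C (cutK k) z)).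
    apply: (@Rint_ge0 _ _ _ leb1) => z; apply: mulr_ge0 => //; apply: mulr_ge0; last exact: AA_ge0.
    by have [[->]|->] := gdP lam eta m Psi rho z.
  exact: le_of_ge0_sub p h.
exact: (ler_cvg_to (@EE_cvg C t) c1 (nearW _ h)).
Qed.

(** Otherwise the dissipation is at least eps at almost every time of an interval of length 2 / eps
    and consumes 2 units of entropy, while [EE_le1] grants only 1 and the cutoff error tends to
    0. *)
Lemma good_times (r eps T0 : R) : 0 < eps -> 0 < T0 ->
  exists t, [/\ T0 <= t, (DD t < +oo)%E &
    \int[mu]_x (\1_(cube r) x * (lamb (wt 0 x) (uu t x) * qq t x)) < eps].
Proof.
move=> eps0 T00; apply: contrapT => hn.
have [k0 hk0] : exists k0 : nat, r <= k0%:R.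
  by exists (Num.bound `|r|); apply: le_trans (ler_norm r) _; apply: ltW; exact: archi_boundP.
pose T1 := T0 + 2 / eps.
have T01 : T0 < T1 by rewrite ltrDl divr_gt0.
have T10 : 0 < T1 by apply: lt_trans T01.
have mcube : measurable_fun setT (\1_(@cube R d r) : V -> R).
  by apply: measurable_indic; exact: measurable_cube.
have lqm t : measurable_fun setT (fun x => lamb (wt 0 x) (uu t x) * qq t x).
  by apply: measurable_funM; [apply: lamb_meas => //; exact: uu_meas|exact: qq_meas].
have AAge k t : (k0 <= k)%N -> T0 <= t -> (DD t < +oo)%E -> eps <= AA 0 (cutK k) t.
  move=> hk ht Dt; rewrite leNgt; apply/negP => hlt; apply: hn; exists t; split => //.
  apply: le_lt_trans hlt.
  have ia : ig (fun x => cutK k x * (lamb (wt 0 x) (uu t x) * qq t x)).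
    have [K K0 hK] : exists2 K : R, 0 < K & forall x, cube (2 * k.+1%:R) x -> lamb (wt 0 x) (uu t x) <= K.
      have [w1 [w2 [w10 hw]]] : exists w1 w2 : R, 0 < w1 /\ forall x, cube (2 * k.+1%:R) x -> w1 <= wt 0 x /\ wt 0 x <= w2.
        by apply: wt_bounds.
      have [K K0 hK] := entropy_bounds lam_gt0 eta_gt0 m_gt1 w2 w10.
      by exists K => // x /hw[h1 h2]; have [] := hK _ _ h1 h2 (u0 t x).
    apply: (@ig_le _ _ _ mu _ (fun x => K * qq t x)); [exact: measurable_funM| |exact/igZ/qq_ig].
    move=> x; rewrite ger0_norm; last by apply: mulr_ge0; [exact: cutK_ge0|exact: lambqq_ge0].
    have [hx|hx] := leP `|x| (2 * k.+1%:R); last first.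
      by rewrite cutK_eq0// mul0r mulr_ge0 ?(ltW K0)// qq_ge0.
    apply: (@le_trans _ _ (lamb (wt 0 x) (uu t x) * qq t x)).
      by apply: ler_piMl; [exact: lambqq_ge0|exact: cutK_le1].
    by apply: ler_wpM2r; [exact: qq_ge0|exact: hK].
  have le1 x : \1_(cube r) x * (lamb (wt 0 x) (uu t x) * qq t x) <= cutK k x * (lamb (wt 0 x) (uu t x) * qq t x).
    apply: ler_wpM2r; first exact: lambqq_ge0.
    rewrite indicE; have [xr|xr] := boolP (x \in cube r); last exact: cutK_ge0.
    rewrite cutK_eq1//; rewrite inE in xr; apply: (le_trans xr); apply: (le_trans hk0).
    by rewrite ler_nat; apply: leqW.
  apply: Rint_le => //; apply: (@ig_le _ _ _ mu _ _ _ _ ia); first exact: measurable_funM.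
  by move=> x; rewrite ger0_norm//; apply: mulr_ge0 => //; exact: lambqq_ge0.
have [c c0 hc] := cut_dissipation; set X := \int[leb1]_z (ind T0 T1 z * (1 * (Dr z + 1))).
have mi : measurable_fun setT (ind T0 T1) by exact: measurable_indic.
have iI : ig1 (ind T0 T1).
  apply: ig_ge0P => //; rewrite integral_indic// setIT.
  by have := @lebesgue_measure_itv R `]T0, T1]; rewrite /= lte_fin T01 => ->; rewrite -EFinB ltry.
have II : \int[leb1]_z ind T0 T1 z = 2 / eps.
  rewrite /Rintegral integral_indic// setIT.
  by have := @lebesgue_measure_itv R `]T0, T1]; rewrite /= lte_fin T01 => ->; rewrite -EFinB /= /T1 addrAC subrr add0r.
have key k : (k0 <= k)%N -> 2 <= 1 + c / k.+1%:R * X.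
  move=> hk; have [i1 h1] := hc 0 k T0 T1 T00 T01.
  have e0 := EE_ge0 0 k T1; have e1 := EE_le1 0 k T0.
  have mgd : measurable_fun setT gd := gd_meas lam_gt0 eta_gt0 m_gt1 Psi1 rho_cont rho_W.
  have ig2 : ig1 (fun z => ind T0 T1 z * (eps * gd z)).
    apply: (@ig_le _ _ _ leb1 _ _ _ _ (igZ eps iI)); first by do 2 apply: measurable_funM => //.
    move=> z; rewrite mulrCA normrM (gtr0_norm eps0) ler_wpM2l ?(ltW eps0)// normrM.
    by have [[->]|->] := gdP lam eta m Psi rho z; rewrite ?normr1 ?normr0 ?mulr1 ?mulr0 ?ger0_norm.
  have h2 : \int[leb1]_z (ind T0 T1 z * (eps * gd z)) <= \int[leb1]_z (ind T0 T1 z * (gd z * AA 0 (cutK k) z)).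
    apply: (@Rint_le _ _ _ leb1 _ _ ig2 i1) => z; rewrite indE.
    have [/andP[/ltW hz1 hz2]|_] := boolP (T0 < z <= T1); last by rewrite !mul0r.
    have [[-> Dz]|->] := gdP lam eta m Psi rho z; last by rewrite !(mulr0, mul0r).
    by rewrite mulr1 !mul1r; exact: AAge.
  have h3 : \int[leb1]_z (ind T0 T1 z * (eps * gd z)) = 2.
    transitivity (\int[leb1]_z (eps * ind T0 T1 z)); last by rewrite RintZ// II mulrCA divff ?mulr1 ?gt_eqF.
    apply: (@Rint_ae _ _ _ leb1); [exact: ig_meas ig2|exact: measurable_funM|].
    have hD := DD_ae lam_gt0 eta_gt0 m_gt1 Psi1 rho_cont rho_W rho_energy T10.
    apply: (@filterS _ (almost_everywhere leb1) _ _ _ _ hD) => z hz; rewrite indE.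
    have [/andP[hz1 hz2]|_] := boolP (T0 < z <= T1); last by rewrite !(mulr0, mul0r).
    by rewrite /gd hz ?mulr1 ?mul1r//; exact: lt_trans hz1.
  rewrite h3 in h2; exact: le2_of_le_sub h2 h1 e0 e1.
have cX : 1 + c / k.+1%:R * X @[k --> \oo] --> (1 : R).
  by have := cvgD (cvg_cst (1 : R)) (cvg_divn c X); rewrite addr0; exact.
have c2 : (2 : R) @[k --> \oo] --> (2 : R) by exact: cvg_cst.
have : (2 : R) <= 1.
  by apply: (ler_cvg_to c2 cX); exists k0 => // k /= hk; exact: key.
by rewrite leNgt => /negP; apply; rewrite ltr1n.
Qed.

(** As C -> oo the weight, hence z, tends to 0 at each point; PH <= z u gives pointwise convergence
    and PH <= u the majorant. *)
Lemma ET_tail t : ET n%:R (uu t) @[n --> \oo] --> (0 : R).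
Proof.
have [||||_ c _] := @Rdct _ _ _ mu (fun n x => PH (wt n%:R x) (uu t x)) (fun=> 0) (uu t) _ _ _ (ig_density (uu t)).
- by move=> n; exact: ig_meas (PH_ig _ _).
- exact: measurable_cst.
- apply: aeW => x.
  have wc : wt n%:R x @[n --> \oo] --> (0 : R).
    rewrite (_ : (fun n => _) = (fun n => expR ((Psi x - kp eta m) / lam) * (expR (- lam^-1)) ^+ n)); last first.
      by apply/funext => n; rewrite /EntropyWeights.wt -expRM_natr -expRD; congr expR; field; rewrite gt_eqF.
    rewrite -[X in _ --> X](mulr0 (expR ((Psi x - kp eta m) / lam))); apply: cvgMl_tmp.
    by apply: cvg_expr; rewrite ger0_norm ?expR_ge0// expR_lt1 oppr_lt0 invr_gt0.
  have zc : EntropyKernel.gz lam eta m (uu t x) * wt n%:R x * uu t x @[n --> \oo] --> (0 : R).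
    have h2 : EntropyKernel.gz lam eta m (uu t x) * wt n%:R x @[n --> \oo] --> EntropyKernel.gz lam eta m (uu t x) * (0 : R) by apply: cvgMl_tmp.
    have h3 : EntropyKernel.gz lam eta m (uu t x) * wt n%:R x * uu t x @[n --> \oo] --> EntropyKernel.gz lam eta m (uu t x) * (0 : R) * uu t x by apply: cvgMr_tmp.
    by rewrite mulr0 mul0r in h3.
  apply: (cvg0_le _ zc) => n; rewrite PH_ge0//=; apply: le_trans (PH_le_phi _ _ _ _ _) _ => //.
  apply: ler_wpM2r => //; apply: PP_le_id; apply: mulr_ge0 => //; exact: gz_ge0.
- by move=> n x; rewrite ger0_norm ?PH_ge0//; exact: PH_le.
by rewrite Rint0 in c.
Qed.

End entropy_decay.

End EntropyDecay.
Import EntropyDecay.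

(** * The profiles U(.; C) and an integrable comparison function *)

Module EquilibriumProfile.

Opaque ez.

Lemma IVT_pos (R : realType) (f : R -> R) (y : R) : 0 < y -> f 0 = 0 -> y <= f y ->
  continuous f -> exists2 r, 0 < r & f r = y.
Proof.
move=> y0 f0 fy cf; have cg : {within `[0, y], continuous f} by exact: continuous_subspaceT.
have hb : Num.min (f 0) (f y) <= y <= Num.max (f 0) (f y).
  by rewrite ge_min f0 (ltW y0) le_max fy orbT.
have [r] := IVT (ltW y0) cg hb; rewrite in_itv /= => /andP[r0 _] E.
exists r => //; rewrite lt_neqAle r0 andbT; apply/eqP => r0'.
by move: y0; rewrite -E -r0' f0 ltxx.
Qed.

Section equilibrium.
Context {R : realType} (d : nat).
Local Notation V := 'rV[R]_d.
Local Notation mu := (@leb R d).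
Local Notation leb1 := (@lebesgue_measure R).
Local Notation ig f := (mu.-integrable setT (EFin \o f)).
Variables (lam eta m : R) (Psi : V -> R).
Hypotheses (d_gt0 : (0 < d)%N) (lam_gt0 : 0 < lam) (eta_gt0 : 0 < eta) (m_gt1 : 1 < m).
Hypotheses (Psi1 : Ck 1 Psi) (Psi_ge0 : forall y, 0 <= Psi y)
  (Psi_growth : exists r delta : R, [/\ 0 < r, 0 < delta &
     forall y : V, r <= enorm y -> (lam * (d%:R + 2) + delta) * ln (enorm y) <= Psi y]).
Local Notation gz := (gz lam eta m).
Local Notation kp := (kp eta m).
Local Notation hfun := (hfun lam eta m).
Local Notation U := (Ufun lam eta m Psi).
Local Notation wt := (wt lam eta m Psi).

Let gz0 : gz 0 = 0. Proof. by rewrite /EntropyKernel.gz mul0r. Qed.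
Let gz_gei r : 0 <= r -> r <= gz r.
Proof. by move=> r0; rewrite /EntropyKernel.gz ler_peMr// ez_ge1. Qed.

Lemma gz_surj y : 0 < y -> exists2 r, 0 < r & gz r = y.
Proof.
move=> y0; apply: IVT_pos => //; last exact: gz_continuous.
by apply: gz_gei; exact: ltW.
Qed.

(** A strictly increasing function reflects convergence. The case l - eps < 0 is separate because
    monotonicity is used on [0, oo[ only. *)
Lemma gz_cvg_inv (a : nat -> R) (l : R) : (forall n, 0 <= a n) -> 0 <= l ->
  gz (a n) @[n --> \oo] --> gz l -> a n @[n --> \oo] --> l.
Proof.
move=> a0 l0 h; apply/cvgrPdist_lt => eps e0.
have h1 : gz l < gz (l + eps) by apply: gz_lt => //; rewrite ltrDl.
have n1 : \forall n \near \oo, gz (a n) < gz (l + eps) by exact: (cvgr_lt _ h).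
have le1 : l < l + eps by rewrite ltrDl.
have n2 : \forall n \near \oo, l - eps < a n.
  have [le|le] := ltP (l - eps) 0; first by apply: nearW => n; exact: lt_le_trans le (a0 n).
  have h2 : gz (l - eps) < gz l by apply: gz_lt => //; rewrite ltrBlDr ltrDl.
  have n3 : \forall n \near \oo, gz (l - eps) < gz (a n) by exact: (cvgr_gt _ h).
  apply: filterS n3 => n hn; rewrite ltNge; apply/negP => hl.
  have := gz_le lam_gt0 eta_gt0 m_gt1 (a0 n) hl.
  by rewrite leNgt => /negP; apply.
near=> n; rewrite distrC ltr_distl; apply/andP; split; first by near: n.
rewrite ltNge; apply/negP => hl.
have := gz_le lam_gt0 eta_gt0 m_gt1 (addr_ge0 l0 (ltW e0)) hl.
rewrite leNgt => /negP; apply; by near: n.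
Unshelve. all: by end_near.
Qed.

Lemma gz_wt z C x : 0 < z -> gz z * wt C x = expR ((hfun z + Psi x - C) / lam).
Proof.
move=> z0; rewrite /EntropyKernel.gz ezE; last exact: ltW.
rewrite /EntropyWeights.wt -mulrA -expRD -{1}(lnK z0) -expRD; congr expR.
rewrite /Defs.hfun -/kp; move: (ln z) (z `^ _) => L P; field.
by rewrite gt_eqF.
Qed.

Lemma hfun_eq z C x : 0 < z -> (hfun z = C - Psi x) <-> (gz z * wt C x = 1).
Proof.
move=> z0; rewrite gz_wt//; split => [->|].
  by rewrite subrK subrr mul0r expR0.
rewrite -[X in _ = X -> _]expR0 => /expR_inj /eqP.
rewrite mulf_eq0 invr_eq0 (gt_eqF lam_gt0) orbF subr_eq0 => /eqP <-.
by rewrite addrK.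
Qed.

(** [gz] attains the value 1 / wt C x, so the choice made by [hinv] is never its default. *)
Lemma Ufun_spec C x : 0 < U C x /\ hfun (U C x) = C - Psi x.
Proof.
have w0 : 0 < (wt C x)^-1 by rewrite invr_gt0 wt_gt0.
have [r r0 E] := gz_surj w0.
apply: (@xgetPex _ 0 [set z | 0 < z /\ hfun z = C - Psi x]); exists r; split => //.
by apply/(hfun_eq _ _ r0); rewrite E mulVf// gt_eqF// wt_gt0.
Qed.

Lemma Ufun_gt0 C x : 0 < U C x. Proof. by have [] := Ufun_spec C x. Qed.

Lemma gz_Ufun C x : gz (U C x) * wt C x = 1.
Proof. by have [u0 h] := Ufun_spec C x; apply/(hfun_eq _ _ u0). Qed.

Lemma gz_UfunE C x : gz (U C x) = (wt C x)^-1.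
Proof.
have wne : wt C x != 0 by rewrite gt_eqF// wt_gt0.
by apply: (mulIf wne); rewrite gz_Ufun mulVf.
Qed.

Let wtV C x : (wt C x)^-1 = expR ((C + kp) / lam) * expR (- Psi x / lam).
Proof. by rewrite /EntropyWeights.wt -expRN -expRD; congr expR; field; rewrite gt_eqF. Qed.

Lemma Ufun_lt C C' x : C < C' -> U C x < U C' x.
Proof.
move=> CC; rewrite ltNge; apply/negP => h.
have := gz_le lam_gt0 eta_gt0 m_gt1 (ltW (Ufun_gt0 C' x)) h.
rewrite !gz_UfunE !wtV leNgt => /negP; apply.
by rewrite ltr_pM2r ?expR_gt0// ltr_expR ltr_pM2r ?invr_gt0// ltrD2r.
Qed.

(** Comparison with a multiple of the Gibbs density exp(-Psi / lam): the inequality r <= gz r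
    discards the power term of h. *)
Lemma Ufun_le_exp C x : U C x <= expR ((C + kp) / lam) * expR (- Psi x / lam).
Proof. by rewrite -wtV -gz_UfunE; apply: gz_gei; exact: ltW (Ufun_gt0 C x). Qed.

Lemma Ufun_cvg (c : nat -> R) (x : nat -> V) C y : c n @[n --> \oo] --> C -> x n @[n --> \oo] --> y ->
  U (c n) (x n) @[n --> \oo] --> U C y.
Proof.
move=> hc hx; apply: gz_cvg_inv; [by move=> n; exact: ltW (Ufun_gt0 _ _)|exact: ltW (Ufun_gt0 _ _)|].
rewrite gz_UfunE wtV; under eq_fun do rewrite gz_UfunE wtV.
have cP : Psi (x n) @[n --> \oo] --> Psi y.
  exact: (@cvg_comp _ _ _ x Psi \oo (nbhs y) _ hx (Ck_continuous Psi1 (x := y))).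
apply: cvgM; apply: cvg_cont_seq; try exact: continuous_expR.
  by apply: cvgMr_tmp; apply: cvgD => //; exact: cvg_cst.
by apply: cvgMr_tmp; exact: cvgN.
Qed.

Lemma Ufun_continuous C : continuous (U C).
Proof.
move=> y; apply: seq_continuous => x hx; apply: Ufun_cvg => //; exact: cvg_cst.
Qed.

Lemma Ufun_meas C : measurable_fun setT (U C).
Proof. by apply: continuous_measurable_rV; exact: Ufun_continuous. Qed.

End equilibrium.

Section power_integral.
Context {R : realType}.
Local Notation leb1 := (@lebesgue_measure R).
Variable a : R.
Hypothesis a0 : 0 < a.

(** The power (1 + |x|)^-(1 + a), written with exp and ln. *)
Definition tail1 (x : R) : R := expR (- (1 + a) * ln (1 + `|x|)).

Lemma tail1_continuous : continuous tail1.
Proof.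
move=> x; apply: (@continuous_comp _ _ _ (fun x : R => - (1 + a) * ln (1 + `|x|)) expR); last exact: continuous_expR.
apply: cvgMl_tmp; apply: (@continuous_comp _ _ _ (fun x : R => 1 + `|x|) (@ln R)).
  by apply: cvgD; [exact: cvg_cst|exact: norm_continuous].
by apply: continuous_ln; rewrite ltr_pwDl.
Qed.

Lemma tail1_gt0 x : 0 < tail1 x. Proof. exact: expR_gt0. Qed.

(** By symmetry it suffices to integrate over the half-line, where -(1/a) (1 + x)^-a is a
    primitive. *)
Lemma tail1_fin : (\int[leb1]_x (tail1 x)%:E < +oo)%E.
Proof.
rewrite ge0_symfun_integralT; last 3 first.
- by move=> x; exact: ltW (tail1_gt0 x).
- exact: tail1_continuous.
- by move=> x; rewrite /tail1 /= normrN.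
rewrite -set_itvcy.
pose F (x : R) := - a^-1 * expR (- a * ln (1 + `|x|)).
have cF : continuous F.
  move=> x; apply: cvgMl_tmp; apply: (@continuous_comp _ _ _ (fun x : R => - a * ln (1 + `|x|)) expR); last exact: continuous_expR.
  apply: cvgMl_tmp; apply: (@continuous_comp _ _ _ (fun x : R => 1 + `|x|) (@ln R)).
    by apply: cvgD; [exact: cvg_cst|exact: norm_continuous].
  by apply: continuous_ln; rewrite ltr_pwDl.
have dF (x : R) : 0 < x -> is_derive x 1 F (tail1 x).
  move=> x0; have x1 : 0 < 1 + x by rewrite addr_gt0.
  have h0 : is_derive x 1 (fun x : R => 1 + x) 1.
    have := is_deriveD (is_derive_cst (1 : R) x 1) (is_derive_id x 1).
    by move=> h; apply: (@is_derive_eq _ _ _ _ _ _ _ _ h); rewrite add0r.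
  have h1 := @is_derive1_comp R (@ln R) (fun x : R => 1 + x) x _ _ (is_derive1_ln x1) h0.
  have h2 := is_deriveM (is_derive_cst (- a : R) x 1) h1.
  have h3 := @is_derive1_comp R expR _ x _ _ (is_derive_expR _) h2.
  have h4 := is_deriveM (is_derive_cst (- a^-1 : R) x 1) h3.
  have h5 : is_derive x 1 (fun x : R => - a^-1 * expR (- a * ln (1 + x))) (tail1 x).
    apply: (@is_derive_eq _ _ _ _ _ _ _ _ h4).
    rewrite /GRing.scale /= !mulr0 !addr0 mulr1 /tail1 gtr0_norm//.
    have -> : - (1 + a) * ln (1 + x) = - ln (1 + x) + - a * ln (1 + x) by ring.
    rewrite expRD expRN lnK//; field.
    by rewrite (gt_eqF a0) gt_eqF.
  apply: (@near_eq_is_derive _ _ _ (fun x : R => - a^-1 * expR (- a * ln (1 + x)))) => //.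
  have : \near x, 0 < x by exact: lt_nbhsr.
  by apply: filterS => z z0; rewrite /F gtr0_norm.
rewrite (@ge0_continuous_FTC2y R tail1 F 0 0).
- by rewrite -EFinB -EFinM ltry.
- by move=> x _; exact: ltW (tail1_gt0 x).
- by apply: continuous_subspaceT; exact: tail1_continuous.
- rewrite -(mulr0 (- a^-1)); apply: cvgMl_tmp.
  apply/cvgrPdist_lt => eps e0; near=> x.
  rewrite sub0r normrN gtr0_norm ?expR_gt0//.
  have hx : expR (- (ln eps) / a) < x by near: x; exact: nbhs_pinfty_gt.
  have x0 : 0 < x by apply: lt_trans hx; exact: expR_gt0.
  rewrite -[X in _ < X](lnK e0) ltr_expR (gtr0_norm x0) mulNr ltrNl.
  rewrite mulrC -ltr_pdivrMr// -ltr_expR lnK ?posrE ?addr_gt0//.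
  by apply: (lt_trans hx); rewrite ltrDr.
- by move=> x x0; have [] := dF x x0.
- by apply: cvg_at_right_filter; exact: cF.
- by move=> x; rewrite in_itv /= andbT => x0; rewrite derive1E; have [_ ->] := dF x x0.
Unshelve. all: by end_near.
Qed.

Variable d : nat.
Local Notation V := 'rV[R]_d.
Local Notation mu := (@leb R d).
Local Notation ig f := (mu.-integrable setT (EFin \o f)).

(** A product over coordinates rather than a power of the norm, so that [leb_prod] gives
    integrability for every a > 0. *)
Definition tail (y : V) : R := \prod_(i < d) tail1 (y ord0 i).

Lemma tail_gt0 y : 0 < tail y.
Proof. by apply: prodr_gt0 => i _; exact: tail1_gt0. Qed.

Lemma tail_meas : measurable_fun setT tail.
Proof.
apply: measurable_prod => i _; apply: (measurableT_comp _ (measurable_coord i)).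
by apply: continuous_measurable_fun; exact: tail1_continuous.
Qed.

Lemma tail_ig : ig tail.
Proof.
apply: ig_ge0P; [exact: tail_meas|by move=> y; exact: ltW (tail_gt0 y)|].
rewrite leb_prod; last 2 first.
- by apply: continuous_measurable_fun; exact: tail1_continuous.
- by move=> x; exact: ltW (tail1_gt0 x).
have h0 : (0 <= \int[leb1]_x (tail1 x)%:E)%E.
  by apply: integral_ge0 => x _; rewrite lee_fin; exact: ltW (tail1_gt0 x).
have [r ->] : exists r : R, (\int[leb1]_x (tail1 x)%:E = r%:E)%E.
  by exists (fine (\int[leb1]_x (tail1 x)%:E)%E); rewrite fineK// ge0_fin_numE// tail1_fin.
by rewrite -EFin_expe ltry.
Qed.

Lemma tail_ln y : ln (tail y) = - (1 + a) * \sum_i ln (1 + `|y ord0 i|).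
Proof. by rewrite /tail -expR_sum expRK mulr_sumr. Qed.

End power_integral.

End EquilibriumProfile.
Import EquilibriumProfile.

(** * Times at which phi(u) is nearly constant on a large cube *)

Module GoodTimes.

Opaque ez.

Lemma cont_sum (R : realType) (d : nat) (I : Type) (s : seq I) (F : I -> 'rV[R]_d -> R) :
  (forall i, continuous (F i)) -> continuous (fun x => \sum_(i <- s) F i x).
Proof.
move=> h; elim: s => [|i s IH].
  by under eq_fun do rewrite big_nil; exact: cont_cst.
by under eq_fun do rewrite big_cons; apply: contD.
Qed.

Lemma mul2_addrr (R : realType) (a : R) : 2 * a = a + a.
Proof. ring. Qed.

Lemma mul_le_inv (R : realType) (k M I : R) : 0 < k -> 0 < M -> I < (M * k)^-1 -> k * I <= M^-1.
Proof. by move=> k0 M0 /ltW h; rewrite -ler_pdivlMl// mulrC -invfM. Qed.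

Lemma div_shift_le_inv (R : realType) (M x : R) : 0 < M -> 0 <= x -> x / (M * (x + 1)) <= M^-1.
Proof.
move=> M0 x0; rewrite ler_pdivrMr ?mulr_gt0 ?ltr_wpDl// mulKf ?gt_eqF//.
by rewrite lerDl.
Qed.

Lemma mulrn_div_lt_inv (R : realType) (M : R) (d : nat) : 0 < M -> 2 / (4 * M * d.+1%:R) *+ d < M^-1.
Proof.
move=> M0; rewrite -[X in X < _]mulr_natr.
have -> : 2 / (4 * M * d.+1%:R) * d%:R = M^-1 * (d%:R / (2 * d.+1%:R)).
  have : (d.+1%:R : R) != 0 by [].
  by move: (d.+1%:R) => D D0; field; rewrite D0 gt_eqF.
rewrite gtr_pMr ?invr_gt0// ltr_pdivrMr ?mulr_gt0// mul1r -natrM ltr_nat.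
by rewrite mul2n -addnn addSn ltnS leq_addr.
Qed.

(** Young's inequality with parameter k; thanks to l <= K u the remainder is K / k. Later k is taken
    large first and the dissipation small afterwards. *)
Lemma flux_amgm (R : realType) (k j u l K : R) : 0 < k -> 0 < u -> 0 <= l -> l <= K * u ->
  l * `|j| / u <= k * (l * (u^-1 * j ^+ 2)) + K / k.
Proof.
move=> k0 u0 l0 lK; set a := l / u.
have a0 : 0 <= a by rewrite divr_ge0// ltW.
have aK : a <= K by rewrite ler_pdivrMr.
have E1 : l * `|j| / u = a * `|j| by rewrite /a mulrAC.
have E2 : k * (l * (u^-1 * j ^+ 2)) = k * (a * j ^+ 2) by rewrite /a !mulrA.
rewrite E1 E2; apply: (@le_trans _ _ (k * (a * j ^+ 2) + a / k)); last first.
  by rewrite lerD2l ler_wpM2r// invr_ge0 ltW.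
rewrite -(real_normK (num_real j)); set b := `|j|.
have -> : k * (a * b ^+ 2) + a / k = a * (k * b ^+ 2 + k^-1) by ring.
apply: ler_wpM2l => //.
have -> : k * b ^+ 2 + k^-1 = b + k^-1 * ((k * b - 2^-1) ^+ 2 + 3 / 4) by field; rewrite gt_eqF.
by rewrite lerDl mulr_ge0 ?invr_ge0 ?(ltW k0)// addr_ge0 ?sqr_ge0// divr_ge0.
Qed.

Section good_step.
Context {R : realType} (d : nat).
Local Notation V := 'rV[R]_d.
Local Notation mu := (@leb R d).
Local Notation leb1 := (@lebesgue_measure R).
Local Notation ig f := (mu.-integrable setT (EFin \o f)).
Local Notation ig1 f := (leb1.-integrable setT (EFin \o f)).
Local Notation e i := (delta_mx ord0 i : V).
Local Notation ind a b := (\1_(`]a, b] : set R) : R -> R).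
Variables (lam eta m : R) (Psi : V -> R) (rho : R -> density R d).
Hypotheses (lam_gt0 : 0 < lam) (eta_gt0 : 0 < eta) (m_gt1 : 1 < m).
Hypotheses (Psi1 : Ck 1 Psi)
  (rho_cont : forall t : R, 0 <= t ->
     weak_cvg (within (`[0, +oo[ : set R) (nbhs t)) (fun s => dprob (rho s)) (dprob (rho t)))
  (rho_W : forall t : R, 0 < t -> W11loc (fun y => LF lam eta m (rho t y)))
  (rho_weak : forall phi : (R^o * V)%type -> R,
     test_fun [set p : R^o * V | 0 < p.1 :> R] phi ->
     (\int[leb1]_(t in (`]0%R, +oo[ : set R))
       (\int[mu]_y
         (rho t y * derive1 (fun s : R => phi (s, y)) t
          - edot (rho t y *: grad Psi y + wgrad (fun z => LF lam eta m (rho t z)) y)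
                 (grad (fun z => phi (t, z)) y)))%R%:E = 0)%E)
  (rho_energy : forall T : R, 0 < T ->
     (\int[leb1]_(t in (`]0%R, T] : set R)) \int[mu]_y
        (enorm (velocity lam eta m Psi rho t y) ^+ 2 * rho t y)%:E < +oo)%E).
Local Notation LF := (LF lam eta m).
Local Notation uu := (uu rho).
Local Notation GG := (GG lam eta m rho).
Local Notation jj := (jj lam eta m Psi rho).
Local Notation DD := (DD lam eta m Psi rho).
Local Notation Dr := (Dr lam eta m Psi rho).
Implicit Types (kap : V -> R).
Local Notation phi := (phi lam eta m).
Local Notation lamb := (lamb lam eta m).
Local Notation phr := (phr lam eta m).
Local Notation PH := (PH lam eta m).
Local Notation dvJ := (dvJ lam eta m Psi rho).
Local Notation gd := (gd lam eta m Psi rho).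
Local Notation qq := (qq lam eta m Psi rho).
Local Notation qi := (qi lam eta m Psi rho).
Local Notation wt := (wt lam eta m Psi).
Local Notation Un n t := (moll n (uu t)).
Local Notation DU n i t := (conv ('D_(e i) (knl n)) (uu t)).
Local Notation gg := (gg lam eta m rho).
Local Notation dm := (dmain lam eta m Psi rho 0).
Local Notation vol := (@vol R d).

Let u0 t y : 0 <= uu t y := density_ge0 (uu t) y.
Let wt0 C x : 0 <= wt C x := ltW (wt_gt0 lam eta m Psi C x).
Let mwt C : measurable_fun setT (wt C). Proof. by apply: wt_meas. Qed.
Let mk n : mol (@knl R d n) := @mol_knl R d n.
Let mdk i n : mol ('D_(e i) (@knl R d n)) := mol_derive (e i) (mk n).
Let lu t : lint (uu t) := uu_lint rho t.
Let lgg i t : lint (gg i t). Proof. by apply: gg_lint. Qed.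
Let Un0 n t x : 0 <= Un n t x.
Proof. by apply: moll_ge0. Qed.
Let DUE n i t x : DU n i t x = moll n (gg i t) x.
Proof. by apply: DUE. Qed.
Let cdm n i t : continuous (dm n i t).
Proof. by apply: dmain_cont. Qed.
Let cUn n t : continuous (Un n t).
Proof. by apply: conv_continuous. Qed.
Let icube r : ig (\1_(@cube R d r) : V -> R) := @ig_cube R d r.
Let mcube r : measurable_fun setT (\1_(@cube R d r) : V -> R) := ig_meas (icube r).

Lemma conv_derive_sum n v t x :
  conv ('D_v (knl n)) (uu t) x = \sum_i v ord0 i * DU n i t x.
Proof.
transitivity (\int[mu]_y (\sum_i v ord0 i * ('D_(e i) (knl n) (x - y) * uu t y)))%R.
  apply: eq_Rintegral => y _; rewrite derive_sum; last exact: mol_differentiable.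
  by rewrite mulr_suml; apply: eq_bigr => i _; rewrite mulrA.
have ic i : ig (fun y => 'D_(e i) (knl n) (x - y) * uu t y)  := ig_conv x (mdk i n) (lu t).
rewrite Rint_sum => [|i]; last exact: igZ.
by apply: eq_bigr => i _; rewrite RintZ.
Qed.

(** The Poincare inequality differentiates in arbitrary directions, so the partial derivatives are
    assembled linearly. *)
Lemma phi_grad n t v : dline (fun x => phi (wt 0 x) (Un n t x)) v
  (fun x => \sum_i v ord0 i * dm n i t x).
Proof.
have dU : dline (Un n t) v (conv ('D_v (knl n)) (uu t)) by apply: dline_conv.
have h : dline (fun x => phi (wt 0 x) (Un n t x)) v
  (fun x => phr (wt 0 x) (Un n t x) * conv ('D_v (knl n)) (uu t) x + lamb (wt 0 x) (Un n t x) * 'D_v Psi x).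
  by apply: phi_dline.
move: h; congr (dline _ _ _); apply/funext => x.
have dP : differentiable Psi x by have [h _] := Psi1; exact: h.
rewrite conv_derive_sum derive_sum// !mulr_sumr -big_split; apply: eq_bigr => i _ /=.
by rewrite /dmain; move: (phr _ _) (lamb _ _) (DU _ _ _ _) ('D__ Psi x) => a b c e'; ring.
Qed.

(** The limit of [dmain], formally the partial derivative of phi(u). *)
Definition gL i t x := phr (wt 0 x) (uu t x) * gg i t x + lamb (wt 0 x) (uu t x) * 'D_(e i) Psi x.

Let mD i : measurable_fun setT ('D_(e i) Psi).
Proof. by apply: continuous_measurable_rV; exact: (DPsi_cont Psi1). Qed.

Let mgL i t : measurable_fun setT (gL i t).
Proof.
have h1 : measurable_fun setT (fun x => phr (wt 0 x) (uu t x)) by apply: phr_meas => //; exact: uu_meas.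
have h2 : measurable_fun setT (fun x => lamb (wt 0 x) (uu t x)) by apply: lamb_meas => //; exact: uu_meas.
have h3 := (lgg i t).1; have h4 := mD i.
by apply: measurable_funD; apply: measurable_funM.
Qed.

Let hK r : exists2 K : R, 0 < K & forall x u, cube r x -> 0 <= u ->
  [/\ lamb (wt 0 x) u <= K, lamb (wt 0 x) u <= K * u & phr (wt 0 x) u <= K].
Proof.
have [w1 [w2 [w10 hw]]] : exists w1 w2 : R, 0 < w1 /\ forall x, cube r x -> w1 <= wt 0 x /\ wt 0 x <= w2.
  by apply: wt_bounds.
have [K K0 hK] := entropy_bounds lam_gt0 eta_gt0 m_gt1 w2 w10.
by exists K => // x u /hw[h1 h2] u0'; have [] := hK _ _ h1 h2 u0'.
Qed.

Lemma dm_cvg i t r : ig (fun x => \1_(cube r) x * `|gL i t x|) /\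
  (\int[mu]_x (\1_(cube r) x * `|dm n i t x|) @[n --> \oo] --> \int[mu]_x (\1_(cube r) x * `|gL i t x|))%R.
Proof.
have [K K0 hKr] := hK r.
have [MP MP0 hMP] := continuous_bounded_cube r (DPsi_cont Psi1 (i := i)).
have [i1 c1] := moll_cvg_loc r (lgg i t); have [i2 c2] := moll_cvg_loc r (lu t).
pose a n x := K * (\1_(cube r) x * `|moll n (gg i t) x| + MP * \1_(cube r) x).
pose aL x := K * (\1_(cube r) x * `|gg i t x| + MP * \1_(cube r) x).
pose b n x := (K + 1) * (\1_(cube r) x * `|moll n (gg i t) x - gg i t x|) + \1_(cube r) x * `|Un n t x - uu t x|.
have b1 n x : \1_(cube r) x * `|moll n (gg i t) x - gg i t x| <= b n x.
  apply: ler_wpDr; first exact: mulr_ge0.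
  by rewrite ler_peMl ?mulr_ge0// lerDr ltW.
have b2 n x : \1_(cube r) x * `|Un n t x - uu t x| <= b n x.
  by apply: ler_wpDl => //; rewrite !mulr_ge0// addr_ge0// ltW.
have mF n : measurable_fun setT (fun x => \1_(cube r) x * `|dm n i t x|).
  have h := measurableT_comp (@normr_measurable R setT) (continuous_measurable_rV (cdm (n := n) (i := i) (t := t))).
  by apply: measurable_funM; [exact: mcube|exact: h].
have mL : measurable_fun setT (fun x => \1_(cube r) x * `|gL i t x|).
  have h := measurableT_comp (@normr_measurable R setT) (@mgL i t).
  by apply: measurable_funM; [exact: mcube|exact: h].
have [|||||||c0 _ c] := @Rint_domdct _ _ _ mu (fun n x => \1_(cube r) x * `|dm n i t x|) a b
   (fun x => \1_(cube r) x * `|gL i t x|) aL mF mL.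
- move=> n x; rewrite ger0_norm ?mulr_ge0// /a indicE.
  have [/set_mem xr|_] := boolP (x \in cube r); last by rewrite !(mul0r, mulr0) addr0 mulr0.
  rewrite !mul1r mulr1; have [h1 _ h3] := hKr x (Un n t x) xr (Un0 n t x).
  have p0 : 0 <= phr (wt 0 x) (Un n t x) by apply: phr_ge0.
  have l0 : 0 <= lamb (wt 0 x) (Un n t x) by apply: lamb_ge0.
  apply: (le_trans (ler_normD _ _)); rewrite mulrDr DUE; apply: lerD.
    by rewrite normrM (ger0_norm p0) ler_wpM2r.
  by rewrite normrM (ger0_norm l0); apply: ler_pM => //; exact: hMP.
- move=> n; apply/igZ/igD; last exact/igZ/icube.
  by apply: ig_cube_cont; apply: cont_norm; apply: conv_continuous.
- by apply/igZ/igD; [exact: (lint_norm (lgg i t)).2|exact/igZ/icube].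
- by move=> n; apply: igD => //; exact: igZ.
- move=> n x; rewrite /a /aL -mulrBr normrM (gtr0_norm K0).
  rewrite opprD addrACA subrr addr0 -mulrBr normrM ger0_norm//.
  apply: (@le_trans _ _ (K * (\1_(cube r) x * `|moll n (gg i t) x - gg i t x|))).
    by apply: ler_wpM2l; [exact: ltW|apply: ler_wpM2l => //; exact: ler_dist_dist].
  by apply: ler_wpDr; [exact: mulr_ge0|rewrite ler_wpM2r ?lerDl// mulr_ge0].
- have E n : (\int[mu]_x b n x = (K + 1) * \int[mu]_x (\1_(cube r) x * `|moll n (gg i t) x - gg i t x|)
     + \int[mu]_x (\1_(cube r) x * `|Un n t x - uu t x|))%R.
    by rewrite RintD ?RintZ//; exact: igZ.
  have c1' : ((K + 1) * \int[mu]_x (\1_(cube r) x * `|moll n (gg i t) x - gg i t x|) @[n --> \oo] --> (K + 1) * (0 : R))%R.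
    by apply: cvgMl_tmp.
  by under eq_fun do rewrite E; have := cvgD c1' c2; rewrite mulr0 addr0; exact.
- apply: aeW => x s sn hs.
  have [xr|xr] := boolP (x \in cube r); last first.
    have I0 : \1_(@cube R d r) x = 0 :> R by rewrite indicE (negbTE xr).
    exact: cvgMl_zero I0.
  apply: cvgMl_tmp.
  have I1 : \1_(@cube R d r) x = 1 :> R by rewrite indicE xr.
  have sq (h : nat -> R) l : (forall n, `|h n - l| <= b (s n) x) -> h n @[n --> \oo] --> l.
    move=> hl; apply/cvgrPdist_lt => eps e0; move/cvgrPdist_lt : hs => /(_ eps e0).
    apply: filterS => n; rewrite sub0r normrN => h'; rewrite distrC.
    by apply: le_lt_trans (hl n) _; apply: le_lt_trans h'; exact: ler_norm.
  have cU : Un (s n) t x @[n --> \oo] --> uu t x.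
    by apply: sq => n; apply: le_trans (b2 (s n) x); rewrite I1 mul1r.
  have cg : moll (s n) (gg i t) x @[n --> \oo] --> gg i t x.
    by apply: sq => n; apply: le_trans (b1 (s n) x); rewrite I1 mul1r.
  apply: cvg_norm; rewrite /dmain; under eq_fun do rewrite DUE.
  apply: cvgD; last by apply: cvgMr_tmp; apply: lamb_cvg.
  by apply: cvgM => //; apply: phr_cvg.
by split.
Qed.

(** Where u > 0, [gL] equals lamb j / u and [flux_amgm] applies; where u = 0, flux and lamb vanish
    almost everywhere, and [gL] with them. *)
Lemma gL_le r : exists2 K : R, 0 <= K & forall i t k, (DD t < +oo)%E -> 0 < k ->
  \int[mu]_x (\1_(cube r) x * `|gL i t x|) <=
  k * \int[mu]_x (\1_(cube r) x * (lamb (wt 0 x) (uu t x) * qq t x)) + K * vol r / k.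
Proof.
have [K K0 hKr] := hK r; exists K => [|i t k Dt k0]; first exact: ltW.
have il : ig (fun x => \1_(cube r) x * (lamb (wt 0 x) (uu t x) * qq t x)).
  apply: (@ig_le _ _ _ mu _ (fun x => K * qq t x)); last exact/igZ/qq_ig.
    apply: measurable_funM => //; apply: measurable_funM; last exact: qq_meas.
    by apply: lamb_meas => //; exact: uu_meas.
  move=> x; have q0 : 0 <= qq t x by exact: qq_ge0.
  have l0 : 0 <= lamb (wt 0 x) (uu t x) by apply: lamb_ge0.
  rewrite indicE; have [/set_mem xr|_] := boolP (x \in cube r); last first.
    by rewrite mul0r normr0 mulr_ge0// ltW.
  have [h1 _ _] := hKr x (uu t x) xr (u0 t x).
  by rewrite mul1r (ger0_norm (mulr_ge0 l0 q0)); exact: (ler_wpM2r q0 h1).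
rewrite -RintZ// (mulrAC K) -RintZ; last exact: icube.
rewrite -RintD; [|exact: igZ|exact/igZ/icube].
apply: Rint_le_ae; [exact: (dm_cvg i t r).1|by apply: igD; [exact: igZ|exact/igZ/icube]|].
have jz0 : {ae mu, forall y, uu t y = 0 -> forall i, jj i t y = 0} by apply: jj_zero.
apply: (@filterS _ (almost_everywhere mu) _ _ _ _ jz0) => x jz.
rewrite indicE; have [/set_mem xr|_] := boolP (x \in cube r); last by rewrite !(mul0r, mulr0) addr0.
rewrite !mul1r mulr1; have [h1 h2 _] := hKr x (uu t x) xr (u0 t x).
have l0 : 0 <= lamb (wt 0 x) (uu t x) by apply: lamb_ge0.
have q0 : 0 <= qq t x by exact: qq_ge0.
have [uz|un] := eqVneq (uu t x) 0.
  have lz : lamb (wt 0 x) (uu t x) = 0.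
    by apply/eqP; rewrite eq_le l0 andbT (le_trans h2)// uz mulr0.
  have gz' : gg i t x = 0.
    rewrite /EntropyDissipation.gg (_ : GG t x ord0 i = 0) ?mulr0//.
    by have := jz uz i; rewrite /SolutionCurve.jj uz mul0r add0r.
  by rewrite /gL gz' lz mulr0 !mul0r addr0 normr0 mulr0 add0r divr_ge0// ltW.
have up : 0 < uu t x by rewrite lt_neqAle eq_sym un u0.
have D0 : ChainRule.DLF lam eta m (uu t x) != 0 by rewrite gt_eqF//; exact: DLF_gt0.
have -> : gL i t x = lamb (wt 0 x) (uu t x) * jj i t x / uu t x.
  rewrite /gL.
  have -> : phr (wt 0 x) (uu t x) = lamb (wt 0 x) (uu t x) * ChainRule.DLF lam eta m (uu t x) / uu t x.
    by rewrite -phr_lamb// mulfK.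
  have -> : gg i t x = (ChainRule.DLF lam eta m (uu t x))^-1 * (jj i t x - uu t x * 'D_(e i) Psi x).
    by rewrite /EntropyDissipation.gg /SolutionCurve.jj addrAC subrr add0r.
  by field; rewrite un.
rewrite normrM normrM normfV (ger0_norm l0) (gtr0_norm up).
apply: (le_trans (flux_amgm (jj i t x) k0 up l0 h2)).
rewrite lerD2r ler_wpM2l ?(ltW k0)// ler_wpM2l//.
exact: qi_le.
Qed.

(** The Poincare inequality requires a continuous gradient, so it is applied to the mollification of
    u(t) with n large: this is the witness U, and c is the mean of phi(U) over the cube. *)
Lemma good_step (k : nat) (T0 : R) : 0 < T0 -> exists t, T0 <= t /\
  exists (U : V -> R) (c : R), [/\ continuous U, (forall x, 0 <= U x), 0 <= c <= 1,
    \int[mu]_x (\1_(cube k.+1%:R) x * `|U x - uu t x|) <= k.+1%:R^-1 &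
    \int[mu]_x (\1_(cube k.+1%:R) x * `|phi (wt 0 x) (U x) - c|) <= k.+1%:R^-1].
Proof.
move=> T00; set r : R := k.+1%:R; have r0 : 0 < r by [].
have vr := @vol_gt0 R d r r0.
(* B is the Poincare constant of this cube, and M = (B + 1) r makes B / M at most 1 / r. The d
   components of the gradient must then sum to less than 1 / M, hence M2; [kap] makes both terms of
   [gL_le] at most 1 / M2. *)
pose B := vol (2 * r) * (2 * r) / vol r.
have B0 : 0 <= B by rewrite divr_ge0 ?(ltW vr)// mulr_ge0 ?vol_ge0// mulr_ge0// ltW.
pose M := (B + 1) * r; have M0 : 0 < M by rewrite mulr_gt0// ltr_wpDl.
have [K K0 hg] := gL_le (3 * r).
have v30 := @vol_ge0 R d (3 * r).
pose M2 := 4 * M * d.+1%:R; have M20 : 0 < M2 by rewrite mulr_gt0// mulr_gt0.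
pose kap := M2 * (K * vol (3 * r) + 1); have kap0 : 0 < kap.
  by rewrite mulr_gt0// ltr_wpDl// mulr_ge0.
have [t [tT Dt ht]] := good_times lam_gt0 eta_gt0 m_gt1 Psi1 rho_cont rho_W rho_weak rho_energy
   (3 * r) (eps := (M2 * kap)^-1) (T0 := T0) ltac:(by rewrite invr_gt0 mulr_gt0) T00.
exists t; split => //.
have gb i : \int[mu]_x (\1_(cube (3 * r)) x * `|gL i t x|) <= 2 / M2.
  have E2 : 2 / M2 = M2^-1 + M2^-1 by exact: mul2_addrr.
  rewrite E2; apply: (le_trans (hg i t kap Dt kap0)); apply: lerD.
    exact: mul_le_inv.
  by apply: div_shift_le_inv => //; exact: mulr_ge0.
have sg : \sum_(i < d) \int[mu]_x (\1_(cube (3 * r)) x * `|gL i t x|) < M^-1.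
  apply: (@le_lt_trans _ _ (\sum_(i < d) 2 / M2)); first by apply: ler_sum => i _.
  by rewrite sumr_const card_ord; exact: mulrn_div_lt_inv.
have cs := @Rcvg_sum R _ (index_enum 'I_d) _ _ (fun i => (dm_cvg i t (3 * r)).2).
have [i2 c2] := moll_cvg_loc r (lu t).
have [n [h1 h2]] : exists n, \sum_(i < d) \int[mu]_x (\1_(cube (3 * r)) x * `|dm n i t x|) < M^-1 /\
    \int[mu]_x (\1_(cube r) x * `|Un n t x - uu t x|) < r^-1.
  have n1 : \forall n \near \oo, \sum_(i < d) \int[mu]_x (\1_(cube (3 * r)) x * `|dm n i t x|) < M^-1 by exact: (cvgr_lt _ cs).
  have r1 : 0 < r^-1 by rewrite invr_gt0.
  have n2 : \forall n \near \oo, \int[mu]_x (\1_(cube r) x * `|Un n t x - uu t x|) < r^-1 by exact: (cvgr_lt _ c2).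
  have : \forall n \near \oo, \sum_(i < d) \int[mu]_x (\1_(cube (3 * r)) x * `|dm n i t x|) < M^-1 /\
    \int[mu]_x (\1_(cube r) x * `|Un n t x - uu t x|) < r^-1 by near=> n; split; near: n.
  by case=> N _ hN; exists N; apply: hN => /=.
pose F x := phi (wt 0 x) (Un n t x).
have cF : continuous F by apply: phi_cont.
have F01 x : 0 <= F x <= 1.
  by rewrite phi_ge0//= phi_le1.
pose c := (\int[mu]_y (\1_(cube r) y * F y)) / vol r.
exists (Un n t), c; split => //; last first.
- have sH : (\int[mu]_x (\1_(cube (3 * r)) x * \sum_i `|dm n i t x|) =
     \sum_(i < d) \int[mu]_x (\1_(cube (3 * r)) x * `|dm n i t x|))%R.
    under eq_Rintegral do rewrite mulr_sumr.
    rewrite Rint_sum// => i; apply: ig_cube_cont; apply: cont_norm; exact: cdm.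
  have := @poincare R d F (fun v x => \sum_i v ord0 i * dm n i t x) (fun x => \sum_i `|dm n i t x|) r r0 cF
    (phi_grad n t) _ _ _ _.
  rewrite sH -/c => hp.
  have {hp} : vol r * \int[mu]_x (\1_(cube r) x * `|F x - c|) <= vol (2 * r) * (2 * r * M^-1).
    apply: (le_trans (hp _ _ _ _)) => [v|||v x|].
    + by apply: cont_sum => i; apply: contM => //; exact: cont_cst.
    + by apply: cont_sum => i; apply: cont_norm; exact: cdm.
    + by move=> x; apply: sumr_ge0.
    + apply: (le_trans (ler_norm_sum _ _ _)); rewrite mulr_sumr; apply: ler_sum => i _.
      by rewrite normrM ler_wpM2r//; exact: norm_coord.
    + by rewrite ler_wpM2l ?vol_ge0// ler_wpM2l ?ltW// mulr_gt0.
  rewrite mulrC -ler_pdivlMr// => hp; apply: (le_trans hp).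
  have -> : vol (2 * r) * (2 * r * M^-1) / vol r = B / M by rewrite /B !mulrA; ring.
  rewrite ler_pdivrMr// /M mulrCA mulVf ?gt_eqF// mulr1 lerDl//.
- exact: ltW.
- rewrite /c divr_ge0 ?(ltW vr)//=; last by apply: Rint_ge0 => x; rewrite mulr_ge0//; case/andP: (F01 x).
  rewrite ler_pdivrMr// mul1r; apply: Rint_le; [exact: ig_cube_cont|exact: icube|move=> x].
  by rewrite ler_piMr//; case/andP: (F01 x).
Unshelve. all: by end_near.
Qed.

End good_step.

End GoodTimes.
Import GoodTimes.

(** * Normalisation of the equilibrium density and its second moment *)

Module EquilibriumMass.

Opaque ez.

Lemma mul_div_le1 (R : realType) (g w v : R) : 0 < g -> 0 < v -> w <= v -> g * (w / (g * v)) <= 1.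
Proof. by move=> g0 v0 wv; rewrite mulrA ler_pdivrMr ?mulr_gt0// mul1r ler_pM2l. Qed.

Lemma exponent_le (R : realType) (c x y z : R) : 0 < c -> y <= z + x ->
  2 * x + - (c + 2) * x <= c * z + - c * y.
Proof. by move=> c0 h; have := ler_wpM2l (ltW c0) h; nra. Qed.

Section mass.
Context {R : realType} (d : nat).
Local Notation V := 'rV[R]_d.
Local Notation mu := (@leb R d).
Local Notation ig f := (mu.-integrable setT (EFin \o f)).
Variables (lam eta m : R) (Psi : V -> R).
Hypotheses (d_gt0 : (0 < d)%N) (lam_gt0 : 0 < lam) (eta_gt0 : 0 < eta) (m_gt1 : 1 < m).
Hypotheses (Psi1 : Ck 1 Psi) (Psi_ge0 : forall y, 0 <= Psi y)
  (Psi_growth : exists r delta : R, [/\ 0 < r, 0 < delta &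
     forall y : V, r <= enorm y -> (lam * (d%:R + 2) + delta) * ln (enorm y) <= Psi y]).
Local Notation gz := (gz lam eta m).
Local Notation kp := (kp eta m).
Local Notation hfun := (hfun lam eta m).
Local Notation U := (Ufun lam eta m Psi).
Local Notation wt := (wt lam eta m Psi).

Let U0 C x : 0 < U C x. Proof. by apply: Ufun_gt0. Qed.
Let cU C : continuous (U C). Proof. by apply: Ufun_continuous. Qed.
Let mU C : measurable_fun setT (U C). Proof. by apply: Ufun_meas. Qed.

Lemma coord_enorm (y : V) i : `|y ord0 i| <= enorm y.
Proof.
rewrite /enorm -sqrtr_sqr; apply: ler_wsqrtr.
by rewrite (bigD1 i)//= lerDl sumr_ge0// => j _; exact: sqr_ge0.
Qed.

Lemma enorm_ge0 (y : V) : 0 <= enorm y. Proof. exact: sqrtr_ge0. Qed.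

(** With growth lam (d + 2) + delta against ln |y|, the factor 1 + |y|^2 uses up two powers of |y|
    and leaves d + delta / lam. As |y_i| <= |y|, this pays for d factors of exponent 1 + a, with a =
    delta / (lam d). *)
Lemma decay : exists a : R, 0 < a /\ exists2 A : R, 0 < A & forall y : V,
  (1 + enorm y ^+ 2) * expR (- Psi y / lam) <= A * tail a y.
Proof.
have [r [del [r0 del0 hP]]] := Psi_growth.
have dR : 0 < d%:R :> R by rewrite ltr0n.
pose b := del / lam; have b0 : 0 < b by rewrite divr_gt0.
exists (b / d%:R); split; first by rewrite divr_gt0.
set a := b / d%:R; have ad : (1 + a) * d%:R = d%:R + b by rewrite /a mulrDl mul1r divfK// gt_eqF.
have a1 : 0 < 1 + a by rewrite addr_gt0// divr_gt0.
pose c := d%:R + b; have c0 : 0 < c by rewrite addr_gt0.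
have cE : c = (1 + a) * d%:R by rewrite ad.
(* Beyond R1 >= 1 one has 1 + |y| <= 2 |y|, the origin of ln 2 in A1; within R1 everything is
   bounded, which gives A2. *)
pose R1 := Num.max r 1.
have R11 : 1 <= R1 by rewrite le_max lexx orbT.
pose A1 := 2 * expR (c * ln 2); pose A2 := (1 + R1 ^+ 2) * expR (c * ln (1 + R1)).
have A10 : 0 < A1 by rewrite mulr_gt0// expR_gt0.
have A20 : 0 < A2 by rewrite mulr_gt0 ?expR_gt0// ltr_pwDl// sqr_ge0.
exists (A1 + A2) => [|y]; first exact: addr_gt0.
set N := enorm y; have N0 : 0 <= N := enorm_ge0 y.
have tl : expR (- c * ln (1 + N)) <= tail a y.
  rewrite -[leRHS]lnK ?posrE ?tail_gt0// ler_expR tail_ln !mulNr lerN2 cE -mulrA.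
  apply: ler_wpM2l; first exact: ltW.
  apply: (@le_trans _ _ (\sum_(i < d) ln (1 + N))); last by rewrite sumr_const card_ord mulr_natl.
  apply: ler_sum => i _; rewrite ler_ln ?posrE ?ltr_pwDl// lerD2l.
  exact: coord_enorm.
have N1 : 0 < 1 + N by rewrite ltr_pwDl.
apply: (@le_trans _ _ ((A1 + A2) * expR (- c * ln (1 + N)))); last by rewrite ler_wpM2l// ltW// addr_gt0.
have E0 : 0 < expR (- c * ln (1 + N)) := expR_gt0 _.
rewrite (mulrDl A1 A2); have [hN|hN] := leP R1 N.
  apply: ler_wpDr; first by rewrite mulr_ge0 ?ltW.
  have rN : r <= N by apply: le_trans hN; rewrite le_max lexx.
  have N1' : 1 <= N := le_trans R11 hN.
  have Np : 0 < N := lt_le_trans ltr01 N1'.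
  have h1 : 1 + N ^+ 2 <= 2 * expR (2 * ln N).
    have -> : expR (2 * ln N) = N ^+ 2 by rewrite expRM_natl lnK.
    by rewrite mulr_natl mulr2n lerD2r expr_ge1.
  have h2 : expR (- Psi y / lam) <= expR (- (c + 2) * ln N).
    rewrite ler_expR !mulNr lerN2 ler_pdivlMr//; apply: le_trans (hP y rN).
    rewrite le_eqVlt; apply/orP; left; apply/eqP; rewrite -/N /c /b; field.
    by rewrite gt_eqF.
  apply: (@le_trans _ _ ((2 * expR (2 * ln N)) * expR (- (c + 2) * ln N))).
    by apply: ler_pM => //; rewrite addr_ge0// sqr_ge0.
  rewrite /A1 -!mulrA -!expRD ler_wpM2l// ler_expR.
  have h3 : ln (1 + N) <= ln 2 + ln N.
    rewrite -lnM ?posrE// ler_ln ?posrE ?mulr_gt0//.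
    by rewrite (_ : 2 * N = N + N) ?lerD2r//; ring.
  exact: exponent_le.
apply: ler_wpDl; first by rewrite mulr_ge0 ?ltW.
apply: (@le_trans _ _ (1 + R1 ^+ 2)).
  rewrite -[leRHS]mulr1; apply: ler_pM; [by rewrite addr_ge0// sqr_ge0|exact: expR_ge0| |].
    by rewrite lerD2l ler_pXn2r ?nnegrE ?(ltW hN)// (le_trans ler01).
  by rewrite -expR0 ler_expR mulNr oppr_le0 divr_ge0// ltW.
rewrite /A2 -mulrA -expRD ler_peMr ?addr_ge0 ?sqr_ge0//.
rewrite -[leLHS]expR0 ler_expR mulNr -mulrBr mulr_ge0 ?(ltW c0)// subr_ge0.
by rewrite ler_ln ?posrE ?lerD2l ?ltW// ltr_pwDl// (le_trans ler01).
Qed.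

Let enorm_meas : measurable_fun setT (fun y : V => enorm y ^+ 2).
Proof.
rewrite (_ : (fun y => _) = (fun y : V => \sum_i y ord0 i ^+ 2)).
  apply: measurable_sum => i; apply: measurable_funX; exact: measurable_coord.
by apply/funext => y; rewrite sqr_sqrtr// sumr_ge0// => i _; exact: sqr_ge0.
Qed.

Lemma U_moment_ig C : ig (fun y => (1 + enorm y ^+ 2) * U C y).
Proof.
have [a [a0 [A A0 hA]]] := decay.
apply: (@ig_le _ _ _ mu _ (fun y => expR ((C + kp) / lam) * (A * tail a y))).
- by apply: measurable_funM => //; apply: measurable_funD => //; exact: measurable_cst.
- move=> y; have p : 0 <= 1 + enorm y ^+ 2 by rewrite addr_ge0// sqr_ge0.
  rewrite ger0_norm ?mulr_ge0 ?(ltW (U0 C y))//.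
  have h : U C y <= expR ((C + kp) / lam) * expR (- Psi y / lam) by apply: Ufun_le_exp.
  apply: le_trans (ler_wpM2l p h) _; rewrite mulrCA ler_wpM2l ?expR_ge0//.
- by do 2 apply: igZ; exact: tail_ig.
Qed.

Lemma U_ig C : ig (U C).
Proof.
apply: (@ig_le _ _ _ mu _ _ (mU C) _ (U_moment_ig C)) => y.
by rewrite gtr0_norm// ler_peMl ?(ltW (U0 C y))// lerDl sqr_ge0.
Qed.

Definition UI C := (\int[mu]_y U C y)%R.

(** On the unit cube 1 / f is continuous, hence bounded, so f is bounded below there by a positive
    constant. *)
Lemma int_cont_gt0 (f : V -> R) : continuous f -> (forall x, 0 < f x) -> ig f ->
  0 < (\int[mu]_x f x)%R.
Proof.
move=> cf f0 igf.
have cV : continuous (fun x => (f x)^-1).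
  move=> x; have fx : f x != 0 by rewrite gt_eqF.
  exact: (cvgV fx (cf x)).
have [M M0 hM] := continuous_bounded_cube 1 cV.
have M1 : 0 < M + 1 by rewrite ltr_wpDl.
apply: (@lt_le_trans _ _ (\int[mu]_x ((M + 1)^-1 * \1_(cube 1) x))%R).
  rewrite RintZ; last exact: ig_cube.
  by rewrite mulr_gt0 ?invr_gt0//; exact: vol_gt0.
apply: Rint_le => //; first exact/igZ/ig_cube.
move=> x; rewrite indicE; have [/set_mem xr|_] := boolP (x \in cube 1); last by rewrite mulr0 ltW.
rewrite mulr1 invf_ple ?posrE//; apply: le_trans (_ : M <= _); last by rewrite lerDl.
by have := hM x xr; rewrite gtr0_norm// invr_gt0.
Qed.

Lemma UI_lt C C' : C < C' -> UI C < UI C'.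
Proof.
move=> CC; rewrite -subr_gt0 -RintB; [|exact: U_ig|exact: U_ig].
apply: int_cont_gt0.
- under eq_fun do rewrite -mulN1r; apply: contD => //; apply: contM => //; exact: cont_cst.
- by move=> x; rewrite subr_gt0; apply: Ufun_lt.
- by apply: igB; exact: U_ig.
Qed.

(** A convergent sequence of constants is bounded by some B, and monotonicity in C makes U(.; B + 1)
    a majorant. *)
Lemma UI_continuous : continuous UI.
Proof.
move=> C; apply: (@seq_continuous R^o) => c hc.
have hc' : cvgn (c : nat -> R) by apply/cvg_ex; exists C.
have [B hB] : exists B, forall n, c n <= B.
  have [M [Mr hM]] := cvg_seq_bounded hc'.
  exists (M + 1) => n; apply: le_trans (ler_norm _) _; apply: hM => //.
  by rewrite ltrDl.
have [|||_ h _] := @Rdct _ _ _ mu (fun n => U (c n)) (U C) (U (B + 1)) _ (mU C) _ (U_ig (B + 1)).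
- by move=> n; exact: mU.
- by apply: aeW => x; apply: Ufun_cvg => //; exact: cvg_cst.
- move=> n x; rewrite gtr0_norm//; apply: ltW; apply: Ufun_lt => //.
  by apply: le_lt_trans (hB n) _; rewrite ltrDl.
exact: h.
Qed.

(** C is chosen so large that U(.; C) is at least 1 / vol 1 on the unit cube: [gz] of this value
    times the largest weight there is at most 1. *)
Lemma UI_ge1 : exists C, 1 <= UI C.
Proof.
have [w1 [w2 [w10 hw]]] : exists w1 w2 : R, 0 < w1 /\ forall x, cube 1 x -> w1 <= wt 0 x /\ wt 0 x <= w2.
  by apply: wt_bounds.
have v0 := @vol_gt0 R d 1 ltr01.
have w20 : 0 < w2.
  have [h1 h2] : w1 <= wt 0 0 /\ wt 0 0 <= w2 by apply: hw; rewrite /cube /= normr0.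
  exact: lt_le_trans w10 (le_trans h1 h2).
pose M := (@vol R d 1)^-1.
have M0 : 0 < M by rewrite invr_gt0.
have g0 : 0 < gz M.
  by rewrite /EntropyKernel.gz; apply: mulr_gt0 => //; exact: ez_gt0.
have k0 : 0 < gz M * w2 by exact: mulr_gt0.
exists (lam * ln (gz M * w2)).
have -> : 1 = \int[mu]_x (M * \1_(@cube R d 1) x).
  rewrite RintZ; last exact: ig_cube.
  by rewrite mulVf// gt_eqF.
apply: Rint_le; [exact/igZ/ig_cube|exact: U_ig|move=> x].
rewrite indicE; have [/set_mem xr|_] := boolP (x \in cube 1); last by rewrite mulr0 ltW.
rewrite mulr1 leNgt; apply/negP => hlt.
have := gz_lt lam_gt0 eta_gt0 m_gt1 (ltW (U0 (lam * ln (gz M * w2)) x)) hlt.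
rewrite gz_UfunE// -(ltr_pM2r (wt_gt0 lam eta m Psi (lam * ln (gz M * w2)) x)) mulVf; last first.
  by rewrite gt_eqF// wt_gt0.
rewrite ltNge => /negP; apply.
have -> : wt (lam * ln (gz M * w2)) x = wt 0 x * (gz M * w2)^-1.
  rewrite -[(_ * _)^-1]lnK ?posrE ?invr_gt0// lnV ?posrE// /EntropyWeights.wt -expRD; congr expR.
  by move: (ln _) => L; field; rewrite gt_eqF.
have [_ h2] := hw x xr.
exact: mul_div_le1.
Qed.

(** This C turns the prefactor in [Ufun_le_exp] into 1 / B, where B exceeds the mass of the
    comparison function. *)
Lemma UI_le1 : exists C, UI C <= 1.
Proof.
have [a [a0 [A A0 hA]]] := decay.
have it := @tail_ig R a a0 d.
pose B := A * \int[mu]_y tail a y + 1.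
have B0 : 0 < B.
  by rewrite ltr_wpDl// mulr_ge0 ?(ltW A0)//; apply: Rint_ge0 => y; exact: ltW (tail_gt0 _ _).
exists (- lam * ln B - kp).
apply: (@le_trans _ _ (\int[mu]_y (B^-1 * (A * tail a y)))).
  apply: Rint_le; [exact: U_ig|by do 2 apply: igZ|move=> y].
  apply: (le_trans (_ : _ <= expR ((- lam * ln B - kp + kp) / lam) * expR (- Psi y / lam))).
    by apply: Ufun_le_exp.
  have -> : (- lam * ln B - kp + kp) / lam = - ln B by move: (ln B) => L; field; rewrite gt_eqF.
  rewrite expRN lnK ?posrE// ler_wpM2l ?invr_ge0 ?(ltW B0)//; apply: le_trans (hA y).
  by rewrite ler_peMl ?expR_ge0// lerDl sqr_ge0.
rewrite RintZ; last exact: igZ.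
by rewrite RintZ// ler_pdivrMl// mulr1 lerDl.
Qed.

Lemma UI_inj C C' : UI C = UI C' -> C = C'.
Proof.
move=> E; have [h|h|//] := ltgtP C C'.
- by have := UI_lt h; rewrite E ltxx.
- by have := UI_lt h; rewrite E ltxx.
Qed.

(** The mass is continuous in C and takes values on both sides of 1, so the choice in [Cstar] is not
    its default. *)
Lemma Cstar_spec : UI (Cstar lam eta m Psi) = 1.
Proof.
have [C1 h1] := UI_le1; have [C2 h2] := UI_ge1.
have C12 : C1 <= C2.
  rewrite leNgt; apply/negP => h; have := UI_lt h; rewrite ltNge => /negP; apply.
  exact: le_trans h1 h2.
have cI : {within `[C1, C2], continuous UI} by apply: continuous_subspaceT; exact: UI_continuous.
have hb : Num.min (UI C1) (UI C2) <= 1 <= Num.max (UI C1) (UI C2).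
  by rewrite ge_min h1 le_max h2 orbT.
have [C _ EC] := IVT C12 cI hb.
have := @xgetPex _ 0 [set C | (\int[leb d]_y (Ufun lam eta m Psi C y)%:E = 1)%E].
rewrite -/(Cstar lam eta m Psi) => h.
have {}h : (\int[leb d]_y (Ufun lam eta m Psi (Cstar lam eta m Psi) y)%:E = 1)%E.
  by apply: h; exists C; rewrite /= -EFin_Rint ?U_ig// -/(UI C) EC.
by apply: EFin_inj; rewrite EFin_Rint ?h//; exact: U_ig.
Qed.

(** Transparent, so that its function is convertible to [rho_infty]. *)
Definition rho_inf_density : density R d.
Proof.
refine (@Density R d (rho_infty lam eta m Psi) (mU _) (fun y => ltW (U0 _ y)) _).
by rewrite -EFin_Rint -?Cstar_spec//; exact: U_ig.
Defined.

Lemma rho_inf_D2 : D2 rho_inf_density.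
Proof.
rewrite /D2 /=; apply: ig_lty.
apply: (@ig_le _ _ _ mu _ _ _ _ (U_moment_ig (Cstar lam eta m Psi))).
  by apply: measurable_funM => //; exact: mU.
move=> y; rewrite (ger0_norm (mulr_ge0 (sqr_ge0 (enorm y)) (ltW (U0 _ y)))).
by apply: ler_wpM2r; [exact: ltW (U0 _ y)|rewrite lerDr].
Qed.

End mass.

End EquilibriumMass.
Import EquilibriumMass.

(** * Strict convexity of the free energy and its unique minimizer *)

Module FreeEnergy.

Opaque ez.

Lemma EFin_sum4 (R : realType) (a b c e : R) : (a%:E + b%:E - c%:E + e%:E = (a + b - c + e)%:E)%E.
Proof. by []. Qed.

Section convexity.
Context {R : realType}.
Variables (lam eta m : R).
Hypotheses (lam_gt0 : 0 < lam) (eta_gt0 : 0 < eta) (m_gt1 : 1 < m).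

(** [FF] is the integrand F of the free energy, and [dFF] its derivative: F' and h differ by the
    constant [kp + lam]. *)
Definition FF (s : R) : R := Hent lam s + eta / (m - 1) * s `^ m.
Definition dFF (s : R) : R := hfun lam eta m s + kp eta m + lam.

Let m0 : 0 < m. Proof. exact: lt_trans m_gt1. Qed.
Let m1 : 0 < m - 1. Proof. by rewrite subr_gt0. Qed.

(** Bernoulli's inequality x^m >= 1 + m (x - 1) at x = e^s; the splitting e^(m s) = e^s e^((m - 1)
    s) reduces it to 1 + t <= e^t. *)
Lemma exp_bernoulli (s : R) : 1 + m * (expR s - 1) <= expR (m * s).
Proof.
have e1 : 1 + (m - 1) * s <= expR ((m - 1) * s) by exact: expR_ge1Dx.
have e2 : expR (m * s) = expR s * expR ((m - 1) * s) by rewrite -expRD; congr expR; ring.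
have es : 0 < expR s := expR_gt0 s.
have e3 : 0 <= expR s * (s - 1) + 1.
  have h : 1 + - s <= expR (- s) by exact: expR_ge1Dx.
  have := ler_wpM2l (ltW es) h; rewrite -expRD subrr expR0 => h2.
  by move: h2; rewrite mulrDr mulr1 mulrN mulrBr mulr1; lra.
rewrite e2; apply: le_trans (ler_wpM2l (ltW es) e1).
have := mulr_ge0 (ltW m1) e3; move: (expR s) => x; lra.
Qed.

(** Bernoulli at x = r / u, scaled by u^m; r = 0 is separate because of the logarithm. *)
Lemma pow_convex (r u : R) : 0 <= r -> 0 < u ->
  u `^ m + m * u `^ (m - 1) * (r - u) <= r `^ m.
Proof.
move=> r0 u0; have um : 0 < u `^ m by exact: powR_gt0.
have uE : u `^ (m - 1) * u = u `^ m.
  by rewrite -[X in _ * X](@powRr1 _ u) ?ltW// -powRD ?subrK// gt_eqF// implybT.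
have [->|rn] := eqVneq r 0.
  rewrite powR0 ?gt_eqF// sub0r mulrN -mulrA uE.
  by move: um; move: (u `^ m) => x; have := m_gt1; nra.
have rp : 0 < r by rewrite lt_neqAle eq_sym rn r0.
have := ler_wpM2l (ltW um) (exp_bernoulli (ln r - ln u)).
rewrite expRD expRN !lnK ?posrE//.
have -> : u `^ m * expR (m * (ln r - ln u)) = r `^ m.
  by rewrite /powR !gt_eqF// -expRD; congr expR; ring.
apply: le_trans; rewrite -uE le_eqVlt; apply/orP; left; apply/eqP.
by move: (u `^ _) => x; field; rewrite gt_eqF.
Qed.

(** For r > 0 the gap is lam r (e^x - 1 - x) with x = ln u - ln r, which vanishes only at x = 0; for
    r = 0 it is lam u > 0. *)
Lemma ent_convex (r u : R) : 0 <= r -> 0 < u ->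
  Hent lam u + lam * (ln u + 1) * (r - u) <= Hent lam r /\
  (Hent lam u + lam * (ln u + 1) * (r - u) = Hent lam r -> r = u).
Proof.
move=> r0 u0; rewrite /Hent; have [->|rn] := eqVneq r 0.
  split; first by rewrite mulr0 mul0r sub0r; have := mulr_gt0 lam_gt0 u0; move: (ln u) => L; lra.
  rewrite mulr0 mul0r sub0r => h.
  have : lam * u = 0 by rewrite -[RHS]oppr0 -h; ring.
  by move=> /eqP; rewrite mulf_eq0 !gt_eqF.
have rp : 0 < r by rewrite lt_neqAle eq_sym rn r0.
have E : lam * r * ln r - (lam * u * ln u + lam * (ln u + 1) * (r - u)) =
   lam * r * (expR (ln u - ln r) - (1 + (ln u - ln r))).
  rewrite expRD expRN !lnK ?posrE//; move: (ln u) (ln r) => L M; field.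
  by rewrite gt_eqF.
have c0 : 0 < lam * r by exact: mulr_gt0.
split.
  rewrite -subr_ge0 E mulr_ge0 ?(ltW c0)// subr_ge0; exact: expR_ge1Dx.
move=> h; have := E; rewrite h subrr => /esym /eqP; rewrite mulf_eq0 (gt_eqF c0) /= subr_eq0 => /eqP h2.
have [s0|sn] := eqVneq (ln u - ln r) 0.
  by apply: ln_inj; rewrite ?posrE//; apply/eqP; rewrite eq_sym -subr_eq0 s0.
by have := expR_gt1Dx sn; rewrite h2 ltxx.
Qed.

Lemma FF_convex (r u : R) : 0 <= r -> 0 < u ->
  FF u + dFF u * (r - u) <= FF r /\ (FF u + dFF u * (r - u) = FF r -> r = u).
Proof.
move=> r0 u0; have [h1 h2] := ent_convex r0 u0; have h3 := pow_convex r0 u0.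
have k0 : 0 < eta / (m - 1) by exact: divr_gt0.
have := ler_wpM2l (ltW k0) h3; rewrite mulrDr => h4.
have E : FF u + dFF u * (r - u) = (Hent lam u + lam * (ln u + 1) * (r - u)) +
  (eta / (m - 1) * u `^ m + eta / (m - 1) * (m * u `^ (m - 1) * (r - u))).
  rewrite /FF /dFF /hfun /kp; move: (ln u) (u `^ m) (u `^ (m - 1)) (Hent lam u) => x1 x2 x3 x4.
  by field; rewrite gt_eqF.
rewrite E /FF; split; first exact: lerD.
move=> hE; apply: h2; apply/eqP; rewrite eq_le h1 /=.
by rewrite -(lerD2r (eta / (m - 1) * r `^ m)) -hE lerD2l.
Qed.

End convexity.

Section minimizer.
Context {R : realType} (d : nat).
Local Notation V := 'rV[R]_d.
Local Notation mu := (@leb R d).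
Local Notation ig f := (mu.-integrable setT (EFin \o f)).
Variables (lam eta m : R) (Psi : V -> R).
Hypotheses (d_gt0 : (0 < d)%N) (lam_gt0 : 0 < lam) (eta_gt0 : 0 < eta) (m_gt1 : 1 < m).
Hypotheses (Psi1 : Ck 1 Psi) (Psi_ge0 : forall y, 0 <= Psi y)
  (Psi_growth : exists r delta : R, [/\ 0 < r, 0 < delta &
     forall y : V, r <= enorm y -> (lam * (d%:R + 2) + delta) * ln (enorm y) <= Psi y]).
Local Notation J := (Jfun lam eta m Psi).
Local Notation Hent := (Hent lam).
Local Notation FF := (FF lam eta m).

Let FFE s : FF s = Hent s + eta / (m - 1) * s `^ m. Proof. by []. Qed.

Let mPsi : measurable_fun setT Psi.
Proof. by apply: continuous_measurable_rV; exact: Ck_continuous Psi1. Qed.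

Let mu_ (u : density R d) : measurable_fun setT u := density_measurable u.

Let mH (u : density R d) : measurable_fun setT (fun y => Hent (u y)).
Proof.
apply: measurable_funM; first by apply: measurable_funM => //; exact: measurable_cst.
by apply: measurableT_comp => //; exact: measurable_ln.
Qed.

Let ja (u : density R d) y := Psi y * u y.
Let jb (u : density R d) y := Num.max (Hent (u y)) 0.
Let jc (u : density R d) y := Num.max (- Hent (u y)) 0.
Let je (u : density R d) y := eta / (m - 1) * u y `^ m.

Let ja0 u y : 0 <= ja u y. Proof. by rewrite mulr_ge0 ?density_ge0. Qed.
Let jb0 u y : 0 <= jb u y. Proof. by rewrite /jb le_max lexx orbT. Qed.
Let jc0 u y : 0 <= jc u y. Proof. by rewrite /jc le_max lexx orbT. Qed.
Let je0 u y : 0 <= je u y.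
Proof. by rewrite mulr_ge0 ?powR_ge0// divr_ge0 ?(ltW eta_gt0)// subr_ge0 ltW. Qed.

Let mja u : measurable_fun setT (ja u). Proof. by apply: measurable_funM. Qed.
Let mjb u : measurable_fun setT (jb u). Proof. by apply: measurable_maxr => //; exact: measurable_cst. Qed.
Let mjc u : measurable_fun setT (jc u).
Proof.
apply: measurable_maxr; last exact: measurable_cst.
rewrite (_ : (fun y => _) = (fun y => -1 * Hent (u y))).
  by apply: measurable_funM; [exact: measurable_cst|exact: mH].
by apply/funext => y; rewrite mulN1r.
Qed.
Let mje u : measurable_fun setT (je u).
Proof. by apply: measurable_funM; [exact: measurable_cst|exact: (measurableT_comp (measurable_powR m) (mu_ u))]. Qed.

Let jbc u y : jb u y - jc u y = Hent (u y).
Proof.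
rewrite /jb /jc; move: (Hent (u y)) => h; have [h0|h0] := leP 0 h.
  have -> : Num.max (- h) 0 = 0 by apply/max_idPr; rewrite oppr_le0.
  by rewrite subr0.
have -> : Num.max (- h) 0 = - h by apply/max_idPl; rewrite oppr_ge0 ltW.
by rewrite sub0r opprK.
Qed.

(** Comparison with an integrable function: -u ln u <= tail + u (-ln tail), and -ln tail <= d +
    |y|^2, so the second moment of u suffices. *)
Lemma Hminus_ig (u : density R d) : D2 u -> ig (jc u).
Proof.
move=> u2; have u0 := density_ge0 u.
have i2 : ig (fun y => enorm y ^+ 2 * u y).
  apply: ig_ge0P => //; last by move=> y; rewrite mulr_ge0 ?sqr_ge0.
  apply: measurable_funM => //.
  rewrite (_ : (fun y => _) = (fun y : V => \sum_i y ord0 i ^+ 2)).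
    apply: measurable_sum => i; apply: measurable_funX; exact: measurable_coord.
  by apply/funext => y; rewrite sqr_sqrtr// sumr_ge0// => i _; exact: sqr_ge0.
have it := @tail_ig R 1 ltr01 d.
apply: (@ig_le _ _ _ mu _ (fun y => lam * (tail 1 y + (d%:R * u y + enorm y ^+ 2 * u y)))); [exact: mjc| |]; last first.
  by apply/igZ/igD => //; apply: igD => //; apply: igZ; exact: ig_density.
move=> y; rewrite ger0_norm// /jc ge_max; apply/andP; split; last first.
  apply: mulr_ge0; first exact: ltW.
  apply: addr_ge0; first exact: ltW (@tail_gt0 R 1 d y).
  by apply: addr_ge0; apply: mulr_ge0 => //; exact: sqr_ge0.
rewrite /Defs.Hent -mulrA -mulrN ler_wpM2l ?(ltW lam_gt0)//.
have t0 := @tail_gt0 R 1 d y.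
have [uz|un] := eqVneq (u y) 0; first by rewrite uz mul0r oppr0 !mulr0 !addr0 ltW.
have up : 0 < u y by rewrite lt_neqAle eq_sym un u0.
have h1 : u y * (ln (tail 1 y) - ln (u y)) <= tail 1 y.
  have := expR_ge1Dx (ln (tail 1 y) - ln (u y)); rewrite expRD expRN !lnK ?posrE// => h.
  have := ler_wpM2l (u0 y) h; rewrite mulrCA divff ?gt_eqF// mulr1 mulrDr mulr1.
  by apply: le_trans; rewrite lerDr.
have h2 : - ln (tail 1 y) <= d%:R + enorm y ^+ 2.
  rewrite tail_ln mulNr opprK.
  have -> : enorm y ^+ 2 = \sum_i y ord0 i ^+ 2.
    by rewrite sqr_sqrtr// sumr_ge0// => i _; exact: sqr_ge0.
  have -> : d%:R = \sum_(i < d) (1 : R) by rewrite sumr_const card_ord.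
  (* Coordinatewise, 2 ln (1 + |y_i|) <= 2 |y_i| <= 1 + y_i^2. *)
  rewrite mulr_sumr -big_split /=; apply: ler_sum => i _.
  have hl : ln (1 + `|y ord0 i|) <= `|y ord0 i|.
    by apply: le_ln1Dx; apply: lt_le_trans (normr_ge0 _); rewrite ltrN10.
  rewrite -(real_normK (num_real (y ord0 i))); move: hl; set x := `|_|; set l := ln _ => hl.
  have := sqr_ge0 (x - 1); nra.
have h3 := ler_wpM2l (u0 y) h2.
move: h1 h3; move: (ln (tail 1 y)) (ln (u y)) (tail 1 y) (enorm y ^+ 2) => a1 a2 a3 a4; lra.
Qed.

Lemma J_fin (u : density R d) : D2 u -> (J u < +oo)%E ->
  [/\ ig (ja u), ig (jb u), ig (je u) & J u = (\int[mu]_y (Psi y * u y + FF (u y)))%R%:E].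
Proof.
move=> u2 Ju; have ic := Hminus_ig u2.
have cE := EFin_Rint ic.
have A0 : (0 <= \int[mu]_y (ja u y)%:E)%E by apply: integral_ge0 => y _; rewrite lee_fin.
have B0 : (0 <= \int[mu]_y (jb u y)%:E)%E by apply: integral_ge0 => y _; rewrite lee_fin.
have E0 : (0 <= \int[mu]_y (je u y)%:E)%E by apply: integral_ge0 => y _; rewrite lee_fin.
have JE : J u = (\int[mu]_y (ja u y)%:E + \int[mu]_y (jb u y)%:E - \int[mu]_y (jc u y)%:E + \int[mu]_y (je u y)%:E)%E by [].
have [fa fb fe] : [/\ (\int[mu]_y (ja u y)%:E < +oo)%E, (\int[mu]_y (jb u y)%:E < +oo)%E & (\int[mu]_y (je u y)%:E < +oo)%E].
  move: Ju A0 B0 E0; rewrite JE -cE.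
  case: (\int[mu]_y (ja u y)%:E)%E => [a||]; case: (\int[mu]_y (jb u y)%:E)%E => [b||];
    case: (\int[mu]_y (je u y)%:E)%E => [c||] //= _ _ _ _; by rewrite !ltry.
have ia : ig (ja u) by apply: ig_ge0P.
have ib : ig (jb u) by apply: ig_ge0P.
have ie : ig (je u) by apply: ig_ge0P.
split => //; rewrite JE -cE -(EFin_Rint ia) -(EFin_Rint ib) -(EFin_Rint ie) EFin_sum4; congr EFin.
rewrite -RintD// -RintB//; last exact: igD.
rewrite -RintD//; last by apply: igB => //; exact: igD.
by apply: eq_Rintegral => y _; rewrite -[_ + _ - _]addrA jbc addrA.
Qed.

(** g is the Bregman distance for F between u and the equilibrium. Since h(rho_infty) = C - Psi, the
    first-order coefficient is the constant c0 and drops out when two densities of mass 1 are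
    compared. *)
Lemma J_gap (u : density R d) : exists2 g : V -> R, measurable_fun setT g &
  [/\ forall y, 0 <= g y, forall y, g y = 0 -> u y = rho_infty lam eta m Psi y &
    exists c0 : R, forall y, Psi y * u y + FF (u y) =
     Psi y * rho_infty lam eta m Psi y + FF (rho_infty lam eta m Psi y) + c0 * (u y - rho_infty lam eta m Psi y) + g y].
Proof.
set U := rho_infty lam eta m Psi; pose Cs := Cstar lam eta m Psi.
have Us y : 0 < U y /\ hfun lam eta m (U y) = Cs - Psi y by apply: Ufun_spec.
have mU : measurable_fun setT U by apply: Ufun_meas.
have mFF (f : V -> R) : measurable_fun setT f -> measurable_fun setT (fun y => FF (f y)).
  move=> mf; apply: measurable_funD.
    apply: measurable_funM; first by apply: measurable_funM => //; exact: measurable_cst.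
    by apply: measurableT_comp => //; exact: measurable_ln.
  by apply: measurable_funM; [exact: measurable_cst|exact: (measurableT_comp (measurable_powR m) mf)].
pose c0 := Cs + kp eta m + lam.
exists (fun y => Psi y * u y + FF (u y) - (Psi y * U y + FF (U y) + c0 * (u y - U y))).
  apply: measurable_funB; first by apply: measurable_funD; [exact: measurable_funM|exact: mFF].
  apply: measurable_funD; first by apply: measurable_funD; [exact: measurable_funM|exact: mFF].
  by apply: measurable_funM; [exact: measurable_cst|exact: measurable_funB].
have gE y : Psi y * u y + FF (u y) - (Psi y * U y + FF (U y) + c0 * (u y - U y)) =
    FF (u y) - (FF (U y) + dFF lam eta m (U y) * (u y - U y)).
  have [_ h] := Us y; rewrite /dFF h /c0; ring.
have hc y : FF (U y) + dFF lam eta m (U y) * (u y - U y) <= FF (u y) /\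
  (FF (U y) + dFF lam eta m (U y) * (u y - U y) = FF (u y) -> u y = U y).
  by have [h _] := Us y; apply: FF_convex => //; exact: density_ge0.
split.
- by move=> y; rewrite gE subr_ge0; have [] := hc y.
- by move=> y /eqP; rewrite gE subr_eq0 => /eqP/esym; have [_] := hc y; exact.
- by exists c0 => y; rewrite [RHS]addrC subrK.
Qed.

Hypothesis J_finite : exists2 u0 : density R d, D2 u0 & (J u0 < +oo)%E.

(** J u - J ri is the integral of the Bregman distance, which vanishes only for u = ri. A competitor
    of finite energy is used first, to bound the nonnegative parts of the integrand of J ri through
    the gap identity. *)
Theorem rho_inf_minimizer (ri : density R d) :
  (forall y, ri y = rho_infty lam eta m Psi y) -> D2 ri -> unique_minimizer lam eta m Psi ri.
Proof.
move=> riE ri2.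
have iri := ig_density ri.
have ic := Hminus_ig ri2.
have Jri : (J ri < +oo)%E.
  have [u0 D0 J0] := J_finite; have [g mg [g0 _ [c0 gE]]] := J_gap u0.
  have [ia ib ie _] := J_fin D0 J0; have ic0 := Hminus_ig D0.
  have iu0 := ig_density u0.
  have itot : ig (fun y => ja ri y + jb ri y + je ri y).
    have iR : ig (fun y => ja u0 y + jb u0 y + je u0 y - c0 * (u0 y - ri y) + jc ri y).
      apply: igD => //; apply: igB; first by apply: igD => //; exact: igD.
      by apply: igZ; exact: igB.
    apply: (@ig_le _ _ _ mu _ _ _ _ iR).
      by apply: measurable_funD; [apply: measurable_funD|].
    move=> y; rewrite ger0_norm ?addr_ge0//.
    have := gE y; rewrite -!riE !FFE -!jbc -/(ja u0 y) -/(ja ri y) -/(je u0 y) -/(je ri y).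
    have := g0 y; have := jc0 u0 y.
    move: (ja u0 y) (jb u0 y) (jc u0 y) (je u0 y) (ja ri y) (jb ri y) (jc ri y) (je ri y) (g y) (c0 * _).
    by move=> x1 x2 x3 x4 x5 x6 x7 x8 x9 x10; lra.
  have fin (f : V -> R) : measurable_fun setT f -> (forall y, 0 <= f y) -> (forall y, f y <= ja ri y + jb ri y + je ri y) -> ig f.
    by move=> mf f0 hf; apply: (@ig_le _ _ _ mu _ _ mf _ itot) => y; rewrite ger0_norm.
  have i1 : ig (ja ri) by apply: fin => // y; rewrite -addrA lerDl addr_ge0.
  have i2 : ig (jb ri) by apply: fin => // y; rewrite addrAC lerDr addr_ge0.
  have i3 : ig (je ri) by apply: fin => // y; rewrite lerDr addr_ge0.
  have -> : J ri = (\int[mu]_y (ja ri y)%:E + \int[mu]_y (jb ri y)%:E - \int[mu]_y (jc ri y)%:E + \int[mu]_y (je ri y)%:E)%E by [].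
  by rewrite -(EFin_Rint ic) -(EFin_Rint i1) -(EFin_Rint i2) -(EFin_Rint i3) EFin_sum4 ltry.
have [ia ib ie JE] := J_fin ri2 Jri.
have FFig u : D2 u -> (J u < +oo)%E -> ig (fun y => Psi y * u y + FF (u y)).
  move=> u2 Ju; have [ja' jb' je' _] := J_fin u2 Ju.
  have := igD ja' (igD (igB jb' (Hminus_ig u2)) je').
  by congr (mu.-integrable _ _); apply/funext => y /=; rewrite jbc.
have gap u : D2 u -> (J u < +oo)%E -> exists2 g : V -> R, ig g &
   [/\ forall y, 0 <= g y, forall y, g y = 0 -> u y = ri y & J u = (J ri + (\int[mu]_y g y)%R%:E)%E].
  move=> u2 Ju; have [g mg [g0 gz [c0 gE]]] := J_gap u.
  have iu := ig_density u; have [_ _ _ JuE] := J_fin u2 Ju.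
  have iF := FFig u u2 Ju; have iFr := FFig ri ri2 Jri.
  have icu : ig (fun y => c0 * (u y - ri y)) by apply: igZ; exact: igB.
  have gE' y : g y = (Psi y * u y + FF (u y)) - (Psi y * ri y + FF (ri y)) - c0 * (u y - ri y).
    by rewrite gE -!riE; ring.
  have ig_g : ig g.
    rewrite (_ : g = fun y => (Psi y * u y + FF (u y)) - (Psi y * ri y + FF (ri y)) - c0 * (u y - ri y)).
      by apply: igB => //; exact: igB.
    by apply/funext.
  exists g => //; split => // [y /gz|]; first by rewrite riE.
  have gI : (\int[mu]_y g y = \int[mu]_y (Psi y * u y + FF (u y)) - \int[mu]_y (Psi y * ri y + FF (ri y)))%R.
    transitivity (\int[mu]_y ((Psi y * u y + FF (u y)) - (Psi y * ri y + FF (ri y)) - c0 * (u y - ri y)))%R.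
      by apply: eq_Rintegral => y _; exact: gE'.
    rewrite RintB//; last exact: igB.
    rewrite RintB// RintZ; last exact: igB.
    by rewrite RintB// !Rint_density subrr mulr0 subr0.
  by rewrite JuE JE gI -EFinD; congr EFin; rewrite addrC subrK.
split; [exact: ri2| |] => u u2.
- have [Ju|] := ltP (J u) +oo%E; last by rewrite leye_eq => /eqP ->; exact: leey.
  have [g ig_g [g0 _ ->]] := gap u u2 Ju.
  by rewrite leeDl// lee_fin; apply: Rint_ge0.
- move=> E; have Ju : (J u < +oo)%E by rewrite E.
  have [g ig_g [g0 gz JuE]] := gap u u2 Ju.
  have gi0 : (\int[mu]_y g y = 0)%R.
    by move: JuE; rewrite E JE -EFinD => -[] /eqP; rewrite -subr_eq0 opprD addrA subrr sub0r oppr_eq0 => /eqP.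
  (* A nonnegative g with zero integral vanishes almost everywhere: [L1_ae_subseq] for a constant
     sequence. *)
  have c0 : (\int[mu]_y g y @[n --> \oo] --> (0 : R))%R by rewrite gi0; exact: cvg_cst.
  have [s sn h] := @L1_ae_subseq _ _ _ mu (fun=> g) (fun=> ig_g) (fun _ => g0) c0.
  apply: (@filterS _ (almost_everywhere mu) _ _ _ _ h) => y hy; apply: gz.
  apply/eqP; rewrite eq_le g0 andbT leNgt; apply/negP => gp.
  have : \forall n \near \oo, g y < g y by exact: (cvgr_lt _ hy).
  by case=> N _ /(_ N (leqnn N)) /=; rewrite ltxx.
Qed.

End minimizer.

End FreeEnergy.
Import FreeEnergy.

(** * Extraction of a limit and its identification *)

Module LongTime.

Opaque ez.

(** The extracted index maps satisfy only n <= s n, while the times have to be nondecreasing. Each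
    new index is taken beyond the previous value of s, and s does not decrease its argument. *)
Lemma mono_subs (s : nat -> nat) : (forall n, (n <= s n)%N) ->
  exists2 f : nat -> nat, (forall n, (n <= f n)%N) & forall n, (s (f n) <= s (f n.+1))%N.
Proof.
move=> hs; pose f := fix f n := if n is n'.+1 then (s (f n')).+1 else 0%N.
exists f => n.
  elim: n => // n IH; rewrite /= ltnS; exact: leq_trans IH (hs _).
by apply: leq_trans (hs _); rewrite /= ltnW.
Qed.

Lemma increasing_ge (f : nat -> nat) : increasing_seq f -> forall n, (n <= f n)%N.
Proof.
move=> hf; elim=> // n IH; apply: (leq_ltn_trans IH).
by have E := hf n.+1 n; rewrite ltnn in E; rewrite ltnNge; apply/negbT; exact: E.
Qed.

(** Inverts the logistic function: z = PP z / (1 - PP z). *)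
Lemma odds_cvg (R : realType) (z : nat -> R) (c : R) : (forall n, 0 <= z n) -> c < 1 ->
  PP (z n) @[n --> \oo] --> c -> z n @[n --> \oo] --> c / (1 - c).
Proof.
move=> z0 c1 h.
have E n : z n = PP (z n) / (1 - PP (z n)).
  have z1 : 1 + z n != 0 by rewrite gt_eqF// ltr_pwDl.
  rewrite PPE//; field; rewrite z1 /=; apply/eqP => hh.
  by have := oner_neq0 R; rewrite -hh; apply/negP; rewrite negbK; apply/eqP; ring.
under eq_fun do rewrite E; apply: cvgM => //; apply: cvgV; first by rewrite subr_eq0 gt_eqF.
by apply: cvgB => //; exact: cvg_cst.
Qed.

Lemma limr_ge_seq (R : realType) (a : nat -> R) (l b : R) : a n @[n --> \oo] --> l ->
  (forall n, b <= a n) -> b <= l.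
Proof.
move=> h hb; rewrite leNgt; apply/negP => lb.
have : \forall n \near \oo, a n < b by exact: (cvgr_lt _ h).
by case=> N _ /(_ N (leqnn N)) /=; rewrite ltNge hb.
Qed.

Lemma limr_le_seq (R : realType) (a : nat -> R) (l b : R) : a n @[n --> \oo] --> l ->
  (forall n, a n <= b) -> l <= b.
Proof.
move=> h hb; rewrite leNgt; apply/negP => lb.
have : \forall n \near \oo, b < a n by exact: (cvgr_gt _ h).
by case=> N _ /(_ N (leqnn N)) /=; rewrite ltNge hb.
Qed.

Lemma minr_cvg (R : realType) (a : nat -> R) (l k : R) : a n @[n --> \oo] --> l ->
  Num.min (a n) k @[n --> \oo] --> Num.min l k.
Proof.
move=> /cvgrPdist_le h; apply/cvgrPdist_le => eps e0; apply: filterS (h _ e0) => n.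
apply: le_trans; have h1 := ler_norm (l - a n); have h2 := ler_norm (a n - l).
have h3 := normr_ge0 (l - a n).
rewrite distrC in h2; move: h1 h2 h3; set N := `|l - a n| => h1 h2 h3.
by rewrite ler_norml; apply/andP; case: (leP l k) => ?; case: (leP (a n) k) => ?; split; lra.
Qed.

Lemma le_of_sub_lt1 (R : realType) (r u k : R) : r - u < 1 -> k + 1 <= r -> k <= u.
Proof. lra. Qed.

Lemma sub_double_le (R : realType) (P a b : R) : (a - b) / 2 <= P -> a - 2 * P <= b.
Proof. lra. Qed.

Section scheffe.
Context {R : realType} (d : nat).
Local Notation V := 'rV[R]_d.
Local Notation mu := (@leb R d).
Local Notation ig f := (mu.-integrable setT (EFin \o f)).

Lemma min_ig (f g : V -> R) : measurable_fun setT f -> (forall x, 0 <= f x) ->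
  ig g -> (forall x, 0 <= g x) -> ig (fun x => Num.min (f x) (g x)).
Proof.
move=> mf f0 hg g0; apply: (@ig_le _ _ _ mu _ g) => //.
  by apply: measurable_minr => //; exact: ig_meas hg.
by move=> x; rewrite ger0_norm ?le_min ?f0 ?g0// ge_min lexx orbT.
Qed.

(** |u_n - r| = u_n + r - 2 min(u_n, r). The minimum is dominated by r and both masses are 1, so
    convergence holds in L^1 and a fortiori against bounded continuous functions. *)
Lemma scheffe (u : nat -> density R d) (r : density R d) :
  {ae mu, forall x, u n x @[n --> \oo] --> r x} ->
  weak_cvg \oo (fun n => dprob (u n)) (dprob r).
Proof.
move=> h f cf bf.
have [M [M0 hM]] : exists M : R, 0 <= M /\ forall y, `|f y| <= M.
  have [N [Nr hN]] := bf; exists (Num.max N 0 + 1); split; first by rewrite addr_ge0// le_max lexx orbT.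
  by move=> y; apply: hN => //; rewrite ltr_pwDr// le_max lexx.
have mf : measurable_fun setT f := continuous_measurable_rV cf.
have iu n := ig_density (u n); have ir := ig_density r.
have mu_ n : measurable_fun setT (u n) := density_measurable (u n).
have mr : measurable_fun setT r := density_measurable r.
have r0 := density_ge0 r; have u0 n := density_ge0 (u n).
have im n : ig (fun x => Num.min (u n x) (r x)) by apply: min_ig.
have [|||_ c _] := @Rdct _ _ _ mu (fun n x => Num.min (u n x) (r x)) r r _ mr _ ir.
- by move=> n; exact: ig_meas (im n).
- apply: (@filterS _ (almost_everywhere mu) _ _ _ _ h) => x hx.
  by have := minr_cvg (k := r x) hx; rewrite minxx.
- by move=> n x; rewrite ger0_norm ?le_min ?r0 ?u0// ge_min lexx orbT.
rewrite Rint_density in c.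
have ifu n : ig (fun y => f y * u n y).
  apply: (@ig_le _ _ _ mu _ (fun y => M * u n y)); [exact: measurable_funM| |exact: igZ].
  by move=> y; rewrite normrM ler_pM// ger0_norm.
have ifr : ig (fun y => f y * r y).
  apply: (@ig_le _ _ _ mu _ (fun y => M * r y)); [exact: measurable_funM| |exact: igZ].
  by move=> y; rewrite normrM ler_pM// ger0_norm.
have bnd n : `|\int[mu]_y (f y * u n y) - \int[mu]_y (f y * r y)| <=
    M * (2 - 2 * \int[mu]_x Num.min (u n x) (r x)).
  rewrite -RintB//; apply: (le_trans (Rint_norm (igB (ifu n) ifr))).
  have i2 : ig (fun x => u n x + r x - 2 * Num.min (u n x) (r x)).
    by apply: igB; [exact: igD|exact: igZ].
  apply: (@le_trans _ _ (\int[mu]_x (M * (u n x + r x - 2 * Num.min (u n x) (r x))))).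
    apply: Rint_le; [exact/ig_norm/igB|exact: igZ|move=> y].
    rewrite -mulrBr normrM; apply: ler_pM => //.
    by case: (leP (u n y) (r y)) => hh; [rewrite ler0_norm ?subr_le0//|rewrite gtr0_norm ?subr_gt0//]; lra.
  rewrite RintZ// RintB//; [|exact: igD|exact: igZ].
  by rewrite RintD// RintZ// !Rint_density.
have c2 : M * (2 - 2 * \int[mu]_x Num.min (u n x) (r x)) @[n --> \oo] --> (0 : R).
  have E : M * (2 - 2 * 1) = 0 :> R by rewrite mulr1 subrr mulr0.
  rewrite -E; apply: cvgMl_tmp; apply: cvgB; first exact: cvg_cst.
  by apply: cvgMl_tmp.
rewrite dprob_int//; last by exists M.
have E n : (\int[dprob (u n)]_y f y = \int[mu]_y (f y * u n y))%R by rewrite dprob_int//; exists M.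
under eq_fun do rewrite E.
apply/cvgrPdist_le => eps e0; move/cvgrPdist_le : c2 => /(_ eps e0).
apply: filterS => n; rewrite sub0r normrN => hh; rewrite distrC.
by apply: le_trans (bnd n) _; apply: le_trans hh; exact: ler_norm.
Qed.

End scheffe.

Section long_time.
Context {R : realType} (d : nat).
Local Notation V := 'rV[R]_d.
Local Notation mu := (@leb R d).
Local Notation leb1 := (@lebesgue_measure R).
Local Notation ig f := (mu.-integrable setT (EFin \o f)).
Local Notation ig1 f := (leb1.-integrable setT (EFin \o f)).
Local Notation e i := (delta_mx ord0 i : V).
Local Notation ind a b := (\1_(`]a, b] : set R) : R -> R).
Variables (lam eta m : R) (Psi : V -> R) (rho : R -> density R d).
Hypotheses (lam_gt0 : 0 < lam) (eta_gt0 : 0 < eta) (m_gt1 : 1 < m).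
Hypotheses (Psi1 : Ck 1 Psi)
  (rho_cont : forall t : R, 0 <= t ->
     weak_cvg (within (`[0, +oo[ : set R) (nbhs t)) (fun s => dprob (rho s)) (dprob (rho t)))
  (rho_W : forall t : R, 0 < t -> W11loc (fun y => LF lam eta m (rho t y)))
  (rho_weak : forall phi : (R^o * V)%type -> R,
     test_fun [set p : R^o * V | 0 < p.1 :> R] phi ->
     (\int[leb1]_(t in (`]0%R, +oo[ : set R))
       (\int[mu]_y
         (rho t y * derive1 (fun s : R => phi (s, y)) t
          - edot (rho t y *: grad Psi y + wgrad (fun z => LF lam eta m (rho t z)) y)
                 (grad (fun z => phi (t, z)) y)))%R%:E = 0)%E)
  (rho_energy : forall T : R, 0 < T ->
     (\int[leb1]_(t in (`]0%R, T] : set R)) \int[mu]_y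
        (enorm (velocity lam eta m Psi rho t y) ^+ 2 * rho t y)%:E < +oo)%E).
Local Notation LF := (LF lam eta m).
Local Notation uu := (uu rho).
Local Notation GG := (GG lam eta m rho).
Local Notation jj := (jj lam eta m Psi rho).
Local Notation DD := (DD lam eta m Psi rho).
Local Notation Dr := (Dr lam eta m Psi rho).
Implicit Types (kap : V -> R).
Local Notation phi := (phi lam eta m).
Local Notation lamb := (lamb lam eta m).
Local Notation phr := (phr lam eta m).
Local Notation PH := (PH lam eta m).
Local Notation dvJ := (dvJ lam eta m Psi rho).
Local Notation gd := (gd lam eta m Psi rho).
Local Notation qq := (qq lam eta m Psi rho).
Local Notation qi := (qi lam eta m Psi rho).
Local Notation wt := (wt lam eta m Psi).
Local Notation gz := (EntropyKernel.gz lam eta m).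
Local Notation ET := (ET lam eta m Psi).
Hypotheses (d_gt0 : (0 < d)%N) (Psi_ge0 : forall y, 0 <= Psi y)
  (Psi_growth : exists r delta : R, [/\ 0 < r, 0 < delta &
     forall y : V, r <= enorm y -> (lam * (d%:R + 2) + delta) * ln (enorm y) <= Psi y]).
Local Notation U := (Ufun lam eta m Psi).
Local Notation UI := (UI lam eta m Psi).

Let u0 t y : 0 <= uu t y := density_ge0 (uu t) y.
Let wt0 C x : 0 <= wt C x := ltW (wt_gt0 lam eta m Psi C x).
Let Up C x : 0 < U C x. Proof. by apply: Ufun_gt0. Qed.
Let iU C : ig (U C). Proof. by apply: U_ig. Qed.
Let mUU C : measurable_fun setT (U C). Proof. by apply: Ufun_meas. Qed.
Let ming C t : ig (fun x => Num.min (uu t x) (U C x)).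
Proof. by apply: min_ig => //; [exact: uu_meas|move=> x; exact: ltW]. Qed.

(** By [PH_lower], u - 2 PH <= min(u, U), and the entropy at time t is at most that at time 1. As
    U(.; C) is a fixed integrable majorant of the minimum, these bounds pass to almost everywhere
    limits. *)
Lemma min_mass C t : 1 <= t -> 1 - 2 * ET C (uu 1) <= \int[mu]_x Num.min (uu t x) (U C x) <= 1.
Proof.
move=> t1; apply/andP; split; last first.
  rewrite -(Rint_density (uu t)); apply: Rint_le; [exact: ming|exact: ig_density|move=> x].
  by rewrite ge_min lexx.
have h : ET C (uu t) <= ET C (uu 1).
  by apply: (ET_le lam_gt0 eta_gt0 m_gt1 Psi1 rho_cont rho_W rho_weak rho_energy).
have iP : ig (fun x => PH (wt C x) (uu t x)) by apply: PH_ig.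
apply: (@le_trans _ _ (1 - 2 * ET C (uu t))); first by rewrite lerD2l lerN2 ler_wpM2l.
rewrite -[X in X - _](Rint_density (uu t)) /EntropyDecay.ET -RintZ// -RintB//; [|exact: ig_density|exact: igZ].
apply: Rint_le; [by apply: igB; [exact: ig_density|exact: igZ]|exact: ming|move=> x].
have p1 : 0 <= PH (wt C x) (uu t x) by exact: PH_ge0.
have p2 : (uu t x - U C x) / 2 <= PH (wt C x) (uu t x).
  apply: PH_lower => //; first exact: ltW.
  by apply: gz_Ufun.
rewrite le_min lerBlDr lerDl mulr_ge0//=.
exact: sub_double_le.
Qed.

Definition good k t := exists (U : V -> R) (c : R), [/\ continuous U, (forall x, 0 <= U x), 0 <= c <= 1,
    \int[mu]_x (\1_(cube k.+1%:R) x * `|U x - uu t x|) <= k.+1%:R^-1 &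
    \int[mu]_x (\1_(cube k.+1%:R) x * `|phi (wt 0 x) (U x) - c|) <= k.+1%:R^-1].

Lemma good_sequence : exists t : nat -> R, forall n, [/\ n.+1%:R <= t n, t n <= t n.+1 & good n (t n)].
Proof.
have [|f hf] := @dep_choice R 1 (fun n x y => [/\ x <= y, n.+1%:R <= y & good n y]).
  move=> n x; have T0 : 0 < Num.max x n.+1%:R by rewrite lt_max ltr0n orbT.
  have [t [ht hU]] := good_step lam_gt0 eta_gt0 m_gt1 Psi1 rho_cont rho_W rho_weak rho_energy n T0.
  by exists t; split => //; apply: le_trans ht; rewrite le_max lexx ?orbT.
(* [f 0] is the arbitrary start of the choice and satisfies nothing, hence the shift. *)
exists (fun n => f n.+1) => n; have [_ h1 h2] := hf n; have [h3 _ _] := hf n.+1.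
by split.
Qed.

(** Both errors of [good], on growing cubes, tend to 0 in L^1, hence almost everywhere along a
    subsequence; Bolzano-Weierstrass then makes the constants converge. [r n] is the value at x of
    the approximating function, only asymptotically equal to u. *)
Lemma limit_profile (t : nat -> R) : (forall n, n.+1%:R <= t n) -> (forall n, good n (t n)) ->
  exists2 p : nat -> nat, (forall n, (n <= p n)%N) & exists c : R, 0 <= c <= 1 /\
   {ae mu, forall x, exists r : nat -> R, [/\ forall n, 0 <= r n,
      r n - uu (t (p n)) x @[n --> \oo] --> (0 : R) & phi (wt 0 x) (r n) @[n --> \oo] --> c]}.
Proof.
move=> t1 hg.
have [Uk hU] := choice hg; have [ck hc] := choice hU.
pose a n x := \1_(cube n.+1%:R) x * `|Uk n x - uu (t n) x| +
  \1_(cube n.+1%:R) x * `|phi (wt 0 x) (Uk n x) - ck n|.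
have i1 n : ig (fun x => \1_(cube n.+1%:R) x * `|Uk n x - uu (t n) x|).
  have [cUk _ _ _ _] := hc n.
  have mUk : measurable_fun setT (Uk n) := continuous_measurable_rV cUk.
  have iuk := ig_density (uu (t n)).
  apply: (@ig_le _ _ _ mu _ (fun x => \1_(cube n.+1%:R) x * `|Uk n x| + uu (t n) x)); last first.
  - by apply: igD => //; apply: ig_cube_cont; exact: cont_norm.
  - move=> x; rewrite normrM ger0_norm// normr_id.
    apply: (@le_trans _ _ (\1_(cube n.+1%:R) x * (`|Uk n x| + `|uu (t n) x|))).
      by apply: ler_wpM2l => //; exact: ler_normB.
    rewrite mulrDr lerD2l (ger0_norm (u0 _ _)) indicE.
    by case: (x \in _); rewrite ?mul1r ?mul0r.
  - apply: measurable_funM; first exact: ig_meas (@ig_cube R d _).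
    apply: measurableT_comp => //; apply: measurable_funB => //; exact: uu_meas.
have i2 n : ig (fun x => \1_(cube n.+1%:R) x * `|phi (wt 0 x) (Uk n x) - ck n|).
  have [cUk Uk0 _ _ _] := hc n.
  have cphi : continuous (fun x => phi (wt 0 x) (Uk n x)) by apply: phi_cont.
  apply: ig_cube_cont; apply: cont_norm; apply: contD => //; exact: cont_cst.
have ia n : ig (a n) by exact: igD.
have a0 n x : 0 <= a n x by rewrite addr_ge0// mulr_ge0.
have ca : (\int[mu]_x a n x @[n --> \oo] --> (0 : R))%R.
  have h2 : 2 * (n.+1%:R^-1 : R) @[n --> \oo] --> (0 : R).
    by rewrite -[X in _ --> X](mulr0 2); apply: cvgMl_tmp; exact: cvg_harmonic.
  apply: (cvg0_le _ h2) => n; rewrite Rint_ge0//= RintD//.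
  by have [_ _ _ h3 h4] := hc n; rewrite mulr_natl mulr2n lerD.
have [s sn hs] := L1_ae_subseq ia a0 ca.
have bc : bounded_fun (ck \o s).
  exists 1; split => // M M1 n _; have [_ _ /andP[c0 c1] _ _] := hc (s n).
  by rewrite /= ger0_norm//; apply: (le_trans c1); exact: ltW.
have [f hf /cvg_ex[c hcv]] := bolzano_weierstrass bc.
have fn := increasing_ge hf.
exists (s \o f); first by move=> n; apply: leq_trans (fn n) (sn _).
exists c; split.
  apply/andP; split.
    by apply: (limr_ge_seq hcv) => n; have [_ _ /andP[]] := hc (s (f n)).
  by apply: (limr_le_seq hcv) => n; have [_ _ /andP[]] := hc (s (f n)).
apply: (@filterS _ (almost_everywhere mu) _ _ _ _ hs) => x hx.
have hx' := cvg_subs hx fn.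
have ev : \forall n \near \oo, \1_(@cube R d (s (f n)).+1%:R) x = 1 :> R.
  exists (Num.bound `|x|) => // n /= hn; rewrite indicE mem_set// /cube /=.
  apply: ltW; apply: lt_le_trans (archi_boundP (normr_ge0 x)) _; rewrite ler_nat.
  by apply: leqW; apply: leq_trans hn _; apply: leq_trans (fn n) (sn _).
exists (fun n => Uk (s (f n)) x); split.
- by move=> n; have [_ + _ _ _] := hc (s (f n)).
- apply/cvgrPdist_le => eps e0; move/cvgrPdist_le : hx' => /(_ eps e0) h.
  near=> n; rewrite sub0r normrN.
  have I1 : \1_(@cube R d (s (f n)).+1%:R) x = 1 :> R by near: n.
  have : `|0 - (a (s (f n)) x)| <= eps by near: n.
  rewrite sub0r normrN ger0_norm//; apply: le_trans.
  by rewrite /a I1 !mul1r lerDl.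
- have d0 : phi (wt 0 x) (Uk (s (f n)) x) - ck (s (f n)) @[n --> \oo] --> (0 : R).
    apply/cvgrPdist_le => eps e0; move/cvgrPdist_le : hx' => /(_ eps e0) h.
    near=> n; rewrite sub0r normrN.
    have I1 : \1_(@cube R d (s (f n)).+1%:R) x = 1 :> R by near: n.
    have : `|0 - (a (s (f n)) x)| <= eps by near: n.
    rewrite sub0r normrN ger0_norm//; apply: le_trans.
    by rewrite /a I1 !mul1r lerDr.
  have hh : phi (wt 0 x) (Uk (s (f n)) x) - ck (s (f n)) + ck (s (f n)) @[n --> \oo] --> 0 + c.
    exact: cvgD d0 hcv.
  have E n : phi (wt 0 x) (Uk (s (f n)) x) = phi (wt 0 x) (Uk (s (f n)) x) - ck (s (f n)) + ck (s (f n)).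
    by rewrite subrK.
  by rewrite add0r in hh; under eq_fun do rewrite E.
Unshelve. all: by end_near.
Qed.

(** c = 0 means u -> 0, against [min_mass] for large C; c = 1 means u -> oo and would give every
    profile mass at most 1. For 0 < c < 1 the limit is U(.; C) with exp(C / lam) = c / (1 - c). *)
Lemma limit_is_equilibrium (t : nat -> R) (c : R) : (forall n, 1 <= t n) -> 0 <= c <= 1 ->
   {ae mu, forall x, exists r : nat -> R, [/\ forall n, 0 <= r n,
      r n - uu (t n) x @[n --> \oo] --> (0 : R) & phi (wt 0 x) (r n) @[n --> \oo] --> c]} ->
   {ae mu, forall x, uu (t n) x @[n --> \oo] --> rho_infty lam eta m Psi x}.
Proof.
move=> t1 /andP[c0 c1] hae.
have tl : ET n%:R (uu 1) @[n --> \oo] --> (0 : R) by apply: ET_tail.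
have minlim (L : V -> R) k : measurable_fun setT L ->
  {ae mu, forall x, Num.min (uu (t n) x) (U k x) @[n --> \oo] --> L x} ->
  1 - 2 * ET k (uu 1) <= \int[mu]_x L x <= 1.
  move=> mL hL; have [||_ h _] := @Rdct _ _ _ mu (fun n x => Num.min (uu (t n) x) (U k x)) L (U k) _ mL hL (iU k).
  - by move=> n; exact: ig_meas (ming _ _).
  - by move=> n x; rewrite ger0_norm ?le_min ?u0 ?(ltW (Up _ _))// ge_min lexx orbT.
  by apply/andP; split; [apply: (limr_ge_seq h)|apply: (limr_le_seq h)] => n;
    have /andP[] := min_mass k (t1 n).
have ucv x (r : nat -> R) (l : R) : r n - uu (t n) x @[n --> \oo] --> (0 : R) -> r n @[n --> \oo] --> l ->
   uu (t n) x @[n --> \oo] --> l.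
  move=> h1 h2; have hh : r n - (r n - uu (t n) x) @[n --> \oo] --> l - 0 by exact: cvgB h2 h1.
  have E n : uu (t n) x = r n - (r n - uu (t n) x) by rewrite opprB addrC subrK.
  by rewrite subr0 in hh; under eq_fun do rewrite E.
have zc x (r : nat -> R) : (forall n, 0 <= r n) -> c < 1 -> phi (wt 0 x) (r n) @[n --> \oo] --> c ->
   gz (r n) @[n --> \oo] --> c / (1 - c) / wt 0 x.
  move=> r0 cl h; have w0 : wt 0 x != 0 by rewrite gt_eqF// wt_gt0.
  have z0 n : 0 <= gz (r n) * wt 0 x by apply: mulr_ge0 => //; exact: gz_ge0.
  have h2 : gz (r n) * wt 0 x / wt 0 x @[n --> \oo] --> c / (1 - c) / wt 0 x.
    by apply: cvgMr_tmp; exact: odds_cvg.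
  have E n : gz (r n) = gz (r n) * wt 0 x / wt 0 x by rewrite mulfK.
  by under eq_fun do rewrite E.
have [ce|cn0] := eqVneq c 0.
  have h x : (exists r : nat -> R, [/\ forall n, 0 <= r n,
      r n - uu (t n) x @[n --> \oo] --> (0 : R) & phi (wt 0 x) (r n) @[n --> \oo] --> c]) ->
      uu (t n) x @[n --> \oo] --> (0 : R).
    move=> [r [r0 h1 h2]]; apply: (ucv x r) => //.
    have := zc x r r0 _ h2; rewrite ce => /(_ ltr01); rewrite !mul0r => h3.
    by apply: (gz_cvg_inv lam_gt0 eta_gt0 m_gt1 r0 (lexx 0)); rewrite /EntropyKernel.gz mul0r.
  have hN (k : R) : 1 - 2 * ET k (uu 1) <= 0.
    have /andP[+ _] : 1 - 2 * ET k (uu 1) <= \int[mu]_x (0 : R) <= 1.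
      apply: minlim; first exact: measurable_cst.
      apply: (@filterS _ (almost_everywhere mu) _ _ _ _ hae) => x /h hx.
      apply: (cvg0_le _ hx) => n; rewrite le_min u0 (ltW (Up _ _))/=.
      by rewrite ge_min lexx.
    by rewrite Rint0.
  exfalso; have h3 : 1 - 2 * ET n%:R (uu 1) @[n --> \oo] --> (1 - 2 * 0 : R).
    by apply: cvgB; [exact: cvg_cst|apply: cvgMl_tmp].
  have := limr_le_seq h3 (fun n => hN n%:R).
  by rewrite mulr0 subr0 leNgt ltr01.
have cp : 0 < c by rewrite lt_neqAle eq_sym cn0.
have Cs := Cstar_spec d_gt0 lam_gt0 eta_gt0 m_gt1 Psi1 Psi_ge0 Psi_growth.
have [ce|cn1] := eqVneq c 1.
  exfalso; have hN (k : R) : UI k <= 1.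
    have /andP[_ //] : 1 - 2 * ET k (uu 1) <= \int[mu]_x U k x <= 1.
    apply: minlim; first exact: mUU.
    apply: (@filterS _ (almost_everywhere mu) _ _ _ _ hae) => x [r [r0 h1 h2]].
    (* The excess 1 absorbs r n - u < 1: once M <= r n, u is at least U(x; k) and the minimum equals
       U(x; k). *)
    pose M := U k x + 1; have M0 : 0 <= M by rewrite addr_ge0// ltW.
    have phM : phi (wt 0 x) M < c.
      have zM : 0 <= gz M * wt 0 x by apply: mulr_ge0 => //; exact: gz_ge0.
      by rewrite ce /EntropyDerivatives.phi PPE// ltrBlDr ltrDl invr_gt0 ltr_pwDl.
    have n1 : \forall n \near \oo, phi (wt 0 x) M < phi (wt 0 x) (r n) by exact: (cvgr_gt _ h2).
    have n2 : \forall n \near \oo, r n - uu (t n) x < 1 by exact: (cvgr_lt _ h1).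
    have n3 : \forall n \near \oo, Num.min (uu (t n) x) (U k x) = U k x.
      near=> n; apply/min_idPr.
      have a1 : phi (wt 0 x) M < phi (wt 0 x) (r n) by near: n.
      have a2 : r n - uu (t n) x < 1 by near: n.
      have a3 : M <= r n.
        rewrite leNgt; apply/negP => hlt; move: a1; rewrite ltNge => /negP; apply.
        apply: PP_le; first by apply: mulr_ge0 => //; exact: gz_ge0.
        by apply: ler_wpM2r => //; apply: gz_le => //; exact: ltW.
      exact: le_of_sub_lt1 a2 a3.
    have [N _ hN] := n3; apply: (@cvg_eventually _ _ _ N) => n hn; exact: hN.
  have h1 : Cstar lam eta m Psi < Cstar lam eta m Psi + 1 by rewrite ltrDl.
  have := UI_lt d_gt0 lam_gt0 eta_gt0 m_gt1 Psi1 Psi_ge0 Psi_growth h1.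
  by rewrite Cs ltNge hN.
have cl : c < 1 by rewrite lt_neqAle cn1.
(* [phi] is taken with constant 0 in the weight, so z for the profile U(.; C) is wt 0 / wt C = exp(C
   / lam). *)
pose C := lam * ln (c / (1 - c)).
have q0 : 0 < c / (1 - c) by rewrite divr_gt0// subr_gt0.
have gU x : gz (U C x) = c / (1 - c) / wt 0 x.
  have -> : gz (U C x) = (wt C x)^-1 by apply: gz_UfunE.
  rewrite -[X in _ = X / _](lnK q0) /EntropyWeights.wt -!expRN -expRD; congr expR.
  by rewrite /C; move: (ln _) => L; field; rewrite gt_eqF.
have h x : (exists r : nat -> R, [/\ forall n, 0 <= r n,
      r n - uu (t n) x @[n --> \oo] --> (0 : R) & phi (wt 0 x) (r n) @[n --> \oo] --> c]) ->
      uu (t n) x @[n --> \oo] --> U C x.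
  move=> [r [r0 h1 h2]]; apply: (ucv x r) => //.
  by apply: (gz_cvg_inv lam_gt0 eta_gt0 m_gt1 r0 (ltW (Up C x))); rewrite gU; exact: zc.
have hN (k : R) : 1 - 2 * ET k (uu 1) <= \int[mu]_x Num.min (U C x) (U k x) <= 1.
  apply: minlim; first by apply: measurable_minr; exact: mUU.
  apply: (@filterS _ (almost_everywhere mu) _ _ _ _ hae) => x /h hx.
  exact: minr_cvg.
(* The upper bound with k = C gives mass at most 1; the lower bound as k -> oo gives mass at least
   1. *)
have UC1 : UI C = 1.
  apply/eqP; rewrite eq_le; apply/andP; split.
    have /andP[_] := hN C.
    by rewrite (_ : (\int[mu]_x _)%R = UI C)//; apply: eq_Rintegral => x _; rewrite minxx.
  have h3 : 1 - 2 * ET n%:R (uu 1) @[n --> \oo] --> (1 - 2 * 0 : R).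
    by apply: cvgB; [exact: cvg_cst|apply: cvgMl_tmp].
  have := limr_le_seq h3 (l := 1 - 2 * 0) (b := UI C); rewrite mulr0 subr0; apply => n.
  have /andP[+ _] := hN n%:R; move/le_trans; apply.
  apply: Rint_le; [|exact: iU|by move=> x; rewrite ge_min lexx].
  by apply: min_ig => // x; exact: ltW.
have CE : C = Cstar lam eta m Psi.
  by apply: (UI_inj d_gt0 lam_gt0 eta_gt0 m_gt1 Psi1 Psi_ge0 Psi_growth); rewrite UC1 Cs.
apply: (@filterS _ (almost_everywhere mu) _ _ _ _ hae) => x /h.
by rewrite CE.
Unshelve. all: by end_near.
Qed.

End long_time.

End LongTime.
Import LongTime.

Theorem theorem7p1 (R : realType) (d : nat) (lam eta m : R)
    (Psi : 'rV[R]_d -> R)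
    (d_gt0 : (0 < d)%N)
    (lam_gt0 : 0 < lam) (lam_lt : lam < expR 1 / 2)
    (eta_gt0 : 0 < eta) (m_gt1 : 1 < m)
    (Psi_ge0 : forall y, 0 <= Psi y)
    (Psi_C1 : Ck 1 Psi)
    (Psi_growth : exists r delta : R, [/\ 0 < r, 0 < delta &
       forall y, r <= enorm y ->
         (lam * (d%:R + 2) + delta) * ln (enorm y) <= Psi y])
    (Psi_lipschitz : exists L : R, forall x y,
       enorm (grad Psi x - grad Psi y) <= L * enorm (x - y))
    (Psi_linear : exists2 K : R, 0 < K &
       forall y, enorm (grad Psi y) <= K * (1 + enorm y))
    (rho0 : density R d) (rho0_D2 : D2 rho0)
    (rho0_J : (Jfun lam eta m Psi rho0 < +oo)%E)
    (rho : R -> density R d)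
    (rho_D2 : forall t, 0 <= t -> D2 (rho t))
    (rho_FP : FP_solution lam eta m Psi rho0 rho)
    (rho_AC : AC2loc (fun t => dprob (rho t)))
    (rho_energy : forall T : R, 0 < T ->
       (\int[lebesgue_measure]_(t in (`]0%R, T] : set R)) \int[leb d]_y
          (enorm (velocity lam eta m Psi rho t y) ^+ 2 * rho t y)%:E < +oo)%E) :
  exists rho_inf : density R d,
    [/\ forall y, rho_inf y = rho_infty lam eta m Psi y,
        unique_minimizer lam eta m Psi rho_inf &
        exists t_ : nat -> R,
          [/\ forall n, 0 <= t_ n,
              nondecreasing_seq t_,
              t_ @ \oo --> +oo &
              weak_cvg \oo (fun n => dprob (rho (t_ n))) (dprob rho_inf)]].
Proof.
have [rho_cont _ rho_W rho_weak] := rho_FP.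
have [t ht] := good_sequence lam_gt0 eta_gt0 m_gt1 Psi_C1 rho_cont rho_W rho_weak rho_energy.
have t1 n : n.+1%:R <= t n by have [] := ht n.
have tS n : t n <= t n.+1 by have [] := ht n.
have tge1 n : 1 <= t n by apply: le_trans (t1 n); rewrite ler1n.
have tmono : nondecreasing_seq t by apply/nondecreasing_seqP.
have [p hp [c [c01 hc]]] := limit_profile m_gt1 Psi_C1 t1 (fun n => let: And3 _ _ h := ht n in h).
have hae := limit_is_equilibrium lam_gt0 eta_gt0 m_gt1 Psi_C1 rho_cont rho_W rho_weak rho_energy
  d_gt0 Psi_ge0 Psi_growth (fun n => tge1 (p n)) c01 hc.
have [f hf pf] := mono_subs hp.
pose ri := rho_inf_density d_gt0 lam_gt0 eta_gt0 m_gt1 Psi_C1 Psi_ge0 Psi_growth.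
exists ri; split; first by [].
- apply: rho_inf_minimizer => //; last exact: rho_inf_D2.
  by exists rho0.
- have t_pos n : 0 < t (p (f n)) by apply: lt_le_trans (tge1 _).
  exists (fun n => t (p (f n))); split.
  + by move=> n; exact: ltW.
  + by apply/nondecreasing_seqP => n; apply: tmono; exact: pf.
  + apply/cvgryPge => A; exists (Num.bound `|A|) => // n /= hn.
    apply: le_trans (ler_norm A) _; apply: le_trans (t1 _).
    apply: ltW; apply: lt_le_trans (archi_boundP (normr_ge0 A)) _; rewrite ler_nat.
    by apply: leqW; apply: leq_trans hn _; apply: leq_trans (hf n) (hp _).
  (* All chosen times are positive, where [uu] and [rho] coincide. *)
  + have E n : rho (t (p (f n))) = uu rho (t (p (f n))) by rewrite /SolutionCurve.uu ptimeE.
    under eq_fun do rewrite E.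
    apply: scheffe; apply: (@filterS _ (almost_everywhere (@leb R d)) _ _ _ _ hae) => x hx.
    exact: (cvg_subs hx hf).
Qed.
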